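(* There exists a geometric constant $M=M(X_2)\ge1$ such that for any positive $\epsilon,\lambda$ satisfying $$8\epsilon\le1,\qquad 9\lambda\sqrt C\le l\epsilon^2(1-\epsilon),\qquad \pi\lambda^2\le q\epsilon^2,$$ the following holds. Given an integer $\ell\ge0$, a number $A\ge0$ and a genus $0$ stable $J$-holomorphic map $(\Sigma,x_1,\dots,x_\ell,f)$ into a compact subset $K\subset X$ with energy $E(f)\le A$, there exist a stable rooted tree $\mathcal T=(V,E,\partial)$ with $$|E_{\mathrm{ext}}|\le\lfloor A/\lambda^2\rfloor+\ell+1,$$ a subset $F\subset E_{\mathrm{ext}}$ in bijection with $\{x_1,\dots,x_\ell\}$, and numbers $\theta,\tau,\boldsymbol\alpha,\eta,\boldsymbol\Lambda$, depending explicitly on $\epsilon,\lambda,M,\mathcal T$, such that $(\Sigma,x_1,\dots,x_\ell,f)$ is isomorphic as a stable map to a point of the metric space $$\mathcal M_{\mathcal T,F}(X,J;\theta,\tau,\boldsymbol\alpha;K,\eta,\boldsymbol\Lambda).$$ In fact, one can take $$\theta=\epsilon,\quad \tau=4\epsilon,\quad \alpha_v=(4\epsilon^3)^{\deg(v)},\quad \eta=\frac1{3\sqrt C}\cdot\frac{\lambda}{\lambda_0},\quad \Lambda_v=\frac{9\pi\sqrt C}{\epsilon^2}\cdot\alpha_v^{-1},\quad \Lambda_e=\frac{M}{\epsilon^2}$$ for vertices $v\in V$ and edges $e\in E$.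
   Context: **Geometry.** $(X,g)$ is a smooth Riemannian manifold, $\omega$ a symplectic form, $J$ an $\omega$-tame almost complex structure, with $C^j$ bounds on the geometry of $(X,\omega,J,g)$ for some $j\ge 3$: there is a constant $B_j$ such that every $x\in X$ is the centre of a unit coordinate ball in which the matrices of $\omega,J,g$ and their inverses have $C^j$ norms $\le B_j$, and $g(V,V)\le B_j\,\omega(V,JV)$ for all tangent vectors $V$. Writing $a=a(X_i)$ means that the constant $a$ depends only on the $C^i$ bounds on the geometry (and $\dim X$). Energy: $E(f,U)=\frac12\int_U|df|^2_h\,\mathrm{dvol}_h$ for any conformal metric $h$. **Constants from a priori estimates.** $B^2(z,r)\subset\mathbb C$ is the closed disc, $B^2(r)=B^2(0,r)$. - $\lambda_0=\lambda_0(X_1)>0$ is fixed so that for every $x\in X$ the set of points at distance $\le2\lambda_0$ from $x$ lies in such a unit coordinate ball centred at $x$, and so that for suitable $c_i=c_i(X_{i+1})\ge1$ ($i\ge2$) every $J$-holomorphic $u:B^2(r)\to X$ satisfies $|(\nabla^iu)(0)|\le c_i\|du\|_\infty(\frac1r+\frac{\|du\|_\infty}{\lambda_0})^{i-1}$. - $C\ge1$ (absolute) and $q=q(X_2)>0$ are the constants of the mean value inequality: every $J$-holomorphic $u:B^2(r)\to X$ with $E(u)\le q$ satisfies $r^2|du(0)|^2\le C\cdot E(u)$. - $l=l(X_2)\in(0,\lambda_0]$ is the constant of the long cylinder lemma: with constants $c=c(X_2)>0$ and $K_i=K_i(X_{i+1})\ge1$, if $u:[R_-,R_+]\times S^1\to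 X$ is $J$-holomorphic with $\|du\|_\infty\le l$ and $\gamma_s=u(s,\cdot)$, then $\int_{[a,b]\times S^1}u^*\omega=\mathcal A(\gamma_a)-\mathcal A(\gamma_b)$ for $R_-\le a\le b\le R_+$, $|\mathcal A(\gamma_s)|\le c\cdot\mathrm{length}(\gamma_s)^2$, and, if $R_+-R_-\ge2$, $|(\nabla^iu)(s,t)|\le K_i\sqrt{E(u)}(e^{s-R_+}+e^{R_--s})$ for $s\in[R_-+1,R_+-1]$ and $i\ge1$. Here $S^1=\mathbb R/2\pi\mathbb Z$ and $\mathcal A$ is the symplectic action of small loops (minus the $\omega$-area of a small filling disc). **Trees.** A graph is a triple $(V,E,\partial)$ with $V$ (vertices), $E$ (edges) finite sets and $\partial:E\to2^V$ with $1\le|\partial(e)|\le2$. Edges with one, resp. two, endpoints are half edges, resp. full edges; $E_{\mathrm{ext}},E_{\mathrm{int}}$ denote the sets of half and full edges; $\deg(v)=|\{e:v\in\partial(e)\}|$. The graph is a tree if the 1-complex with 0-cells $V\sqcup E$ and a 1-cell joining $v$ to $e$ whenever $v\in\partial(e)$ is contractible; it is stable if $\deg(v)\ge3$ for all $v$. A rooted tree is a tree with a chosen half edge $e_0$ (root edge), whose endpoint is $v_0$ (root). It has a unique orientation (each edge having at most one positive endpoint $e^+$ and at most one negative endpoint $e^-$, every endpoint being one or the other) such that $v_0=e_0^+$ and each vertex $v$ is the positive endpoint of a unique edge, denoted $e_v$. Put $v^+=\{e\in E: e^-=v\}$. **Curves.** $\mathbb C\subset\mathbb P^1$ via $z\mapsto[z:1]$.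 $\mathbb P^1$ has the round metric of area $4\pi$. Let $\mathbb A_{\mathcal T}=\mathbb C^{E_{\mathrm{int}}}\oplus\bigoplus_{v\in V}(\mathbb C^2)^{v^+}$ with coordinates $\gamma_e$ ($e\in E_{\mathrm{int}}$) and $(z_{v,e},\rho_{v,e})$ ($e\in v^+$), with the $\|\cdot\|_\infty$ distance. For positive constants $\theta,\tau,\boldsymbol\alpha=\{\alpha_v\}_{v\in V}$ with $\tau\le\frac12$, $\alpha_v\le\theta\le\frac16$, the compact set $\mathcal M_{\mathcal T}(\theta,\tau,\boldsymbol\alpha)\subset\mathbb A_{\mathcal T}$ is defined by $|z_{v,e}|\le\theta$, $\alpha_v\le|\rho_{v,e}|\le2\theta$, $|\rho_{v,e}|+|\rho_{v,e'}|\le\tau|z_{v,e}-z_{v,e'}|$ (for all $v$ and $e\ne e'$ in $v^+$), and $|\gamma_e|\le\tau$ for $e\in E_{\mathrm{int}}$. For $p=(\{\gamma_e\},\{(z_{v,e},\rho_{v,e})\})$ in it, $\mathcal C_{p,\mathcal T}\subset(\mathbb P^1)^V$ is the closed subscheme of tuples $\{[x_v:y_v]\}$ with $(x_u-z_{u,e}y_u)y_v=\gamma_e\rho_{u,e}x_vy_u$ for each $e\in E_{\mathrm{int}}$, $u=e^-$, $v=e^+$; it is a prestable genus $0$ curve. $\pi_v:\mathcal C_{p,\mathcal T}\to\mathbb P^1$ is the projection to the $v$-th factor. Marked points: $\sigma_{\mathcal T}(e_0,p)\in\mathcal C_{p,\mathcal T}$ is the point with all coordinates $[1:0]$; for $e_0\ne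 e\in E_{\mathrm{ext}}$ with $u=e^-$, $\sigma_{\mathcal T}(e,p)$ is the unique point with $\pi_u(\sigma_{\mathcal T}(e,p))=[z_{u,e}:1]$. Let $\mathbb P_{\mathcal T}=\prod_{v\in V}(\mathbb P^1\times(\mathbb P^1)^{v^+})$; its factors are indexed by pairs $(v,e)$ with $v\in\partial(e)$ (the first factor for $v$ is indexed by $(v,e_v)$), with projections $\pi_{v,e}$ and distance the maximum of the distances in the factors. Embed $\mathcal C_{p,\mathcal T}\hookrightarrow\mathbb P_{\mathcal T}$ by letting the $(u,e_u)$-component be $[x_u:y_u]$ and the $(u,e)$-component, $e\in u^+$, be $[x_u-z_{u,e}y_u:\rho_{u,e}y_u]$. **Regions.** In $\mathcal C_{p,\mathcal T}$ put, for $v\in V$, $R_v(p)=\pi_v^{-1}(B^2(1)\setminus\bigsqcup_{e\in v^+}\mathrm{int}\,B^2(z_{v,e},|\rho_{v,e}|))$ (thick region); for $e\in E_{\mathrm{int}}$ with $u=e^-,v=e^+$, $R_e(p)=\pi_u^{-1}(B^2(z_{u,e},|\rho_{u,e}|))\cap\pi_v^{-1}(\mathbb P^1\setminus\mathrm{int}\,B^2(1))$ (neck); $R_{e_0}(p)=\pi_{v_0}^{-1}(\mathbb P^1\setminus\mathrm{int}\,B^2(1))$, and for $e_0\ne e\in E_{\mathrm{ext}}$ with $u=e^-$, $R_e(p)=\pi_u^{-1}(B^2(z_{u,e},|\rho_{u,e}|))$ (ends). On $R_v(p)$ use $\mathrm{dist}_v=\pi_{v,e_v}^*\mathrm{dist}$;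 on $R_e(p)$ use $\mathrm{dist}_e=\max_{u\in\partial(e)}\pi_{u,e}^*\mathrm{dist}$. **Space of maps.** For a stable rooted tree $\mathcal T$, $F\subset E_{\mathrm{ext}}$, compact $K\subset X$, $\eta>0$ and $\boldsymbol\Lambda=\{\Lambda_w\}_{w\in V\cup E}$ positive, $\mathcal M_{\mathcal T,F}(X,J;\theta,\tau,\boldsymbol\alpha;K,\eta,\boldsymbol\Lambda)$ is the set of pairs $(p,f)$ with $p\in\mathcal M_{\mathcal T}(\theta,\tau,\boldsymbol\alpha)$ and $f:\mathcal C_{p,\mathcal T}\to X$ $J$-holomorphic such that $f(\mathcal C_{p,\mathcal T})\subset K$; for every $w\in V\cup E$ the restriction $f|_{R_w(p)}$ has Lipschitz constant $\le\Lambda_w\lambda_0$ with respect to $\mathrm{dist}_w$; and $E(f,R_e(p))\ge(\eta\lambda_0)^2$ for all $e\in E_{\mathrm{ext}}\setminus F$. A point $(p,f)$ of it is regarded as the stable map $(\mathcal C_{p,\mathcal T},\{\sigma_{\mathcal T}(e,p)\}_{e\in F},f)$. Its metric is: the distance of $(p,f),(p',f')$ is the maximum of $\|p-p'\|_\infty$ and the Hausdorff distance of the graphs $\Gamma_f,\Gamma_{f'}\subset\mathbb P_{\mathcal T}\times X$, where $\mathbb P_{\mathcal T}\times X$ has the metric given by the maximum of the distance on $\mathbb P_{\mathcal T}$ and $\lambda_0^{-1}$ times the distance on $X$. *)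

(* Defs.v *)
From HB Require Import structures.
From mathcomp Require Import all_boot all_order all_algebra.
From mathcomp Require Import complex.
From mathcomp Require Import all_classical all_reals all_analysis.

Set Implicit Arguments.
Unset Strict Implicit.
Unset Printing Implicit Defensive.

Import Order.TTheory GRing.Theory Num.Theory.
Import numFieldNormedType.Exports.

Local Open Scope classical_set_scope.
Local Open Scope ring_scope.

Section Smooth.
Context {R : realType}.

(* Used only on open [U] in finite-dimensional [V]; there, continuity of all
   iterated directional derivatives up to order [k] is the usual C^k. *)
Fixpoint Ck {V W : normedModType R} (k : nat) (U : set V) (f : V -> W) : Prop :=
  (forall x, U x -> {for x, continuous f}) /\
  (if k is k'.+1 then
     forall v, (forall x, U x -> derivable f x v) /\ Ck k' U ('D_v f)
   else True).

Definition smooth_on {V W : normedModType R} (U : set V) (f : V -> W) : Prop :=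
  forall k, Ck k U f.

Definition evec {n : nat} (i : 'I_n) : 'rV[R]_n := delta_mx 0 i.

Definition unit_ball {n : nat} : set 'rV[R]_n :=
  [set v | \sum_i v 0 i ^+ 2 < 1].

End Smooth.

(* [coords] and [param] are only meaningful on [dom] and [img]. *)
Record chart (R : realType) (n : nat) (X : topologicalType) := Chart {
  dom : set X;
  img : set 'rV[R]_n;
  coords : X -> 'rV[R]_n;
  param : 'rV[R]_n -> X }.

Section Charts.
Context {R : realType} {n : nat} {X : topologicalType}.
Implicit Types c : chart R n X.

Definition is_chart c : Prop :=
  [/\ open (dom c), open (img c),
      forall x, dom c x ->
        [/\ img c (coords c x), param c (coords c x) = x
          & {for x, continuous (coords c)}]
    & forall y, img c y ->
        [/\ dom c (param c y), coords c (param c y) = y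
          & {for y, continuous (param c)}]].

Definition transition c c' : 'rV[R]_n -> 'rV[R]_n := coords c' \o param c.

Definition compatible c c' : Prop :=
  smooth_on (coords c @` (dom c `&` dom c')) (transition c c') /\
  smooth_on (coords c' @` (dom c `&` dom c')) (transition c' c).

(* Vectors are rows: [v *m jacobian c c' y] is the image of [v] under the
   differential of the transition map. *)
Definition jacobian c c' (y : 'rV[R]_n) : 'M[R]_n :=
  \matrix_(i, j) ('D_(evec i) (transition c c') y) 0 j.

End Charts.

(* In the chart [c], at the point with coordinates [y], for row vectors v, w:
   g(v, w) = v *m metric c y *m w^T, omega(v, w) = v *m sform c y *m w^T and
   J v = v *m acs c y. *)
Record geometry (R : realType) (n : nat) := Geometry {
  space :> topologicalType;
  space_hausdorff : hausdorff_space space;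
  space_countable : @second_countable space;
  atlas : set (chart R n space);
  atlas_chart : forall c, atlas c -> is_chart c;
  atlas_compat : forall c c', atlas c -> atlas c' -> compatible c c';
  atlas_maximal : forall c, is_chart c ->
    (forall c', atlas c' -> compatible c c') -> atlas c;
  chart_at : space -> chart R n space;
  chart_at_atlas : forall x, atlas (chart_at x);
  chart_at_dom : forall x, dom (chart_at x) x;
  metric : chart R n space -> 'rV[R]_n -> 'M[R]_n;
  sform : chart R n space -> 'rV[R]_n -> 'M[R]_n;
  acs : chart R n space -> 'rV[R]_n -> 'M[R]_n;
  tensors_smooth : forall c, atlas c ->
    [/\ smooth_on (img c) (metric c), smooth_on (img c) (sform c)
      & smooth_on (img c) (acs c)];
  tensors_transform : forall c c' x, atlas c -> atlas c' ->
    dom c x -> dom c' x ->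
    let D := jacobian c c' (coords c x) in
    [/\ metric c (coords c x) = D *m metric c' (coords c' x) *m D^T,
        sform c (coords c x) = D *m sform c' (coords c' x) *m D^T
      & acs c (coords c x) *m D = D *m acs c' (coords c' x)];
  metric_riemannian : forall c y, atlas c -> img c y ->
    (metric c y)^T = metric c y /\
    (forall v : 'rV[R]_n, v != 0 -> 0 < (v *m metric c y *m v^T) 0 0);
  form_symplectic : forall c y, atlas c -> img c y ->
    [/\ (sform c y)^T = - sform c y, sform c y \in unitmx
      & forall i j k : 'I_n,
          'D_(evec i) (fun y' => sform c y' j k : R) y
          + 'D_(evec j) (fun y' => sform c y' k i : R) y
          + 'D_(evec k) (fun y' => sform c y' i j : R) y = 0];
  acs_tame : forall c y, atlas c -> img c y ->
    acs c y *m acs c y = - 1%:M /\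
    (forall v : 'rV[R]_n, v != 0 ->
       0 < (v *m sform c y *m (v *m acs c y)^T) 0 0) }.

Section Geometry.
Context {R : realType} {n : nat} (X : geometry R n).
Implicit Types (c : chart R n X) (x : X).

Definition Ck_norm_le (k : nat) (U : set 'rV[R]_n) (A : 'rV[R]_n -> 'M[R]_n)
    (b : R) : Prop :=
  forall (s : seq 'I_n) y i j, (size s <= k)%N -> U y ->
    `| foldr (fun a (h : 'rV[R]_n -> R) => 'D_(evec a) h)
             (fun y' => A y' i j) s y | <= b.

(* [c] is a unit coordinate ball centred at [x] in which, for each k <= j, the
   C^k norms of the matrices and of their inverses are at most [B k]. *)
Definition good_ball (j : nat) (B : nat -> R) x c : Prop :=
  [/\ atlas c, img c = unit_ball, dom c x, coords c x = 0
    & forall k, (k <= j)%N -> forall A,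
        A = metric c \/ A = sform c \/ A = acs c ->
        Ck_norm_le k (img c) A (B k) /\
        Ck_norm_le k (img c) (fun y => invmx (A y)) (B k)].

Definition bounded_geometry (j : nat) (B : nat -> R) : Prop :=
  (forall x, exists c, good_ball j B x c) /\
  (forall k c y (v : 'rV[R]_n), (k <= j)%N -> atlas c -> img c y ->
     (v *m metric c y *m v^T) 0 0
       <= B k * (v *m sform c y *m (v *m acs c y)^T) 0 0).

Definition smooth_map {V : normedModType R} (U : set V) (u : V -> X) : Prop :=
  (forall z, U z -> {for z, continuous u}) /\
  (forall c, atlas c -> smooth_on (U `&` u @^-1` dom c) (coords c \o u)).

(* The derivative of [u] at [z] along [e], in the chart [chart_at (u z)]. *)
Definition vel {V : normedModType R} (u : V -> X) (z e : V) : 'rV[R]_n :=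
  'D_e (coords (chart_at (u z)) \o u) z.

Definition at_pt {T : Type} (F : chart R n X -> 'rV[R]_n -> T) x : T :=
  F (chart_at x) (coords (chart_at x) x).

Definition gdot x (v w : 'rV[R]_n) : R := (v *m at_pt (@metric _ _ X) x *m w^T) 0 0.

Definition curve_length (c : R -> X) (a b : R) : \bar R :=
  (\int[lebesgue_measure]_(t in `[a, b])
     (Num.sqrt (gdot (c t) (vel c t 1) (vel c t 1)))%:E)%E.

(* A piecewise smooth curve can be reparametrized to stop at its corners, so
   smooth (not necessarily immersed) curves give the usual distance. *)
Definition rdist x y : \bar R :=
  ereal_inf [set curve_length c 0 1 | c in
    [set c : R -> X | [/\ smooth_map setT c, c 0 = x & c 1 = y]]].

Notation plane := (R * R)%type.

Definition mu2 := (@lebesgue_measure R \x @lebesgue_measure R)%E.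

Definition dir (b : bool) : plane := if b then (0, 1) else (1, 0).

Definition disc (r : R) : set plane :=
  [set z | z.1 ^+ 2 + z.2 ^+ 2 <= r ^+ 2].

(* On a closed set [D], smoothness means having a smooth extension to a
   neighbourhood; at the boundary points of the domains used below the
   derivatives do not depend on the extension. *)
Definition Jhol (D : set plane) (u : plane -> X) : Prop :=
  exists O, [/\ open O, D `<=` O, smooth_map O u
    & forall z, D z ->
        vel u z (0, 1) = vel u z (1, 0) *m at_pt (@acs _ _ X) (u z)].

(* sum_(i,j) Gamma^k_(ij) v^i w^j for the Levi-Civita connection of g *)
Definition christoffel c (y v w : 'rV[R]_n) : 'rV[R]_n :=
  \row_k \sum_i \sum_j \sum_l
    2^-1 * invmx (metric c y) k l
    * ('D_(evec i) (fun y' => metric c y' j l : R) y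
       + 'D_(evec j) (fun y' => metric c y' i l : R) y
       - 'D_(evec l) (fun y' => metric c y' i j : R) y)
    * v 0 i * w 0 j.

(* [nabla c u [:: e_1; ...; e_i]] is (nabla^i u)(e_1, ..., e_i), i.e.
   nabla_(e_1) ... nabla_(e_(i-1)) (du e_i), for the flat metric on the source,
   in the chart [c]. *)
Fixpoint nabla c (u : plane -> X) (s : seq plane) : plane -> 'rV[R]_n :=
  match s with
  | [::] => fun=> 0
  | e :: s' =>
      let w := coords c \o u in
      if s' is [::] then 'D_e w
      else fun z => 'D_e (nabla c u s') z
                    + christoffel c (w z) ('D_e w z) (nabla c u s' z)
  end.

(* Hilbert-Schmidt norm of nabla^i u at [z] *)
Definition norm_nabla (i : nat) (u : plane -> X) (z : plane) : R :=
  Num.sqrt (\sum_(s : i.-tuple bool)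
    let v := nabla (chart_at (u z)) u (map dir s) z in gdot (u z) v v).

Definition norm_du := norm_nabla 1.

Definition sup_du (D : set plane) (u : plane -> X) : R :=
  sup [set norm_du u z | z in D].

Definition energy (D : set plane) (u : plane -> X) : \bar R :=
  (2^-1%:E * \int[mu2]_(z in D) ((norm_du u z) ^+ 2)%:E)%E.

Definition area (D : set plane) (u : plane -> X) : R :=
  Rintegral mu2 D (fun z : plane =>
    (vel u z (1, 0) *m at_pt (@sform _ _ X) (u z) *m (vel u z (0, 1))^T) 0 0).

Definition loop_length (c : R -> X) : \bar R := curve_length c 0 (2 * pi).

(* [c] is 2pi-periodic; a filling disc is small if it lies within distance
   length(c) of the base point c(0). *)
Definition is_action (c : R -> X) (a : R) : Prop :=
  exists O (v : plane -> X),
    [/\ open O, disc 1 `<=` O, smooth_map O v,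
        (forall t, v (cos t, sin t) = c t)
      & (forall z, disc 1 z -> (rdist (c 0%R) (v z) <= loop_length c)%E) /\
        a = - area (disc 1) v].

End Geometry.

Section Constants.
Context {R : realType}.

(* A constant depending on the dimension and on bounds B_0, B_1, ... *)
Definition geo_constant := nat -> (nat -> R) -> R.

(* [a = a(X_i)] *)
Definition depends_on (i : nat) (a : geo_constant) : Prop :=
  forall n B B', (forall k, (k <= i)%N -> B k = B' k) -> a n B = a n B'.

Definition lambda0_spec (lambda0 : geo_constant) : Prop :=
  depends_on 1 lambda0 /\
  exists c : nat -> geo_constant,
    (forall i, (2 <= i)%N ->
       depends_on i.+1 (c i) /\ (forall n B, 1 <= c i n B)) /\
    forall n j B (X : geometry R n), (3 <= j)%N -> bounded_geometry X j B ->
      [/\ 0 < lambda0 n B,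
          (forall x : X, exists2 b, good_ball j B x b &
             [set y | (rdist x y <= (2 * lambda0 n B)%:E)%E] `<=` dom b)
        & forall i r (u : R * R -> X), (2 <= i)%N -> (i < j)%N -> 0 < r ->
            Jhol (disc r) u ->
            let m := sup_du (disc r) u in
            norm_nabla i u (0, 0)
              <= c i n B * m * (r^-1 + m / lambda0 n B) ^+ (i - 1)].

Definition mean_value_spec (C : R) (q : geo_constant) : Prop :=
  [/\ 1 <= C, depends_on 2 q
    & forall n j B (X : geometry R n), (3 <= j)%N -> bounded_geometry X j B ->
        0 < q n B /\
        forall r (u : R * R -> X), 0 < r -> Jhol (disc r) u ->
          (energy (disc r) u <= (q n B)%:E)%E ->
          ((r ^+ 2 * norm_du u (0, 0) ^+ 2)%:E <= C%:E * energy (disc r) u)%E].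

Definition strip (a b : R) : set (R * R) := [set z | a <= z.1 <= b].

Definition cylinder (a b : R) : set (R * R) :=
  [set z | a <= z.1 <= b /\ 0 <= z.2 <= 2 * pi].

(* Maps on [Rm, Rp] x S^1 are 2pi-periodic maps on [strip Rm Rp]. *)
Definition long_cylinder_spec (lambda0 l : geo_constant) : Prop :=
  depends_on 2 l /\
  exists (c : geo_constant) (K : nat -> geo_constant),
    [/\ depends_on 2 c,
        (forall i, (1 <= i)%N ->
           depends_on i.+1 (K i) /\ (forall n B, 1 <= K i n B))
      & forall n j B (X : geometry R n), (3 <= j)%N -> bounded_geometry X j B ->
        [/\ 0 < l n B <= lambda0 n B, 0 < c n B
          & forall (Rm Rp : R) (u : R * R -> X), Rm < Rp ->
              Jhol (strip Rm Rp) u ->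
              (forall s t, Rm <= s <= Rp -> u (s, t + 2 * pi) = u (s, t)) ->
              (forall z, strip Rm Rp z -> norm_du u z <= l n B) ->
              let loop s := fun t : R => u (s, t) in
              (exists action : R -> R,
                [/\ (forall s a, Rm <= s <= Rp ->
                       (is_action (loop s) a <-> a = action s)),
                    (forall a b, Rm <= a -> a <= b -> b <= Rp ->
                       area (cylinder a b) u = action a - action b)
                  & (forall s, Rm <= s <= Rp ->
                       ((`|action s|%R)%:E <=
                          (c n B)%:E * loop_length (loop s) ^+ 2)%E)])
              /\
              (2 <= Rp - Rm -> forall i s t, (1 <= i)%N -> (i < j)%N ->
                 Rm + 1 <= s <= Rp - 1 ->
                 norm_nabla i u (s, t)
                   <= K i n B * Num.sqrt (fine (energy (cylinder Rm Rp) u))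
                      * (expR (s - Rp) + expR (Rm - s)))]].

Definition a_priori_constants (lambda0 : geo_constant) (C : R)
    (q l : geo_constant) : Prop :=
  [/\ lambda0_spec lambda0, mean_value_spec C q & long_cylinder_spec lambda0 l].

End Constants.

Section ProjectiveLine.
Context {R : realType}.
Notation C := R[i].

(* [Some z] is [z : 1] and [None] is [1 : 0]. *)
Definition P1 : Type := option C.

Definition hx (p : P1) : C := if p is Some z then z else 1.
Definition hy (p : P1) : C := if p is Some _ then 1 else 0.

(* [x : y], for (x, y) != (0, 0) *)
Definition P1_of (x y : C) : P1 := if y == 0 then None else Some (x / y).

Definition P1_swap (p : P1) : P1 := P1_of (hy p) (hx p).

Definition absC (z : C) : R := complex.Re `|z|.

Definition P1_norm (p : P1) : R :=
  Num.sqrt (absC (hx p) ^+ 2 + absC (hy p) ^+ 2).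

(* The distance of the round metric of area 4 pi *)
Definition P1_dist (p p' : P1) : R :=
  2 * acos (absC (hx p * (hx p')^*%C + hy p * (hy p')^*%C)
            / (P1_norm p * P1_norm p')).

Definition affine (z : R * R) : P1 := Some (Complex z.1 z.2).

(* R[i] with its norm topology and normed space structure *)
Definition Cfield : numFieldType := R[i].

Definition affine_holo_at (phi : Cfield -> P1) (z : Cfield) : Prop :=
  (\forall w \near z, phi w <> None) /\
  derivable (fun w : Cfield => hx (phi w) : Cfield) z 1.

Definition P1_holomorphic (phi : P1 -> P1) : Prop :=
  forall z : C,
    (affine_holo_at (fun w => phi (Some w)) z \/
     affine_holo_at (fun w => P1_swap (phi (Some w))) z) /\
    (affine_holo_at (fun w => phi (P1_swap (Some w))) z \/
     affine_holo_at (fun w => P1_swap (phi (P1_swap (Some w)))) z).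

End ProjectiveLine.

Arguments P1 R : clear implicits.

(* The curve obtained from [curve_comp * P1] by gluing [branch nd false] to
   [branch nd true] for each node; [curve_genus] is the vanishing of its
   arithmetic genus #nodes - #components + 1. *)
Record marked_curve (R : realType) (m : nat) := MarkedCurve {
  curve_comp : finType;
  curve_node : finType;
  branch : curve_node -> bool -> curve_comp * P1 R;
  mark : 'I_m -> curve_comp * P1 R;
  branch_inj : forall nd b nd' b',
    branch nd b = branch nd' b' -> nd = nd' /\ b = b';
  mark_inj : injective mark;
  mark_smooth : forall i nd b, mark i <> branch nd b;
  curve_nonempty : (0 < #|curve_comp|)%N;
  curve_connected : forall a a' : curve_comp,
    connect [rel s t | [exists nd, exists b,
               ((branch nd b).1 == s) && ((branch nd (~~ b)).1 == t)]] a a';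
  curve_genus : (#|curve_node| + 1)%N = #|curve_comp| }.

Section StableMaps.
Context {R : realType} {n : nat} (X : geometry R n) {m : nat}.
Implicit Type S : marked_curve R m.

Definition same_point S (p p' : curve_comp S * P1 R) : Prop :=
  p = p' \/ exists nd b, p = branch nd b /\ p' = branch nd (~~ b).

Definition Jhol_P1 (u : P1 R -> X) : Prop :=
  Jhol setT (u \o affine) /\ Jhol setT (u \o P1_swap \o affine).

Definition Jhol_curve S (f : curve_comp S * P1 R -> X) : Prop :=
  (forall p p', same_point p p' -> f p = f p') /\
  (forall a, Jhol_P1 (fun z => f (a, z))).

Definition stable_map S (f : curve_comp S * P1 R -> X) : Prop :=
  Jhol_curve f /\
  forall a, (forall z z', f (a, z) = f (a, z')) ->
    (3 <= #|[set i | (mark S i).1 == a]%SET|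
          + #|[set nb : curve_node S * bool | (branch nb.1 nb.2).1 == a]%SET|)%N.

(* Energy on the subset [U] of the curve. By conformal invariance it is
   computed with the flat metric of the affine chart of each component. *)
Definition curve_energy S (f : curve_comp S * P1 R -> X)
    (U : set (curve_comp S * P1 R)) : \bar R :=
  (\sum_(a : curve_comp S)
     energy [set z | U (a, affine z)] (fun z => f (a, affine z)))%E.

End StableMaps.

Section Contractible.
Context {R : realType}.

Definition contractible {T : topologicalType} (A : set T) : Prop :=
  exists2 a, A a & exists H : R * T -> T,
    [/\ {within `[0, 1] `*` A, continuous H},
        (forall t x, 0 <= t <= 1 -> A x -> A (H (t, x))),
        (forall x, A x -> H (0, x) = x)
      & (forall x, A x -> H (1, x) = a)].

(* The 1-complex with 0-cells [V + E], realized in the Euclidean space with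
   basis the 0-cells, a 1-cell being the segment joining its endpoints *)
Definition realization {V E : finType} (bd : E -> {set V})
    : set 'rV[R]_#|{: V + E}| :=
  let pt (k : V + E) : 'rV[R]_#|{: V + E}| := evec (enum_rank k) in
  range pt `|`
  [set x | exists v e t, [/\ v \in bd e, 0 <= t <= 1
    & x = (1 - t) *: pt (inl v) + t *: pt (inr e)]].

End Contractible.

(* [epos e], [eneg e] are the positive and negative endpoint of [e] (if any)
   for the orientation determined by the root, and [up v] is the edge e_v. *)
Record rooted_tree (R : realType) := RootedTree {
  vert : finType;
  edge : finType;
  bd : edge -> {set vert};
  bd_card : forall e, (1 <= #|bd e| <= 2)%N;
  bd_tree : contractible (R := R) (realization (R := R) bd);
  root_edge : edge;
  root_vertex : vert;
  root_half : bd root_edge = [set root_vertex]%SET;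
  epos : edge -> option vert;
  eneg : edge -> option vert;
  up : vert -> edge;
  bd_orient : forall e,
    bd e = [set v | (epos e == Some v) || (eneg e == Some v)]%SET;
  pos_neg : forall e v, epos e = Some v -> eneg e <> Some v;
  root_pos : epos root_edge = Some root_vertex;
  up_pos : forall v e, (epos e == Some v) = (e == up v) }.

Section Trees.
Context {R : realType} (T : rooted_tree R).

Definition Eext : {set edge T} := [set e | #|bd e| == 1]%SET.
Definition Eint : {set edge T} := [set e | #|bd e| == 2]%SET.
Definition degree (v : vert T) : nat := #|[set e | v \in bd e]%SET|.
Definition stable_tree : Prop := forall v, (3 <= degree v)%N.

(* Each edge belongs to v^+ for at most one v, so z_(v,e) and rho_(v,e) are
   indexed by e alone. The values of [gam] outside [Eint], and those of [zed]
   and [rho] at edges without negative endpoint, are never used. *)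
Record params := Params {
  gam : edge T -> R[i];
  zed : edge T -> R[i];
  rho : edge T -> R[i] }.

Definition param_space (theta tau : R) (alpha : vert T -> R) : set params :=
  [set p |
    [/\ forall v e, eneg e = Some v ->
          absC (zed p e) <= theta /\ alpha v <= absC (rho p e) <= 2 * theta,
        forall v e e', eneg e = Some v -> eneg e' = Some v -> e <> e' ->
          absC (rho p e) + absC (rho p e') <= tau * absC (zed p e - zed p e')
      & forall e, e \in Eint -> absC (gam p e) <= tau]].

Notation ambient := (vert T -> P1 R).

Definition Cp (p : params) : set ambient :=
  [set x | forall e u v, eneg e = Some u -> epos e = Some v ->
    (hx (x u) - zed p e * hy (x u)) * hy (x v)
      = gam p e * rho p e * hx (x v) * hy (x u)].

(* [x] is the marked point sigma(e, p) of C_p, for a half edge [e]. *)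
Definition is_sigma (p : params) (e : edge T) (x : ambient) : Prop :=
  Cp p x /\
  (if e == root_edge T then x = (fun=> None)
   else forall u, eneg e = Some u -> x u = Some (zed p e)).

(* The component of the embedding of C_p with index (e^+, e), resp. (e^-, e) *)
Definition proj_pos (x : ambient) (v : vert T) : P1 R := x v.
Definition proj_neg (p : params) (x : ambient) (u : vert T) (e : edge T)
    : P1 R :=
  P1_of (hx (x u) - zed p e * hy (x u)) (rho p e * hy (x u)).

Definition in_disc (z : R[i]) (r : R) (a : P1 R) : Prop :=
  if a is Some w then absC (w - z) <= r else False.
Definition in_open_disc (z : R[i]) (r : R) (a : P1 R) : Prop :=
  if a is Some w then absC (w - z) < r else False.

(* For an edge, both conditions apply to a full edge, only the first one to a
   half edge other than the root edge, only the second one to the root edge. *)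
Definition region (p : params) (w : vert T + edge T) : set ambient :=
  match w with
  | inl v => [set x | [/\ Cp p x, in_disc 0 1 (x v)
      & forall e, eneg e = Some v ->
          ~ in_open_disc (zed p e) (absC (rho p e)) (x v)]]
  | inr e => [set x | [/\ Cp p x,
      forall u, eneg e = Some u -> in_disc (zed p e) (absC (rho p e)) (x u)
      & forall v, epos e = Some v -> ~ in_open_disc 0 1 (x v)]]
  end.

Definition region_dist (p : params) (w : vert T + edge T) (x y : ambient) : R :=
  match w with
  | inl v => P1_dist (proj_pos x v) (proj_pos y v)
  | inr e =>
      Num.max
        (if epos e is Some v then P1_dist (proj_pos x v) (proj_pos y v) else 0)
        (if eneg e is Some u then P1_dist (proj_neg p x u e) (proj_neg p y u e)
         else 0)
  end.

(* [h] identifies the curve [S] with C_p. As C_p is a nodal curve, a bijection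
   that is holomorphic on every component is an isomorphism of curves. *)
Definition curve_iso {m : nat} (S : marked_curve R m) (p : params)
    (h : curve_comp S * P1 R -> ambient) : Prop :=
  [/\ forall a v, P1_holomorphic (fun z => h (a, z) v),
      forall y y', h y = h y' <-> same_point y y'
    & range h = Cp p].

(* The restriction of [f] to C_p is what matters. J-holomorphicity and energy
   on C_p are those on its normalization, described by an unmarked curve [N]
   isomorphic to C_p; they do not depend on the choice of [N] and [h]. *)
Definition map_space {n : nat} (X : geometry R n) (F : {set edge T})
    (lambda0 theta tau : R) (alpha : vert T -> R) (K : set X) (eta : R)
    (Lambda : vert T + edge T -> R) : set (params * (ambient -> X)) :=
  [set pf | let p := pf.1 in let f := pf.2 in
    [/\ param_space theta tau alpha p,
        f @` Cp p `<=` K,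
        forall w x y, region p w x -> region p w y ->
          (rdist (f x) (f y) <= (Lambda w * lambda0 * region_dist p w x y)%:E)%E
      & exists (N : marked_curve R 0) (h : curve_comp N * P1 R -> ambient),
          [/\ curve_iso p h, Jhol_curve (f \o h)
            & forall e, e \in (Eext :\: F)%SET ->
                (((eta * lambda0) ^+ 2)%:E
                   <= curve_energy (f \o h) (h @^-1` region p (inr e)))%E]]].

(* The stable map (S, x_1, ..., x_m, f) is isomorphic to the stable map
   (C_p, (sigma(e, p))_(e in F), f'), the marked points being matched by the
   bijection [b] from {1, ..., m} to F. *)
Definition stable_map_iso {n m : nat} (X : geometry R n) (S : marked_curve R m)
    (f : curve_comp S * P1 R -> X) (F : {set edge T}) (b : 'I_m -> edge T)
    (p : params) (f' : ambient -> X) : Prop :=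
  injective b /\ F = [set b i | i : 'I_m]%SET /\
  exists h : curve_comp S * P1 R -> ambient,
    [/\ curve_iso p h, forall i, is_sigma p (b i) (h (mark S i))
      & f' \o h = f].

End Trees.

(* Main.v *)
(** On each component, the node leading to the root component is put at infinity;
    on the root component, a marked point or, if there is none, a point of
    maximal density. Points are then chosen: the other nodes and marked points,
    and, greedily, a point of maximal [|df|] among those where [|df|] times the
    distance to the points already chosen is at least
    [kap = 3 sqrt C lam / eps]. By the mean value inequality the added points
    are centres of disjoint discs of energy at least [lam^2], so there are at
    most [A / lam^2] of them; afterwards [|df| dist <= kap] everywhere, with
    [24 kap <= l].

    The vertices of the tree are the clusters, i.e. the sets of chosen points
    whose diameter is small compared to their distance to the other points. A
    cluster [W] with centre [c] provides the coordinate [(z - c) eps / diam W].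
    Distances on thick regions are estimated by integrating [|df|] along segments
    with detours around the removed discs; on necks and ends, the long cylinder
    lemma makes [|df|] decay exponentially in the logarithmic coordinate. *)

Require Import Defs.
From HB Require Import structures.
From mathcomp Require Import all_boot all_order all_algebra.
From mathcomp Require Import complex.
From mathcomp Require Import all_classical all_reals all_analysis.
From mathcomp Require Import measurable_realfun.
From mathcomp Require Import ring lra.

Set Implicit Arguments.
Unset Strict Implicit.
Unset Printing Implicit Defensive.

Import Order.TTheory GRing.Theory Num.Theory.
Import numFieldNormedType.Exports.

Local Open Scope classical_set_scope.
Local Open Scope ring_scope.

(** * Calculus of C^k functions *)

Section C1.
Context {R : realType}.

(** Every half edge except the root is a chosen point, whence the count [A / lam ^ 2 + m + 1]. Each
    component has at least two chosen points: a constant one by stability, a nonconstant one because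
    with at most one point decay on an infinite cylinder would force [df = 0]. The energy of a long
    cylinder is bounded by the actions of its boundary loops rather than by [A]; this is why [M] is
    geometric. Clusters use the ratio [6 eps ^ 3]: small enough for gluing parameters at most
    [4 eps], large enough that one factor [4 eps ^ 3] pays for the growth of the diameter each time
    a child is merged. This is the origin of [alpha_v]. Without marked points the end of the root
    edge must carry energy. With the density maximum at infinity one has [|z| ^ 2 |df| <= a], which
    keeps the chosen points within [2 a / kap]; the region of the end then contains a neighbourhood
    of infinity large enough for the mean value inequality. Distances are infima over smooth curves,
    so broken paths are made smooth by resting at their corners. *)

Lemma C1_differentiable (V : normedModType R) (N : nat) (e : 'I_N -> V)
    (c : 'I_N -> {linear V -> R}) (f : V -> R) (x : V) :
  (forall v, v = \sum_i c i v *: e i) -> (forall i, continuous (c i)) ->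
  (\forall y \near x, forall i, derivable f y (e i)) ->
  (forall i, {for x, continuous ('D_(e i) f)}) ->
  differentiable f x.
Proof.
move=> basis ccont fder fC1.
pose L v : R := \sum_i c i v * 'D_(e i) f x.
have lin : linear L.
  move=> a u v; rewrite /L scaler_sumr -big_split/=; apply: eq_bigr => i _.
  by rewrite linearP mulrDl -scalerAl.
pose L' : {linear V -> R} := HB.pack L (GRing.isLinear.Build _ _ _ _ L lin).
have cL : continuous L'.
  move=> v; apply: cvg_big => [|i _]; first exact: add_continuous.
  by apply: cvgMr_tmp; exact: ccont.
suff H : f \o shift x = cst (f x) + L' +o_ 0 id.
  by apply/diff_locallyP; rewrite (diff_unique cL H).
apply/eqaddoP => _/posnumP[eps].
have /choice[k kP] (i : 'I_N) : exists k, 0 < k /\ forall v, `|c i v| <= k * `|v|.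
  have [k k0 kP] := linear_lipschitz (@ccont i).
  by exists k; split.
(* [M |h|] has to bound two things: the norms of all points visited between the partial sums of [h],
   through the terms [k i |e i|], and the sum of the coordinates of [h], through the terms [k i]. *)
pose M := 1 + \sum_i k i * (1 + `|e i|).
have M0 : 0 < M.
  by rewrite ltr_wpDr // sumr_ge0 // => i _; rewrite mulr_ge0 ?addr_ge0 // ltW //; case: (kP i).
have e0 : 0 < eps%:num / M by rewrite divr_gt0.
have : \forall y \near x, forall i, derivable f y (e i) /\
    `|'D_(e i) f x - 'D_(e i) f y| <= eps%:num / M.
  near=> y => i; split; first by move: i; near: y.
  move: i; near: y; apply: filter_forall => i.
  by have /cvgrPdist_le/(_ _ e0) := fC1 i.
move=> /nbhs_ballP[d /= d0 dP].
near=> h.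
rewrite /= -[in X in `|X|](addr0 h).
(* [S j] keeps the first [j] coordinates of [h]. From [S j] to [S j.+1] only one coordinate moves,
   so the mean value theorem and the continuity of ['D_(e i) f] at [x] control each increment of
   [f]. *)
pose S (j : nat) := \sum_(i < N | (i < j)%N) c i h *: e i.
have hS : h = S N.
  rewrite /S {1}(basis h); apply: eq_bigl => i; by rewrite ltn_ord.
have Mh : M * `|h| < d.
  rewrite -ltr_pdivlMl //; near: h; apply: nbhs0_lt.
  by rewrite mulr_gt0 ?invr_gt0.
have normS j t (i0 : 'I_N) : (j <= i0)%N -> `|t| <= 1 ->
    ball x d (S j + (t * c i0 h) *: e i0 + x).
  move=> ji t1; rewrite -ball_normE /= opprD addrC subrK normrN.
  apply: le_lt_trans Mh; apply: le_trans (ler_normD _ _) _.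
  apply: (@le_trans _ _ (\sum_(i < N | (i < j)%N) k i * `|h| * `|e i| + k i0 * `|h| * `|e i0|)).
    apply: lerD; last first.
      rewrite normrZ normrM; apply: ler_wpM2r => //.
      apply: le_trans (_ : 1 * `|c i0 h| <= _); first exact: ler_wpM2r.
      by rewrite mul1r; case: (kP i0).
    apply: le_trans (ler_norm_sum _ _ _) _; apply: ler_sum => i _.
    by rewrite normrZ; apply: ler_wpM2r => //; case: (kP i).
  rewrite /M mulrDl mul1r mulr_suml.
  apply: (@le_trans _ _ (\sum_(i < N) k i * (1 + `|e i|) * `|h|)); last by rewrite lerDr.
  rewrite [leRHS](bigID (fun i : 'I_N => (i < j)%N)) /=; apply: lerD.
    apply: ler_sum => i _; case: (kP i) => ki _.
    rewrite -!mulrA ler_pM2l // mulrC; apply: ler_wpM2r => //; lra.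
  rewrite (bigD1 i0) /=; last by rewrite -leqNgt.
  apply: ler_wpDr.
    apply: sumr_ge0 => i _; case: (kP i) => ki _.
    by rewrite !mulr_ge0 ?addr_ge0// ltW.
  case: (kP i0) => ki _.
  rewrite -!mulrA ler_pM2l // mulrC; apply: ler_wpM2r => //; lra.
have step j : (j <= N)%N -> `|f (S j + x) - f x - \sum_(i < N | (i < j)%N) c i h * 'D_(e i) f x|
    <= \sum_(i < N | (i < j)%N) `|c i h| * (eps%:num / M).
  elim: j => [_|j IH jN].
    rewrite /S !big_pred0 ?add0r ?subrr ?subr0 ?normr0 //.
  pose i0 := Ordinal jN.
  have bigS (T : nmodType) (F : 'I_N -> T) : \sum_(i < N | (i < j.+1)%N) F i =
      \sum_(i < N | (i < j)%N) F i + F i0.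
    rewrite (bigD1 i0) //= addrC; congr (_ + _); apply: eq_bigl => i.
    rewrite ltnS andbC -val_eqE /= ltn_neqAle; by [].
  rewrite !bigS.
  have -> : S j.+1 = S j + c i0 h *: e i0 by rewrite /S bigS.
  have {}IH := IH (ltnW jN).
  set a := \sum_(i < N | (i < j)%N) _ in IH *.
  set b := \sum_(i < N | (i < j)%N) _ in IH *.
  pose phi t := f (S j + (t * c i0 h) *: e i0 + x).
  pose dphi t := c i0 h * 'D_(e i0) f (S j + (t * c i0 h) *: e i0 + x).
  have dph (t : R) : `|t| <= 1 -> is_derive t 1 phi (dphi t).
    move=> t1; have [fd _] := dP _ (normS j t i0 (leqnn j) t1) i0.
    set y := S j + (t * c i0 h) *: e i0 + x in fd *.
    have gd : is_derive (0 : R) 1 (fun s => f (s *: e i0 + y)) ('D_(e i0) f y).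
      have := derivable1P f y (e i0) => -[/(_ fd) H _].
      apply: DeriveDef => //.
      apply: (congr1 (fun F : R -> R => lim (F @ 0^'))); apply/funext => s /=.
      by rewrite addr0 scale0r add0r [s *: 1]mulr1.
    have -> : phi = (fun s => f (s *: e i0 + y)) \o (fun s => (s - t) * c i0 h).
      apply/funext => s; rewrite /phi /y /=; congr f.
      rewrite -[in RHS](addrC x) -[in LHS](addrC x) [RHS]addrCA; congr (_ + _).
      rewrite [RHS]addrCA; congr (_ + _).
      by rewrite -scalerDl -mulrDl subrK.
    rewrite /dphi -/y.
    have gd0 : is_derive (((t - t) * c i0 h) : R) 1 (fun s => f (s *: e i0 + y)) ('D_(e i0) f y).
      by rewrite subrr mul0r.
    have id1 : is_derive t 1 (fun s => (s - t) * c i0 h) (c i0 h).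
      have -> : (fun s => (s - t) * c i0 h) = (c i0 h) \*: (id - cst t).
        by apply/funext => s; rewrite /= mulrC.
      by apply: is_derive_eq; rewrite subr0 /GRing.scale /= mulr1.
    have -> : c i0 h * 'D_(e i0) f y = 'D_(e i0) f y * c i0 h by rewrite mulrC.
    exact: (@is_derive1_comp R (fun s => f (s *: e i0 + y)) (fun s => (s - t) * c i0 h) t _ _ gd0 id1).
  have [t t01 Ht] : exists2 t, t \in `]0, 1[ & phi 1 - phi 0 = dphi t * (1 - 0).
    apply: MVT => //.
      move=> t /itvP t01; apply: dph; rewrite ger0_norm ?t01 //.
    apply: derivable_within_continuous => t; rewrite in_itv /= => /andP[t0 t1].
    by have [] := dph t; rewrite ?ger0_norm.
  rewrite /phi mul1r mul0r scale0r addr0 subr0 mulr1 in Ht.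
  have -> : f (S j + c i0 h *: e i0 + x) - f x - (a + c i0 h * 'D_(e i0) f x) =
    (f (S j + x) - f x - a) + (dphi t - c i0 h * 'D_(e i0) f x) by rewrite -Ht; ring.
  apply: le_trans (ler_normD _ _) _; apply: lerD => //.
  rewrite /dphi -mulrBr normrM ler_wpM2l // distrC.
  have := normS j t i0 (leqnn j); rewrite ger0_norm ?(itvP t01) // => /(_ isT)/dP/(_ i0)[//].
rewrite addr0.
have := step N (leqnn N); rewrite -hS.
have allN (T : nmodType) (F : 'I_N -> T) : \sum_(i < N | (i < N)%N) F i = \sum_i F i.
  by apply: eq_bigl => i; rewrite ltn_ord.
rewrite !allN.
rewrite [X in `|X| <= _ -> _](_ : _ = f (h + x) - (f x + L h)); last by rewrite opprD addrA.
move=> /le_trans; apply.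
rewrite -mulr_suml.
apply: (@le_trans _ _ (M * `|h| * (eps%:num / M))); last first.
  by rewrite mulrCA mulrAC mulfV ?gt_eqF // mul1r.
apply: ler_wpM2r; first exact: ltW.
rewrite /M mulrDl mul1r mulr_suml; apply: ler_wpDl => //.
apply: ler_sum => i _; case: (kP i) => ki kiP.
apply: le_trans (kiP h) _; apply: ler_wpM2r => //.
by rewrite ler_peMr ?(ltW ki) // lerDl.
Unshelve. all: by end_near. Qed.

End C1.

Section Derivatives.
Context {R : realType}.
Implicit Types V W : normedModType R.

Lemma is_derive_scale V W (h : V -> R) (f : V -> W) (x v : V) (dh : R) (df : W) :
  is_derive x v h dh -> is_derive x v f df ->
  is_derive x v (fun y => h y *: f y) (h x *: df + dh *: f x).
Proof.
move=> [hd hE] [fd fE].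
have H : (fun t : R => t^-1 *: (h (t *: v + x) *: f (t *: v + x) - h x *: f x)) @ 0^'
    --> h x *: df + dh *: f x.
  have -> : (fun t : R => t^-1 *: (h (t *: v + x) *: f (t *: v + x) - h x *: f x)) =
      (fun t : R => h (t *: v + x) *: (t^-1 *: (f (t *: v + x) - f x))
                    + (t^-1 *: (h (t *: v + x) - h x)) *: f x).
    apply/funext => t; rewrite [in RHS]scalerA mulrC -[in RHS]scalerA.
    have -> : (t^-1 *: (h (t *: v + x) - h x)) *: f x =
              t^-1 *: ((h (t *: v + x) - h x) *: f x) by rewrite scalerA.
    rewrite -scalerDr; congr (_ *: _).
    by rewrite scalerBr scalerBl addrA subrK.
  apply: cvgD.
    apply: cvgZ; last by rewrite -fE; exact: fd.
    suff : {for 0, continuous (fun t : R => h (t *: v + x))}.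
      by move=> /continuous_withinNx; rewrite scale0r add0r.
    exact/differentiable_continuous/derivable1_diffP/(derivable1P _ _ _).1.
  by apply: cvgZr_tmp; rewrite -hE; exact: hd.
apply: DeriveDef; last by apply/cvg_lim => //; exact: H.
by apply/cvg_ex; eexists; exact: H.
Qed.

(** On the line through [x] in the direction [v] the inner map depends on one real variable, where
    derivable and differentiable agree; there the chain rule for differentials applies. *)
Lemma is_derive_comp_diff V V' W (f : V' -> W) (phi : V -> V') (x v : V) (w : V') :
  differentiable f (phi x) -> is_derive x v phi w ->
  is_derive x v (f \o phi) ('d f (phi x) w).
Proof.
move=> fd [phid phiE].
pose c (t : R) := phi (t *: v + x).
have cd : differentiable c 0 by apply/derivable1_diffP/(derivable1P _ _ _).1.
have c0 : c 0 = phi x by rewrite /c scale0r add0r.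
have fcd : differentiable f (c 0) by rewrite c0.
have [d1 E1] : is_derive (0 : R) 1 (f \o c) ('d f (phi x) w).
  apply: DeriveDef; first by apply: diff_derivable; apply: differentiable_comp.
  rewrite deriveE; last exact: differentiable_comp.
  rewrite diff_comp //= c0; congr ('d f (phi x) _).
  rewrite -deriveE // -phiE /derive; apply: (congr1 (fun F : R -> V' => lim (F @ 0^'))).
  by apply/funext => s /=; rewrite /c addr0 scale0r add0r [s *: 1]mulr1.
apply: DeriveDef; first by apply/derivable1P.
rewrite -E1 /derive; apply: (congr1 (fun F : R -> W => lim (F @ 0^'))).
by apply/funext => s /=; rewrite /c addr0 scale0r add0r [s *: 1]mulr1.
Qed.

Lemma is_derive_coord V m n (M : V -> 'M[R]_(m, n)) (x v : V) (D : 'M[R]_(m, n)) i j :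
  is_derive x v M D -> is_derive x v (fun y => M y i j : R) (D i j).
Proof.
move=> [dM <-]; apply: DeriveDef; first exact: (derivable_mxP _ _ _).1.
by rewrite derive_mx // mxE.
Qed.

Lemma differentiable_row V n (f : V -> 'rV[R]_n) (x : V) :
  (forall j, differentiable (fun y => f y 0 j : R) x) -> differentiable f x.
Proof.
move=> H.
have -> : f = \sum_(j < n) (fun y => f y 0 j *: (evec j : 'rV[R]_n)).
  apply/funext => y; rewrite fct_sumE [LHS]row_sum_delta; exact: eq_bigr.
by apply: differentiable_sum => j; apply: differentiableZl.
Qed.

Lemma C1_differentiable_row V n (N : nat) (e : 'I_N -> V)
    (c : 'I_N -> {linear V -> R}) (f : V -> 'rV[R]_n) (x : V) :
  (forall v, v = \sum_i c i v *: e i) -> (forall i, continuous (c i)) ->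
  (\forall y \near x, forall i, derivable f y (e i)) ->
  (forall i, {for x, continuous ('D_(e i) f)}) ->
  differentiable f x.
Proof.
move=> basis cc fd fC; apply: differentiable_row => j.
apply: (C1_differentiable basis cc).
  by near=> y => i; apply: (derivable_mxP _ _ _).1; move: i; near: y.
move=> i.
have E : \near x, ('D_(e i) (fun y => f y 0 j : R)) x = ('D_(e i) f x) 0 j.
  near=> y; rewrite derive_mx ?mxE //.
  by move: i; near: y.
rewrite /prop_for /continuous_at (nbhs_singleton E).
apply: (@cvg_trans _ (('D_(e i) f y) 0 j @[y --> x])).
  by apply: near_eq_cvg; near=> y; apply/esym; near: y.
apply: (@cvg_comp _ _ _ ('D_(e i) f) (fun M : 'rV[R]_n => M 0 j) _ (nbhs ('D_(e i) f x))).
  exact: fC.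
exact: coord_continuous.
Unshelve. all: by end_near. Qed.

End Derivatives.

Section PlaneBasis.
Context {R : realType}.
Notation plane := (R * R)%type.

Definition plane_basis (i : 'I_2) : plane := if i == 0 then (1, 0) else (0, 1).
Definition plane_coord_fun (i : 'I_2) (v : plane) : R := if i == 0 then v.1 else v.2.
Fact plane_coord_linear i : linear (plane_coord_fun i).
Proof. by move=> a u v; rewrite /plane_coord_fun; case: ifP. Qed.
HB.instance Definition _ i :=
  GRing.isLinear.Build R plane R _ (plane_coord_fun i) (plane_coord_linear i).
Definition plane_coord i : {linear plane -> R} := plane_coord_fun i.

Lemma plane_basisE v : v = \sum_i plane_coord i v *: plane_basis i.
Proof.
rewrite big_ord_recl big_ord1 /= /plane_coord /= /plane_coord_fun /plane_basis /=.
apply: injective_projections.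
  by change (v.1 = v.1 * 1 + v.2 * 0); ring.
by change (v.2 = v.1 * 0 + v.2 * 1); ring.
Qed.

Lemma plane_coord_continuous i : continuous (plane_coord i).
Proof.
move=> v; rewrite /plane_coord /= /plane_coord_fun; case: (i == 0).
  exact: cvg_fst.
exact: cvg_snd.
Qed.

End PlaneBasis.

Section CkCalculus.
Context {R : realType}.
Implicit Types V W : normedModType R.

Lemma Ck_sub V W k (U U' : set V) (f : V -> W) : U' `<=` U -> Ck k U f -> Ck k U' f.
Proof.
move=> UU; elim: k f => [|k IH] f [cf Hf]; split.
- by move=> x /UU; exact: cf.
- by [].
- by move=> x /UU; exact: cf.
- move=> v; case: (Hf v) => fd fC; split; last exact: IH.
  by move=> x /UU; exact: fd.
Qed.

Lemma CkW V W k (U : set V) (f : V -> W) : Ck k.+1 U f -> Ck k U f.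
Proof.
elim: k f => [|k IH] f [cf Hf]; split => // v; case: (Hf v) => fd fC; split => //.
exact: IH.
Qed.

Lemma Ck_le V W k k' (U : set V) (f : V -> W) : (k <= k')%N -> Ck k' U f -> Ck k U f.
Proof.
move=> kk'; rewrite -(subnKC kk'); elim: (k' - k)%N => [|d IH]; first by rewrite addn0.
by rewrite addnS => /CkW.
Qed.

Lemma Ck_ext V W k (U : set V) (f g : V -> W) : open U ->
  (forall x, U x -> f x = g x) -> Ck k U f -> Ck k U g.
Proof.
move=> oU; elim: k f g => [|k IH] f g fg [cf Hf].
  split=> // x Ux.
  have nfg : \near x, f x = g x.
    by near=> y; apply: fg; near: y; exact: open_nbhs_nbhs.
  rewrite /prop_for /continuous_at -(fg _ Ux).
  apply: cvg_trans (cf _ Ux); apply: near_eq_cvg.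
  by near=> y; apply: fg; near: y; exact: open_nbhs_nbhs.
have nfg x : U x -> \near x, f x = g x.
  by move=> Ux; near=> y; apply: fg; near: y; exact: open_nbhs_nbhs.
split.
  move=> x Ux; rewrite /prop_for /continuous_at -(fg _ Ux).
  by apply: cvg_trans (cf _ Ux); apply: near_eq_cvg; exact: nfg.
move=> v; case: (Hf v) => fd fC; split.
  move=> x Ux; apply: near_eq_derivable (fd _ Ux); exact: nfg.
apply: IH fC => x Ux; apply: near_eq_derive; exact: nfg.
Unshelve. all: by end_near. Qed.

Lemma Ck_bigU V W k I (P : I -> set V) (f : V -> W) :
  (forall i, Ck k (P i) f) -> Ck k (\bigcup_i P i) f.
Proof.
elim: k f => [|k IH] f H; split => //.
- by move=> x [i _ Pi]; have [cf _] := H i; exact: cf.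
- by move=> x [i _ Pi]; have [cf _] := H i; exact: cf.
move=> v; split; last by apply: IH => i; have [_ /(_ v)[]] := H i.
by move=> x [i _ Pi]; have [_ /(_ v)[fd _]] := H i; exact: fd.
Qed.

Lemma Ck_near V W k (U : set V) (f : V -> W) :
  (forall x, U x -> exists U', U' x /\ Ck k U' f) -> Ck k U f.
Proof.
move=> H.
apply: (@Ck_sub _ _ _ (\bigcup_(s in [set U' | Ck k U' f]) s)).
  by move=> x /H[U' [U'x C]]; exists U'.
rewrite bigcup_set_type; apply: Ck_bigU => -[U' /=]; by rewrite inE.
Qed.

Lemma Ck_continuous V W k (U : set V) (f : V -> W) x : Ck k U f -> U x -> {for x, continuous f}.
Proof. by case: k => [|k] [cf _]; exact: cf. Qed.

Lemma Ck_derivable V W k (U : set V) (f : V -> W) x v : Ck k.+1 U f -> U x -> derivable f x v.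
Proof. by move=> [_ /(_ v)[fd _]]; exact: fd. Qed.

Lemma Ck_derive V W k (U : set V) (f : V -> W) v : Ck k.+1 U f -> Ck k U ('D_v f).
Proof. by move=> [_ /(_ v)[]]. Qed.

(* One step of an induction on [k]: it suffices to differentiate on [U]. *)
Lemma CkS V W k (U : set V) (f : V -> W) (df : V -> V -> W) : open U ->
  (forall x v, U x -> is_derive x v f (df v x)) ->
  (forall x, U x -> {for x, continuous f}) ->
  (forall v, Ck k U (df v)) -> Ck k.+1 U f.
Proof.
move=> oU fd cf C; split=> // v; split; first by move=> x /fd-/(_ v)[].
by apply: Ck_ext (C v) => // x /fd-/(_ v)[].
Qed.

Lemma Ck_cst V W k (U : set V) (a : W) : Ck k U (fun=> a).
Proof.
elim: k a => [|k IH] a; split => //; try by move=> x _; exact: cst_continuous.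
move=> v; split; first by move=> x _; exact: derivable_cst.
have -> : 'D_v (fun=> a) = (fun=> 0) by apply/funext => x; exact: derive_cst.
exact: IH.
Qed.

Lemma CkD V W k (U : set V) (f g : V -> W) : open U ->
  Ck k U f -> Ck k U g -> Ck k U (fun x => f x + g x).
Proof.
move=> oU; elim: k f g => [|k IH] f g fC gC.
  split=> // x Ux; apply: continuousD; solve [apply: (Ck_continuous _ Ux); eassumption].
apply: (@CkS _ _ _ _ _ (fun v x => 'D_v f x + 'D_v g x)) => //.
- move=> x v Ux; apply: is_deriveD; apply: derivableP; solve [apply: (Ck_derivable _ Ux); eassumption].
- move=> x Ux; apply: continuousD; solve [apply: (Ck_continuous _ Ux); eassumption].
- by move=> v; apply: IH; exact: Ck_derive.
Qed.

Lemma CkZ V W k (U : set V) (h : V -> R) (f : V -> W) : open U ->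
  Ck k U h -> Ck k U f -> Ck k U (fun x => h x *: f x).
Proof.
move=> oU; elim: k h f => [|k IH] h f hC fC.
  split=> // x Ux; apply: continuousZ; solve [apply: (Ck_continuous _ Ux); eassumption].
apply: (@CkS _ _ _ _ _ (fun v x => h x *: 'D_v f x + 'D_v h x *: f x)) => //.
- move=> x v Ux; apply: is_derive_scale; apply: derivableP; solve [apply: (Ck_derivable _ Ux); eassumption].
- move=> x Ux; apply: continuousZ; solve [apply: (Ck_continuous _ Ux); eassumption].
- move=> v; apply: CkD => //; apply: IH.
  + exact: CkW.
  + exact: Ck_derive.
  + exact: Ck_derive.
  + exact: CkW.
Qed.

Lemma CkM V k (U : set V) (f g : V -> R) : open U ->
  Ck k U f -> Ck k U g -> Ck k U (fun x => f x * g x).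
Proof. exact: (@CkZ V R^o). Qed.

Lemma CkN V W k (U : set V) (f : V -> W) : open U ->
  Ck k U f -> Ck k U (fun x => - f x).
Proof.
move=> oU fC; apply: (@Ck_ext _ _ _ _ (fun x => -1 *: f x)) => //.
  by move=> x _; rewrite scaleN1r.
by apply: CkZ => //; exact: Ck_cst.
Qed.

Lemma CkV V k (U : set V) (f : V -> R) : open U ->
  (forall x, U x -> f x != 0) -> Ck k U f -> Ck k U (fun x => (f x)^-1).
Proof.
move=> oU f0; elim: k => [|k IH] fC.
  split=> // x Ux; apply: continuousV; [exact: f0|solve [apply: (Ck_continuous _ Ux); eassumption]].
apply: (@CkS _ _ _ _ _ (fun v x => - ((f x)^-1 * (f x)^-1 * 'D_v f x))) => //.
- move=> x v Ux; apply: DeriveDef.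
    by apply: derivableV; [exact: f0|solve [apply: (Ck_derivable _ Ux); eassumption]].
  rewrite deriveV; [|exact: f0|solve [apply: (Ck_derivable _ Ux); eassumption]].
  rewrite [LHS]mulNr; congr (- (_ * _)); by rewrite -invfM.
- move=> x Ux; apply: continuousV; [exact: f0|solve [apply: (Ck_continuous _ Ux); eassumption]].
- move=> v; apply: CkN => //; apply: CkM => //; last exact: Ck_derive.
  by apply: CkM => //; apply: IH; exact: CkW.
Qed.

Lemma Ck_linear V W k (U : set V) (f : {linear V -> W}) : continuous f -> Ck k U f.
Proof.
move=> cf; case: k => [|k]; split=> //; try by move=> x _; exact: cf.
move=> v; have fd x : is_derive x v f (f v).
  have fd : differentiable f x by exact: linear_differentiable.
  by apply: DeriveDef; [exact: diff_derivable|rewrite deriveE // diff_lin].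
split; first by move=> x _; have [] := fd x.
have -> : 'D_v f = (fun=> f v) by apply/funext => x; have [] := fd x.
exact: Ck_cst.
Qed.

End CkCalculus.

Section CkPlane.
Context {R : realType}.
Notation plane := (R * R)%type.
Implicit Types V W : normedModType R.

Lemma continuous_pair (T U1 U2 : topologicalType) (f : T -> U1) (g : T -> U2) x :
  {for x, continuous f} -> {for x, continuous g} ->
  {for x, continuous (fun y => (f y, g y))}.
Proof. by move=> fx gx; exact: (cvg_pair fx gx). Qed.

Lemma Ck_fst k (U : set plane) : Ck k U (fst : plane -> R).
Proof. exact: (@Ck_linear _ _ _ _ _ (plane_coord 0) (@plane_coord_continuous _ _)). Qed.

Lemma Ck_snd k (U : set plane) : Ck k U (snd : plane -> R).
Proof. exact: (@Ck_linear _ _ _ _ _ (plane_coord 1) (@plane_coord_continuous _ _)). Qed.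

(** [Ck] speaks of directional derivatives only, while the chain rule needs a differential of the
    outer map; continuous partial derivatives provide it. *)
Lemma Ck1_differentiable_plane n (U : set plane) (f : plane -> 'rV[R]_n) x :
  open U -> Ck 1 U f -> U x -> differentiable f x.
Proof.
move=> oU fC Ux; apply: (C1_differentiable_row plane_basisE plane_coord_continuous).
  by near=> y => i; apply: (Ck_derivable fC); near: y; exact: open_nbhs_nbhs.
by move=> i; apply: (@Ck_continuous _ _ _ 0 U) => //; exact: Ck_derive.
Unshelve. all: by end_near. Qed.

Lemma Ck1_differentiable_rV m n (U : set 'rV[R]_m) (f : 'rV[R]_m -> 'rV[R]_n) x :
  open U -> Ck 1 U f -> U x -> differentiable f x.
Proof.
move=> oU fC Ux.
pose c (i : 'I_m) (v : 'rV[R]_m) : R := v 0 i.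
have lin i : linear (c i) by move=> a u v; rewrite /c !mxE.
pose c' i : {linear 'rV[R]_m -> R} := HB.pack (c i) (GRing.isLinear.Build _ _ _ _ (c i) (lin i)).
apply: (@C1_differentiable_row _ _ _ _ (fun i => evec i) c').
- by move=> v; exact: row_sum_delta.
- by move=> i; exact: coord_continuous.
- by near=> y => i; apply: (Ck_derivable fC); near: y; exact: open_nbhs_nbhs.
- by move=> i; apply: (@Ck_continuous _ _ _ 0 U) => //; exact: Ck_derive.
Unshelve. all: by end_near. Qed.

Lemma diff_plane n (f : plane -> 'rV[R]_n) x w : differentiable f x ->
  'd f x w = w.1 *: 'D_(1, 0) f x + w.2 *: 'D_(0, 1) f x.
Proof.
move=> fd; rewrite !deriveE // -!linearZ -linearD; congr ('d f x _).
by rewrite [LHS]plane_basisE big_ord_recl big_ord1.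
Qed.

Lemma is_derive_pair V V1 V2 (f : V -> V1) (g : V -> V2) x v df dg :
  is_derive x v f df -> is_derive x v g dg ->
  is_derive x v (fun y => (f y, g y)) (df, dg).
Proof.
move=> [fd fE] [gd gE].
have H : (fun t : R => t^-1 *: ((f (t *: v + x), g (t *: v + x)) - (f x, g x))) @ 0^' --> (df, dg).
  by apply: cvg_pair => /=; [rewrite -fE; exact: fd|rewrite -gE; exact: gd].
apply: DeriveDef; last by apply/cvg_lim => //; exact: H.
by apply/cvg_ex; eexists; exact: H.
Qed.

Lemma Ck_comp_plane V n k (U : set V) (U' : set plane) (f : plane -> 'rV[R]_n)
    (phi1 phi2 : V -> R) : open U -> open U' ->
  (forall x, U x -> U' (phi1 x, phi2 x)) ->
  Ck k U phi1 -> Ck k U phi2 -> Ck k U' f -> Ck k U (fun x => f (phi1 x, phi2 x)).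
Proof.
move=> oU oU' UU'; elim: k f => [|k IH] f C1 C2 fC.
  split=> // x Ux; apply: (@continuous_comp _ _ _ (fun y => (phi1 y, phi2 y)) f).
    by apply: continuous_pair; solve [apply: (Ck_continuous _ Ux); eassumption].
  by apply: (Ck_continuous fC); exact: UU'.
have cont x : U x -> {for x, continuous (fun x => f (phi1 x, phi2 x))}.
  move=> Ux; apply: (@continuous_comp _ _ _ (fun y => (phi1 y, phi2 y)) f).
    by apply: continuous_pair; solve [apply: (Ck_continuous _ Ux); eassumption].
  by apply: (Ck_continuous fC); exact: UU'.
apply: (@CkS _ _ _ _ _ _ (fun v x => 'D_v phi1 x *: 'D_(1, 0) f (phi1 x, phi2 x)
   + 'D_v phi2 x *: 'D_(0, 1) f (phi1 x, phi2 x))) => //.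
- move=> x v Ux.
  have fd : differentiable f (phi1 x, phi2 x).
    by apply: (Ck1_differentiable_plane oU'); [exact: Ck_le fC|exact: UU'].
  have := @is_derive_comp_diff _ _ _ _ f (fun y => (phi1 y, phi2 y)) x v
     ('D_v phi1 x, 'D_v phi2 x) fd; rewrite diff_plane //; apply.
  apply: is_derive_pair; apply: derivableP; solve [apply: (Ck_derivable _ Ux); eassumption].
- move=> v; apply: CkD => //; apply: CkZ => //.
  + exact: (Ck_derive v C1).
  + by apply: (IH ('D_(1, 0) f)); [exact: CkW|exact: CkW|exact: Ck_derive].
  + exact: (Ck_derive v C2).
  + by apply: (IH ('D_(0, 1) f)); [exact: CkW|exact: CkW|exact: Ck_derive].
Qed.

Lemma Ck_comp_line V n k (U : set V) (U' : set R) (f : R -> 'rV[R]_n)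
    (phi : V -> R) : open U -> open U' -> (forall x, U x -> U' (phi x)) ->
  Ck k U phi -> Ck k U' f -> Ck k U (fun x => f (phi x)).
Proof.
move=> oU oU' UU'; elim: k f => [|k IH] f C1 fC.
  split=> // x Ux; apply: continuous_comp; first solve [apply: (Ck_continuous _ Ux); eassumption].
  by apply: (Ck_continuous fC); exact: UU'.
apply: (@CkS _ _ _ _ _ _ (fun v x => 'D_v phi x *: 'D_1 f (phi x))) => //.
- move=> x v Ux.
  have fd : differentiable f (phi x).
    by apply/derivable1_diffP; apply: (Ck_derivable fC); exact: UU'.
  have := @is_derive_comp_diff _ _ _ _ f phi x v ('D_v phi x) fd.
  rewrite -[X in 'd f (phi x) X]mulr1 linearZ -deriveE //; apply.
  apply: derivableP; solve [apply: (Ck_derivable _ Ux); eassumption].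
- move=> x Ux; apply: continuous_comp; first solve [apply: (Ck_continuous _ Ux); eassumption].
  by apply: (Ck_continuous fC); exact: UU'.
- move=> v; apply: CkZ => //; first exact: Ck_derive.
  by apply: (IH ('D_1 f)); [exact: CkW|exact: Ck_derive].
Qed.

Lemma is_derive_expR_comp V (f : V -> R) x v df :
  is_derive x v f df -> is_derive x v (fun y => expR (f y)) (expR (f x) * df).
Proof.
move=> fd; have ed : differentiable (expR : R -> R) (f x) by apply/derivable1_diffP.
have := is_derive_comp_diff ed fd.
by rewrite -[X in 'd _ _ X]mulr1 linearZ /= -deriveE // derive_val mulrC.
Qed.

Lemma is_derive_cos_comp V (f : V -> R) x v df :
  is_derive x v f df -> is_derive x v (fun y => cos (f y)) (- (sin (f x) * df)).
Proof.
move=> fd; have ed : differentiable (cos : R -> R) (f x) by apply/derivable1_diffP.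
have := is_derive_comp_diff ed fd.
by rewrite -[X in 'd _ _ X]mulr1 linearZ /= -deriveE // derive_val [_ *: _]mulrC mulNr.
Qed.

Lemma is_derive_sin_comp V (f : V -> R) x v df :
  is_derive x v f df -> is_derive x v (fun y => sin (f y)) (cos (f x) * df).
Proof.
move=> fd; have ed : differentiable (sin : R -> R) (f x) by apply/derivable1_diffP.
have := is_derive_comp_diff ed fd.
by rewrite -[X in 'd _ _ X]mulr1 linearZ /= -deriveE // derive_val mulrC.
Qed.

Lemma Ck_expR V k (U : set V) (f : V -> R) : open U ->
  Ck k U f -> Ck k U (fun x => expR (f x)).
Proof.
move=> oU; elim: k => [|k IH] fC.
  split=> // x Ux; apply: (@continuous_comp _ _ _ f expR); last exact: continuous_expR.
  solve [apply: (Ck_continuous _ Ux); eassumption].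
apply: (@CkS _ _ _ _ _ _ (fun v x => expR (f x) * 'D_v f x)) => //.
- move=> x v Ux; apply: is_derive_expR_comp; apply: derivableP.
  solve [apply: (Ck_derivable _ Ux); eassumption].
- move=> x Ux; apply: (@continuous_comp _ _ _ f expR); last exact: continuous_expR.
  solve [apply: (Ck_continuous _ Ux); eassumption].
- by move=> v; apply: CkM => //; [apply: IH; exact: CkW|exact: Ck_derive].
Qed.

Lemma Ck_cos_sin V k (U : set V) (f : V -> R) : open U ->
  Ck k U f -> Ck k U (fun x => cos (f x)) /\ Ck k U (fun x => sin (f x)).
Proof.
move=> oU; elim: k => [|k IH] fC.
  split; split=> // x Ux.
    apply: (@continuous_comp _ _ _ f cos); last exact: continuous_cos.
    solve [apply: (Ck_continuous _ Ux); eassumption].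
  apply: (@continuous_comp _ _ _ f sin); last exact: continuous_sin.
  solve [apply: (Ck_continuous _ Ux); eassumption].
have [cC sC] := IH (CkW fC).
split.
  apply: (@CkS _ _ _ _ _ _ (fun v x => - (sin (f x) * 'D_v f x))) => //.
  - move=> x v Ux; apply: is_derive_cos_comp; apply: derivableP.
    solve [apply: (Ck_derivable _ Ux); eassumption].
  - move=> x Ux; solve [apply: (Ck_continuous cC); eassumption].
  - by move=> v; apply: CkN => //; apply: CkM => //; exact: Ck_derive.
apply: (@CkS _ _ _ _ _ _ (fun v x => cos (f x) * 'D_v f x)) => //.
- move=> x v Ux; apply: is_derive_sin_comp; apply: derivableP.
  solve [apply: (Ck_derivable _ Ux); eassumption].
- move=> x Ux; solve [apply: (Ck_continuous sC); eassumption].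
- by move=> v; apply: CkM => //; exact: Ck_derive.
Qed.

End CkPlane.

(** * Maps into a manifold *)

Section Manifold.
Context {R : realType} {n : nat} (X : geometry R n).
Implicit Types (V : normedModType R) (c : chart R n X) (x : X).
Notation plane := (R * R)%type.

Lemma open_preimage_on (S T : topologicalType) (U : set S) (D : set T) (u : S -> T) :
  open U -> (forall z, U z -> {for z, continuous u}) -> open D ->
  open (U `&` u @^-1` D).
Proof.
move=> oU cu oD; rewrite openE => z [Uz Dz]; rewrite /interior.
apply: filterI; first exact: open_nbhs_nbhs.
by apply: (cu _ Uz); exact: open_nbhs_nbhs.
Qed.

Lemma atlas_open_dom c : atlas c -> open (dom c).
Proof. by move=> /atlas_chart[]. Qed.

Lemma open_overlap c c' : atlas c -> atlas c' ->
  open (coords c @` (dom c `&` dom c')).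
Proof.
move=> ac ac'; have [oc oi cP pP] := atlas_chart ac.
have -> : coords c @` (dom c `&` dom c') = img c `&` param c @^-1` dom c'.
  apply/seteqP; split=> [_ [x [dx d'x] <-]|y [iy d'y]].
    by have [iy pc _] := cP _ dx; split=> //=; rewrite pc.
  by have [dy cy _] := pP _ iy; exists (param c y).
apply: open_preimage_on => //; last exact: atlas_open_dom.
by move=> y /pP[].
Qed.

Section Smooth.
Context {V : normedModType R} (U : set V) (u : V -> X).
Hypotheses (oU : open U) (su : smooth_map U u).

Lemma smooth_map_Ck k c : atlas c -> Ck k (U `&` u @^-1` dom c) (coords c \o u).
Proof. by move=> ac; case: su => _ /(_ c ac) /(_ k). Qed.

Lemma smooth_map_open c : atlas c -> open (U `&` u @^-1` dom c).
Proof.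
move=> ac; apply: open_preimage_on => //; last exact: atlas_open_dom.
by case: su.
Qed.

Lemma smooth_map_derivable c z e : atlas c -> U z -> dom c (u z) ->
  derivable (coords c \o u) z e.
Proof. by move=> ac Uz dz; apply: Ck_derivable (smooth_map_Ck 1 ac) _. Qed.

Lemma chart_change_derive c c' z e : atlas c -> atlas c' -> U z ->
  dom c (u z) -> dom c' (u z) ->
  'D_e (coords c' \o u) z = 'D_e (coords c \o u) z *m Defs.jacobian c c' (coords c (u z)).
Proof.
move=> ac ac' Uz dz d'z.
have [oc oi cP pP] := atlas_chart ac.
have [tC _] := atlas_compat ac ac'.
have td : differentiable (transition c c') (coords c (u z)).
  apply: (Ck1_differentiable_rV (open_overlap ac ac') (tC 1%N)).
  by exists (u z).
have wd : is_derive z e (coords c \o u) ('D_e (coords c \o u) z).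
  by apply: derivableP; exact: smooth_map_derivable.
have [_ H] := is_derive_comp_diff td wd.
have E : \near z, (coords c' \o u) z = (transition c c' \o (coords c \o u)) z.
  near=> y; rewrite /transition /=.
  have : (U `&` u @^-1` dom c) y.
    by near: y; apply: open_nbhs_nbhs; split => //; exact: smooth_map_open.
  by move=> [_ /cP[_ -> _]].
rewrite (near_eq_derive _ E) H.
set y := coords c (u z); set w := 'D_e _ z.
rewrite {1}[w]row_sum_delta linear_sum; apply/rowP => j.
rewrite summxE [RHS]mxE; apply: eq_bigr => i _.
by rewrite linearZ mxE mxE -deriveE.
Unshelve. all: by end_near. Qed.

End Smooth.

(** The pullback by [u] of a covariant 2-tensor, computed in a given chart. [vel] uses
    [chart_at (u z)], which may jump with [z]; by [pullform_chart] the value does not depend on the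
    chart, so near a point one fixed chart can be used and continuity follows. *)
Definition pullform (T : chart R n X -> 'rV[R]_n -> 'M[R]_n) c {V} (u : V -> X) (z e e' : V) : R :=
  ('D_e (coords c \o u) z *m T c (coords c (u z)) *m ('D_e' (coords c \o u) z)^T) 0 0.

Definition covariant (T : chart R n X -> 'rV[R]_n -> 'M[R]_n) : Prop :=
  (forall c, atlas c -> smooth_on (img c) (T c)) /\
  forall c c' x, atlas c -> atlas c' -> dom c x -> dom c' x ->
    let D := Defs.jacobian c c' (coords c x) in
    T c (coords c x) = D *m T c' (coords c' x) *m D^T.

Lemma metric_covariant : covariant (@metric _ _ X).
Proof.
split=> [c /tensors_smooth[]//|c c' x ac ac' dx d'x].
by have [] := tensors_transform ac ac' dx d'x.
Qed.

Lemma sform_covariant : covariant (@sform _ _ X).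
Proof.
split=> [c /tensors_smooth[]//|c c' x ac ac' dx d'x].
by have [] := tensors_transform ac ac' dx d'x.
Qed.

Lemma pullform_chart T V (U : set V) (u : V -> X) c c' z e e' : covariant T ->
  open U -> smooth_map U u -> atlas c -> atlas c' -> U z ->
  dom c (u z) -> dom c' (u z) -> pullform T c u z e e' = pullform T c' u z e e'.
Proof.
move=> [_ Tt] oU su ac ac' Uz dz d'z; rewrite /pullform.
rewrite (Tt _ _ _ ac ac' dz d'z).
rewrite !(chart_change_derive oU su _ ac ac' Uz dz d'z) trmx_mul.
by rewrite !mulmxA.
Qed.

Lemma continuous_mxE (S : topologicalType) p q (M : S -> 'M[R]_(p, q)) s i j :
  {for s, continuous M} -> {for s, continuous (fun t => M t i j)}.
Proof.
move=> cM; apply: (@continuous_comp _ _ _ M (fun A : 'M[R]_(p, q) => A i j)) => //.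
exact: coord_continuous.
Qed.

Lemma continuous_sumR (S : topologicalType) m (F : 'I_m -> S -> R) s :
  (forall i, {for s, continuous (F i)}) -> {for s, continuous (fun t => \sum_i F i t)}.
Proof. by move=> cF; apply: cvg_big => [|i _]; [exact: add_continuous|exact: cF]. Qed.

Lemma pullform_continuous T V (U : set V) (u : V -> X) z e e' : covariant T ->
  open U -> smooth_map U u -> U z ->
  {for z, continuous (fun y => pullform T (chart_at (u y)) u y e e')}.
Proof.
move=> cT oU su Uz; set c := chart_at (u z).
have ac : atlas c by exact: chart_at_atlas.
have dz : dom c (u z) by exact: chart_at_dom.
have W : (U `&` u @^-1` dom c) z by [].
have oW : open (U `&` u @^-1` dom c) := smooth_map_open oU su ac.
have E : \near z, pullform T (chart_at (u z)) u z e e' = pullform T c u z e e'.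
  near=> y.
  have [Uy dy] : (U `&` u @^-1` dom c) y by near: y; exact: open_nbhs_nbhs.
  apply: (pullform_chart e e' cT oU su _ ac Uy _ dy); first exact: chart_at_atlas.
  exact: chart_at_dom.
rewrite /prop_for /continuous_at (nbhs_singleton E).
apply: (@cvg_trans _ (pullform T c u y e e' @[y --> z])).
  by apply: near_eq_cvg; near=> y; apply/esym; near: y.
have [_ _ cP _] := atlas_chart ac.
have wc : {for z, continuous (coords c \o u)}.
  by apply: (Ck_continuous (smooth_map_Ck su 0 ac)).
have dc e0 : {for z, continuous ('D_e0 (coords c \o u))}.
  by apply: (@Ck_continuous _ _ _ 0 _ _ z) W; apply: Ck_derive; exact: smooth_map_Ck.
have Tc : {for z, continuous (fun y => T c (coords c (u y)))}.
  apply: (@continuous_comp _ _ _ (coords c \o u) (T c)) => //.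
  apply: (Ck_continuous (cT.1 _ ac 0%N)).
  by have [] := cP _ dz.
suff : {for z, continuous (fun y => pullform T c u y e e')} by [].
have -> : (fun y => pullform T c u y e e') = fun y =>
   \sum_j (\sum_i 'D_e (coords c \o u) y 0 i * T c (coords c (u y)) i j)
     * 'D_e' (coords c \o u) y 0 j.
  apply/funext => y; rewrite /pullform mxE; apply: eq_bigr => j _.
  by rewrite !mxE.
apply: continuous_sumR => j; apply: continuousM; last exact: continuous_mxE.
apply: continuous_sumR => i; apply: continuousM; first exact: continuous_mxE.
exact: continuous_mxE.
Unshelve. all: by end_near. Qed.

Lemma gdot_vel V (u : V -> X) (z e e' : V) :
  gdot (u z) (vel u z e) (vel u z e') = pullform (@metric _ _ X) (chart_at (u z)) u z e e'.
Proof. by []. Qed.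

Lemma gdotC x (v w : 'rV[R]_n) : gdot x v w = gdot x w v.
Proof.
rewrite /gdot /at_pt; set M := metric _ _.
have Ms : M^T = M.
  have [] := @metric_riemannian _ _ X (chart_at x) (coords (chart_at x) x) (chart_at_atlas x).
    by have [_ _ /(_ _ (chart_at_dom x))[]] := atlas_chart (chart_at_atlas x).
  by [].
have -> : (w *m M *m v^T) 0 0 = ((w *m M *m v^T)^T) 0 0 by rewrite [RHS]mxE.
by rewrite !trmx_mul trmxK Ms mulmxA.
Qed.

Lemma gdot_ge0 x (v : 'rV[R]_n) : 0 <= gdot x v v.
Proof.
have [->|v0] := eqVneq v 0; first by rewrite /gdot !mul0mx mxE.
have [] := @metric_riemannian _ _ X (chart_at x) (coords (chart_at x) x) (chart_at_atlas x).
  by have [_ _ /(_ _ (chart_at_dom x))[]] := atlas_chart (chart_at_atlas x).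
by move=> _ /(_ _ v0)/ltW.
Qed.

Lemma gdotDl x (u v w : 'rV[R]_n) : gdot x (u + v) w = gdot x u w + gdot x v w.
Proof. by rewrite /gdot !mulmxDl mxE. Qed.

Lemma gdotZl x a (v w : 'rV[R]_n) : gdot x (a *: v) w = a * gdot x v w.
Proof. by rewrite /gdot -!scalemxAl mxE. Qed.

Lemma gdotDr x (u v w : 'rV[R]_n) : gdot x w (u + v) = gdot x w u + gdot x w v.
Proof. by rewrite ![gdot x w _]gdotC gdotDl. Qed.

Lemma gdotZr x a (v w : 'rV[R]_n) : gdot x w (a *: v) = a * gdot x w v.
Proof. by rewrite ![gdot x w _]gdotC gdotZl. Qed.

Lemma norm_duE (u : plane -> X) z :
  norm_du u z = Num.sqrt (gdot (u z) (vel u z (1, 0)) (vel u z (1, 0))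
                        + gdot (u z) (vel u z (0, 1)) (vel u z (0, 1))).
Proof.
rewrite /norm_du /norm_nabla; congr Num.sqrt.
rewrite (reindex (fun b : bool => [tuple b])) /=; last first.
  exists (fun s : 1.-tuple bool => thead s) => [b _|s _]; first by rewrite theadE.
  by apply/val_inj; case: s => -[|b [|]].
rewrite big_bool [LHS]addrC; congr (_ + _).
Qed.

Lemma norm_du_ge0 (u : plane -> X) z : 0 <= norm_du u z.
Proof. exact: sqrtr_ge0. Qed.

Lemma sqr_norm_du (u : plane -> X) z :
  norm_du u z ^+ 2 = gdot (u z) (vel u z (1, 0)) (vel u z (1, 0))
                   + gdot (u z) (vel u z (0, 1)) (vel u z (0, 1)).
Proof. by rewrite norm_duE sqr_sqrtr // addr_ge0 ?gdot_ge0. Qed.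

Lemma norm_du_continuous (U : set plane) (u : plane -> X) z :
  open U -> smooth_map U u -> U z -> {for z, continuous (norm_du u)}.
Proof.
move=> oU su Uz.
have -> : norm_du u = fun z => Num.sqrt
    (pullform (@metric _ _ X) (chart_at (u z)) u z (1, 0) (1, 0)
   + pullform (@metric _ _ X) (chart_at (u z)) u z (0, 1) (0, 1)).
  by apply/funext => y; rewrite norm_duE !gdot_vel.
apply: (@continuous_comp _ _ _ (fun z =>
    (pullform (@metric _ _ X) (chart_at (u z)) u z (1, 0) (1, 0)
   + pullform (@metric _ _ X) (chart_at (u z)) u z (0, 1) (0, 1))) Num.sqrt);
  last exact: sqrt_continuous.
by apply: continuousD; apply: (pullform_continuous metric_covariant oU su Uz).
Qed.

Section CompPlane.
Context {V : normedModType R} (U : set V) (U' : set plane) (u : plane -> X)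
  (p1 p2 : V -> R).
Hypotheses (oU : open U) (oU' : open U') (su : smooth_map U' u)
  (UU' : forall z, U z -> U' (p1 z, p2 z))
  (C1 : smooth_on U p1) (C2 : smooth_on U p2).

Lemma smooth_map_comp_plane : smooth_map U (fun z => u (p1 z, p2 z)).
Proof.
split=> [z Uz|c ac k].
  apply: (@continuous_comp _ _ _ (fun y => (p1 y, p2 y)) u).
    by apply: continuous_pair; [exact: (Ck_continuous (C1 0%N))|exact: (Ck_continuous (C2 0%N))].
  by case: su => cu _; apply: cu; exact: UU'.
have oW := smooth_map_open oU' su ac.
have cp z : U z -> {for z, continuous (fun y => (p1 y, p2 y))}.
  by move=> Uz; apply: continuous_pair; [exact: (Ck_continuous (C1 0%N))|exact: (Ck_continuous (C2 0%N))].
have oW' : open (U `&` (fun z => u (p1 z, p2 z)) @^-1` dom c).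
  have -> : U `&` (fun z => u (p1 z, p2 z)) @^-1` dom c =
     U `&` (fun y => (p1 y, p2 y)) @^-1` (U' `&` u @^-1` dom c).
    apply/seteqP; split=> [z [Uz dz]|z [Uz [_ dz]]]; last by [].
    by split=> //=; split => //; exact: UU'.
  exact: open_preimage_on.
apply: (@Ck_comp_plane _ _ _ _ _ (U' `&` u @^-1` dom c) (coords c \o u)) => //.
- by move=> z [Uz dz]; split => //; exact: UU'.
- by apply: Ck_sub (C1 k) => z [].
- by apply: Ck_sub (C2 k) => z [].
- exact: smooth_map_Ck.
Qed.

Lemma vel_comp_plane z e : U z ->
  vel (fun z => u (p1 z, p2 z)) z e =
    'D_e p1 z *: vel u (p1 z, p2 z) (1, 0) + 'D_e p2 z *: vel u (p1 z, p2 z) (0, 1).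
Proof.
move=> Uz; rewrite /vel; set c := chart_at _.
have ac : atlas c by exact: chart_at_atlas.
have W : (U' `&` u @^-1` dom c) (p1 z, p2 z).
  by split; [exact: UU'|exact: chart_at_dom].
have ud : differentiable (coords c \o u) (p1 z, p2 z).
  apply: Ck1_differentiable_plane W; first exact: smooth_map_open.
  exact: smooth_map_Ck.
have pd : is_derive z e (fun y => (p1 y, p2 y)) ('D_e p1 z, 'D_e p2 z).
  apply: is_derive_pair; apply: derivableP.
    exact: (Ck_derivable (C1 1%N)).
  exact: (Ck_derivable (C2 1%N)).
have [_] := is_derive_comp_diff ud pd.
by rewrite diff_plane.
Qed.

End CompPlane.

Lemma gdot_comb_le x (a b : R) (v w : 'rV[R]_n) :
  gdot x (a *: v + b *: w) (a *: v + b *: w) <=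
  (a ^+ 2 + b ^+ 2) * (gdot x v v + gdot x w w).
Proof.
(* The difference of the two sides is the square norm of [b *: v - a *: w]. *)
have := gdot_ge0 x (b *: v - a *: w).
rewrite -scaleNr !gdotDl !gdotDr !gdotZl !gdotZr (gdotC x w v).
move: (gdot x v v) (gdot x v w) (gdot x w w) => p q r; nra.
Qed.

Lemma gdot_conformal x (a b : R) (v w : 'rV[R]_n) :
  gdot x (a *: v + b *: w) (a *: v + b *: w)
  + gdot x (- b *: v + a *: w) (- b *: v + a *: w) =
  (a ^+ 2 + b ^+ 2) * (gdot x v v + gdot x w w).
Proof.
rewrite !gdotDl !gdotDr !gdotZl !gdotZr (gdotC x w v).
move: (gdot x v v) (gdot x v w) (gdot x w w) => p q r; ring.
Qed.

(** The four values are the Cauchy-Riemann equations for the complex derivative [a + i b]; such a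
    matrix is a rotation scaled by the modulus, which scales the Hilbert-Schmidt norm. *)
Lemma norm_du_conformal (U : set plane) (U' : set plane) (u : plane -> X)
    (p1 p2 : plane -> R) (z : plane) (a b : R) :
  open U -> open U' -> smooth_map U' u -> (forall z, U z -> U' (p1 z, p2 z)) ->
  smooth_on U p1 -> smooth_on U p2 -> U z ->
  'D_(1, 0) p1 z = a -> 'D_(1, 0) p2 z = b ->
  'D_(0, 1) p1 z = - b -> 'D_(0, 1) p2 z = a ->
  norm_du (fun z => u (p1 z, p2 z)) z = Num.sqrt (a ^+ 2 + b ^+ 2) * norm_du u (p1 z, p2 z).
Proof.
move=> oU oU' su UU C1 C2 Uz E1 E2 E3 E4.
rewrite !norm_duE -sqrtrM ?addr_ge0 ?sqr_ge0 //; congr Num.sqrt.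
rewrite !(vel_comp_plane oU' su UU C1 C2 _ Uz) E1 E2 E3 E4.
exact: gdot_conformal.
Qed.

Lemma Jhol_conformal (D D' U U' : set plane) (u : plane -> X) (p1 p2 : plane -> R) :
  open U -> open U' -> D `<=` U -> smooth_map U' u ->
  (forall z, D' z -> vel u z (0, 1) = vel u z (1, 0) *m at_pt (@acs _ _ X) (u z)) ->
  (forall z, U z -> U' (p1 z, p2 z)) -> (forall z, D z -> D' (p1 z, p2 z)) ->
  smooth_on U p1 -> smooth_on U p2 ->
  (forall z, D z -> 'D_(0, 1) p1 z = - 'D_(1, 0) p2 z /\ 'D_(0, 1) p2 z = 'D_(1, 0) p1 z) ->
  Jhol D (fun z => u (p1 z, p2 z)).
Proof.
move=> oU oU' DU su Ju UU DD C1 C2 CR.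
exists U; split => //; first exact: smooth_map_comp_plane oU oU' su UU C1 C2.
move=> z Dz; have Uz := DU _ Dz; have [E1 E2] := CR _ Dz.
rewrite !(vel_comp_plane oU' su UU C1 C2 _ Uz) E1 E2 (Ju _ (DD _ Dz)).
set J := at_pt _ _; set v := vel _ _ _.
have JJ : J *m J = - 1%:M.
  have [] := @acs_tame _ _ X (chart_at (u (p1 z, p2 z))) (coords (chart_at (u (p1 z, p2 z))) (u (p1 z, p2 z))) (chart_at_atlas _).
    by have [_ _ /(_ _ (chart_at_dom _))[]] := atlas_chart (chart_at_atlas (u (p1 z, p2 z))).
  by [].
rewrite mulmxDl -!scalemxAl -mulmxA JJ mulmxN mulmx1 scalerN scaleNr.
by rewrite addrC.
Qed.

End Manifold.

(** * A smooth step built from flat functions *)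

Section SmoothStep.
Context {R : realType}.
Implicit Types (P : {poly R}) (x y t : R).

Definition flat (P : {poly R}) (x : R) : R :=
  if 0 < x then P.[x^-1] * expR (- x^-1) else 0.

Lemma exprn_expRN_le y m : 0 <= y -> y ^+ m * expR (- y) <= m%:R ^+ m.
Proof.
move=> y0; case: m => [|m]; first by rewrite !expr0 mul1r -expR0 ler_expR oppr_le0.
have m0 : (0 : R) < m.+1%:R by rewrite ltr0n.
set z := y / m.+1%:R; have z0 : 0 <= z by rewrite divr_ge0 // ltW.
(* After this substitution it remains to compare the powers of [z] and [expR z], and
   [z <= 1 + z <= expR z]. *)
have -> : y = m.+1%:R * z by rewrite mulrC divfK ?gt_eqF.
rewrite exprMn -mulrA ler_piMr ?exprn_ge0 ?ler0n //.
rewrite expRN expRM_natl ler_pdivrMr ?exprn_gt0 ?expR_gt0 // mul1r.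
by rewrite lerXn2r ?nnegrE ?expR_ge0 //; apply: le_trans (expR_ge1Dx z); rewrite lerDr.
Qed.

Lemma poly_expRN_bounded P : exists2 B, 0 <= B &
  forall y, 0 <= y -> `|P.[y]| * y ^+ 2 * expR (- y) <= B.
Proof.
exists (\sum_(i < size P) `|P`_i| * (i + 2)%N%:R ^+ (i + 2)).
  by apply: sumr_ge0 => i _; rewrite mulr_ge0 // exprn_ge0.
move=> y y0; rewrite horner_coef -mulrA.
apply: (@le_trans _ _ ((\sum_(i < size P) `|P`_i| * y ^+ i) * (y ^+ 2 * expR (- y)))).
  rewrite ler_wpM2r ?mulr_ge0 ?exprn_ge0 ?expR_ge0 //.
  apply: le_trans (ler_norm_sum _ _ _) _; apply: ler_sum => i _.
  by rewrite normrM normrX (ger0_norm y0).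
rewrite mulr_suml; apply: ler_sum => i _.
rewrite -mulrA ler_wpM2l // mulrA -exprD; exact: exprn_expRN_le.
Qed.

(** A quadratic bound at the origin makes the derivative there exist and vanish, whatever the
    polynomial. *)
Lemma flat_le P : exists2 B, 0 <= B & forall x, `|flat P x| <= B * x ^+ 2.
Proof.
have [B B0 HB] := poly_expRN_bounded P; exists B => // x.
rewrite /flat; case: ifPn => x0; last by rewrite normr0 mulr_ge0 ?sqr_ge0.
have := HB x^-1; rewrite invr_ge0 ltW // => /(_ isT) H.
rewrite normrM (ger0_norm (expR_ge0 _)) -ler_pdivrMr ?exprn_gt0 //.
by apply: le_trans H; rewrite -exprVn mulrAC.
Qed.

Definition dflat P : {poly R} := 'X^2 * (P - P^`()).

Lemma is_derive_flat P x : is_derive x 1 (flat P) (flat (dflat P) x).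
Proof.
have [x0|x0|->] := ltrgt0P x.
- have Q : is_derive x 1 (fun y : R => P.[y^-1] * expR (- y^-1)) (flat (dflat P) x).
    have dV : is_derive x 1 (fun y : R => y^-1) (- (x ^- 2)).
      apply: DeriveDef; first by apply: derivableV => //; exact: lt0r_neq0.
      by rewrite deriveV ?lt0r_neq0 // derive_id [LHS]mulr1.
    have dP : is_derive x 1 (fun y : R => P.[y^-1]) (P^`().[x^-1] * - (x ^- 2)).
      exact: (@is_derive1_comp R (horner P) (fun y => y^-1) x _ _ (is_derive_poly P x^-1) dV).
    have dN : is_derive x 1 (fun y : R => - y^-1) (x ^- 2).
      by have := is_deriveN dV; rewrite opprK.
    have dE : is_derive x 1 (fun y : R => expR (- y^-1)) (expR (- x^-1) * x ^- 2).
      exact: is_derive_expR_comp.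
    rewrite /flat x0 /dflat; apply: (is_derive_eq (is_deriveM dP dE)); rewrite !hornerE -!exprVn.
      set w := x^-1; move: (P.[w]) (P^`().[w]) (expR _) => p q E.
      change (p * (E * w ^+ 2) + E * (q * - w ^+ 2) = w ^+ 2 * (p - q) * E); ring.
  apply: near_eq_is_derive Q; near=> y.
  rewrite /flat ifT //; near: y; exact: lt_nbhsr.
- have -> : flat (dflat P) x = 0 by rewrite /flat ltNge (ltW x0).
  apply: (near_eq_is_derive _ (is_derive_cst (0 : R) x (1 : R))).
  near=> y; rewrite /flat ifF //; apply/negbTE; rewrite -leNgt ltW //.
  near: y; exact: lt_nbhsl.
- have [B B0 HB] := flat_le P.
  have H : (fun t : R => t^-1 *: (flat P (t *: 1 + 0) - flat P 0)) @ 0^' --> (0 : R).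
    apply/cvgrPdist_le => e e0; near=> t.
    rewrite sub0r normrN addr0 [t *: 1]mulr1 {2}/flat ltxx subr0 normrM normfV.
    have t0 : t != 0 by near: t; exact: nbhs_dnbhs_neq.
    rewrite mulrC ler_pdivrMr ?normr_gt0 //.
    apply: le_trans (HB t) _; rewrite -[t ^+ 2]real_normK ?num_real // expr2 mulrA ler_wpM2r //.
    apply: (@le_trans _ _ ((B + 1) * `|t|)); first by rewrite ler_wpM2r // lerDl.
    rewrite -ler_pdivlMl ?ltr_wpDl //; apply: ltW; near: t; apply: dnbhs0_lt.
    by rewrite mulr_gt0 // invr_gt0 ltr_wpDl.
  have -> : flat (dflat P) 0 = 0 by rewrite /flat ltxx.
  apply: DeriveDef; last by apply/cvg_lim => //; exact: H.
  by apply/cvg_ex; eexists; exact: H.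
Unshelve. all: by end_near. Qed.

Lemma is_derive_line {W : normedModType R} (f : R -> W) x d v :
  is_derive x 1 f d -> is_derive x v f (v *: d).
Proof.
move=> [/derivable1_diffP fd <-]; apply: DeriveDef; first exact: diff_derivable.
by rewrite !deriveE // -linearZ [v *: 1]mulr1.
Qed.

Definition bump (x : R) : R := flat 1 x.
Definition dbump (x : R) : R := flat (dflat 1) x.

Lemma bump_ge0 x : 0 <= bump x.
Proof. by rewrite /bump /flat; case: ifP => // _; rewrite hornerE mul1r expR_ge0. Qed.

Lemma bump_gt0 x : 0 < x -> 0 < bump x.
Proof. by move=> x0; rewrite /bump /flat x0 hornerE mul1r expR_gt0. Qed.

Lemma bump_eq0 x : x <= 0 -> bump x = 0.
Proof. by move=> x0; rewrite /bump /flat ltNge x0. Qed.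

Lemma dbump_ge0 x : 0 <= dbump x.
Proof.
rewrite /dbump /flat; case: ifP => // x0.
by rewrite /dflat derivC subr0 mulr1 !hornerE mulr_ge0 ?expR_ge0 // exprn_ge0 // invr_ge0 ltW.
Qed.

Definition step_den t : R := bump (t - 3^-1) + bump (2 / 3 - t).
(** The two bumps never vanish together because [1 / 3 < 2 / 3], so the quotient is smooth. It is
    [0] up to [1 / 3] and [1] from [2 / 3] on, where the curves of [reach] rest. *)
Definition step t : R := bump (t - 3^-1) * (step_den t)^-1.
Definition dstep t : R :=
  (dbump (t - 3^-1) * bump (2 / 3 - t) + bump (t - 3^-1) * dbump (2 / 3 - t))
  * ((step_den t)^-1) ^+ 2.

Lemma step_den_gt0 t : 0 < step_den t.
Proof.
rewrite /step_den; have [t3|t3] := ltP 3^-1 t.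
  by apply: ltr_wpDr; [exact: bump_ge0|apply: bump_gt0; rewrite subr_gt0].
by apply: ltr_wpDl; [exact: bump_ge0|apply: bump_gt0; lra].
Qed.

Lemma step0 t : t <= 3^-1 -> step t = 0.
Proof. by move=> t3; rewrite /step bump_eq0 ?mul0r // subr_le0. Qed.

Lemma step1 t : 2 / 3 <= t -> step t = 1.
Proof.
move=> t3; have := step_den_gt0 t.
rewrite /step /step_den (@bump_eq0 (2 / 3 - t)) ?subr_le0 // addr0 => h.
by rewrite mulfV ?gt_eqF.
Qed.

Lemma step_ge0 t : 0 <= step t.
Proof. by rewrite mulr_ge0 ?bump_ge0 // invr_ge0 ltW // step_den_gt0. Qed.

Lemma step_le1 t : step t <= 1.
Proof. by rewrite ler_pdivrMr ?step_den_gt0 // mul1r lerDl bump_ge0. Qed.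

Lemma is_derive_bump_shift t a : is_derive t 1 (fun t => bump (t - a)) (dbump (t - a)).
Proof.
have d : is_derive t 1 (fun t : R => t - a) (1 : R).
  by apply: is_derive_eq; rewrite subr0.
have := @is_derive1_comp R (flat 1) (fun t => t - a) t _ _ (is_derive_flat 1 (t - a)) d.
by rewrite mulr1.
Qed.

Lemma is_derive_bump_refl t a : is_derive t 1 (fun t => bump (a - t)) (- dbump (a - t)).
Proof.
have d : is_derive t 1 (fun t : R => a - t) (- 1 : R).
  by apply: (is_derive_eq (is_deriveB (is_derive_cst a t 1) (is_derive_id t 1))); rewrite sub0r.
have := @is_derive1_comp R (flat 1) (fun t => a - t) t _ _ (is_derive_flat 1 (a - t)) d.
by rewrite mulrN1.
Qed.

Lemma is_derive_step t : is_derive t 1 step (dstep t).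
Proof.
have d1 := is_derive_bump_shift t 3^-1; have d2 := is_derive_bump_refl t (2 / 3).
have d3 : is_derive t 1 step_den (dbump (t - 3^-1) - dbump (2 / 3 - t)) := is_deriveD d1 d2.
have D0 : step_den t != 0 by rewrite gt_eqF // step_den_gt0.
have d4 : is_derive t 1 (fun t => (step_den t)^-1)
    (- ((step_den t)^-1 ^+ 2 * (dbump (t - 3^-1) - dbump (2 / 3 - t)))).
  have [dd dE] := d3.
  apply: DeriveDef; first exact: derivableV.
  by rewrite deriveV // dE [LHS]mulNr exprVn.
apply: (is_derive_eq (is_deriveM d1 d4)).
rewrite /dstep /GRing.scale /= -/(step_den t).
set p := dbump (t - _); set q := dbump (_ - t); set a := bump (t - _).
have -> : (step_den t)^-1 * p = (step_den t)^-1 ^+ 2 * (step_den t * p).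
  by rewrite expr2 -mulrA mulKf.
rewrite /step_den -/a; set b := bump (_ - t); ring.
Qed.

Lemma dstep_ge0 t : 0 <= dstep t.
Proof.
by rewrite /dstep mulr_ge0 ?sqr_ge0 // addr_ge0 // mulr_ge0 ?bump_ge0 ?dbump_ge0.
Qed.

Lemma Ck_flat_affine k P (a b : R) : Ck k setT (fun t : R => flat P (a * t + b)).
Proof.
have aff t : is_derive t 1 (fun t : R => a * t + b) a.
  have h : is_derive t 1 (fun t : R => a *: t) (a *: 1) by exact: is_deriveZ.
  by have := is_deriveD h (is_derive_cst b t 1); rewrite addr0 [a *: 1]mulr1.
have d P' t : is_derive t 1 (fun t => flat P' (a * t + b)) (flat (dflat P') (a * t + b) * a).
  exact: (@is_derive1_comp R (flat P') (fun t => a * t + b) t _ _ (is_derive_flat P' _) (aff t)).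
elim: k P => [|k IH] P.
  split=> // t _; apply: differentiable_continuous; apply/derivable1_diffP.
  by have [] := d P t.
apply: (@CkS _ _ _ _ _ _ (fun v t => v *: (flat (dflat P) (a * t + b) * a))).
- exact: openT.
- by move=> t v _; apply: is_derive_line; exact: d.
- move=> t _; apply: differentiable_continuous; apply/derivable1_diffP.
  by have [] := d P t.
- move=> v; apply: CkZ; [exact: openT|exact: Ck_cst|].
  by apply: CkM; [exact: openT|exact: IH|exact: Ck_cst].
Qed.

Lemma Ck_step k : Ck k setT step.
Proof.
have C1 : Ck k setT (fun t : R => bump (t - 3^-1)).
  have -> : (fun t : R => bump (t - 3^-1)) = fun t => flat 1 (1 * t + - 3^-1).
    by apply/funext => t; rewrite mul1r.
  exact: Ck_flat_affine.
have C2 : Ck k setT (fun t : R => bump (2 / 3 - t)).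
  have -> : (fun t : R => bump (2 / 3 - t)) = fun t => flat 1 ((-1) * t + 2 / 3).
    by apply/funext => t; rewrite mulN1r addrC.
  exact: Ck_flat_affine.
apply: CkM; [exact: openT|exact: C1|].
apply: CkV; [exact: openT| |by apply: CkD => //; exact: openT].
by move=> t _; rewrite gt_eqF // step_den_gt0.
Qed.

Lemma dstep_continuous : continuous dstep.
Proof.
move=> t.
have := Ck_derive (1 : R) (Ck_step 1) => /Ck_continuous/(_ I).
have -> : 'D_1 step = dstep by apply/funext => s; have [] := is_derive_step s.
exact.
Qed.

End SmoothStep.

(** * Lengths of curves *)

Section Reach.
Context {R : realType} {n : nat} (X : geometry R n).
Notation plane := (R * R)%type.

Definition speed (c : R -> X) (t : R) : R := Num.sqrt (gdot (c t) (vel c t 1) (vel c t 1)).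

(* The curve is constant near its ends, so that such curves can be
   concatenated; [g] bounds its speed and [G] is a primitive of [g]. *)
Definition reach (x y : X) (L : R) : Prop :=
  exists (c : R -> X) (G g : R -> R),
    [/\ smooth_map setT c,
        (forall t, t <= 3^-1 -> c t = x) /\ (forall t, 2 / 3 <= t -> c t = y),
        (forall t, t <= 3^-1 -> G t = 0) /\ (forall t, 2 / 3 <= t -> G t = L),
        (forall t : R, is_derive t 1 G (g t)) /\ continuous g
      & forall t, speed c t <= g t].

Lemma speed_continuous (c : R -> X) : smooth_map setT c -> continuous (speed c).
Proof.
move=> sc t; apply: (@continuous_comp _ _ _
  (fun t => pullform (@metric _ _ X) (chart_at (c t)) c t 1 1) Num.sqrt);
  last exact: sqrt_continuous.
exact: (pullform_continuous (@metric_covariant R n X) (@openT _) sc).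
Qed.

Lemma reach_rdist x y L : reach x y L -> (rdist x y <= L%:E)%E.
Proof.
move=> [c [G [g [sc [cx cy] [G0 G1] [dG cg] sg]]]].
apply: (@le_trans _ _ (curve_length c 0 1)).
  apply: ereal_inf_lbound; exists c => //; split => //.
    by rewrite cx // invr_ge0.
  by rewrite cy // ler_pdivrMr // mul1r ler_nat.
have cG t : {for t, continuous G}.
  by apply: differentiable_continuous; apply/derivable1_diffP; have [] := dG t.
have I : (\int[lebesgue_measure]_(t in `[0%R, 1%R]) (g t)%:E = L%:E)%E.
  rewrite (@continuous_FTC2 _ g G).
  - by rewrite G1 ?G0 ?sube0 // ?invr_ge0 // ler_pdivrMr // mul1r ler_nat.
  - exact: ltr01.
  - exact: continuous_subspaceT.
  - split=> [t _||]; first by have [] := dG t.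
      by apply: cvg_at_right_filter; exact: cG.
    by apply: cvg_at_left_filter; exact: cG.
  - by move=> t _; rewrite derive1E; have [] := dG t.
rewrite -I /curve_length; apply: ge0_le_integral => //=.
- apply/measurable_EFinP; apply: measurable_funTS; apply: continuous_measurable_fun.
  exact: speed_continuous.
- apply/measurable_EFinP; apply: measurable_funTS; exact: continuous_measurable_fun.
- by move=> t _; rewrite lee_fin; exact: sg.
Qed.

Lemma smooth_map_cst (x : X) : smooth_map (setT : set R) (fun=> x).
Proof.
split=> [z _|c ac k]; first exact: cst_continuous.
exact: Ck_cst.
Qed.

Lemma speed_near (c c' : R -> X) t : (\near t, c t = c' t) -> speed c t = speed c' t.
Proof.
move=> cc'; rewrite /speed /vel (nbhs_singleton cc').
rewrite (@near_eq_derive _ _ _ (coords (chart_at (c' t)) \o c) (coords (chart_at (c' t)) \o c')) //.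
by near=> y => /=; rewrite (near cc' y).
Unshelve. all: by end_near. Qed.

Lemma smooth_map_near (c : R -> X) :
  (forall t, exists U c', [/\ open U, U t, smooth_map setT c' & forall s, U s -> c s = c' s]) ->
  smooth_map setT c.
Proof.
move=> H; split=> [t _|ch ach k].
  have [U [c' [oU Ut [cc' _] E]]] := H t.
  have nU : nbhs t U by exact: open_nbhs_nbhs.
  rewrite /prop_for /continuous_at (E _ Ut).
  apply: cvg_trans (cc' t I); apply: near_eq_cvg.
  by apply: filterS nU => s /E.
apply: Ck_near => t [_ dt].
have [U [c' [oU Ut sc' E]]] := H t.
have oD := smooth_map_open (@openT R) sc' ach.
have C := smooth_map_Ck sc' k ach.
exists (U `&` ([set: R] `&` c' @^-1` dom ch)); split.
  by split => //; split => //=; rewrite -E.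
apply: (@Ck_ext _ _ _ _ _ (coords ch \o c')); first exact: openI.
  by move=> s [Us _] /=; rewrite E.
by apply: Ck_sub C => s [].
Qed.

Lemma speed_affine (c : R -> X) (a b t : R) : smooth_map setT c ->
  speed (fun t => c (a * t + b)) t = `|a| * speed c (a * t + b).
Proof.
move=> sc; rewrite /speed.
have -> : vel (fun t => c (a * t + b)) t 1 = a *: vel c (a * t + b) 1.
  rewrite /vel; set ch := chart_at _.
  have cd : derivable (coords ch \o c) (a * t + b) 1.
    apply: (@smooth_map_derivable _ _ _ _ setT c sc) => //; first exact: chart_at_atlas.
    exact: chart_at_dom.
  have ad : is_derive t 1 (fun t : R => a * t + b) a.
    have h : is_derive t 1 (fun t : R => a *: t) (a *: 1) by exact: is_deriveZ.
    by have := is_deriveD h (is_derive_cst b t 1); rewrite addr0 [a *: 1]mulr1.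
  move/derivable1_diffP in cd.
  have [_] := @is_derive_comp_diff _ _ _ _ _ (fun t : R => a * t + b) t 1 a cd ad.
  by move=> H; rewrite [LHS]H -[X in 'd _ _ X]mulr1 linearZ /= -deriveE.
by rewrite gdotZl gdotZr mulrA -expr2 sqrtrM ?sqr_ge0 // sqrtr_sqr.
Qed.

Lemma smooth_map_affine (c : R -> X) (a b : R) : smooth_map setT c ->
  smooth_map setT (fun t => c (a * t + b)).
Proof.
have aC k (U : set R) : open U -> Ck k U (fun t : R => a * t + b).
  move=> oU; apply: CkD => //; last exact: Ck_cst.
  apply: CkM => //; first exact: Ck_cst.
  by apply: (@Ck_linear _ _ _ _ _ idfun) => x; exact: cvg_id.
have ac : continuous (fun t : R => a * t + b).
  by move=> t; exact: (Ck_continuous (aC 0%N setT (@openT _))).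
move=> sc; split=> [t _|ch ach k].
  apply: continuous_comp; first exact: ac.
  by case: sc => cc _; exact: cc.
have oD := smooth_map_open (@openT R) sc ach.
have oD' : open ([set: R] `&` (fun t => c (a * t + b)) @^-1` dom ch).
  apply: open_preimage_on; [exact: openT| |exact: atlas_open_dom].
  move=> t _; apply: continuous_comp; first exact: ac.
  by case: sc => cc _; exact: cc.
apply: (@Ck_comp_line _ _ _ _ _ ([set: R] `&` c @^-1` dom ch) (coords ch \o c)) => //.
- exact: aC.
- exact: smooth_map_Ck.
Qed.

Lemma reach_refl x : reach x x 0.
Proof.
exists (fun=> x), (fun=> 0), (fun=> 0); split => //.
- exact: smooth_map_cst.
- by split=> [t|]; [exact: is_derive_cst|exact: cst_continuous].
- move=> t; rewrite /speed.
  have -> : vel (fun=> x) t 1 = 0.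
    by rewrite /vel; exact: derive_cst.
  by rewrite /gdot !mul0mx mxE sqrtr0.
Qed.

(** The curve is kept; only the majorant of its speed grows, by a multiple of [dstep]. *)
Lemma reach_le x y L L' : L <= L' -> reach x y L -> reach x y L'.
Proof.
move=> LL [c [G [g [sc cxy [G0 G1] [dG cg] sg]]]].
exists c, (fun t => G t + (L' - L) * step t), (fun t => g t + (L' - L) * dstep t); split; [exact: sc|exact: cxy| | |].
- split=> t Ht; first by rewrite G0 // step0 // mulr0 addr0.
  by rewrite G1 // step1 // mulr1 addrC subrK.
- split=> [t|t].
    exact: (is_deriveD (dG t) (is_deriveZ (L' - L) (is_derive_step t))).
  apply: cvgD; first exact: cg.
  by apply: cvgMl_tmp; exact: dstep_continuous.
- move=> t; apply: le_trans (sg t) _; rewrite lerDl mulr_ge0 ?subr_ge0 //; exact: dstep_ge0.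
Qed.

Lemma reach_trans y x z L L' : reach x y L -> reach y z L' -> reach x z (L + L').
Proof.
move=> [c [G [g [sc [c0 c1] [G0 G1] [dG cg] sg]]]].
move=> [c' [G' [g' [sc' [c'0 c'1] [G'0 G'1] [dG' cg'] sg']]]].
(* The factor [4] squeezes the two motions into [[1/3, 5/12]] and [[7/12, 2/3]]. Hence the new curve
   again rests outside [[1/3, 2/3]], and both formulas agree between [5/12] and [7/12]. *)
pose d t := if t < 2^-1 then c (4 * t + - 1) else c' (4 * t + - 2).
have dl t : t < 7 / 12 -> d t = c (4 * t + - 1).
  move=> t3; rewrite /d; case: ltP => // t2.
  rewrite c'0; first by rewrite c1 //; lra.
  lra.
have dr t : 5 / 12 < t -> d t = c' (4 * t + - 2).
  move=> t3; rewrite /d; case: ltP => // t2.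
  rewrite c1; first by rewrite c'0 //; lra.
  lra.
have nl (t : R) : t < 2^-1 -> \forall s \near t, d s = c (4 * s + - 1).
  move=> t2; near=> s; apply: dl; near: s; apply: lt_nbhsl; lra.
have nr (t : R) : 2^-1 <= t -> \forall s \near t, d s = c' (4 * s + - 2).
  move=> t2; near=> s; apply: dr; near: s; apply: lt_nbhsr; lra.
have g_ge0 t : 0 <= g t by apply: le_trans (sg t); exact: sqrtr_ge0.
have g'_ge0 t : 0 <= g' t by apply: le_trans (sg' t); exact: sqrtr_ge0.
have aff (a b t : R) : is_derive t 1 (fun t : R => a * t + b) a.
  have h : is_derive t 1 (fun t : R => a *: t) (a *: 1) by exact: is_deriveZ.
  by have := is_deriveD h (is_derive_cst b t 1); rewrite addr0 [a *: 1]mulr1.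
have caff (a b : R) : continuous (fun t : R => a * t + b).
  by move=> t; apply: differentiable_continuous; apply/derivable1_diffP; have [] := aff a b t.
have cg1 : continuous (fun t : R => g (4 * t + - 1)).
  move=> t; apply: (@continuous_comp _ _ _ (fun t : R => 4 * t + - 1) g).
    exact: caff.
  exact: cg.
have cg2 : continuous (fun t : R => g' (4 * t + - 2)).
  move=> t; apply: (@continuous_comp _ _ _ (fun t : R => 4 * t + - 2) g').
    exact: caff.
  exact: cg'.
exists d, (fun t => G (4 * t + - 1) + G' (4 * t + - 2)),
  (fun t => g (4 * t + - 1) * 4 + g' (4 * t + - 2) * 4); split.
- apply: smooth_map_near => t; have [t2|t2] := ltP t 2^-1.
    exists [set s | s < 7 / 12], (fun t => c (4 * t + - 1)).
    by split; [exact: open_lt|rewrite /=; lra|exact: smooth_map_affine|exact: dl].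
  exists [set s | 5 / 12 < s], (fun t => c' (4 * t + - 2)).
  by split; [exact: open_gt|rewrite /=; lra|exact: smooth_map_affine|exact: dr].
- split=> t Ht; first by rewrite dl ?c0 //; lra.
  by rewrite dr ?c'1 //; lra.
- split=> t Ht.
    by rewrite G0 ?G'0 ?addr0 //; lra.
  by rewrite G1 ?G'1 //; lra.
- split=> [t|t].
    exact: (is_deriveD
      (@is_derive1_comp R G (fun t => 4 * t + - 1) t _ _ (dG _) (aff _ _ _))
      (@is_derive1_comp R G' (fun t => 4 * t + - 2) t _ _ (dG' _) (aff _ _ _))).
  apply: cvgD; apply: cvgMr_tmp.
    exact: cg1.
  exact: cg2.
- move=> t; have [t2|t2] := ltP t 2^-1.
    rewrite (speed_near (nl _ t2)) speed_affine // ger0_norm // mulrC.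
    by apply: ler_wpDr; [rewrite mulr_ge0|rewrite ler_wpM2r].
  rewrite (speed_near (nr _ t2)) speed_affine // ger0_norm // mulrC.
  by apply: ler_wpDl; [rewrite mulr_ge0|rewrite ler_wpM2r].
Unshelve. all: by end_near. Qed.

(** Running along the segment with parameter [step] makes the curve rest at both ends; its speed is
    at most [L] times the length times [dstep], which has the primitive [step]. *)
Lemma reach_segment (U : set plane) (u : plane -> X) (z z' : plane) L :
  open U -> smooth_map U u ->
  (forall s, 0 <= s <= 1 ->
     let y := (z.1 + s * (z'.1 - z.1), z.2 + s * (z'.2 - z.2)) in
     U y /\ norm_du u y <= L) ->
  reach (u z) (u z') (L * Num.sqrt ((z'.1 - z.1) ^+ 2 + (z'.2 - z.2) ^+ 2)).
Proof.
move=> oU su H; set D := Num.sqrt _.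
pose p (a b t : R) := a + step t * (b - a).
have pC a b : smooth_on setT (p a b).
  move=> k; apply: CkD; [exact: openT|exact: Ck_cst|].
  by apply: CkM; [exact: openT|exact: Ck_step|exact: Ck_cst].
have pD a b (t : R) : is_derive t 1 (p a b) (dstep t * (b - a)).
  have h := is_deriveM (is_derive_step t) (is_derive_cst (b - a) t (1 : R)).
  apply: (is_derive_eq (is_deriveD (is_derive_cst a t (1 : R)) h)).
  by rewrite scaler0 !add0r [_ *: _]mulrC.
pose c t := u (p z.1 z'.1 t, p z.2 z'.2 t).
have UU t : setT t -> U (p z.1 z'.1 t, p z.2 z'.2 t).
  by move=> _; have [] := H (step t); rewrite ?step_ge0 ?step_le1.
have L0 : 0 <= L.
  have [|_] := H 0; first by rewrite lexx ler01.
  by apply: le_trans; exact: norm_du_ge0.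
exists c, (fun t => (L * D) * step t), (fun t => (L * D) * dstep t); split.
- exact: (smooth_map_comp_plane (@openT _) oU su UU (pC _ _) (pC _ _)).
- split=> t Ht; rewrite /c /p; first by rewrite step0 // !mul0r !addr0; case: (z).
  by rewrite step1 // !mul1r ![_ + (_ - _)]addrC !subrK; case: (z').
- by split=> t Ht; [rewrite step0 // mulr0|rewrite step1 // mulr1].
- split=> [t|t]; first exact: (is_deriveZ _ (is_derive_step t)).
  by apply: cvgMl_tmp; exact: dstep_continuous.
- move=> t; rewrite /speed (vel_comp_plane oU su UU (pC _ _) (pC _ _)) //.
  rewrite -[leRHS]ger0_norm; last first.
    by rewrite mulr_ge0 ?dstep_ge0 // mulr_ge0 // sqrtr_ge0.
  rewrite -sqrtr_sqr ler_wsqrtr //.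
  have [_ ->] := pD z.1 z'.1 t; have [_ ->] := pD z.2 z'.2 t.
  apply: le_trans (gdot_comb_le _ _ _ _ _) _.
  rewrite -sqr_norm_du.
  have [_ nL] : U (p z.1 z'.1 t, p z.2 z'.2 t) /\ norm_du u (p z.1 z'.1 t, p z.2 z'.2 t) <= L.
    by apply: H; rewrite step_ge0 step_le1.
  have h : norm_du u (p z.1 z'.1 t, p z.2 z'.2 t) ^+ 2 <= L ^+ 2.
    by rewrite lerXn2r // nnegrE norm_du_ge0.
  have key (ds a b N : R) : D ^+ 2 = a ^+ 2 + b ^+ 2 -> N <= L ^+ 2 ->
      ((ds * a) ^+ 2 + (ds * b) ^+ 2) * N <= (L * D * ds) ^+ 2.
    move=> DE NL; have -> : (L * D * ds) ^+ 2 = (ds ^+ 2 * D ^+ 2) * L ^+ 2 by ring.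
    rewrite DE !exprMn -mulrDr; apply: ler_wpM2l => //.
    by rewrite mulr_ge0 ?addr_ge0 ?sqr_ge0.
  by apply: key => //; rewrite sqr_sqrtr ?addr_ge0 ?sqr_ge0.
Qed.

Lemma gdot_eq0 (x : X) v : gdot x v v = 0 -> v = 0.
Proof.
move=> g0; apply/eqP; apply: contraT => v0.
have [] := @metric_riemannian _ _ X (chart_at x) (coords (chart_at x) x) (chart_at_atlas x).
  by have [_ _ /(_ _ (chart_at_dom x))[]] := atlas_chart (chart_at_atlas x).
by move=> _ /(_ _ v0); rewrite [X in 0 < X]g0 ltxx.
Qed.

Lemma norm_du_eq0 (u : plane -> X) z : norm_du u z = 0 ->
  vel u z (1, 0) = 0 /\ vel u z (0, 1) = 0.
Proof.
move=> n0; have := sqr_norm_du u z; rewrite n0 expr0n /= => /esym/eqP.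
by rewrite paddr_eq0 ?gdot_ge0 // => /andP[/eqP/gdot_eq0 -> /eqP/gdot_eq0 ->].
Qed.

Lemma is_derive0_cst_near (f : R -> R) (t : R) :
  (\forall s \near t, is_derive s (1 : R) f 0) -> \forall s \near t, f s = f t.
Proof.
move=> /nbhs_ballP[e /= e0 He].
apply/nbhs_ballP; exists e => //= s; rewrite -ball_normE /= => ts.
have fd (r : R) : r \in `[Num.min s t, Num.max s t] -> is_derive r 1 f 0.
  rewrite in_itv /= => /andP[r1 r2]; apply: He; rewrite -ball_normE /=.
  move: r1 r2 ts; rewrite /Num.min /Num.max; case: ltP => st r1 r2.
    by rewrite !ger0_norm ?subr_ge0 // ?(ltW st) // => h; apply: le_lt_trans h; rewrite lerD2l lerN2.
  rewrite distrC => h; apply: le_lt_trans h.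
  by rewrite [leLHS]distrC !ger0_norm ?subr_ge0 // lerD2r.
have le_mM : Num.min s t <= Num.max s t by rewrite le_max !ge_min !lexx.
have fdo (r : R) : r \in `]Num.min s t, Num.max s t[ -> is_derive r (1 : R) f ((fun=> 0) r).
  by move=> rI; apply: fd; exact: subset_itv_oo_cc rI.
have fc : {within `[Num.min s t, Num.max s t], continuous f}.
  by apply: derivable_within_continuous => r /fd[].
have [x _] := MVT_segment le_mM fdo fc.
rewrite mul0r => /eqP; rewrite subr_eq0 => /eqP.
by rewrite /Num.min /Num.max; case: ltP.
Qed.

(** The set where [c t = c 0] is open by the mean value theorem in a chart, closed because the
    manifold is Hausdorff, and the line is connected. *)
Lemma vel0_constant (c : R -> X) : smooth_map setT c -> (forall t, vel c t 1 = 0) ->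
  forall t, c t = c 0.
Proof.
move=> sc v0; suff : [set t | c t = c 0] = setT by move=> E t; rewrite -[_ = _]/([set t | c t = c 0] t) E.
have cc : continuous c by move=> t; case: sc => h _; exact: h.
have cR : connected (setT : set R).
  by apply/connected_intervalP => x y.
apply: (cR); first by exists 0.
- exists [set t | c t = c 0]; last by rewrite setTI.
  rewrite openE => t /= ct; rewrite /interior /=.
  set ch := chart_at (c t).
  have ach : atlas ch by exact: chart_at_atlas.
  have dt : dom ch (c t) by exact: chart_at_dom.
  have [_ _ cP _] := atlas_chart ach.
  have oD := smooth_map_open (@openT R) sc ach.
  have nD : nbhs t (setT `&` c @^-1` dom ch) by exact: open_nbhs_nbhs.
  have D0 (s : R) : dom ch (c s) -> is_derive s (1 : R) (coords ch \o c) 0.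
    move=> ds; apply: DeriveDef.
      by apply: (@smooth_map_derivable _ _ _ _ setT c sc).
    have := v0 s; rewrite /vel => vs.
    have := @chart_change_derive _ _ X _ setT c (@openT _) sc (chart_at (c s)) ch s (1 : R).
    by rewrite vs mul0mx; apply => //; [exact: chart_at_atlas|exact: chart_at_dom].
  have E j : \forall s \near t, coords ch (c s) 0 j = coords ch (c t) 0 j.
    apply: (@is_derive0_cst_near (fun s => coords ch (c s) 0 j)).
    apply: filterS nD => s [_ /= ds].
    by have := is_derive_coord 0 j (D0 _ ds); rewrite mxE.
  near=> s.
  have [_ ds] : (setT `&` c @^-1` dom ch) s by near: s.
  have [_ ps _] := cP _ ds; have [_ pt _] := cP _ dt.
  suff E2 : coords ch (c s) = coords ch (c t) by rewrite /= -ct -ps -pt E2.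
  apply/rowP => j; move: j; near: s; apply: filter_forall => j; exact: E.
- exists [set t | c t = c 0]; last by rewrite setTI.
  have -> : [set t | c t = c 0] = c @^-1` [set c 0] by [].
  apply: closed_comp; first by move=> t _; exact: cc.
  apply: accessible_closed_set1; apply: hausdorff_accessible; exact: space_hausdorff.
Unshelve. all: by end_near. Qed.

Lemma norm_du0_constant (u : plane -> X) : smooth_map setT u ->
  (forall z, norm_du u z = 0) -> forall z z', u z = u z'.
Proof.
move=> su u0.
suff H z : u z = u (0, 0) by move=> z z'; rewrite H [RHS]H.
pose c t := u (t * z.1, t * z.2).
have pC (a : R) : smooth_on setT (fun t : R => t * a).
  move=> k; apply: CkM; [exact: openT| |exact: Ck_cst].
  by apply: (@Ck_linear _ _ _ _ _ idfun) => x; exact: cvg_id.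
have sc : smooth_map setT c.
  exact: (smooth_map_comp_plane (@openT _) (@openT _) su (fun _ _ => I) (pC _) (pC _)).
have := vel0_constant sc _ 1.
rewrite /c !mul0r !mul1r; case: (z) => a b /=; apply => t.
rewrite (vel_comp_plane (@openT _) su (fun _ _ => I) (pC _) (pC _)) //.
by have [-> ->] := norm_du_eq0 (u0 (t * a, t * b)); rewrite !scaler0 addr0.
Qed.

End Reach.

(** * Planar integrals under inversion *)

Section PlaneMeasure.
Context {R : realType}.
Notation mu := (@lebesgue_measure R).
Notation M := (measurableTypeR R).
Notation plane := (M * M)%type.
Local Open Scope ereal_scope.

(** The image of Lebesgue measure under the inverse affine map, scaled by [|k|], gives every
    interval its length, so it is Lebesgue measure by uniqueness. For [k < 0] the preimage of []a,
    b]] is half open on the other side, which does not change its length. *)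
Lemma integral_affine (k c : R) (f : M -> \bar R) : k != 0%R ->
  measurable_fun [set: M] f -> (forall x, 0 <= f x) ->
  \int[mu]_x f x = `|k|%:E * \int[mu]_x f (k * x + c)%R.
Proof.
move=> k0 mf f0.
pose phi : measurableTypeR R -> measurableTypeR R := fun x => (k * x + c)%R.
have mphi : measurable_fun [set: M] phi.
  apply: measurable_funD; last exact: measurable_cst.
  by apply: measurable_funM; [exact: measurable_cst|exact: measurable_id].
have kp : (0 < `|k|)%R by rewrite normr_gt0.
pose K : {nonneg R} := NngNum (ltW kp).
pose nu : {measure set M -> \bar R} := mscale K (pushforward mu phi).
have E (A : set M) : measurable A -> mu A = nu mphi A.
  apply: lebesgue_measure_unique => _ [[a b]] _ <-.
  change (mu `]a, b] = `|k|%:E * mu (phi @^-1` [set` `]a, b]])).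
  have [kpos|kneg] := ltP 0%R k.
    have -> : phi @^-1` [set` `]a, b]] = [set` `]((a - c) / k)%R, ((b - c) / k)%R]].
      apply/seteqP; split=> x; rewrite /phi /= !in_itv /= ltr_pdivrMr // ler_pdivlMr //;
      by rewrite ltrBlDr lerBrDr [(x * k)%R]mulrC.
    rewrite !lebesgue_measure_itv /= !lte_fin ltr_pM2r ?invr_gt0 // ltrD2r.
    case: ifP => ab; last by rewrite mule0.
    rewrite -!EFinB -EFinM; congr (_%:E); rewrite gtr0_norm //.
    by field; rewrite gt_eqF.
  have kn : (k < 0)%R by rewrite lt_neqAle k0.
  have -> : phi @^-1` [set` `]a, b]] = [set` `[((b - c) / k)%R, ((a - c) / k)%R[].
    apply/seteqP; split=> x; rewrite /phi /= !in_itv /= ler_ndivrMr // ltr_ndivlMr //;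
    by rewrite lerBrDr ltrBlDr [(x * k)%R]mulrC andbC.
  rewrite !lebesgue_measure_itv /= !lte_fin ltr_nM2r ?invr_lt0 // ltrD2r.
  case: ifP => ab; last by rewrite mule0.
  rewrite -!EFinB -EFinM; congr (_%:E); rewrite ltr0_norm //.
  by field; rewrite lt_eqF.
transitivity (\int[nu mphi]_x f x).
  by apply: eq_measure_integral => A mA _; exact: E.
rewrite ge0_integral_mscale //=; congr (_ * _).
by rewrite ge0_integral_pushforward // preimage_setT.
Qed.

(** The measurable sets of the plane are generated by rectangles; rational boxes present an open set
    as a countable union of these. *)
Lemma open_measurable_plane (U : set plane) : @open (R * R)%type U -> measurable U.
Proof.
move=> oU.
pose box (a b c d : rat) : set plane := `]ratr a, ratr b[ `*` `]ratr c, ratr d[.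
have -> : U = \bigcup_(a : rat) \bigcup_(b : rat) \bigcup_(c : rat) \bigcup_(d : rat)
    (if `[< box a b c d `<=` U >] then box a b c d else set0).
  apply/seteqP; split=> [[x y] Uxy|z [a _ [b _ [c _ [d _]]]]]; last first.
    by case: ifP => [/asboolP|//]; apply.
  have : nbhs ((x, y) : (R * R)%type) U by exact: open_nbhs_nbhs.
  move=> /nbhs_ballP[e /= e0 He].
  have [a] := @rat_in_itvoo R (x - e)%R x (ltac:(by rewrite ltrBlDr ltrDl)).
  have [b] := @rat_in_itvoo R x (x + e)%R (ltac:(by rewrite ltrDl)).
  have [c] := @rat_in_itvoo R (y - e)%R y (ltac:(by rewrite ltrBlDr ltrDl)).
  have [d] := @rat_in_itvoo R y (y + e)%R (ltac:(by rewrite ltrDl)).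
  rewrite !in_itv /= => /andP[d1 d2] /andP[c1 c2] /andP[b1 b2] /andP[a1 a2].
  exists a => //; exists b => //; exists c => //; exists d => //.
  rewrite asboolT; first by split; rewrite /= in_itv /= ?a2 ?b1 ?c2 ?d1.
  move=> [s t] [] /=; rewrite !in_itv /= => /andP[s1 s2] /andP[t1 t2].
  apply: He; split; rewrite -ball_normE /= ltr_norml; apply/andP; split; lra.
do 4 (apply: bigcupT_measurable_rat => ?).
case: ifP => _; last exact: measurable0.
by apply: measurableX; exact: measurable_itv.
Qed.

Lemma measurable_continuous_plane (f : plane -> M) :
  (forall z, {for z, continuous (f : (R * R)%type -> R)}) -> measurable_fun [set: plane] f.
Proof.
move=> cf; apply: (measurability _ (RGenOpens.measurableE R)) => // _ [_ [a [b ->] <-]].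
rewrite setTI; apply: open_measurable_plane.
by apply: (proj1 (@continuousP _ _ (f : (R * R)%type -> R)) cf); exact: itv_open.
Qed.

Notation mu2 := (mu \x mu).
Implicit Types F G : plane -> \bar R.

Lemma measurable_affine1 (k c d : R) :
  measurable_fun [set: plane] (fun z : plane => (k * z.1 + (c * z.2 + d))%R : M).
Proof.
apply: measurable_funD.
  by apply: measurable_funM; [exact: measurable_cst|exact: measurable_fst].
apply: measurable_funD; last exact: measurable_cst.
by apply: measurable_funM; [exact: measurable_cst|exact: measurable_snd].
Qed.

Lemma measurable_affine2 (k c d : R) :
  measurable_fun [set: plane] (fun z : plane => (k * z.2 + (c * z.1 + d))%R : M).
Proof.
apply: measurable_funD.
  by apply: measurable_funM; [exact: measurable_cst|exact: measurable_snd].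
apply: measurable_funD; last exact: measurable_cst.
by apply: measurable_funM; [exact: measurable_cst|exact: measurable_fst].
Qed.

Lemma measurable_comp_pair F (p q : plane -> M) : measurable_fun [set: plane] F ->
  measurable_fun [set: plane] p -> measurable_fun [set: plane] q ->
  measurable_fun [set: plane] (fun z => F (p z, q z)).
Proof.
move=> mF mp mq; apply: (measurableT_comp mF).
exact: measurable_fun_pair.
Qed.

Lemma integral_affine2 (k c d : R) F : k != 0%R ->
  measurable_fun [set: plane] F -> (forall z, 0 <= F z) ->
  \int[mu2]_z F z = `|k|%:E * \int[mu2]_z F (z.1, (k * z.2 + (c * z.1 + d))%R).
Proof.
move=> k0 mF F0.
have mG : measurable_fun [set: plane] (fun z : plane => F (z.1, (k * z.2 + (c * z.1 + d))%R)).
  by apply: measurable_comp_pair => //; exact: measurable_affine2.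
rewrite (fubini_tonelli1 _ mF F0) (fubini_tonelli1 _ mG) //.
rewrite -ge0_integralZl //; last 2 first.
- by apply: measurable_fun_fubini_tonelli_F => // z; exact: F0.
- by move=> x _; apply: integral_ge0 => y _; exact: F0.
apply: eq_integral => x _; rewrite /fubini_F /=.
apply: integral_affine => //.
by apply: measurable_fun_pair2.
Qed.

Lemma integral_swap F : measurable_fun [set: plane] F -> (forall z, 0 <= F z) ->
  \int[mu2]_z F z = \int[mu2]_z F (z.2, z.1).
Proof.
move=> mF F0.
have mG : measurable_fun [set: plane] (fun z : plane => F (z.2, z.1)).
  exact: measurable_comp_pair.
by rewrite (fubini_tonelli1 _ mF F0) (fubini_tonelli2 _ mG).
Qed.

Lemma integral_affine1 (k c d : R) F : k != 0%R ->
  measurable_fun [set: plane] F -> (forall z, 0 <= F z) ->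
  \int[mu2]_z F z = `|k|%:E * \int[mu2]_z F ((k * z.1 + (c * z.2 + d))%R, z.2).
Proof.
move=> k0 mF F0.
have mG : measurable_fun [set: plane] (fun z : plane => F (z.2, z.1)).
  exact: measurable_comp_pair.
have mH : measurable_fun [set: plane] (fun z : plane => F ((k * z.1 + (c * z.2 + d))%R, z.2)).
  by apply: measurable_comp_pair => //; exact: measurable_affine1.
by rewrite integral_swap // (integral_affine2 c d k0 mG) // [in RHS]integral_swap.
Qed.

Lemma integral_translate (a : plane) F :
  measurable_fun [set: plane] F -> (forall z, 0 <= F z) ->
  \int[mu2]_z F z = \int[mu2]_z F ((z.1 + a.1)%R, (z.2 + a.2)%R).
Proof.
move=> mF F0.
have mH : measurable_fun [set: plane] (fun z : plane => F ((1 * z.1 + (0 * z.2 + a.1))%R, z.2)).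
  by apply: measurable_comp_pair => //; exact: measurable_affine1.
rewrite (integral_affine1 0 a.1 (oner_neq0 R) mF) // (integral_affine2 0 a.2 (oner_neq0 R) mH) //.
rewrite normr1 !mul1e; apply: eq_integral => z _ /=.
by rewrite !mul1r !mul0r !add0r.
Qed.

Definition cmul (a z : plane) : plane := (a.1 * z.1 - a.2 * z.2, a.2 * z.1 + a.1 * z.2)%R.
Definition sqn (z : plane) : R := (z.1 ^+ 2 + z.2 ^+ 2)%R.
Definition cinv (z : plane) : plane := (z.1 / sqn z, - (z.2 / sqn z))%R.

Lemma sqn_ge0 z : (0 <= sqn z)%R.
Proof. by rewrite addr_ge0 // sqr_ge0. Qed.

Lemma sqn_eq0 z : (sqn z == 0)%R = (z == (0, 0)%R).
Proof.
case: z => x y; rewrite /sqn /= paddr_eq0 ?sqr_ge0 // !sqrf_eq0.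
by rewrite xpair_eqE.
Qed.

Lemma sqnM a z : sqn (cmul a z) = (sqn a * sqn z)%R.
Proof. rewrite /sqn /cmul /=; ring. Qed.

Lemma cmulA a b z : cmul a (cmul b z) = cmul (cmul a b) z.
Proof. by rewrite /cmul /=; congr (_, _); ring. Qed.

Lemma cmulC a b : cmul a b = cmul b a.
Proof. by rewrite /cmul /=; congr (_, _); ring. Qed.

Lemma cmul1 z : cmul (1, 0)%R z = z.
Proof. by case: z => x y; rewrite /cmul /= !mul1r !mul0r subr0 add0r. Qed.

Lemma cmulV z : z != (0, 0)%R -> cmul z (cinv z) = (1, 0)%R.
Proof.
rewrite -sqn_eq0 => z0; rewrite /cmul /cinv /=; congr (_, _); last by ring.
by move: z0; rewrite /sqn => z0; field.
Qed.

Lemma sqnV z : sqn (cinv z) = (sqn z)^-1%R.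
Proof.
have [z0|z0] := eqVneq (sqn z) 0%R.
  by rewrite /cinv {1}/sqn /= z0 invr0 !mulr0 oppr0 expr0n addr0.
by rewrite {1}/sqn /cinv /= sqrrN !exprMn -mulrDl -/(sqn z) expr2 mulrA mulfV // mul1r.
Qed.

Lemma cinvM a b : cinv (cmul a b) = cmul (cinv a) (cinv b).
Proof.
rewrite /cinv sqnM /cmul /= invfM; congr (_, _); ring.
Qed.

Lemma cinvK z : cinv (cinv z) = z.
Proof.
have [/eqP|z0] := eqVneq (sqn z) 0%R.
  by rewrite sqn_eq0 => /eqP ->; rewrite /cinv /= !mul0r oppr0 mul0r oppr0.
rewrite {1}/cinv sqnV /cinv /= invrK mulNr opprK !divfK //; by case: z z0.
Qed.

(** If the real part of [a] is nonzero, multiplication by [a] is a product of two triangular maps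
    whose diagonal entries multiply to [sqn a]; for purely imaginary [a] it is a scaling followed by
    an exchange of coordinates. *)
Lemma integral_cmul (a : plane) F : a != (0, 0)%R ->
  measurable_fun [set: plane] F -> (forall z, 0 <= F z) ->
  \int[mu2]_z F z = (sqn a)%:E * \int[mu2]_z F (cmul a z).
Proof.
case: a => a b; rewrite -sqn_eq0 /sqn /cmul /= => N0 mF F0.
have [a0|a0] := eqVneq a 0%R.
  move: N0; rewrite a0 expr0n /= add0r sqrf_eq0 => b0.
  have nb0 : (- b)%R != 0%R by rewrite oppr_eq0.
  have mH : measurable_fun [set: plane] (fun z : plane => F ((- b * z.1 + (0 * z.2 + 0))%R, z.2)).
    by apply: measurable_comp_pair => //; exact: measurable_affine1.
  have mK : measurable_fun [set: plane] (fun z : plane =>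
      F ((- b * z.1 + (0 * (b * z.2 + (0 * z.1 + 0)) + 0))%R, (b * z.2 + (0 * z.1 + 0))%R)).
    apply: measurable_comp_pair => //; last exact: measurable_affine2.
    rewrite (_ : (fun z : plane => _) = (fun z : plane => (- b * z.1 + (0 * z.2 + 0))%R)).
      exact: measurable_affine1.
    by apply/funext => z; rewrite !mul0r.
  rewrite (integral_affine1 0 0 nb0 mF) // (integral_affine2 0 0 b0 mH) //.
  rewrite muleA -EFinM normrN -normrM -expr2 ger0_norm ?sqr_ge0 //; congr (_ * _).
  rewrite [LHS]integral_swap //; apply: eq_integral => z _ /=.
  by rewrite !mul0r !addr0 !add0r mulNr.
have Na0 : ((a ^+ 2 + b ^+ 2) / a)%R != 0%R by rewrite mulf_neq0 // invr_eq0.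
have mH : measurable_fun [set: plane] (fun z : plane =>
   F (z.1, ((a ^+ 2 + b ^+ 2) / a * z.2 + (b / a * z.1 + 0))%R)).
  by apply: measurable_comp_pair => //; exact: measurable_affine2.
rewrite (integral_affine2 (b / a) 0 Na0 mF) // (integral_affine1 (- b) 0 a0 mH) //.
rewrite muleA -EFinM -normrM divfK // ger0_norm ?addr_ge0 ?sqr_ge0 //; congr (_ * _).
apply: eq_integral => z _ /=; congr F; congr (_, _).
  by rewrite addr0 mulNr.
by field.
Qed.

Lemma measurable_sqn : measurable_fun [set: plane] (sqn : plane -> M).
Proof.
apply: measurable_funD; apply: measurable_funX; [exact: measurable_fst|exact: measurable_snd].
Qed.

Lemma mu2_set0 : mu2 [set (0, 0)%R] = 0.
Proof.
have -> : [set (0, 0)%R] = [set (0 : M)%R] `*` [set (0 : M)%R].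
  by apply/seteqP; split=> [z ->|[x y] [] /= -> ->].
have m0 : measurable [set (0 : M)%R] by exact: measurable_set1.
have E : mu [set (0 : M)%R] = 0 by exact: lebesgue_measure_set1.
transitivity (mu [set (0 : M)%R] * mu [set (0 : M)%R]); last by rewrite E mule0.
exact: product_measure1E.
Qed.

Lemma measurable_set00 : measurable [set (0, 0)%R : plane].
Proof.
have -> : [set (0, 0)%R] = [set (0 : M)%R] `*` [set (0 : M)%R].
  by apply/seteqP; split=> [z ->|[x y] [] /= -> ->].
by apply: measurableX; exact: measurable_set1.
Qed.

Lemma integral_off0 F G : measurable_fun [set: plane] F -> measurable_fun [set: plane] G ->
  (forall z, 0 <= F z) -> (forall z, 0 <= G z) ->
  (forall z, z != (0, 0)%R -> F z = G z) ->
  \int[mu2]_z F z = \int[mu2]_z G z.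
Proof.
move=> mF mG F0 G0 FG; apply: ge0_ae_eq_integral => //.
exists [set (0, 0)%R]; split; [exact: measurable_set00|exact: mu2_set0|].
move=> z /= h; apply: contrapT => z0; apply: h => _; apply: FG.
by apply/eqP.
Qed.

Fact mu2_sigma_finite : sigma_finite [set: plane] mu2.
Proof.
exists (fun k : nat => [set` `[(- k%:R : R), k%:R]%R] `*` [set` `[(- k%:R : R), k%:R]%R]).
  apply/esym; rewrite -subTset => -[x y] _.
  exists (Num.truncn (`|x| + `|y|)).+1 => //=.
  have := truncnS_gt (`|x| + `|y|); set N := (_.+1)%:R => h.
  have [x1 x2] : (- N <= x /\ x <= N)%R.
    by apply/andP; rewrite -ler_norml (le_trans _ (ltW h)) // lerDl.
  have [y1 y2] : (- N <= y /\ y <= N)%R.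
    by apply/andP; rewrite -ler_norml (le_trans _ (ltW h)) // lerDr.
  by rewrite !in_itv /= x1 x2 y1 y2.
move=> k; split; first by apply: measurableX; exact: measurable_itv.
rewrite [X in X < _](_ : _ = mu [set` `[(- k%:R : R), k%:R]%R] * mu [set` `[(- k%:R : R), k%:R]%R]).
  by rewrite !lebesgue_measure_itv /=; case: ifP => _; rewrite -?EFinB -?EFinM ?mule0 ltry.
by apply: product_measure1E; exact: measurable_itv.
Qed.

Definition mu2s : {sigma_finite_measure set plane -> \bar R} :=
  HB.pack mu2 (Measure_isSigmaFinite.Build _ _ _ mu2 mu2_sigma_finite).

(* The inversion formula avoids any change of variables theorem: [mu2 / sqn] is
   invariant under multiplication, and Tonelli's theorem for the product of a
   function and a test function shows that it is invariant under [cinv]. *)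
Definition haar (h : plane -> \bar R) : \bar R := \int[mu2]_z (h z * ((sqn z)^-1)%:E).

Lemma measurable_invr : measurable_fun [set: M] (fun x : M => x^-1%R : M).
Proof.
have -> : (fun x : M => x^-1%R : M) = (fun x => if x == 0%R then 0%R else x^-1%R).
  by apply/funext => x; case: eqP => // ->; rewrite invr0.
rewrite -(setUv [set (0 : M)%R]); apply/measurable_funU; first exact: measurable_set1.
  exact: measurableC (measurable_set1 _).
split.
  apply: (eq_measurable_fun (cst (0 : M)%R)); last exact: measurable_cst.
  by move=> x; rewrite inE /= => ->; rewrite eqxx.
apply: (eq_measurable_fun (fun x : R => x^-1%R : R)).
  by move=> x; rewrite inE /= => /eqP/negbTE ->.
apply: open_continuous_measurable_fun.
  rewrite openC; exact: closed_eq.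
by move=> x; rewrite inE /= => /eqP x0; exact: inv_continuous.
Qed.

Lemma measurable_invsqn : measurable_fun [set: plane] (fun z : plane => ((sqn z)^-1)%:E).
Proof.
apply/measurable_EFinP.
by apply: (measurableT_comp measurable_invr); exact: measurable_sqn.
Qed.

Lemma measurable_haar F : measurable_fun [set: plane] F ->
  measurable_fun [set: plane] (fun z : plane => F z * ((sqn z)^-1)%:E).
Proof. by move=> mF; apply: emeasurable_funM => //; exact: measurable_invsqn. Qed.

Lemma invsqn_ge0 z : (0 <= ((sqn z)^-1)%:E :> \bar R)%E.
Proof. by rewrite lee_fin invr_ge0 sqn_ge0. Qed.

Lemma haar_ge0 F z : (forall z, 0 <= F z) -> 0 <= F z * ((sqn z)^-1)%:E.
Proof. by move=> F0; apply: mule_ge0 => //; exact: invsqn_ge0. Qed.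

Lemma measurable_cinv F : measurable_fun [set: plane] F ->
  measurable_fun [set: plane] (fun z => F (cinv z)).
Proof.
move=> mF; apply: measurable_comp_pair => //.
  apply: measurable_funM => //.
  by apply: (measurableT_comp measurable_invr); exact: measurable_sqn.
apply: measurableT_comp => //; apply: measurable_funM => //.
by apply: (measurableT_comp measurable_invr); exact: measurable_sqn.
Qed.

Lemma measurable_cmul F (a : plane) : measurable_fun [set: plane] F ->
  measurable_fun [set: plane] (fun z => F (cmul a z)).
Proof.
move=> mF; apply: measurable_comp_pair => //.
  by apply: measurable_funB; apply: measurable_funM => //.
by apply: measurable_funD; apply: measurable_funM => //.
Qed.

Lemma haar_cmul a F : a != (0, 0)%R -> measurable_fun [set: plane] F ->
  (forall z, 0 <= F z) -> haar (fun z => F (cmul a z)) = haar F.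
Proof.
move=> a0 mF F0; rewrite /haar [RHS](@integral_cmul a) //; last 2 first.
- exact: measurable_haar.
- by move=> z; exact: haar_ge0.
rewrite -ge0_integralZl //; last 3 first.
- exact: (measurable_cmul a (measurable_haar mF)).
- by move=> z _; exact: haar_ge0.
- by rewrite lee_fin sqn_ge0.
apply: eq_integral => z _; rewrite sqnM invfM muleCA -EFinM; congr (_ * _%:E).
by rewrite mulrA mulfV ?mul1r // sqn_eq0.
Qed.

Definition hbox : set plane := [set` `[(1 : R), 2]%R] `*` [set` `[(0 : R), 1]%R].

Lemma measurable_hbox : measurable hbox.
Proof. by apply: measurableX; exact: measurable_itv. Qed.

Lemma mu2_hbox : mu2 hbox = 1.
Proof.
transitivity (mu [set` `[(1 : R), 2]%R] * mu [set` `[(0 : R), 1]%R]).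
  by apply: product_measure1E; exact: measurable_itv.
rewrite !lebesgue_measure_itv /= !lte_fin ltr01 ltr1n /=.
by rewrite -!EFinB -EFinM; congr (_%:E); ring.
Qed.

Definition hind (z : plane) : \bar R := (\1_hbox z)%:E.

Lemma measurable_hind : measurable_fun [set: plane] hind.
Proof. by apply/measurable_EFinP; apply: measurable_indic; exact: measurable_hbox. Qed.

Lemma hind_ge0 z : 0 <= hind z.
Proof. by rewrite lee_fin. Qed.

(** Cancelling the test function in [haar_cinv] requires its integral to be positive and finite; on
    this box [sqn] stays between [1] and [5]. *)
Lemma haar_hbox : exists2 r : R, (0 < r)%R & haar hind = r%:E.
Proof.
have b z : hbox z -> (1 <= sqn z <= 5)%R.
  case: z => x y [] /=; rewrite !in_itv /= /sqn /= => /andP[x1 x2] /andP[y1 y2].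
  apply/andP; split; nra.
have up : haar hind <= 1.
  rewrite -mu2_hbox -[hbox]setIT -integral_indic //; last exact: measurable_hbox.
  apply: ge0_le_integral => //.
  - by move=> z _; apply: haar_ge0; exact: hind_ge0.
  - exact: (measurable_haar measurable_hind).
  - exact: measurable_hind.
  - move=> z _; rewrite /hind indicE; case: (boolP (z \in hbox)) => [/set_mem/b/andP[z1 _]|_].
      by rewrite mul1e lee_fin invf_le1 // (lt_le_trans _ z1).
    by rewrite mul0e.
have lo : (5^-1)%:E <= haar hind.
  have -> : (5^-1)%:E = \int[mu2]_z ((5^-1)%:E * hind z).
    rewrite ge0_integralZl //; last 2 first.
    - exact: measurable_hind.
    - by move=> z _; exact: hind_ge0.
    transitivity ((5^-1)%:E * mu2 hbox); first by rewrite mu2_hbox mule1.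
    congr (_ * _); rewrite -[in LHS](setIT hbox); apply/esym.
    by apply: integral_indic; [exact: measurableT|exact: measurable_hbox].
  apply: ge0_le_integral => //.
  - by move=> z _; apply: mule_ge0; [rewrite lee_fin invr_ge0|exact: hind_ge0].
  - by apply: measurable_funeM; exact: measurable_hind.
  - exact: (measurable_haar measurable_hind).
  - move=> z _; rewrite /hind indicE; case: (boolP (z \in hbox)) => [/set_mem/b/andP[z1 z5]|_].
      by rewrite mule1 mul1e lee_fin lef_pV2 // posrE // (lt_le_trans _ z1).
    by rewrite mule0 mul0e.
case: (haar hind) up lo => [r| |] //; rewrite !lee_fin => up lo; exists r => //.
by rewrite (lt_le_trans _ lo) // invr_gt0.
Qed.

Lemma measurable_mul2 F : measurable_fun [set: plane] F ->
  measurable_fun [set: plane * plane] (fun p : plane * plane => F (cmul p.1 p.2)).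
Proof.
move=> mF.
apply: (measurableT_comp mF).
apply: measurable_fun_pair.
  by apply: measurable_funB; apply: measurable_funM => //; apply: measurableT_comp.
by apply: measurable_funD; apply: measurable_funM => //; apply: measurableT_comp.
Qed.

Lemma haar_cinv h : measurable_fun [set: plane] h -> (forall z, 0 <= h z) ->
  haar (fun z => h (cinv z)) = haar h.
Proof.
move=> mh h0; have [r r0 Er] := haar_hbox.
suff E : haar hind * haar h = haar hind * haar (fun z => h (cinv z)).
  move: E; rewrite Er => E; apply/esym.
  have := congr1 (fun x => (r^-1)%:E * x) E.
  by rewrite !muleA -EFinM mulVf ?gt_eqF // !mul1e.
have mch := measurable_cinv mh.
(* As the inverse of zero is zero, the weight vanishes at the origin, so the substitutions below
   need no separate care there. *)
pose w z : \bar R := ((sqn z)^-1)%:E.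
have mw : measurable_fun [set: plane] w := measurable_invsqn.
have w0 z : 0 <= w z by exact: invsqn_ge0.
(* Integrated first in [s], invariance under multiplication replaces [h (x^-1 s)] by [h s], and the
   double integral is [haar hind * haar h]. *)
pose A (x s : plane) := hind x * w x * (h (cmul (cinv x) s) * w s).
have A0 p : 0 <= A p.1 p.2.
  by rewrite /A; do 2 apply: mule_ge0 => //; exact: hind_ge0.
have m2 G : measurable_fun [set: plane] G ->
    measurable_fun [set: plane * plane] (fun p : plane * plane => G (cmul (cinv p.1) p.2)).
  move=> mG; apply: (@measurableT_comp _ _ _ _ _ _ (fun p : plane * plane => G (cmul p.1 p.2)) _
     (fun p : plane * plane => (cinv p.1, p.2))); first exact: measurable_mul2.
  apply: measurable_fun_pair => //.
  apply: (measurableT_comp (f := cinv)) => //.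
  apply: measurable_fun_pair.
    apply: measurable_funM => //.
    by apply: (measurableT_comp measurable_invr); exact: measurable_sqn.
  apply: measurableT_comp => //; apply: measurable_funM => //.
  by apply: (measurableT_comp measurable_invr); exact: measurable_sqn.
have mA : measurable_fun [set: plane * plane] (fun p : plane * plane => A p.1 p.2).
  apply: emeasurable_funM.
    apply: (@measurableT_comp _ _ _ _ _ _ (fun x => hind x * w x) _ fst) => //.
    by apply: emeasurable_funM => //; exact: measurable_hind.
  apply: emeasurable_funM; first exact: m2.
  exact: measurableT_comp.
(* This is [A] after the substitution [x = s t], under which [h (x^-1 s)] becomes [h (t^-1)].
   Integrated first in [s], it gives [haar hind] times the integral of [h] composed with [cinv]. *)
pose B (s t : plane) := w s * (hind (cmul s t) * h (cinv t) * w t).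
have B0 p : 0 <= B p.1 p.2.
  by rewrite /B; do 3 apply: mule_ge0 => //; exact: hind_ge0.
have mB : measurable_fun [set: plane * plane] (fun p : plane * plane => B p.1 p.2).
  apply: emeasurable_funM; first exact: measurableT_comp.
  apply: emeasurable_funM; last exact: measurableT_comp.
  apply: emeasurable_funM; first by apply: measurable_mul2; exact: measurable_hind.
  exact: (@measurableT_comp _ _ _ _ _ _ (fun z => h (cinv z)) _ snd).
transitivity (\int[mu2]_x \int[mu2]_s A x s).
  rewrite muleC /haar -ge0_integralZl //; last 3 first.
  - exact: (measurable_haar measurable_hind).
  - by move=> z _; apply: haar_ge0; exact: hind_ge0.
  - by apply: integral_ge0 => z _; exact: haar_ge0.
  apply: eq_integral => x _.
  rewrite [RHS](_ : _ = hind x * w x * haar (fun s => h (cmul (cinv x) s))); last first.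
    rewrite /haar -ge0_integralZl //.
    - exact: (measurable_haar (measurable_cmul _ mh)).
    - by move=> s _; apply: mule_ge0 => //; exact: invsqn_ge0.
    - by apply: mule_ge0 => //; exact: hind_ge0.
  have [x0|x0] := eqVneq x (0, 0)%R.
    have -> : w x = 0 by rewrite /w x0 /sqn /= expr0n addr0 invr0.
    by rewrite x0 /= /sqn /= expr0n addr0 invr0 !mule0 mul0e.
  rewrite haar_cmul //; first by rewrite muleC.
  by rewrite -sqn_eq0 sqnV invr_eq0 sqn_eq0.
rewrite (@fubini_tonelli _ _ _ _ _ mu2s mu2s (fun p => A p.1 p.2)) //.
transitivity (\int[mu2]_s \int[mu2]_t B s t).
  apply: eq_integral => s _.
  have mK : measurable_fun [set: plane] (fun x => hind x * h (cmul (cinv x) s)).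
    apply: emeasurable_funM; first exact: measurable_hind.
    apply: (@measurableT_comp _ _ _ _ _ _ (fun p : plane * plane => h (cmul (cinv p.1) p.2)) _
      (fun x => (x, s)) (m2 _ mh)).
    exact: measurable_fun_pair.
  rewrite [LHS](_ : _ = w s * haar (fun x => hind x * h (cmul (cinv x) s))); last first.
    rewrite /haar -ge0_integralZl //.
    - by apply: eq_integral => x _; rewrite /A /= muleACA muleA muleC.
    - exact: measurable_haar.
    - by move=> x _; apply: mule_ge0; [apply: mule_ge0 => //; exact: hind_ge0|exact: invsqn_ge0].
  have [s0|s0] := eqVneq s (0, 0)%R.
    have ws : w s = 0 by rewrite /w s0 /sqn /= expr0n addr0 invr0.
    rewrite ws mul0e; apply/esym/integral0_eq => t _.
    by rewrite /B ws mul0e.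
  rewrite -(haar_cmul s0 mK); last by move=> z; apply: mule_ge0 => //; exact: hind_ge0.
  rewrite /haar -ge0_integralZl //; last 2 first.
  - exact: (measurable_haar (measurable_cmul _ mK)).
  - by move=> x _; apply: mule_ge0; [apply: mule_ge0 => //; exact: hind_ge0|exact: invsqn_ge0].
  apply: eq_integral => t _; rewrite /B; congr (_ * _).
  have [t0|t0] := eqVneq t (0, 0)%R.
    by rewrite /w t0 /sqn /= expr0n addr0 invr0 !mule0.
  by rewrite cinvM (cmulC (cinv s)) -cmulA (cmulC (cinv s) s) cmulV // (cmulC (cinv t)) cmul1.
rewrite (@fubini_tonelli _ _ _ _ _ mu2s mu2s (fun p => B p.1 p.2)) //.
rewrite [in RHS]/haar -ge0_integralZl //; last 3 first.
- exact: measurable_haar.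
- by move=> z _; apply: mule_ge0; [exact: h0|exact: invsqn_ge0].
- by apply: integral_ge0 => z _; apply: mule_ge0; [exact: hind_ge0|exact: invsqn_ge0].
apply: eq_integral => t _ /=; rewrite -/(haar hind).
have [t0|t0] := eqVneq t (0, 0)%R.
  have wt : w t = 0 by rewrite /w t0 /sqn /= expr0n addr0 invr0.
  rewrite -/(w t) wt !mule0; apply: integral0_eq => s _.
  by rewrite /B wt !mule0.
have mt := measurable_cmul t measurable_hind.
rewrite -(haar_cmul t0 measurable_hind hind_ge0) muleC /haar -ge0_integralZl //; last 3 first.
- exact: measurable_haar.
- by move=> z _; apply: mule_ge0; [exact: hind_ge0|exact: invsqn_ge0].
- by apply: mule_ge0; [exact: h0|exact: invsqn_ge0].
have ac (a b c d : \bar R) : a * (b * c * d) = c * d * (b * a).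
  by rewrite muleC -!muleA muleCA; congr (c * _); rewrite muleCA.
by apply: eq_integral => s _; rewrite /B cmulC ac.
Qed.

(** Invariance of [mu2 / sqn] is applied to [G * sqn]; the square of [(sqn z)^-1] is the Jacobian
    determinant of the inversion. *)
Lemma integral_inversion G : measurable_fun [set: plane] G -> (forall z, 0 <= G z) ->
  \int[mu2]_z G z = \int[mu2]_z (G (cinv z) * (((sqn z)^-1) ^+ 2)%:E).
Proof.
move=> mG G0.
pose h z := G z * (sqn z)%:E.
have mh : measurable_fun [set: plane] h.
  by apply: emeasurable_funM => //; apply/measurable_EFinP; exact: measurable_sqn.
have h0 z : 0 <= h z by apply: mule_ge0 => //; rewrite lee_fin sqn_ge0.
transitivity (haar h).
  apply: integral_off0 => //; first exact: measurable_haar.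
    by move=> z; exact: haar_ge0.
  by move=> z z0; rewrite /h -muleA -EFinM mulfV ?mule1 // sqn_eq0.
rewrite -haar_cinv //; apply: eq_integral => z _.
by rewrite /h sqnV -muleA -EFinM -expr2.
Qed.

End PlaneMeasure.

(** * Holomorphic maps of the sphere and their energy *)

Section ConformalMaps.
Context {R : realType}.
Notation plane := (R * R)%type.

Lemma open_nonzero (p : plane -> R) : continuous p -> open [set z | p z != 0].
Proof.
move=> cp; have -> : [set z | p z != 0] = p @^-1` (~` [set 0]).
  by apply/seteqP; split=> z /= /eqP.
by apply: (proj1 (continuousP p)) => //; rewrite openC; exact: closed_eq.
Qed.

Lemma sqn_continuous : continuous (sqn : plane -> R).
Proof.
move=> z; rewrite /sqn; apply: cvgD; rewrite expr2.
  by under eq_fun do rewrite expr2; apply: cvgM; exact: cvg_fst.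
by under eq_fun do rewrite expr2; apply: cvgM; exact: cvg_snd.
Qed.

Lemma Ck_sqn k (U : set plane) : open U -> Ck k U (sqn : plane -> R).
Proof.
move=> oU; apply: CkD => //; rewrite -[X in Ck k U X]/(fun z : plane => _);
  under [X in Ck _ _ X]eq_fun do rewrite expr2; apply: CkM => //;
  first [exact: Ck_fst | exact: Ck_snd].
Qed.

Definition nonzero : set plane := [set z | z != (0, 0)].

Lemma nonzeroE : nonzero = [set z : plane | sqn z != 0].
Proof. by apply/seteqP; split=> z /=; rewrite sqn_eq0. Qed.

Lemma open_nonzero_plane : open nonzero.
Proof. by rewrite nonzeroE; apply: open_nonzero; exact: sqn_continuous. Qed.

Lemma smooth_cinv1 : smooth_on nonzero (fun z : plane => (cinv z).1).
Proof.
move=> k; have oN := open_nonzero_plane.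
apply: CkM => //; first exact: Ck_fst.
apply: CkV => //; last exact: Ck_sqn.
by move=> z; rewrite nonzeroE.
Qed.

Lemma smooth_cinv2 : smooth_on nonzero (fun z : plane => (cinv z).2).
Proof.
move=> k; have oN := open_nonzero_plane.
apply: CkN => //; apply: CkM => //; first exact: Ck_snd.
apply: CkV => //; last exact: Ck_sqn.
by move=> z; rewrite nonzeroE.
Qed.

Lemma is_derive_fst (z v : plane) : is_derive z v (fst : plane -> R) v.1.
Proof.
have fd : differentiable (plane_coord 0) z.
  by apply: linear_differentiable; exact: plane_coord_continuous.
apply: DeriveDef; first exact: diff_derivable fd.
rewrite [LHS](deriveE v fd) diff_lin //; exact: plane_coord_continuous.
Qed.

Lemma is_derive_snd (z v : plane) : is_derive z v (snd : plane -> R) v.2.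
Proof.
have fd : differentiable (plane_coord 1) z.
  by apply: linear_differentiable; exact: plane_coord_continuous.
apply: DeriveDef; first exact: diff_derivable fd.
rewrite [LHS](deriveE v fd) diff_lin //; exact: plane_coord_continuous.
Qed.

Lemma is_derive_sqn (z v : plane) : is_derive z v sqn (2 * (z.1 * v.1 + z.2 * v.2)).
Proof.
have d1 := is_derive_fst z v; have d2 := is_derive_snd z v.
have -> : sqn = (fst : plane -> R) * fst + (snd : plane -> R) * snd.
  by apply/funext => y; rewrite /sqn !expr2.
apply: (is_derive_eq (is_deriveD (is_deriveM d1 d1) (is_deriveM d2 d2))).
by change (z.1 * v.1 + z.1 * v.1 + (z.2 * v.2 + z.2 * v.2) = 2 * (z.1 * v.1 + z.2 * v.2)); ring.
Qed.

Lemma is_derive_inv {V : normedModType R} (f : V -> R) (x v : V) df : f x != 0 ->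
  is_derive x v f df -> is_derive x v (fun y => (f y)^-1) (- (df / f x ^+ 2)).
Proof.
move=> f0 [fd fE]; apply: DeriveDef; first exact: derivableV.
by rewrite deriveV // fE [LHS]mulNr mulrC.
Qed.

Lemma is_derive_cinv1 (z v : plane) : z != (0, 0) ->
  is_derive z v (fun z => (cinv z).1)
    ((v.1 * (z.2 ^+ 2 - z.1 ^+ 2) - 2 * z.1 * z.2 * v.2) / sqn z ^+ 2).
Proof.
rewrite -sqn_eq0 => z0.
apply: (is_derive_eq (is_deriveM (is_derive_fst z v) (is_derive_inv z0 (is_derive_sqn z v)))).
change (z.1 * - (2 * (z.1 * v.1 + z.2 * v.2) / sqn z ^+ 2) + (sqn z)^-1 * v.1 =
  (v.1 * (z.2 ^+ 2 - z.1 ^+ 2) - 2 * z.1 * z.2 * v.2) / sqn z ^+ 2).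
by move: z0; rewrite /sqn => z0; field.
Qed.

Lemma is_derive_cinv2 (z v : plane) : z != (0, 0) ->
  is_derive z v (fun z => (cinv z).2)
    ((2 * z.1 * z.2 * v.1 + v.2 * (z.2 ^+ 2 - z.1 ^+ 2)) / sqn z ^+ 2).
Proof.
rewrite -sqn_eq0 => z0.
apply: (is_derive_eq (is_deriveN (is_deriveM (is_derive_snd z v) (is_derive_inv z0 (is_derive_sqn z v))))).
change (- (z.2 * - (2 * (z.1 * v.1 + z.2 * v.2) / sqn z ^+ 2) + (sqn z)^-1 * v.2) =
  (2 * z.1 * z.2 * v.1 + v.2 * (z.2 ^+ 2 - z.1 ^+ 2)) / sqn z ^+ 2).
by move: z0; rewrite /sqn => z0; field.
Qed.

Lemma smooth_affine_plane (p : plane -> R) (a b d : R) (U : set plane) : open U ->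
  (forall z, p z = a * z.1 + b * z.2 + d) -> smooth_on U p.
Proof.
move=> oU pE k; apply: (@Ck_ext _ _ _ _ _ (fun z : plane => a * z.1 + b * z.2 + d)) => //.
apply: CkD => //; last exact: Ck_cst.
by apply: CkD => //; apply: CkM => //; [exact: Ck_cst|exact: Ck_fst|exact: Ck_cst|exact: Ck_snd].
Qed.

Lemma is_derive_shift1 (z v : plane) (a : R) : is_derive z v (fun z : plane => z.1 + a) v.1.
Proof.
by apply: (is_derive_eq (is_deriveD (is_derive_fst z v) (is_derive_cst a z v))); rewrite addr0.
Qed.

Lemma is_derive_shift2 (z v : plane) (a : R) : is_derive z v (fun z : plane => z.2 + a) v.2.
Proof.
by apply: (is_derive_eq (is_deriveD (is_derive_snd z v) (is_derive_cst a z v))); rewrite addr0.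
Qed.

End ConformalMaps.

Section MapsOfPlane.
Context {R : realType} {n : nat} (X : geometry R n).
Notation plane := (R * R)%type.
Implicit Types (u : plane -> X) (D : set plane).

Lemma JholT u : Jhol setT u -> smooth_map setT u /\
  forall z, vel u z (0, 1) = vel u z (1, 0) *m at_pt (@acs _ _ X) (u z).
Proof.
move=> [W [oW TW su Ju]]; have <- : W = setT by apply/seteqP; split.
by split=> // z; exact: Ju.
Qed.

Lemma JholTP u : smooth_map setT u ->
  (forall z, vel u z (0, 1) = vel u z (1, 0) *m at_pt (@acs _ _ X) (u z)) -> Jhol setT u.
Proof. by move=> su Ju; exists setT; split => //; exact: openT. Qed.

Definition shift_plane (a z : plane) : plane := (z.1 + a.1, z.2 + a.2).

Lemma smooth_shift1 (a : plane) (U : set plane) : open U ->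
  smooth_on U (fun z : plane => z.1 + a.1).
Proof.
by move=> oU; apply: (@smooth_affine_plane _ _ 1 0 a.1) => // z; rewrite mul1r mul0r addr0.
Qed.

Lemma smooth_shift2 (a : plane) (U : set plane) : open U ->
  smooth_on U (fun z : plane => z.2 + a.2).
Proof.
by move=> oU; apply: (@smooth_affine_plane _ _ 0 1 a.2) => // z; rewrite mul1r mul0r add0r.
Qed.

Lemma norm_du_shift u a z : smooth_map setT u ->
  norm_du (fun z => u (shift_plane a z)) z = norm_du u (shift_plane a z).
Proof.
move=> su.
rewrite (norm_du_conformal (@openT _) (@openT _) su (fun _ _ => I)
   (smooth_shift1 a (@openT _)) (smooth_shift2 a (@openT _)) I
   (@derive_val _ _ _ _ _ _ _ (is_derive_shift1 z (1, 0) a.1))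
   (@derive_val _ _ _ _ _ _ _ (is_derive_shift2 z (1, 0) a.2))) /=.
- by rewrite expr1n expr0n addr0 sqrtr1 mul1r.
- by rewrite oppr0; exact: (@derive_val _ _ _ _ _ _ _ (is_derive_shift1 z (0, 1) a.1)).
- exact: (@derive_val _ _ _ _ _ _ _ (is_derive_shift2 z (0, 1) a.2)).
Qed.

Lemma Jhol_shift u a : Jhol setT u -> Jhol setT (fun z => u (shift_plane a z)).
Proof.
move=> /JholT[su Ju].
apply: (@Jhol_conformal _ _ X setT setT setT setT u (fun z => z.1 + a.1) (fun z => z.2 + a.2)) => //.
- exact: openT.
- exact: openT.
- by apply: smooth_shift1; exact: openT.
- by apply: smooth_shift2; exact: openT.
- move=> z _; have [_ ->] := is_derive_shift1 z (0, 1) a.1.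
  have [_ ->] := is_derive_shift2 z (1, 0) a.2; have [_ ->] := is_derive_shift2 z (0, 1) a.2.
  by have [_ ->] := is_derive_shift1 z (1, 0) a.1; rewrite /= oppr0.
Qed.

Lemma norm_du_near u u' (z : plane) : (\near z, u z = u' z) -> norm_du u z = norm_du u' z.
Proof.
move=> uu; rewrite !norm_duE /vel (nbhs_singleton uu).
have E v : 'D_v (coords (chart_at (u' z)) \o u) z = 'D_v (coords (chart_at (u' z)) \o u') z.
  by apply: near_eq_derive; near=> y => /=; rewrite (near uu y).
by rewrite !E.
Unshelve. all: by end_near. Qed.

Lemma norm_du_cinv u z : smooth_map setT u -> z != (0, 0) ->
  norm_du (fun z => u (cinv z)) z = (sqn z)^-1 * norm_du u (cinv z).
Proof.
move=> su z0; have N0 : sqn z != 0 by rewrite sqn_eq0.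
have -> : (fun z => u (cinv z)) = (fun z => u ((cinv z).1, (cinv z).2)).
  by apply/funext => y; case: (cinv y).
rewrite (norm_du_conformal open_nonzero_plane (@openT _) su (fun _ _ => I)
   smooth_cinv1 smooth_cinv2 z0
   (@derive_val _ _ _ _ _ _ _ (is_derive_cinv1 (1, 0) z0))
   (@derive_val _ _ _ _ _ _ _ (is_derive_cinv2 (1, 0) z0))) /=.
- rewrite !mul1r !mulr0 !mul0r subr0 addr0 mulr1.
  have -> : ((z.2 ^+ 2 - z.1 ^+ 2) / sqn z ^+ 2) ^+ 2 + (2 * z.1 * z.2 / sqn z ^+ 2) ^+ 2
      = ((sqn z)^-1) ^+ 2.
    by move: N0; rewrite /sqn => N0; field.
  rewrite sqrtr_sqr ger0_norm //.
  by rewrite invr_ge0 sqn_ge0.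
- have [_ ->] := is_derive_cinv1 (0, 1) z0 => /=.
  by rewrite -[RHS]mulNr; congr (_ / _); ring.
- have [_ ->] := is_derive_cinv2 (0, 1) z0 => /=.
  by congr (_ / _); ring.
Qed.

Lemma measurable_norm_du u : smooth_map setT u ->
  measurable_fun (setT : set (measurableTypeR R * measurableTypeR R)) (fun z => (norm_du u z ^+ 2)%:E).
Proof.
move=> su; apply/measurable_EFinP; apply: measurable_funX.
apply: measurable_continuous_plane => z.
exact: (norm_du_continuous (@openT _) su).
Qed.

Lemma energy_ge0 D u : (0 <= energy D u)%E.
Proof.
by apply: mule_ge0; [rewrite lee_fin invr_ge0|apply: integral_ge0 => z _; rewrite lee_fin sqr_ge0].
Qed.

Notation MM := (measurableTypeR R * measurableTypeR R)%type.

Lemma energy_mkcond (D : set MM) u : measurable D -> energy D u =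
  (2^-1%:E * \int[mu2]_z ((norm_du u z ^+ 2)%:E * (\1_D z)%:E))%E.
Proof.
move=> mD; congr (_ * _)%E; rewrite integral_mkcond; apply: eq_integral => z _.
by rewrite patchE indicE; case: (z \in D); rewrite ?mule1 ?mule0.
Qed.

Lemma measurable_density D u : smooth_map setT u -> measurable (D : set MM) ->
  measurable_fun (setT : set MM) (fun z => ((norm_du u z ^+ 2)%:E * (\1_D z)%:E)%E).
Proof.
move=> su mD; apply: emeasurable_funM; first exact: measurable_norm_du.
by apply/measurable_EFinP; exact: measurable_indic.
Qed.

Lemma density_ge0 D u z : (0 <= (norm_du u z ^+ 2)%:E * (\1_D z)%:E :> \bar R)%E.
Proof. by apply: mule_ge0; rewrite lee_fin ?sqr_ge0. Qed.

Lemma energy_le D D' u : smooth_map setT u -> measurable (D : set MM) ->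
  measurable (D' : set MM) -> D `<=` D' -> (energy D u <= energy D' u)%E.
Proof.
move=> su mD mD' DD; apply: lee_wpmul2l; first by rewrite lee_fin invr_ge0.
apply: ge0_subset_integral => //.
- by apply: measurable_funTS; exact: measurable_norm_du.
- by move=> z _; rewrite lee_fin sqr_ge0.
Qed.

Lemma energy_shift D u a : smooth_map setT u -> measurable (D : set MM) ->
  energy D u = energy [set z | D (shift_plane a z)] (fun z => u (shift_plane a z)).
Proof.
move=> su mD.
have mD' : measurable ([set z | D (shift_plane a z)] : set MM).
  have mT : measurable_fun (setT : set MM) (shift_plane a : MM -> MM).
    apply: measurable_fun_pair.
      by apply: measurable_funD; [exact: measurable_fst|exact: measurable_cst].
    by apply: measurable_funD; [exact: measurable_snd|exact: measurable_cst].
  by have := mT measurableT D mD; rewrite setTI.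
rewrite !energy_mkcond //; congr (_ * _)%E.
rewrite [LHS](integral_translate a (measurable_density su mD)); last exact: density_ge0.
apply: eq_integral => z _; by rewrite norm_du_shift // !indicE.
Qed.

Lemma measurable_cinv_preimage D : measurable (D : set MM) ->
  measurable ([set z | D (cinv z)] : set MM).
Proof.
move=> mD.
have mI : measurable_fun (setT : set MM) (fun z => (\1_D z)%:E : \bar R).
  by apply/measurable_EFinP; exact: measurable_indic.
have := measurable_cinv mI => mC.
have -> : [set z | D (cinv z)] = setT `&` (fun z => (\1_D (cinv z))%:E : \bar R) @^-1` [set 1%E].
  rewrite setTI; apply/seteqP; split=> z /=; rewrite indicE.
    by move=> Dz; rewrite mem_set.
  by case: (boolP (cinv z \in D)) => [/set_mem//|_] /= [] /eqP; rewrite eq_sym oner_eq0.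
by apply: mC => //; exact: emeasurable_set1.
Qed.

(* [u] and [u'] are the two affine charts of a map of the sphere. *)
Lemma energy_inversion D u u' : smooth_map setT u -> smooth_map setT u' ->
  (forall z, z != (0, 0) -> u' z = u (cinv z)) -> measurable (D : set MM) ->
  energy D u = energy [set z | D (cinv z)] u'.
Proof.
move=> su su' uu mD; have mD' := measurable_cinv_preimage mD.
rewrite !energy_mkcond //; congr (_ * _)%E.
have mF := measurable_density su mD.
rewrite [LHS](integral_inversion mF); last exact: density_ge0.
apply: integral_off0.
- apply: emeasurable_funM; first exact: (measurable_cinv mF).
  apply/measurable_EFinP; apply: measurable_funX.
  by apply: (measurableT_comp (@measurable_invr R)); exact: measurable_sqn.
- exact: measurable_density.
- by move=> z; apply: mule_ge0; [exact: density_ge0|rewrite lee_fin sqr_ge0].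
- exact: density_ge0.
move=> z z0.
have E : norm_du u' z = (sqn z)^-1 * norm_du u (cinv z).
  rewrite -norm_du_cinv //; apply: norm_du_near; near=> y; apply: uu.
  by near: y; apply: open_nbhs_nbhs; split => //; exact: open_nonzero_plane.
by rewrite E exprMn EFinM muleC muleA !indicE.
Unshelve. all: by end_near. Qed.

End MapsOfPlane.

Section Sphere.
Context {R : realType} {n : nat} (X : geometry R n).
Notation plane := (R * R)%type.
Implicit Types (u : P1 R -> X).

(** In contrast to [Jhol], the equation is required on the whole open set where the map is smooth,
    so that such maps can be glued ([Jhol_on_union]). *)
Definition Jhol_on (U : set plane) (u : plane -> X) : Prop :=
  [/\ open U, smooth_map U u
    & forall z, U z -> vel u z (0, 1) = vel u z (1, 0) *m at_pt (@acs _ _ X) (u z)].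

Lemma Jhol_onT (u : plane -> X) : Jhol setT u <-> Jhol_on setT u.
Proof.
split=> [/JholT[su Ju]|[_ su Ju]].
  by split => //; exact: openT.
by apply: JholTP => // z; exact: Ju.
Qed.

Lemma vel_near (u u' : plane -> X) (z v : plane) : (\near z, u z = u' z) -> vel u z v = vel u' z v.
Proof.
move=> uu; rewrite /vel (nbhs_singleton uu).
by apply: near_eq_derive; near=> y => /=; rewrite (near uu y).
Unshelve. all: by end_near. Qed.

Lemma Jhol_on_comp (U U' : set plane) (u : plane -> X) (p : plane -> plane) :
  Jhol_on U' u -> open U -> (forall z, U z -> U' (p z)) ->
  smooth_on U (fun z => (p z).1) -> smooth_on U (fun z => (p z).2) ->
  (forall z, U z -> 'D_(0, 1) (fun z => (p z).1) z = - 'D_(1, 0) (fun z => (p z).2) z /\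
     'D_(0, 1) (fun z => (p z).2) z = 'D_(1, 0) (fun z => (p z).1) z) ->
  Jhol_on U (fun z => u (p z)).
Proof.
move=> [oU' su Ju] oU UU C1 C2 CR.
have E : (fun z => u (p z)) = (fun z => u ((p z).1, (p z).2)).
  by apply/funext => z; case: (p z).
have UU' z : U z -> U' ((p z).1, (p z).2) by move=> /UU; case: (p z).
have [W [oW UW sW JW]] : Jhol U (fun z => u ((p z).1, (p z).2)).
  exact: (@Jhol_conformal _ _ X U U' U U' u (fun z => (p z).1) (fun z => (p z).2)).
rewrite E; split => //.
exact: (smooth_map_comp_plane oU oU' su UU' C1 C2).
Qed.

Lemma Jhol_on_ext (U : set plane) (u u' : plane -> X) : (forall z, U z -> u z = u' z) ->
  Jhol_on U u -> Jhol_on U u'.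
Proof.
move=> uu [oU su Ju].
have near_uu z : U z -> \near z, u z = u' z.
  by move=> Uz; near=> y; apply: uu; near: y; exact: open_nbhs_nbhs.
split => //.
  split=> [z Uz|c ac k].
    rewrite /prop_for /continuous_at -(uu _ Uz).
    apply: cvg_trans (su.1 _ Uz); apply: near_eq_cvg; exact: near_uu.
  have E : U `&` u' @^-1` dom c = U `&` u @^-1` dom c.
    by apply/seteqP; split=> z [Uz /= dz]; split => //=; rewrite ?uu // -uu.
  rewrite E; apply: Ck_ext (smooth_map_Ck su k ac); first exact: smooth_map_open.
  by move=> z [Uz _] /=; rewrite uu.
move=> z Uz; have := Ju _ Uz.
by rewrite !(vel_near _ (near_uu _ Uz)) uu.
Unshelve. all: by end_near. Qed.

Lemma Jhol_on_union (U U' : set plane) (u : plane -> X) :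
  Jhol_on U u -> Jhol_on U' u -> Jhol_on (U `|` U') u.
Proof.
move=> [oU su Ju] [oU' su' Ju']; split; first exact: openU.
- split=> [z [Uz|Uz]|c ac k]; [exact: su.1|exact: su'.1|].
  apply: Ck_near => z [[Uz|Uz] dz].
    by exists (U `&` u @^-1` dom c); split => //; exact: (smooth_map_Ck su k ac).
  by exists (U' `&` u @^-1` dom c); split => //; exact: (smooth_map_Ck su' k ac).
- by move=> z [/Ju|/Ju'].
Qed.

Definition caff (a b z : plane) : plane := shift_plane b (cmul a z).

Lemma caff1E a b z : (caff a b z).1 = a.1 * z.1 + (- a.2) * z.2 + b.1.
Proof. by rewrite /caff /= mulNr. Qed.

Lemma caff2E a b z : (caff a b z).2 = a.2 * z.1 + a.1 * z.2 + b.2.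
Proof. by []. Qed.

Lemma is_derive_affine (p : plane -> R) (a b d : R) (z v : plane) :
  (forall z, p z = a * z.1 + b * z.2 + d) -> is_derive z v p (a * v.1 + b * v.2).
Proof.
move=> pE; have -> : p = a \*: (fst : plane -> R) + b \*: (snd : plane -> R) + cst d.
  by apply/funext => y; rewrite pE.
apply: (is_derive_eq (is_deriveD (is_deriveD (is_deriveZ a (is_derive_fst z v))
  (is_deriveZ b (is_derive_snd z v))) (is_derive_cst d z v))).
by rewrite addr0.
Qed.

Lemma Jhol_on_caff (U' : set plane) (u : plane -> X) (a b : plane) : Jhol_on U' u ->
  Jhol_on [set z | U' (caff a b z)] (fun z => u (caff a b z)).
Proof.
move=> Ju; have oU' : open U' by case: Ju.
have C1 (U : set plane) : open U -> smooth_on U (fun z => (caff a b z).1).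
  by move=> oU; apply: smooth_affine_plane => // z; exact: caff1E.
have C2 (U : set plane) : open U -> smooth_on U (fun z => (caff a b z).2).
  by move=> oU; apply: smooth_affine_plane => // z; exact: caff2E.
have oU : open [set z | U' (caff a b z)].
  have -> : [set z | U' (caff a b z)] = setT `&` (fun z => ((caff a b z).1, (caff a b z).2)) @^-1` U'.
    rewrite setTI; have -> // : (fun z => ((caff a b z).1, (caff a b z).2)) = caff a b.
    by apply/funext => z; case: (caff a b z).
  apply: open_preimage_on => //; first exact: openT.
  move=> z _; apply: continuous_pair.
    exact: (Ck_continuous (C1 setT (@openT _) 0%N)).
  exact: (Ck_continuous (C2 setT (@openT _) 0%N)).
apply: (Jhol_on_comp Ju) => //; [exact: C1|exact: C2|].
move=> z _.
have [_ ->] := is_derive_affine z (0, 1) (caff1E a b); have [_ ->] := is_derive_affine z (1, 0) (caff1E a b).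
have [_ ->] := is_derive_affine z (0, 1) (caff2E a b); have [_ ->] := is_derive_affine z (1, 0) (caff2E a b).
by rewrite /= !mulr0 !mulr1 !add0r !addr0.
Qed.

Lemma Jhol_on_cinv (u : plane -> X) : Jhol_on setT u -> Jhol_on nonzero (fun z => u (cinv z)).
Proof.
move=> Ju; apply: (Jhol_on_comp Ju) => //.
- exact: open_nonzero_plane.
- exact: smooth_cinv1.
- exact: smooth_cinv2.
move=> z z0; have [_ ->] := is_derive_cinv1 (0, 1) z0; have [_ ->] := is_derive_cinv1 (1, 0) z0.
have [_ ->] := is_derive_cinv2 (0, 1) z0; have [_ ->] := is_derive_cinv2 (1, 0) z0.
by split; rewrite /= -?[RHS]mulNr; congr (_ / _); ring.
Qed.

Definition chart0 u : plane -> X := u \o affine.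
Definition chart1 u : plane -> X := u \o P1_swap \o affine.

Lemma P1_swapK : involutive (@P1_swap R).
Proof.
move=> [z|]; rewrite /P1_swap /P1_of /=; last first.
  by rewrite (oner_eq0 R[i]) mul0r /= eqxx.
have [->|z0] := eqVneq z 0; first by rewrite /= (oner_eq0 R[i]) mul0r.
by rewrite /= mul1r invr_eq0 (negbTE z0) div1r invrK.
Qed.

Lemma affine_eq0 (w : plane) : (Complex w.1 w.2 == 0) = (w == (0, 0)).
Proof. by case: w => x y; rewrite eq_complex /= xpair_eqE. Qed.

Lemma P1_swap_affine (w : plane) : w != (0, 0) -> P1_swap (affine w) = affine (cinv w).
Proof.
move=> w0; rewrite /P1_swap /P1_of /= affine_eq0 (negbTE w0) div1r.
by congr Some.
Qed.

Lemma P1_swap_affine0 : P1_swap (affine ((0, 0) : plane)) = None.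
Proof. by rewrite /P1_swap /P1_of /= (_ : (0 +i* 0)%C = 0) // eqxx. Qed.

Lemma Jhol_P1P u : Jhol_P1 u <-> Jhol_on setT (chart0 u) /\ Jhol_on setT (chart1 u).
Proof. by rewrite /Jhol_P1 !Jhol_onT. Qed.

Lemma Jhol_P1_swap u : Jhol_P1 u -> Jhol_P1 (u \o P1_swap).
Proof.
move=> [J0 J1]; split => //.
have -> : (u \o P1_swap) \o P1_swap \o affine = u \o affine; last exact: J0.
by apply/funext => z /=; rewrite P1_swapK.
Qed.

Definition P1_shift (q : R[i]) (p : P1 R) : P1 R := omap (+%R^~ q) p.

Definition plane_of (q : R[i]) : plane := (complex.Re q, complex.Im q).

Lemma affine_plane_of q : affine (plane_of q) = Some q.
Proof. by case: q. Qed.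

Lemma chart0_shift u q : chart0 (u \o P1_shift q) = (fun z => chart0 u (shift_plane (plane_of q) z)).
Proof. by apply/funext => z; case: q. Qed.

Lemma cmul_caff (a b z w : plane) : cmul (caff a b z) w = shift_plane (cmul b w) (cmul (cmul a z) w).
Proof. by rewrite /caff /shift_plane /cmul /=; congr (_, _); ring. Qed.

Lemma caff_opp (a w : plane) : caff (- a) a w = cmul a (shift_plane (1, 0) (- w)).
Proof.
by case: a => a b; case: w => c d; rewrite /caff /shift_plane /cmul /=; congr (_, _); ring.
Qed.

Lemma shift_planeNK (a b : plane) : shift_plane (shift_plane a b) (- a) = b.
Proof. by case: a => a a'; case: b => b b'; rewrite /shift_plane /=; congr (_, _); ring. Qed.

(** In the chart at infinity the translation is [z / (1 + q z)]. Away from [0] it is a translation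
    between two inversions; where [1 + q z] is nonzero it equals [q^-1 (1 - 1 / (1 + q z))]. Thus
    affine maps and inversion suffice, and the two open sets cover the plane. *)
Lemma Jhol_P1_shift q u : Jhol_P1 u -> Jhol_P1 (u \o P1_shift q).
Proof.
move=> /Jhol_P1P[J0 J1]; apply/Jhol_P1P; split.
  rewrite chart0_shift; apply/Jhol_onT; apply: Jhol_shift; exact/Jhol_onT.
set Q := plane_of q.
have J0' : Jhol_on setT (fun z => chart0 u (shift_plane Q z)).
  apply/Jhol_onT; apply: Jhol_shift; exact/Jhol_onT.
have JN : Jhol_on nonzero (chart1 (u \o P1_shift q)).
  apply: Jhol_on_ext (Jhol_on_cinv J0') => z z0.
  by rewrite /chart1 /chart0 /= P1_swap_affine //= /Q; case: (q).
have [Q0|Q0] := eqVneq Q (0, 0).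
  have q0 : q = 0 by move: Q0; rewrite /Q /plane_of; case: (q) => a b /= [-> ->].
  have -> : u \o P1_shift q = u; last exact: J1.
  by apply/funext => -[z|] //=; rewrite q0 addr0.
pose Qi := cinv Q.
(* The outer affine map [w |-> Qi (1 - w)]; below, [w] is the inverse of [1 + Q z]. *)
have J2 : Jhol_on setT (fun t => chart1 u (caff (- Qi) Qi t)).
  have -> : setT = [set t | [set: plane] (caff (- Qi) Qi t)] by apply/seteqP; split.
  exact: Jhol_on_caff.
have := Jhol_on_caff Q (1, 0) (Jhol_on_cinv J2).
set U := [set z | _]; move=> J3.
suff J4 : Jhol_on U (chart1 (u \o P1_shift q)).
  have -> : setT = nonzero `|` U; last exact: Jhol_on_union.
  apply/seteqP; split=> // z _; have [->|z0] := eqVneq z (0, 0); last by left.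
  right; rewrite /U /= /nonzero /= /caff /shift_plane /= /cmul /=.
  by rewrite !mulr0 subr0 !add0r; apply/negP => /eqP[] /eqP; rewrite oner_eq0.
apply: Jhol_on_ext J3 => z Uz.
have [->|z0] := eqVneq z (0, 0).
  have c1 : caff Q (1, 0) (0, 0) = (1, 0).
    by rewrite /caff /shift_plane /cmul /= !mulr0 subr0 !add0r.
  rewrite c1; have -> : cinv (1, 0) = (1, 0) :> plane.
    by rewrite /cinv /sqn /= expr1n expr0n addr0 divr1 mul0r oppr0.
  have -> : caff (- Qi) Qi (1, 0) = (0, 0).
    by rewrite /caff /shift_plane /cmul /= !mulr1 !mulr0 subr0 addr0 !addNr.
  by rewrite /chart1 /= P1_swap_affine0.
set w := cinv (caff Q (1, 0) z).
set t := caff (- Qi) Qi w.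
have tE : t = cmul z w.
  have QQ := cmulV Q0; have cc := cmulV Uz; rewrite -/w in cc.
  rewrite /t caff_opp; have -> : shift_plane (1, 0) (- w) = cmul (cmul Q z) w.
    by rewrite -cc cmul_caff cmul1 shift_planeNK.
  by rewrite !cmulA (cmulC Qi) QQ cmul1.
have w0 : w != (0, 0) by rewrite -sqn_eq0 /w sqnV invr_eq0 sqn_eq0.
have t0 : t != (0, 0) by rewrite tE -sqn_eq0 sqnM mulf_neq0 // sqn_eq0.
rewrite /chart1 /= !P1_swap_affine //=; congr u; congr Some.
have -> : cinv t = shift_plane Q (cinv z).
  rewrite tE cinvM /w cinvK /caff.
  by rewrite cmulC cmul_caff cmul1 -cmulA (cmulV z0) cmulC cmul1 /shift_plane addrC [X in (_, X)]addrC.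
by rewrite /Q /plane_of; case: (q).
Qed.

End Sphere.

(** * Decay on annuli *)

Section Annulus.
Context {R : realType} {n : nat} (X : geometry R n).
Notation plane := (R * R)%type.
Notation MM := (measurableTypeR R * measurableTypeR R)%type.
Implicit Types (u : plane -> X) (z : plane).

Definition modulus z : R := Num.sqrt (sqn z).

Lemma modulus_ge0 z : 0 <= modulus z.
Proof. exact: sqrtr_ge0. Qed.

Lemma sqr_modulus z : modulus z ^+ 2 = sqn z.
Proof. by rewrite sqr_sqrtr // sqn_ge0. Qed.

Lemma modulus_eq0 z : (modulus z == 0) = (z == (0, 0)).
Proof. by rewrite sqrtr_eq0 -sqn_eq0 eq_le sqn_ge0 andbT. Qed.

Lemma modulus_gt0 z : (0 < modulus z) = (z != (0, 0)).
Proof. by rewrite lt0r modulus_eq0 modulus_ge0 andbT. Qed.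

Lemma measurable_le_continuous (p : plane -> R) (a : R) : continuous p ->
  measurable ([set z | p z <= a] : set MM).
Proof.
move=> cp.
have -> : [set z | p z <= a] = ~` [set z | a < p z].
  by apply/seteqP; split=> z /=; rewrite leNgt => /negP.
apply: measurableC; apply: open_measurable_plane.
have -> : [set z | a < p z] = p @^-1` [set y | a < y] by [].
by apply: (proj1 (continuousP p)) => //; exact: open_gt.
Qed.

Definition mean_value (C q : R) : Prop :=
  forall r u, 0 < r -> Jhol (disc r) u -> (energy (disc r) u <= q%:E)%E ->
    ((r ^+ 2 * norm_du u (0, 0) ^+ 2)%:E <= C%:E * energy (disc r) u)%E.

Definition cdisc (c : plane) (r : R) : set plane := [set w | modulus (shift_plane (- c) w) <= r].

Lemma shift_plane_continuous (a : plane) : continuous (shift_plane a).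
Proof.
move=> w; apply: (@continuous_pair _ _ _ (fun z : plane => z.1 + a.1) (fun z : plane => z.2 + a.2)).
  by apply: cvgD; [exact: cvg_fst|exact: cvg_cst].
by apply: cvgD; [exact: cvg_snd|exact: cvg_cst].
Qed.

Lemma modulus_continuous : continuous modulus.
Proof.
move=> w; apply: (@continuous_comp _ _ _ sqn Num.sqrt); last exact: sqrt_continuous.
exact: sqn_continuous.
Qed.

Lemma measurable_cdisc c r : measurable (cdisc c r : set MM).
Proof.
apply: measurable_le_continuous => w.
apply: (@continuous_comp _ _ _ (shift_plane (- c)) modulus); first exact: shift_plane_continuous.
exact: modulus_continuous.
Qed.

(** Contraposition of the mean value inequality: an energy below [L <= q] would make it applicable
    and give [(r |du|) ^ 2 < C L]. *)
Lemma ball_energy C q u z r (L : R) : mean_value C q -> 0 < C -> Jhol setT u -> 0 < r -> L <= q ->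
  C * L <= (r * norm_du u z) ^+ 2 ->
  (L%:E <= energy (cdisc z r) u)%E.
Proof.
move=> mv C0 Ju r0 Lq CL; set D := cdisc z r.
have [su _] := JholT Ju.
have mD : measurable (D : set MM) := measurable_cdisc z r.
have E : energy D u = energy (disc r) (fun w => u (shift_plane z w)).
  rewrite (energy_shift z su mD); congr energy; apply/seteqP; split=> w; rewrite /D /cdisc /disc /=;
    have -> : shift_plane (- z) (shift_plane z w) = w by
      case: (z) => a b; case: (w) => c d; rewrite /shift_plane /=; congr (_, _); ring.
    by move=> h; rewrite -[_ + _]/(sqn w) -sqr_modulus lerXn2r // nnegrE ?modulus_ge0 // ltW.
  by move=> h; rewrite -(ger0_norm (modulus_ge0 w)) -(ger0_norm (ltW r0)) -ler_sqr
    -?sqr_normr ?normr_id ?real_normK ?num_real // sqr_modulus.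
have JS : Jhol (disc r) (fun w => u (shift_plane z w)).
  have [s' J'] := JholT (Jhol_shift z Ju); exists setT; split; [exact: openT|by []|exact: s'|by move=> w _; exact: J'].
rewrite leNgt; apply/negP => EL.
have fin : energy D u \is a fin_num.
  by rewrite ge0_fin_numE; [exact: (lt_trans EL (ltry _))|exact: energy_ge0].
have Eq : (energy D u <= q%:E)%E by rewrite (le_trans (ltW EL)) // lee_fin.
have := mv r _ r0 JS; rewrite -E => /(_ Eq).
rewrite -(fineK fin) -EFinM lee_fin norm_du_shift // => h.
have : C * fine (energy D u) < C * L by rewrite ltr_pM2l // -lte_fin fineK.
rewrite ltNge => /negP; apply; apply: le_trans CL _.
by rewrite exprMn; apply: le_trans h; rewrite /shift_plane /= !add0r; case: (z).
Qed.

(** With [pol2], the complex exponential. It turns annuli into cylinders and [|z| |du|] into the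
    norm of the derivative. *)
Definition pol1 z : R := expR z.1 * cos z.2.
Definition pol2 z : R := expR z.1 * sin z.2.

Lemma smooth_pol : smooth_on setT pol1 /\ smooth_on setT pol2.
Proof.
have oT : open [set: plane] := openT.
by split=> k; apply: CkM => //; [apply: Ck_expR => //; exact: Ck_fst| |
  apply: Ck_expR => //; exact: Ck_fst|];
  have [c s] := @Ck_cos_sin _ _ k [set: plane] snd oT (Ck_snd _ _).
Qed.

Lemma is_derive_pol1 z v :
  is_derive z v pol1 (expR z.1 * cos z.2 * v.1 - expR z.1 * sin z.2 * v.2).
Proof.
apply: (is_derive_eq (is_deriveM (is_derive_expR_comp (is_derive_fst z v))
  (is_derive_cos_comp (is_derive_snd z v)))).
change (expR z.1 * - (sin z.2 * v.2) + cos z.2 * (expR z.1 * v.1) =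
  expR z.1 * cos z.2 * v.1 - expR z.1 * sin z.2 * v.2); ring.
Qed.

Lemma is_derive_pol2 z v :
  is_derive z v pol2 (expR z.1 * sin z.2 * v.1 + expR z.1 * cos z.2 * v.2).
Proof.
apply: (is_derive_eq (is_deriveM (is_derive_expR_comp (is_derive_fst z v))
  (is_derive_sin_comp (is_derive_snd z v)))).
change (expR z.1 * (cos z.2 * v.2) + sin z.2 * (expR z.1 * v.1) =
  expR z.1 * sin z.2 * v.1 + expR z.1 * cos z.2 * v.2); ring.
Qed.

Definition polar z : plane := (pol1 z, pol2 z).

Lemma sqn_polar z : sqn (polar z) = expR z.1 ^+ 2.
Proof.
rewrite /sqn /= /pol1 /pol2 !exprMn -mulrDr; have := cos2Dsin2 z.2 => ->; exact: mulr1.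
Qed.

Lemma modulus_polar z : modulus (polar z) = expR z.1.
Proof. by rewrite /modulus sqn_polar sqrtr_sqr ger0_norm // expR_ge0. Qed.

Lemma polar_surj z : z != (0, 0) -> exists t, z = polar (ln (modulus z), t).
Proof.
move=> z0; have m0 : 0 < modulus z by rewrite modulus_gt0.
pose a := z.1 / modulus z; pose b := z.2 / modulus z.
have ab : a ^+ 2 + b ^+ 2 = 1.
  rewrite /a /b !expr_div_n -mulrDl -[_ + _]/(sqn z) -sqr_modulus divff //.
  by rewrite expf_neq0 // gt_eqF.
have a1 : -1 <= a <= 1.
  by rewrite -ler_norml -(@ler_sqr R) ?nnegrE // expr1n real_normK ?num_real // -ab lerDl sqr_ge0.
have zE : z = (modulus z * a, modulus z * b).
  by rewrite ![modulus z * _]mulrC !divfK ?gt_eqF //; case: (z).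
have sb : sin (acos a) = `|b|.
  rewrite sin_acos // -ab addrAC subrr add0r sqrtr_sqr //.
have [b0|b0] := leP 0 b.
  exists (acos a); rewrite {1}zE /polar /pol1 /pol2 /= lnK ?posrE //.
  by rewrite acosK ?in_itv // sb ger0_norm.
exists (- acos a); rewrite {1}zE /polar /pol1 /pol2 /= lnK ?posrE //.
by rewrite cosN sinN acosK ?in_itv // sb ltr0_norm // opprK.
Qed.

Lemma norm_du_polar u z : smooth_map setT u ->
  norm_du (u \o polar) z = modulus (polar z) * norm_du u (polar z).
Proof.
move=> su; have [s1 s2] := smooth_pol.
have E := norm_du_conformal (@openT _) (@openT _) su (fun _ _ => I) s1 s2 I
  (@derive_val _ _ _ _ _ _ _ (is_derive_pol1 z (1, 0)))
  (@derive_val _ _ _ _ _ _ _ (is_derive_pol2 z (1, 0))).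
rewrite [LHS]E /=.
- rewrite !mulr0 !mulr1 subr0 addr0 -[_ ^+ 2 + _]/(sqn (polar z)) //.
- have [_ ->] := is_derive_pol1 z (0, 1) => /=; ring.
- have [_ ->] := is_derive_pol2 z (0, 1) => /=; ring.
Qed.

Lemma Jhol_polar u : Jhol setT u -> Jhol setT (u \o polar).
Proof.
move=> /JholT[su Ju]; have [s1 s2] := smooth_pol.
apply: (@Jhol_conformal _ _ X setT setT setT setT u pol1 pol2) => //; try exact: openT.
move=> z _; have [_ ->] := is_derive_pol1 z (0, 1); have [_ ->] := is_derive_pol1 z (1, 0).
have [_ ->] := is_derive_pol2 z (0, 1); have [_ ->] := is_derive_pol2 z (1, 0).
by split => /=; ring.
Qed.

End Annulus.

Section Decay.
Context {R : realType} {n : nat} (X : geometry R n).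
Notation plane := (R * R)%type.
Notation MM := (measurableTypeR R * measurableTypeR R)%type.
Implicit Types (u : plane -> X) (z : plane).

Definition omega (x : X) (v w : 'rV[R]_n) : R := (v *m at_pt (@sform _ _ X) x *m w^T) 0 0.

Definition tame_bound (b : R) : Prop :=
  forall (x : X) v, gdot x v v <= b * omega x v (v *m at_pt (@acs _ _ X) x).

Lemma chart_at_img (x : X) : img (chart_at x) (coords (chart_at x) x).
Proof. by have [_ _ /(_ _ (chart_at_dom x))[]] := atlas_chart (chart_at_atlas x). Qed.

Lemma bounded_geometry_tame j B : bounded_geometry X j B -> tame_bound (B 0%N).
Proof.
move=> [_ H] x v; apply: (H 0%N) => //; [exact: chart_at_atlas|exact: chart_at_img].
Qed.

Lemma omegaC x v w : omega x v w = - omega x w v.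
Proof.
have [aS _ _] := form_symplectic (chart_at_atlas x) (chart_at_img x).
rewrite /omega -[w *m _ *m _]trmxK [in RHS]mxE !trmx_mul trmxK mulmxA.
rewrite [X in - (v *m X *m _) 0 0]aS.
by rewrite mulmxN mulNmx [in RHS]mxE opprK.
Qed.

Lemma omega_ge0 x v : 0 <= omega x v (v *m at_pt (@acs _ _ X) x).
Proof.
have [->|v0] := eqVneq v 0; first by rewrite /omega !mul0mx mxE.
by have [_ /(_ _ v0)/ltW] := acs_tame (chart_at_atlas x) (chart_at_img x).
Qed.

Lemma omegaNr x v w : omega x v (- w) = - omega x v w.
Proof. by rewrite /omega raddfN /= mulmxN mxE. Qed.

(** Taming is used for [v] and for [J v]; both give the same area term because
    [omega (J v, J (J v)) = omega (v, J v)]. *)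
Lemma density_le_omega b u z : tame_bound b ->
  vel u z (0, 1) = vel u z (1, 0) *m at_pt (@acs _ _ X) (u z) ->
  norm_du u z ^+ 2 <= 2 * `|b| * omega (u z) (vel u z (1, 0)) (vel u z (0, 1)).
Proof.
move=> tb Ju; rewrite sqr_norm_du Ju; set v := vel u z (1, 0); set J := at_pt _ _.
have JJ : v *m J *m J = - v.
  have [h _] := acs_tame (chart_at_atlas (u z)) (chart_at_img (u z)).
  by rewrite -mulmxA [J *m J]h mulmxN mulmx1.
have h1 := tb (u z) v; have h2 := tb (u z) (v *m J).
rewrite -/J in h1 h2; rewrite JJ omegaNr -omegaC in h2.
have w0 := omega_ge0 (u z) v; rewrite -/J in w0.
have : b * omega (u z) v (v *m J) <= `|b| * omega (u z) v (v *m J).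
  by rewrite ler_wpM2r // ler_norm.
lra.
Qed.

Lemma omega_density_continuous u : smooth_map setT u ->
  forall z, {for z, continuous (fun z => omega (u z) (vel u z (1, 0)) (vel u z (0, 1)))}.
Proof.
move=> su z; exact: (pullform_continuous (@sform_covariant R n X) (@openT _) su).
Qed.

Lemma cylinderE (a b : R) : cylinder a b = [set` `[a, b]%R] `*` [set` `[(0 : R), 2 * pi]%R].
Proof. by apply/seteqP; split=> z; rewrite /cylinder /= !in_itv /=. Qed.

Lemma measurable_cylinder (a b : R) : measurable (cylinder a b : set MM).
Proof. by rewrite cylinderE; apply: measurableX; exact: measurable_itv. Qed.

Lemma cylinder_energy b (a a' : R) u : tame_bound b -> Jhol setT u ->
  (energy (cylinder a a') u <= (`|b| * area (cylinder a a') u)%:E)%E.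
Proof.
move=> tb /JholT[su Ju]; set D := cylinder a a'.
have mD : measurable (D : set MM) := measurable_cylinder a a'.
pose w z := omega (u z) (vel u z (1, 0)) (vel u z (0, 1)).
have cw : continuous w := omega_density_continuous su.
have w0 z : 0 <= w z by rewrite /w Ju omega_ge0.
have mw : measurable_fun (setT : set MM) (fun z => (w z)%:E).
  by apply/measurable_EFinP; exact: measurable_continuous_plane.
have cD : compact D.
  rewrite /D cylinderE; apply: compact_setX; exact: segment_compact.
have [M M0 HM] : exists2 M : R, 0 <= M & forall z, D z -> w z <= M.
  have [M [_ HM]] := compact_bounded (continuous_compact (continuous_subspaceT cw) cD).
  exists (Num.max (M + 1) 0) => [|z Dz]; first by rewrite le_max lexx orbT.
  rewrite le_max; apply/orP; left; apply: le_trans (ler_norm _) _.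
  by apply: HM; [rewrite ltrDl|exists z].
have muD : (mu2 (D : set MM) < +oo)%E.
  have -> : mu2 D = (lebesgue_measure ([set` `[a, a']%R] : set (measurableTypeR R)) *
      lebesgue_measure ([set` `[(0 : R), 2 * pi]%R] : set (measurableTypeR R)))%E.
    by rewrite /D cylinderE; apply: product_measure1E; exact: measurable_itv.
  by rewrite !lebesgue_measure_itv /=; do 2 case: ifP => _; rewrite ?mule0 ?mul0e // -!EFinD -EFinM ltry.
(* [area] is the [fine] part of an integral, so it bounds the energy only once that integral is
   known to be finite; continuity on a compact rectangle gives this. *)
have fin : (\int[mu2]_(z in D) (w z)%:E)%E \is a fin_num.
  rewrite ge0_fin_numE; last by apply: integral_ge0 => z _; rewrite lee_fin.
  apply: (@le_lt_trans _ _ (\int[mu2]_(z in D) (cst M%:E z))%E).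
    apply: ge0_le_integral => //.
    - by move=> z _; rewrite lee_fin.
    - exact: measurable_funTS.
  rewrite integral_cst //.
  by apply: lte_mul_pinfty => //; rewrite lee_fin.
rewrite EFinM /area /Rintegral [X in (_ * X)%E](fineK fin) -/w.
have -> : energy D u = (\int[mu2]_(z in D) (2^-1%:E * (norm_du u z ^+ 2)%:E))%E.
  rewrite /energy ge0_integralZl //.
    by apply: measurable_funTS; exact: measurable_norm_du.
  by move=> z _; rewrite lee_fin sqr_ge0.
have -> : (`|b|%:E * \int[mu2]_(z in D) (w z)%:E = \int[mu2]_(z in D) (`|b|%:E * (w z)%:E))%E.
  rewrite ge0_integralZl //; first exact: measurable_funTS.
  by move=> z _; rewrite lee_fin w0.
apply: ge0_le_integral => //.
- by move=> z _; rewrite -EFinM lee_fin mulr_ge0 ?invr_ge0 ?sqr_ge0.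
- by apply: measurable_funeM; apply: measurable_funTS; exact: measurable_norm_du.
- by apply: measurable_funeM; exact: measurable_funTS.
move=> z _; rewrite -!EFinM lee_fin.
have := density_le_omega tb (Ju z); rewrite -/(w z); lra.
Qed.

Definition long_cylinder (l c K1 : R) : Prop :=
  forall (Rm Rp : R) u, Rm < Rp -> Jhol (strip Rm Rp) u ->
    (forall s t, Rm <= s <= Rp -> u (s, t + 2 * pi) = u (s, t)) ->
    (forall z, strip Rm Rp z -> norm_du u z <= l) ->
    (exists action : R -> R,
      (forall a b, Rm <= a -> a <= b -> b <= Rp ->
         area (cylinder a b) u = action a - action b) /\
      (forall s, Rm <= s <= Rp ->
         ((`|action s|%R)%:E <= c%:E * loop_length (fun t : R => u (s, t)) ^+ 2)%E)) /\
    (2 <= Rp - Rm -> forall s t, Rm + 1 <= s <= Rp - 1 ->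
       norm_du u (s, t) <= K1 * Num.sqrt (fine (energy (cylinder Rm Rp) u))
                           * (expR (s - Rp) + expR (Rm - s))).

(** The energy of a cylinder is at most [|b|] times its area, which is a difference of two actions;
    each action is at most [c] times the square of a loop length, and loops have length at most
    [2 pi l]. No energy of the given map enters. *)
Definition decay_constant (b l c K1 : R) : R :=
  K1 * Num.sqrt (`|b| * (2 * (c * (2 * pi * l) ^+ 2))).

Lemma loop_length_le u s (l : R) : smooth_map setT u -> (forall t, norm_du u (s, t) <= l) ->
  (loop_length (fun t : R => u (s, t)) <= (2 * pi * l)%:E)%E.
Proof.
move=> su ul.
have sl : smooth_map setT (fun t : R => u (s, t)).
  apply: (smooth_map_comp_plane (@openT R) (@openT _) su (fun _ _ => I)) => k.
    exact: Ck_cst.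
  by apply: (@Ck_linear _ _ _ _ _ idfun) => x; exact: cvg_id.
have l0 : 0 <= l by apply: le_trans (ul 0); exact: norm_du_ge0.
have pi0 := pi_ge0 R.
rewrite /loop_length /curve_length.
have -> : (2 * pi * l)%:E = (\int[lebesgue_measure]_(t in `[0%R, (2 * pi)%R]) (cst l%:E t) :> \bar R)%E.
  rewrite integral_cst //= lebesgue_measure_itv /= lte_fin.
  case: ifPn => [_|]; first by rewrite sube0 -EFinM mulrC.
  by rewrite mulr_gt0 ?pi_gt0.
apply: ge0_le_integral => //=.
- apply/measurable_EFinP; apply: measurable_funTS; apply: continuous_measurable_fun.
  exact: speed_continuous.
move=> t _; rewrite lee_fin; apply: le_trans (ul t).
have -> : vel (fun t : R => u (s, t)) t 1 = vel u (s, t) (0, 1).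
  have C1 : smooth_on (setT : set R) (fun=> s) by move=> k; exact: Ck_cst.
  have C2 : smooth_on (setT : set R) (@idfun R).
    by move=> k; apply: (@Ck_linear _ _ _ _ _ idfun) => x; exact: cvg_id.
  rewrite (vel_comp_plane (@openT _) su (fun _ _ => I) C1 C2 1 I).
  have [_ ->] := is_derive_cst s t (1 : R); have [_ ->] := is_derive_id t (1 : R).
  by rewrite scale0r add0r scale1r.
rewrite norm_duE ler_wsqrtr // lerDr gdot_ge0 //.
Qed.

(** The long cylinder lemma in the coordinate [s = ln |z|]: the two exponentials become [|z| / r2]
    and [r1 / |z|], and the factors [expR 1] are the unit margins at the ends of the cylinder. *)
Lemma annulus_decay b l c K1 u (r1 r2 : R) z :
  tame_bound b -> long_cylinder l c K1 -> 0 < l -> 0 < c -> 0 <= K1 ->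
  Jhol setT u -> 0 < r1 ->
  (forall z, r1 <= modulus z <= r2 -> modulus z * norm_du u z <= l) ->
  expR 1 * r1 <= modulus z -> expR 1 * modulus z <= r2 ->
  modulus z * norm_du u z
    <= decay_constant b l c K1 * (modulus z / r2 + r1 / modulus z).
Proof.
move=> tb lc l0 c0 K0 Ju r10 ul z1 z2.
have [su _] := JholT Ju.
have e1 : 1 < expR 1 :> R by rewrite expR_gt1.
have m0 : 0 < modulus z by apply: lt_le_trans z1; rewrite mulr_gt0 ?expR_gt0.
have r20 : 0 < r2 by apply: lt_le_trans z2; rewrite mulr_gt0 ?expR_gt0.
have z0 : z != (0, 0) by rewrite -modulus_gt0.
have [t zE] := polar_surj z0.
pose s := ln (modulus z); pose Rm := ln r1; pose Rp := ln r2.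
have s1 : Rm + 1 <= s.
  by rewrite -ler_expR expRD !lnK ?posrE // mulrC.
have s2 : s <= Rp - 1.
  by rewrite -(lerD2r 1) subrK -ler_expR expRD !lnK ?posrE // mulrC.
have RR : 2 <= Rp - Rm by lra.
have R12 : Rm < Rp by lra.
have Ju' := Jhol_polar Ju; have [su' _] := JholT Ju'.
have JS : Jhol (strip Rm Rp) (u \o polar).
  by have [_ J'] := JholT Ju'; exists setT; split => //; exact: openT.
have ul' y : strip Rm Rp y -> norm_du (u \o polar) y <= l.
  move=> /andP[y1 y2]; rewrite norm_du_polar //; apply: ul; rewrite modulus_polar.
  by rewrite -[X in X <= _ <= _](@lnK _ r1) ?posrE // -[X in _ <= _ <= X](@lnK _ r2) ?posrE // !ler_expR y1 y2.
have per s' t' : Rm <= s' <= Rp -> (u \o polar) (s', t' + 2 * pi) = (u \o polar) (s', t').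
  move=> _; rewrite /polar /pol1 /pol2 /=.
  by rewrite cosD sinD mulr_natl cos2pi sin2pi !mulr1 !mulr0 subr0 addr0.
have [[action [area_eq action_le]] dec] := lc Rm Rp _ R12 JS per ul'.
have := dec RR s t; rewrite s1 s2 => /(_ isT).
rewrite norm_du_polar // -zE => h; apply: le_trans h _.
have -> : expR (s - Rp) = modulus z / r2 by rewrite expRD expRN !lnK ?posrE.
have -> : expR (Rm - s) = r1 / modulus z by rewrite expRD expRN !lnK ?posrE.
apply: ler_wpM2r; first by rewrite addr_ge0 // divr_ge0 // ltW.
apply: ler_wpM2l => //; apply: ler_wsqrtr.
have act s' : Rm <= s' <= Rp -> `|action s'| <= c * (2 * pi * l) ^+ 2.
  move=> hs; rewrite -lee_fin; apply: le_trans (action_le _ hs) _.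
  rewrite EFinM; apply: lee_wpmul2l; first by rewrite lee_fin ltW.
  have ll : (loop_length (fun t => (u \o polar) (s', t)) <= (2 * pi * l)%:E)%E.
    by apply: loop_length_le => // t'; exact: ul'.
  have l1 : (0 <= loop_length (fun t => (u \o polar) (s', t)))%E.
    by apply: integral_ge0 => t' _; rewrite lee_fin sqrtr_ge0.
  rewrite !expr2 EFinM; exact: lee_pmul.
have E1 : fine (energy (cylinder Rm Rp) (u \o polar)) <= `|b| * area (cylinder Rm Rp) (u \o polar).
  have h := cylinder_energy Rm Rp tb Ju'.
  rewrite -lee_fin fineK // ge0_fin_numE ?energy_ge0 //; apply: le_lt_trans h _; exact: ltry.
apply: le_trans E1 _; apply: ler_wpM2l => //.
rewrite area_eq ?lexx // ?(ltW R12) //; apply: le_trans (ler_norm _) _.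
apply: le_trans (ler_normB _ _) _.
by rewrite mulr_natl mulr2n lerD // act // ?lexx ?(ltW R12).
Qed.

End Decay.

(** * Distance bounds from density bounds *)

Section PlaneReach.
Context {R : realType} {n : nat} (X : geometry R n).
Notation plane := (R * R)%type.
Implicit Types (u : plane -> X) (z w : plane).

Definition pdot (z w : plane) : R := z.1 * w.1 + z.2 * w.2.

Lemma sqnD z w : sqn (z + w) = sqn z + 2 * pdot z w + sqn w.
Proof. by case: z => a b; case: w => c d; rewrite /sqn /pdot /=; ring. Qed.

Lemma sqnZ (a : R) z : sqn (a *: z) = a ^+ 2 * sqn z.
Proof.
by case: z => b c; change ((a * b) ^+ 2 + (a * c) ^+ 2 = a ^+ 2 * (b ^+ 2 + c ^+ 2)); ring.
Qed.

Lemma modulusZ (a : R) z : modulus (a *: z) = `|a| * modulus z.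
Proof. by rewrite /modulus sqnZ sqrtrM ?sqr_ge0 // sqrtr_sqr. Qed.

Lemma modulusN z : modulus (- z) = modulus z.
Proof. by rewrite -scaleN1r modulusZ normrN1 mul1r. Qed.

Lemma pdot_le z w : pdot z w <= modulus z * modulus w.
Proof.
have h : pdot z w ^+ 2 <= (modulus z * modulus w) ^+ 2.
  rewrite exprMn !sqr_modulus /pdot /sqn; case: z => a b; case: w => c d /=.
  by have := sqr_ge0 (a * d - b * c); nra.
apply: le_trans (ler_norm _) _.
by rewrite -(ler_pXn2r (n := 2)) ?nnegrE ?mulr_ge0 ?modulus_ge0 // real_normK ?num_real.
Qed.

Lemma modulusD z w : modulus (z + w) <= modulus z + modulus w.
Proof.
rewrite -(ler_pXn2r (n := 2)) ?nnegrE ?addr_ge0 ?modulus_ge0 //.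
by rewrite sqr_modulus sqnD -!sqr_modulus; have := pdot_le z w; nra.
Qed.

Definition decay (l Kc : R) : Prop :=
  forall u (r1 r2 : R) z, Jhol setT u -> 0 < r1 ->
  (forall z, r1 <= modulus z <= r2 -> modulus z * norm_du u z <= l) ->
  expR 1 * r1 <= modulus z -> expR 1 * modulus z <= r2 ->
  modulus z * norm_du u z <= Kc * (modulus z / r2 + r1 / modulus z).

Lemma disc_decay l Kc u (r : R) z : decay l Kc -> 0 <= Kc -> Jhol setT u -> 0 < r ->
  (forall z, modulus z <= r -> modulus z * norm_du u z <= l) ->
  expR 1 * modulus z < r -> norm_du u z <= Kc / r.
Proof.
move=> dec Kc0 Ju r0 ul zr; have [su _] := JholT Ju.
have H y : y != (0, 0) -> expR 1 * modulus y <= r -> norm_du u y <= Kc / r.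
  move=> y0 yr; have m0 : 0 < modulus y by rewrite modulus_gt0.
  rewrite -(ler_pM2l m0); apply/ler_addgt0Pr => e e0.
  have [Kc00|Kc1] := eqVneq Kc 0.
    have := dec u (modulus y / expR 1) r y Ju _ _ _ yr.
    rewrite Kc00 !mul0r mulr0 => h; apply: le_trans (h _ _ _) _.
    - by rewrite divr_gt0 // expR_gt0.
    - by move=> w /andP[_ /ul].
    - by rewrite mulrC divfK // gt_eqF // expR_gt0.
    - by rewrite add0r ltW.
  have KcP : 0 < Kc by rewrite lt0r Kc1.
  (* Small enough for the unit margin and for [Kc * (r1 / |y|)] to be at most [e]. *)
  pose r1 := Num.min (modulus y / expR 1) (e * modulus y / Kc).
  have r10 : 0 < r1 by rewrite lt_min !divr_gt0 ?expR_gt0 // mulr_gt0.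
  apply: le_trans (dec u r1 r y Ju r10 _ _ yr) _.
  - by move=> w /andP[_ /ul].
  - by rewrite mulrC -ler_pdivlMr ?expR_gt0 // ge_min lexx.
  rewrite mulrDr; apply: lerD; first by rewrite mulrA [Kc * _]mulrC mulrA.
  rewrite mulrA ler_pdivrMr // mulrC -ler_pdivlMr //.
  by rewrite ge_min lexx orbT.
have [->|z0] := eqVneq z (0, 0); last by apply: H => //; exact: ltW.
rewrite leNgt; apply/negP => lt0.
have cn : {for (0, 0), continuous (norm_du u)} by exact: (norm_du_continuous (@openT _) su).
have nr : \forall y \near ((0, 0) : plane), Kc / r < norm_du u y.
  exact: (cn _ (lt_nbhsr lt0)).
(* The centre is approached along the real axis. *)
have cm : {for (0 : R), continuous (fun t : R => (t, 0 : R))}.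
  by apply: continuous_pair; [exact: cvg_id|exact: cst_continuous].
have nr' : \forall t \near (0 : R), Kc / r < norm_du u (t, 0) by exact: cm nr.
move/nbhs_ballP: nr' => [e /= e0 He].
pose t := Num.min (e / 2) (r / (expR 1 * 2)).
have t0 : 0 < t by rewrite lt_min !divr_gt0 ?mulr_gt0 ?expR_gt0.
have te : ball (0 : R) e t.
  rewrite -ball_normE /= sub0r normrN gtr0_norm // (@le_lt_trans _ _ (e / 2)) //.
    by rewrite ge_min lexx.
  lra.
have := He t te; rewrite ltNge => /negP; apply; apply: H.
  by rewrite xpair_eqE gt_eqF.
rewrite /modulus /sqn /= expr0n addr0 sqrtr_sqr gtr0_norm //.
have : t <= r / (expR 1 * 2) by rewrite ge_min lexx orbT.
rewrite ler_pdivlMr ?mulr_gt0 ?expR_gt0 // => h.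
by have := expR_gt0 (1 : R); nra.
Qed.

(** A Liouville theorem: let [r] tend to infinity in [disc_decay]. *)
Lemma global_decay l Kc u : decay l Kc -> 0 <= Kc -> Jhol setT u ->
  (forall z, modulus z * norm_du u z <= l) -> forall z, norm_du u z = 0.
Proof.
move=> dec Kc0 Ju ul z; apply/eqP; rewrite eq_le norm_du_ge0 andbT.
apply/ler_addgt0Pr => e e0; rewrite add0r.
pose r := Num.max (expR 1 * modulus z + 1) (Kc / e + 1).
have m0 := modulus_ge0 z; have e1 := expR_gt0 (1 : R).
have rz : expR 1 * modulus z < r by rewrite lt_max ltrDl ltr01.
have rK : Kc / e < r by rewrite lt_max ltrDl ltr01 orbT.
have r0 : 0 < r by apply: le_lt_trans rK; rewrite divr_ge0 // ltW.
apply: le_trans (disc_decay dec Kc0 Ju r0 _ rz) _; first by move=> y _; exact: ul.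
by rewrite ler_pdivrMr // mulrC -ler_pdivrMr // ltW.
Qed.

(** From [1 + x <= expR x] at [x = -1/8], raised to the eighth power. It lets a margin by a factor
    [3] replace the factor [expR 1] of the decay estimates. *)
Lemma expR1_lt3 : expR 1 < 3 :> R.
Proof.
have h : (7 / 8 : R) <= expR (- 8^-1).
  by apply: le_trans (expR_ge1Dx _); lra.
have E : expR 1 * expR (- 8^-1) ^+ 8 = 1 :> R.
  rewrite -expRM_natl -expRD; rewrite (_ : 1 + _ = 0) ?expR0 //.
  by rewrite mulrN mulfV ?subrr.
have h8 : (7 / 8 : R) ^+ 8 <= expR (- 8^-1) ^+ 8 by rewrite lerXn2r // nnegrE ?expR_ge0 //; lra.
have c8 : (1 / 3 : R) < (7 / 8) ^+ 8 by rewrite !exprS expr0; lra.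
have := expR_gt0 (1 : R); nra.
Qed.

Definition seg z z' (s : R) : plane := z + s *: (z' - z).

Lemma reach_seg u z z' L : smooth_map setT u ->
  (forall s, 0 <= s <= 1 -> norm_du u (seg z z' s) <= L) ->
  reach (u z) (u z') (L * modulus (z' - z)).
Proof.
move=> su H; apply: (@reach_segment _ _ _ setT) => //; first exact: openT.
by move=> s hs; split => //; exact: H.
Qed.

Lemma modulus_seg z z' s : 0 <= s <= 1 ->
  modulus (seg z z' s) <= Num.max (modulus z) (modulus z').
Proof.
move=> /andP[s0 s1].
have -> : seg z z' s = (1 - s) *: z + s *: z'.
  by rewrite /seg scalerBr scalerBl scale1r addrAC addrA.
apply: le_trans (modulusD _ _) _; rewrite !modulusZ !ger0_norm ?subr_ge0 //.
set M := Num.max _ _.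
have h1 : modulus z <= M by rewrite le_max lexx.
have h2 : modulus z' <= M by rewrite le_max lexx orbT.
nra.
Qed.

Lemma disc_reach l Kc u (r : R) z z' : decay l Kc -> 0 <= Kc -> Jhol setT u -> 0 < r ->
  (forall z, modulus z <= 3 * r -> modulus z * norm_du u z <= l) ->
  modulus z <= r -> modulus z' <= r ->
  reach (u z) (u z') (Kc * (modulus (z' - z) / r)).
Proof.
move=> dec Kc0 Ju r0 ul zr zr'; have [su _] := JholT Ju.
have e3 := expR1_lt3.
rewrite mulrA mulrAC; apply: reach_le (reach_seg su _); first exact: lexx.
move=> s hs; have h := modulus_seg z z' hs.
have hr : modulus (seg z z' s) <= r by apply: le_trans h _; rewrite ge_max zr.
apply: le_trans (@disc_decay _ _ u (3 * r) _ dec Kc0 Ju _ ul _) _.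
- by rewrite mulr_gt0.
- have := modulus_ge0 (seg z z' s); have := expR_gt0 (1 : R); nra.
- rewrite ler_wpM2l // lef_pV2 ?posrE ?mulr_gt0 //; nra.
Qed.

(* The chord from [a] to [b] of a disc centred at [c] is replaced by three
   sides of a rectangle touching the circle from outside. *)
Lemma reach_chord u (a b c : plane) (rho L : R) : smooth_map setT u -> 0 <= L ->
  0 < rho -> modulus (a - c) = rho -> modulus (b - c) = rho ->
  (forall w, rho <= modulus (w - c) -> sqn (w - c) <= 2 * rho ^+ 2 -> norm_du u w <= L) ->
  reach (u a) (u b) (2 * L * modulus (b - a)).
Proof.
move=> su L0 rho0 ac bc H.
have [->|ab] := eqVneq a b; first by rewrite subrr /modulus /sqn /= expr0n addr0 sqrtr0 mulr0; exact: reach_refl.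
set v := b - a; have v0 : 0 < modulus v.
  by rewrite modulus_gt0 -[(0, 0)]/(0 : plane) subr_eq0 eq_sym.
pose h := modulus v / 2; have h0 : 0 < h by rewrite divr_gt0.
pose t := (modulus v)^-1 *: v.
have tE : v = modulus v *: t by rewrite scalerA divff ?scale1r // gt_eqF.
have sqt : sqn t = 1.
  by rewrite -sqr_modulus modulusZ ger0_norm ?invr_ge0 ?modulus_ge0 // mulVf ?expr1n // gt_eqF.
pose x := a - c.
have xs : sqn x = rho ^+ 2 by rewrite -sqr_modulus ac.
have xt : pdot x t = - h.
  have E : sqn (x + modulus v *: t) = rho ^+ 2.
    by rewrite -tE -bc -sqr_modulus; congr (modulus _ ^+ 2); rewrite /x /v addrC subrKA.
  move: E; rewrite sqnD sqnZ sqt xs.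
  have -> : pdot x (modulus v *: t) = modulus v * pdot x t.
    by case: (x) => x1 x2; case: (t) => t1 t2;
      change (x1 * (modulus v * t1) + x2 * (modulus v * t2) = modulus v * (x1 * t1 + x2 * t2)); ring.
  move=> E; have : modulus v * (2 * pdot x t + modulus v) = 0 by lra.
  move/eqP; rewrite mulf_eq0 gt_eqF //= => /eqP; rewrite /h; lra.
(* The unit normal of the chord on the side away from the centre. *)
have [nu [sqnu nut [d0 xd]]] : exists nu, [/\ sqn nu = 1, pdot nu t = 0
    & 0 <= pdot x nu /\ pdot x nu ^+ 2 = rho ^+ 2 - h ^+ 2].
  pose nu0 : plane := (- t.2, t.1).
  have s0 : sqn nu0 = 1 by rewrite -sqt /sqn /nu0 /= sqrrN addrC.
  have p0 : pdot nu0 t = 0 by rewrite /pdot /nu0 /=; ring.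
  have q0 : pdot x nu0 ^+ 2 = rho ^+ 2 - h ^+ 2.
    have : pdot x nu0 ^+ 2 + pdot x t ^+ 2 = sqn x * sqn t by rewrite /pdot /nu0 /sqn /=; ring.
    by rewrite xt xs sqt mulr1 sqrrN => <-; rewrite addrK.
  have [p|p] := leP 0 (pdot x nu0); first by exists nu0.
  have N y : pdot y (- nu0) = - pdot y nu0 by rewrite /pdot /=; ring.
  exists (- nu0); split.
  - by rewrite -s0 /sqn /= !sqrrN.
  - have -> : pdot (- nu0) t = - pdot nu0 t by rewrite /pdot /=; ring.
    by rewrite p0 oppr0.
  - by rewrite N sqrrN; split=> //; rewrite oppr_ge0 ltW.
set d := pdot x nu in d0 xd.
(* At this height the far side of the rectangle lies on a tangent of the circle. Since [k] is at
   most half the chord, the detour is at most twice as long as the chord. *)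
pose k := rho - d.
have hrho : h <= rho.
  by rewrite -(ler_pXn2r (n := 2)) ?nnegrE ?(ltW h0) ?(ltW rho0) // -subr_ge0 -xd sqr_ge0.
have k0 : 0 <= k by rewrite /k; nra.
have kh : k <= h by rewrite -(ler_pXn2r (n := 2)) ?nnegrE ?(ltW h0) // /k; nra.
have E1 (kap : R) : sqn (x + kap *: nu) = rho ^+ 2 + 2 * kap * d + kap ^+ 2.
  rewrite sqnD sqnZ sqnu xs mulr1 /d.
  have -> : pdot x (kap *: nu) = kap * pdot x nu; last by rewrite mulrA.
  by case: (x) => x1 x2; case: (nu) => t1 t2;
    change (x1 * (kap * t1) + x2 * (kap * t2) = kap * (x1 * t1 + x2 * t2)); ring.
have B1 (kap : R) : 0 <= kap <= k -> norm_du u (a + kap *: nu) <= L.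
  move=> /andP[q0 q1]; have e : a + kap *: nu - c = x + kap *: nu by rewrite /x addrAC.
  apply: H; rewrite e; last by rewrite E1; rewrite /k in q1 *; nra.
  by rewrite -(ler_pXn2r (n := 2)) ?nnegrE ?modulus_ge0 ?(ltW rho0) // sqr_modulus E1; nra.
have E2 (tau : R) : sqn (x + k *: nu + tau *: t) = rho ^+ 2 + (h - tau) ^+ 2.
  rewrite sqnD E1 sqnZ sqt mulr1.
  have -> : pdot (x + k *: nu) (tau *: t) = tau * (pdot x t + k * pdot nu t).
    by case: (x) => x1 x2; case: (t) => t1 t2; case: (nu) => n1 n2;
      change ((x1 + k * n1) * (tau * t1) + (x2 + k * n2) * (tau * t2) =
        tau * (x1 * t1 + x2 * t2 + k * (n1 * t1 + n2 * t2))); ring.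
  rewrite xt nut /k; nra.
have B2 (tau : R) : 0 <= tau <= modulus v -> norm_du u (a + k *: nu + tau *: t) <= L.
  move=> /andP[q0 q1]; have e : a + k *: nu + tau *: t - c = x + k *: nu + tau *: t.
    by rewrite addrAC [a + _ - c]addrAC.
  have q2 : tau <= 2 * h by rewrite /h; lra.
  apply: H; rewrite e; last by rewrite E2; nra.
  by rewrite -(ler_pXn2r (n := 2)) ?nnegrE ?modulus_ge0 ?(ltW rho0) // sqr_modulus E2 lerDl sqr_ge0.
pose a' := a + k *: nu; pose b' := b + k *: nu.
have mnu : modulus (k *: nu) = k by rewrite modulusZ /modulus sqnu sqrtr1 mulr1 ger0_norm.
have r1 : reach (u a) (u a') (L * k).
  have e : a' - a = k *: nu by rewrite /a' addrAC subrr add0r.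
  rewrite -[k in L * k]mnu -e; apply: reach_seg => // s /andP[s0 s1]; rewrite /seg e scalerA.
  by apply: B1; apply/andP; split; nra.
have bt : b = a + modulus v *: t by rewrite -tE /v addrC subrK.
have r2 : reach (u a') (u b') (L * modulus v).
  have e : b' - a' = v by rewrite /a' /b' opprD addrACA subrr addr0.
  rewrite -e; apply: reach_seg => // s /andP[s0 s1]; rewrite /seg e tE scalerA.
  by apply: B2; apply/andP; split; nra.
have r3 : reach (u b') (u b) (L * k).
  have e : b - b' = - (k *: nu) by rewrite /b' opprD addrA subrr add0r.
  rewrite -[k in L * k]mnu -modulusN -e; apply: reach_seg => // s /andP[s0 s1].
  have -> : seg b' b s = b + (k * (1 - s)) *: nu.
    by rewrite /seg e /b' scalerN scalerA -addrA -scalerBl; congr (_ + _ *: _); ring.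
  have e1 : b + (k * (1 - s)) *: nu - c = (b - c) + (k * (1 - s)) *: nu by rewrite addrAC.
  have bcs : sqn (b - c) = rho ^+ 2 by rewrite -sqr_modulus bc.
  have bd : pdot (b - c) nu = d.
    have -> : b - c = x + modulus v *: t by rewrite -tE /x /v [RHS]addrC subrKA.
    have -> : pdot (x + modulus v *: t) nu = pdot x nu + modulus v * pdot nu t.
      by case: (x) => x1 x2; case: (t) => t1 t2; case: (nu) => n1 n2;
      change ((x1 + modulus v * t1) * n1 + (x2 + modulus v * t2) * n2 =
        x1 * n1 + x2 * n2 + modulus v * (n1 * t1 + n2 * t2)); ring.
    by rewrite nut mulr0 addr0.
  have E3 (kap : R) : sqn (b - c + kap *: nu) = rho ^+ 2 + 2 * kap * d + kap ^+ 2.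
    rewrite sqnD sqnZ sqnu bcs mulr1 -bd.
    have -> : pdot (b - c) (kap *: nu) = kap * pdot (b - c) nu; last by rewrite mulrA.
    by case: (b - c) => x1 x2; case: (nu) => t1 t2;
      change (x1 * (kap * t1) + x2 * (kap * t2) = kap * (x1 * t1 + x2 * t2)); ring.
  have q0 : 0 <= k * (1 - s) by rewrite mulr_ge0 // subr_ge0.
  have q1 : k * (1 - s) <= rho - d by rewrite -/k ler_piMr // gerBl.
  move: (k * (1 - s)) q0 q1 e1 => kap q0 q1 e1.
  apply: H; rewrite e1; last by rewrite E3; nra.
  by rewrite -(ler_pXn2r (n := 2)) ?nnegrE ?modulus_ge0 ?(ltW rho0) // sqr_modulus E3; nra.
apply: reach_le (reach_trans r1 (reach_trans r2 r3)).
rewrite -/v; have : modulus v = 2 * h by rewrite /h; lra.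
move=> ->; nra.
Qed.

Lemma seg_sub z z' (s s' : R) : seg z z' s' - seg z z' s = (s' - s) *: (z' - z).
Proof. by rewrite /seg opprD addrACA subrr add0r -scalerBl. Qed.

Lemma seg_seg z z' (s s' r : R) : seg (seg z z' s) (seg z z' s') r = seg z z' (s + r * (s' - s)).
Proof. by rewrite {1}/seg seg_sub scalerA {1}/seg -addrA -scalerDl. Qed.

(** Along the segment, the squared distance to [c] minus [rho ^ 2] is a quadratic polynomial; being
    negative at [s0] but not at [s1], it has positive leading coefficient and two roots, between
    which the disc is crossed. *)
Lemma seg_exit z z' c (rho s1 s2 s0 : R) : 0 <= rho -> s1 <= s0 <= s2 ->
  rho <= modulus (seg z z' s1 - c) -> rho <= modulus (seg z z' s2 - c) ->
  modulus (seg z z' s0 - c) < rho ->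
  exists a b, [/\ s1 <= a, a <= b & b <= s2] /\
    [/\ modulus (seg z z' a - c) = rho, modulus (seg z z' b - c) = rho,
      forall s, s <= a -> rho <= modulus (seg z z' s - c)
      & forall s, b <= s -> rho <= modulus (seg z z' s - c)].
Proof.
move=> rho0 /andP[s10 s02] h1 h2 h0.
pose A := sqn (z' - z); pose B := pdot (z - c) (z' - z); pose D := sqn (z - c) - rho ^+ 2.
have phiE s : sqn (seg z z' s - c) - rho ^+ 2 = A * s ^+ 2 + 2 * B * s + D.
  have -> : seg z z' s - c = (z - c) + s *: (z' - z) by rewrite /seg addrAC.
  rewrite sqnD sqnZ /D /B /A.
  have -> : pdot (z - c) (s *: (z' - z)) = s * pdot (z - c) (z' - z).
    by case: (z - c) => x1 x2; case: (z' - z) => t1 t2;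
      change (x1 * (s * t1) + x2 * (s * t2) = s * (x1 * t1 + x2 * t2)); ring.
  ring.
have out s : (rho <= modulus (seg z z' s - c)) = (0 <= A * s ^+ 2 + 2 * B * s + D).
  by rewrite -phiE subr_ge0 -sqr_modulus ler_pXn2r ?nnegrE ?modulus_ge0.
have p0 : A * s0 ^+ 2 + 2 * B * s0 + D < 0 by rewrite ltNge -out -ltNge.
rewrite !out in h1 h2.
have A0 : 0 < A.
  rewrite lt0r sqn_ge0 andbT; apply/eqP => A0.
  have e : z' - z = 0 by apply/eqP; rewrite -[0]/((0, 0) : plane) -sqn_eq0 -/A A0.
  move: p0 h1; rewrite /B A0 e.
  have -> : pdot (z - c) 0 = 0 by rewrite /pdot /= !mulr0 addr0.
  by rewrite !mul0r mulr0 !mul0r !add0r ltNge => /negP.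
have De : 0 < B ^+ 2 - A * D.
  have h := sqr_ge0 (A * s0 + B); nra.
pose q := Num.sqrt (B ^+ 2 - A * D).
have q0 : 0 < q by rewrite sqrtr_gt0.
have qq : q ^+ 2 = B ^+ 2 - A * D by rewrite sqr_sqrtr // ltW.
pose a := (- B - q) / A; pose b := (- B + q) / A.
have aA : A * a = - B - q by rewrite /a mulrC divfK // gt_eqF.
have bA : A * b = - B + q by rewrite /b mulrC divfK // gt_eqF.
have fact s : A * (A * s ^+ 2 + 2 * B * s + D) = (A * s - A * a) * (A * s - A * b).
  rewrite aA bA; have -> : (A * s - (- B - q)) * (A * s - (- B + q)) = (A * s + B) ^+ 2 - q ^+ 2 by ring.
  by rewrite qq; ring.
have pos s : (0 <= A * s ^+ 2 + 2 * B * s + D) = (0 <= (s - a) * (s - b)).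
  by rewrite -(pmulr_rge0 _ A0) fact -!mulrBr mulrACA pmulr_rge0 ?mulr_gt0.
have ab : a <= b by rewrite -(ler_pM2l A0) aA bA; lra.
have {}p0 : (s0 - a) * (s0 - b) < 0 by rewrite ltNge -pos -ltNge.
rewrite !pos in h1 h2.
have a0 : a < s0 by rewrite ltNge; apply/negP => h; nra.
have b0 : s0 < b by rewrite ltNge; apply/negP => h; nra.
exists a, b; split.
  split=> //; first by rewrite leNgt; apply/negP => h; nra.
  by rewrite leNgt; apply/negP => h; nra.
have eqr s : (s - a) * (s - b) = 0 -> modulus (seg z z' s - c) = rho.
  move=> h; apply/eqP; rewrite -(@eqrXn2 _ 2) ?modulus_ge0 // sqr_modulus -subr_eq0 phiE.
  by rewrite -(mulrI_eq0 _ (lregP (lt0r_neq0 A0))) fact -!mulrBr mulrACA h mulr0.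
split.
- by apply: eqr; rewrite subrr mul0r.
- by apply: eqr; rewrite subrr mulr0.
- by move=> s sa; rewrite out pos; nra.
- by move=> s sb; rewrite out pos; nra.
Qed.

(* Discs given as centre-radius pairs; the path follows the segment and makes
   a detour around each disc that it meets. *)
Lemma reach_avoiding u (D : seq (plane * R)) (z z' : plane) (L : R) :
  smooth_map setT u -> 0 <= L ->
  (forall d, d \in D -> 0 < d.2) ->
  (forall d d' w, d \in D -> d' \in D -> d != d' -> modulus (w - d.1) = d.2 ->
     d'.2 <= modulus (w - d'.1)) ->
  (forall d w, d \in D -> d.2 <= modulus (w - d.1) -> sqn (w - d.1) <= 2 * d.2 ^+ 2 ->
     norm_du u w <= L) ->
  (forall s, 0 <= s <= 1 -> (forall d, d \in D -> d.2 <= modulus (seg z z' s - d.1)) ->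
     norm_du u (seg z z' s) <= L) ->
  (forall d, d \in D -> d.2 <= modulus (z - d.1) /\ d.2 <= modulus (z' - d.1)) ->
  reach (u z) (u z') (2 * L * modulus (z' - z)).
Proof.
move=> su L0 D0 disj near_ far ends.
pose out s := forall d, d \in D -> d.2 <= modulus (seg z z' s - d.1).
(* Induction on the list of discs that may still be met, for all subsegments with both ends outside
   every disc. The bound is additive in the parameter, so a segment crossing a disc can be cut at
   entry and exit. *)
suff P (D' : seq (plane * R)) : {subset D' <= D} -> forall s1 s2, 0 <= s1 -> s1 <= s2 -> s2 <= 1 -> out s1 -> out s2 ->
    (forall d s, d \in D -> d \notin D' -> s1 <= s <= s2 -> d.2 <= modulus (seg z z' s - d.1)) ->
    reach (u (seg z z' s1)) (u (seg z z' s2)) (2 * L * (modulus (z' - z) * (s2 - s1))).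
  have := P D (fun _ => id) 0 1 (lexx _) ler01 (lexx _).
  have -> : seg z z' 0 = z by rewrite /seg scale0r addr0.
  have -> : seg z z' 1 = z' by rewrite /seg scale1r addrC subrK.
  rewrite subr0 mulr1; apply.
  - by move=> d dD; rewrite /seg scale0r addr0; have [] := ends d dD.
  - by move=> d dD; rewrite /seg scale1r [z + _]addrC subrK; have [] := ends d dD.
  - by move=> d s ->.
elim: D' => [|d D' IH] DD s1 s2 s10 s12 s21 o1 o2 av.
  have E : modulus (seg z z' s2 - seg z z' s1) = modulus (z' - z) * (s2 - s1).
    by rewrite seg_sub modulusZ mulrC ger0_norm // subr_ge0.
  rewrite -E; apply: (@reach_le _ _ _ _ _ (L * modulus (seg z z' s2 - seg z z' s1))).
    by rewrite ler_wpM2r ?modulus_ge0 // ler_peMl // ler1n.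
  apply: reach_seg => // s /andP[s0 s1']; rewrite seg_seg.
  have i1 : s1 <= s1 + s * (s2 - s1) by rewrite lerDl mulr_ge0 // subr_ge0.
  have i2 : s1 + s * (s2 - s1) <= s2 by rewrite -lerBrDl ler_piMl // subr_ge0.
  apply: far; first by rewrite (le_trans s10 i1) (le_trans i2 s21).
  by move=> d dD; apply: av => //; rewrite i1 i2.
have dD : d \in D by apply: DD; rewrite mem_head.
have DD' : {subset D' <= D} by move=> e eD; apply: DD; rewrite in_cons eD orbT.
have [[s0 s0i h0]|h] := pselect (exists2 s0, s1 <= s0 <= s2 & modulus (seg z z' s0 - d.1) < d.2); last first.
  apply: IH => // e s eD eD' si; have [->|ed] := eqVneq e d; last first.
    by apply: av => //; rewrite in_cons negb_or ed.
  by rewrite leNgt; apply/negP => hs; apply: h; exists s.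
have [a [b [[s1a ab bs2] [ma mb outa outb]]]] :=
  seg_exit (ltW (D0 _ dD)) s0i (o1 _ dD) (o2 _ dD) h0.
have oa : out a.
  by move=> e eD; have [->|ed] := eqVneq e d; [rewrite ma|apply: disj ma; rewrite // eq_sym].
have ob : out b.
  by move=> e eD; have [->|ed] := eqVneq e d; [rewrite mb|apply: disj mb; rewrite // eq_sym].
have r1 : reach (u (seg z z' s1)) (u (seg z z' a)) (2 * L * (modulus (z' - z) * (a - s1))).
  apply: IH => //; first by rewrite (le_trans (le_trans ab bs2)).
  move=> e s eD eD' /andP[si1 si2]; have [->|ed] := eqVneq e d; first exact: outa.
  apply: av => //; first by rewrite in_cons negb_or ed.
  by rewrite si1 (le_trans si2) // (le_trans ab).
have r3 : reach (u (seg z z' b)) (u (seg z z' s2)) (2 * L * (modulus (z' - z) * (s2 - b))).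
  apply: IH => //; first by rewrite (le_trans s10) // (le_trans s1a).
  move=> e s eD eD' /andP[si1 si2]; have [->|ed] := eqVneq e d; first exact: outb.
  apply: av => //; first by rewrite in_cons negb_or ed.
  by rewrite si2 andbT (le_trans _ si1) // (le_trans s1a).
have r2 : reach (u (seg z z' a)) (u (seg z z' b)) (2 * L * (modulus (z' - z) * (b - a))).
  have -> : modulus (z' - z) * (b - a) = modulus (seg z z' b - seg z z' a).
    by rewrite seg_sub modulusZ mulrC ger0_norm // subr_ge0.
  apply: (@reach_chord u _ _ d.1 d.2) => //; first exact: D0.
  by move=> w; exact: near_.
apply: reach_le (reach_trans r1 (reach_trans r2 r3)).
rewrite le_eqVlt; apply/orP; left; apply/eqP; ring.
Qed.

End PlaneReach.

(** * The round distance compared with affine coordinates *)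

Section SphereDistance.
Context {R : realType}.
Notation plane := (R * R)%type.
Implicit Types (z w : R[i]) (p : P1 R).

Lemma absC_modulus z : absC z = modulus (plane_of z).
Proof. by case: z. Qed.

Lemma absC_ge0 z : 0 <= absC z.
Proof. by rewrite absC_modulus modulus_ge0. Qed.

Lemma plane_ofB z w : plane_of (z - w) = plane_of z - plane_of w.
Proof. by case: z; case: w. Qed.

Lemma plane_ofD z w : plane_of (z + w) = plane_of z + plane_of w.
Proof. by case: z; case: w. Qed.

Lemma plane_ofM z w : plane_of (z * w) = cmul (plane_of z) (plane_of w).
Proof. by case: z => a b; case: w => c d; rewrite /cmul /plane_of /= [b * c + _]addrC. Qed.

Lemma plane_ofV z : plane_of z^-1 = cinv (plane_of z).
Proof. by case: z. Qed.

Lemma plane_of_eq0 z : (plane_of z == (0, 0)) = (z == 0).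
Proof. by case: z => a b; rewrite /plane_of /= xpair_eqE eq_complex. Qed.

Lemma absC_eq0 z : (absC z == 0) = (z == 0).
Proof. by rewrite absC_modulus modulus_eq0 plane_of_eq0. Qed.

Lemma absC_gt0 z : (0 < absC z) = (z != 0).
Proof. by rewrite lt0r absC_eq0 absC_ge0 andbT. Qed.

Lemma absC0 : absC (0 : R[i]) = 0.
Proof. by apply/eqP; rewrite absC_eq0. Qed.

Lemma absCM z w : absC (z * w) = absC z * absC w.
Proof. by rewrite !absC_modulus plane_ofM /modulus sqnM sqrtrM ?sqn_ge0. Qed.

Lemma absC1 : absC (1 : R[i]) = 1.
Proof. by rewrite absC_modulus /modulus /sqn /= expr1n expr0n addr0 sqrtr1. Qed.

Lemma absCV z : absC z^-1 = (absC z)^-1.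
Proof.
have [->|z0] := eqVneq z 0; first by rewrite invr0 absC0 invr0.
apply: (mulfI (_ : absC z != 0)); first by rewrite absC_eq0.
by rewrite -absCM !divff ?absC1 // absC_eq0.
Qed.

Lemma absCN z : absC (- z) = absC z.
Proof. by rewrite -mulN1r absCM -(@mul1r R[i] (-1)) absCM absC1 absC_modulus /modulus /sqn /= sqrrN expr1n oppr0 expr0n addr0 sqrtr1 !mul1r. Qed.

Lemma absCD z w : absC (z + w) <= absC z + absC w.
Proof. by rewrite !absC_modulus plane_ofD modulusD. Qed.

Lemma absCB z w : absC (z - w) = absC (w - z).
Proof. by rewrite -absCN opprB. Qed.

Lemma absC_tri z w v : absC (z - w) <= absC (z - v) + absC (v - w).
Proof. by rewrite -[z - w](subrKA v) absCD. Qed.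

Notation cR := (real_complex R).

Lemma absC_cR (x : R) : absC (cR x) = `|x|.
Proof. by rewrite absC_modulus /modulus /sqn /= expr0n addr0 sqrtr_sqr. Qed.

Lemma sqr_absC z : absC z ^+ 2 = complex.Re z ^+ 2 + complex.Im z ^+ 2.
Proof. by rewrite absC_modulus sqr_modulus. Qed.

Lemma sin_le (x : R) : 0 <= x -> sin x <= x.
Proof.
move=> x0; have [c _ E] := @MVT_segment R sin cos 0 x x0
  (fun t _ => is_derive_sin t) (continuous_subspaceT (@continuous_sin R)).
move: E; rewrite sin0 !subr0 => ->.
by rewrite ler_piMl // cos_le1.
Qed.

Lemma P1_norm_gt0 p : 0 < P1_norm p.
Proof.
rewrite sqrtr_gt0; case: p => [z|] /=; rewrite absC1 expr1n.
  by rewrite ltr_wpDl ?sqr_ge0.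
by rewrite absC0 expr0n addr0.
Qed.

(** An arc is at least the sine of its angle: with [H] the hermitian product and [D] the
    determinant, the identity [N ^ 2 = H ^ 2 + D ^ 2] makes [D / N] the sine of [acos (H / N)]. *)
Lemma P1_dist_ge p p' :
  2 * absC (hx p * hy p' - hy p * hx p') / (P1_norm p * P1_norm p') <= P1_dist p p'.
Proof.
have N0 := P1_norm_gt0 p; have N0' := P1_norm_gt0 p'.
rewrite /P1_dist -mulrA ler_pM2l //.
pose H := absC (hx p * (hx p')^*%C + hy p * (hy p')^*%C).
pose D := absC (hx p * hy p' - hy p * hx p'); pose N := P1_norm p * P1_norm p'.
rewrite -/H -/D -/N.
have NP : 0 < N by rewrite mulr_gt0.
have E : N ^+ 2 = H ^+ 2 + D ^+ 2.
  rewrite /N exprMn !sqr_sqrtr ?addr_ge0 ?sqr_ge0 // /H /D !sqr_absC.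
  move: (hx p) (hy p) (hx p') (hy p') => [a b] [c d] [a' b'] [c' d'] /=; ring.
have H0 : 0 <= H := absC_ge0 _; have D0 : 0 <= D := absC_ge0 _.
have HN : H / N <= 1.
  by rewrite ler_pdivrMr // mul1r -(ler_pXn2r (n := 2)) ?nnegrE ?(ltW NP) // E lerDl sqr_ge0.
have h1 : -1 <= H / N <= 1.
  by rewrite HN andbT; apply: (@le_trans _ _ 0); rewrite ?lerN10 // divr_ge0 // ltW.
have <- : sin (acos (H / N)) = D / N.
  rewrite sin_acos // -[RHS]ger0_norm; last by rewrite divr_ge0 // ltW.
  rewrite -sqrtr_sqr; congr Num.sqrt.
  have N2 : N ^+ 2 != 0 by rewrite expf_neq0 // gt_eqF.
  by rewrite !expr_div_n -[1](divff N2) -mulrBl E addrAC subrr add0r.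
by apply: sin_le; exact: acos_ge0.
Qed.

Lemma P1_dist_ge0 p p' : 0 <= P1_dist p p'.
Proof.
apply: le_trans (P1_dist_ge p p'); by rewrite divr_ge0 ?mulr_ge0 ?absC_ge0 // ltW // P1_norm_gt0.
Qed.

Lemma P1_norm_unit z : absC z <= 1 -> P1_norm (Some z) ^+ 2 <= 2.
Proof.
move=> z1; rewrite sqr_sqrtr ?addr_ge0 ?sqr_ge0 //= absC1 expr1n.
have := absC_ge0 z; nra.
Qed.

(** Both norms are at most [sqrt 2] on the unit disc, which cancels the factor [2] in
    [P1_dist_ge]. *)
Lemma P1_dist_unit_disc z w : absC z <= 1 -> absC w <= 1 ->
  absC (z - w) <= P1_dist (Some z) (Some w).
Proof.
move=> z1 w1; apply: le_trans (P1_dist_ge _ _); rewrite /= mulr1 mul1r.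
have N0 := P1_norm_gt0 (Some z); have N0' := P1_norm_gt0 (Some w).
have := P1_norm_unit z1; have := P1_norm_unit w1; have := absC_ge0 (z - w).
move: (P1_norm _) (P1_norm _) N0 N0' => N N' N0 N0' d0 h h'.
rewrite ler_pdivlMr ?mulr_gt0 // mulrC ler_wpM2r //.
have := sqr_ge0 (N - N'); nra.
Qed.

Lemma P1_swap_Some z : z != 0 -> P1_swap (Some z) = Some z^-1.
Proof. by move=> z0; rewrite /P1_swap /P1_of /= (negbTE z0) div1r. Qed.

Lemma P1_swap0 : P1_swap (Some (0 : R[i])) = None.
Proof. by rewrite /P1_swap /P1_of /= eqxx. Qed.

Lemma P1_swap_None : P1_swap (None : P1 R) = Some 0.
Proof. by rewrite -P1_swap0 P1_swapK. Qed.

Lemma P1_dist_swap_disc z w : absC z <= 1 -> absC w <= 1 ->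
  absC (z - w) <= P1_dist (P1_swap (Some z)) (P1_swap (Some w)).
Proof.
move=> z1 w1; apply: le_trans (P1_dist_ge _ _).
(* The swapped point has homogeneous coordinates [(c, c u)] with norm at most [sqrt 2 |c|], so the
   factors [|c|] cancel in the quotient. *)
have key (u : R[i]) : absC u <= 1 -> exists c : R[i],
    [/\ c != 0, hx (P1_swap (Some u)) = c, hy (P1_swap (Some u)) = c * u
      & P1_norm (P1_swap (Some u)) ^+ 2 <= 2 * absC c ^+ 2].
  move=> u1; have [->|u0] := eqVneq u 0.
    exists 1; rewrite P1_swap0 /= mulr0 oner_neq0 absC1; split => //.
    by rewrite /P1_norm sqr_sqrtr ?addr_ge0 ?sqr_ge0 //= absC1 absC0 expr0n /= expr1n; lra.
  exists u^-1; rewrite P1_swap_Some //= mulVf // invr_eq0; split => //.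
  rewrite sqr_sqrtr ?addr_ge0 ?sqr_ge0 //= absC1 absCV.
  have : 1 <= (absC u)^-1 by rewrite invf_ge1 // absC_gt0.
  by move: (absC u)^-1 => k k1; rewrite expr1n; nra.
have [c [c0 -> -> Nc]] := key _ z1; have [d [d0 -> -> Nd]] := key _ w1.
have -> : c * (d * w) - c * z * d = c * d * (w - z) by ring.
rewrite !absCM absCB.
have N0 := P1_norm_gt0 (P1_swap (Some z)); have N0' := P1_norm_gt0 (P1_swap (Some w)).
move: (P1_norm _) (P1_norm _) N0 N0' Nc Nd => N N' N0 N0' h h'.
rewrite ler_pdivlMr ?mulr_gt0 // mulrC mulrA ler_wpM2r ?absC_ge0 //.
move: (absC c) (absC d) (absC_gt0 c) (absC_gt0 d) h h'; rewrite c0 d0 => a b a0 b0 h h'.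
have : (N' * N) ^+ 2 <= (2 * (a * b)) ^+ 2.
  have -> : (2 * (a * b)) ^+ 2 = (2 * a ^+ 2) * (2 * b ^+ 2) by ring.
  by rewrite exprMn ler_pM ?sqr_ge0.
by rewrite ler_pXn2r // nnegrE ltW // !mulr_gt0.
Qed.

End SphereDistance.

Section ReachSym.
Context {R : realType} {n : nat} (X : geometry R n).

Lemma reach_sym (x y : X) L : reach x y L -> reach y x L.
Proof.
move=> [c [G [g [sc [c0 c1] [G0 G1] [dG cg] sg]]]].
have aE (t : R) : -1 * t + 1 = 1 - t by ring.
exists (fun t => c (-1 * t + 1)), (fun t => L - G (-1 * t + 1)), (fun t => g (-1 * t + 1)); split.
- exact: smooth_map_affine.
- by split=> t ht; [apply: c1|apply: c0]; rewrite aE; lra.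
- by split=> t ht; [rewrite G1|rewrite G0]; rewrite ?aE; lra.
- split=> [t|t].
    have da : is_derive t (1 : R) (fun t : R => -1 * t + 1) (-1).
      have -> : (fun t : R => -1 * t + 1) = (-1 : R) \*: (@idfun R) + cst (1 : R) by [].
      apply: (is_derive_eq (is_deriveD (is_deriveZ (-1 : R) (is_derive_id t (1 : R))) (is_derive_cst (1 : R) t (1 : R)))).
      by rewrite addr0; exact: mulr1.
    have dc := @is_derive1_comp R G (fun t : R => -1 * t + 1) t _ _ (dG (-1 * t + 1)) da.
    apply: (is_derive_eq (is_deriveB (is_derive_cst L t (1 : R)) dc)).
    by rewrite mulrN1 opprK; exact: add0r.
  apply: (@continuous_comp _ _ _ (fun t : R => -1 * t + 1) g); last exact: cg.
  by apply: cvgD; [apply: cvgMl_tmp; exact: cvg_id|exact: cvg_cst].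
- by move=> t; rewrite speed_affine // normrN1 mul1r.
Qed.

End ReachSym.

(** * Distance bounds on discs, exteriors and necks *)

Section SphereReach.
Context {R : realType} {n : nat} (X : geometry R n).
Notation cR := (real_complex R).
Notation plane := (R * R)%type.
Implicit Types (u : P1 R -> X) (z w c : R[i]).

Definition dens u z : R := norm_du (chart0 u) (plane_of z).

Lemma chart0_plane_of u z : chart0 u (plane_of z) = u (Some z).
Proof. by rewrite /chart0 /= affine_plane_of. Qed.

Lemma Jhol_P1_chart0 u : Jhol_P1 u -> Jhol setT (chart0 u).
Proof. by case. Qed.

Lemma dens_ge0 u z : 0 <= dens u z.
Proof. exact: norm_du_ge0. Qed.

(** The coordinate change [z |-> 1 / z + c], which sends infinity to [c] and [0] to infinity: a disc
    about [0] parametrizes the exterior of a disc about [c]. *)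
Definition P1_inv (c : R[i]) (p : P1 R) : P1 R := P1_shift c (P1_swap p).

Lemma P1_invE c z : z != 0 -> P1_inv c (Some z) = Some (z^-1 + c).
Proof. by move=> z0; rewrite /P1_inv P1_swap_Some. Qed.

Lemma P1_inv_ne c z : z != c -> P1_inv c (Some (z - c)^-1) = Some z.
Proof. by move=> zc; rewrite P1_invE ?invr_eq0 ?subr_eq0 // invrK subrK. Qed.

Lemma Jhol_P1_inv u c : Jhol_P1 u -> Jhol_P1 (u \o P1_inv c).
Proof. by move=> Ju; exact: Jhol_P1_swap (Jhol_P1_shift c Ju). Qed.

Lemma dens_shift u c z : Jhol_P1 u -> dens (u \o P1_shift c) z = dens u (z + c).
Proof.
move=> Ju; rewrite /dens chart0_shift norm_du_shift ?plane_ofD //.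
by have [] := JholT (Jhol_P1_chart0 Ju).
Qed.

Lemma dens_inv u c z : Jhol_P1 u -> z != 0 ->
  dens (u \o P1_inv c) z = (absC z ^+ 2)^-1 * dens u (z^-1 + c).
Proof.
move=> Ju z0; rewrite -dens_shift //; set v := u \o P1_shift c.
have [sv _] := JholT (Jhol_P1_chart0 (Jhol_P1_shift c Ju)).
have z0' : plane_of z != (0, 0) by rewrite plane_of_eq0.
rewrite /dens plane_ofV absC_modulus sqr_modulus -norm_du_cinv //.
apply: norm_du_near; near=> y; rewrite /chart0 /= /P1_inv P1_swap_affine //.
by near: y; apply: open_nbhs_nbhs; split => //; exact: open_nonzero_plane.
Unshelve. all: by end_near. Qed.

Lemma disc_reachC l Kc u c r z z' : decay X l Kc -> 0 <= Kc -> Jhol_P1 u -> 0 < r ->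
  (forall z, absC (z - c) <= 3 * r -> absC (z - c) * dens u z <= l) ->
  absC (z - c) <= r -> absC (z' - c) <= r ->
  reach (u (Some z)) (u (Some z')) (Kc * (absC (z' - z) / r)).
Proof.
move=> dec Kc0 Ju r0 ul zr zr'.
have Jc := Jhol_P1_chart0 (Jhol_P1_shift c Ju).
have := disc_reach dec Kc0 Jc r0 _ _ _ => /(_ (plane_of (z - c)) (plane_of (z' - c))).
rewrite !chart0_plane_of /= !subrK -plane_ofB -!absC_modulus opprB addrA subrK; apply => //.
move=> y yr; have := ul (Complex y.1 y.2 + c); rewrite addrK !absC_modulus -dens_shift // /dens.
have -> : plane_of (Complex y.1 y.2) = y by case: (y).
by apply.
Qed.

(** The product of the density with the distance to the centre is invariant under inversion, so this
    is [disc_reachC] for [u \o P1_inv c] on the disc of radius [s^-1]. *)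
Lemma exterior_reach l Kc u c s w w' : decay X l Kc -> 0 <= Kc -> 0 <= l -> Jhol_P1 u -> 0 < s ->
  (forall z, s / 3 <= absC (z - c) -> absC (z - c) * dens u z <= l) ->
  absC w * s <= 1 -> absC w' * s <= 1 ->
  reach (u (P1_inv c (Some w))) (u (P1_inv c (Some w'))) (Kc * (absC (w' - w) * s)).
Proof.
move=> dec Kc0 l0 Ju s0 ul ws ws'.
have := @disc_reachC l Kc _ 0 s^-1 w w' dec Kc0 (Jhol_P1_inv c Ju).
rewrite invrK; apply; rewrite ?invr_gt0 // ?subr0 //; try by rewrite -[s^-1]mul1r ler_pdivlMr.
move=> z; rewrite subr0 => zs.
have [->|z0] := eqVneq z 0; first by rewrite absC0 mul0r.
have a0 : 0 < absC z by rewrite absC_gt0.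
rewrite dens_inv //; have := ul (z^-1 + c); rewrite addrK absCV => h.
apply: le_trans (h _); last first.
  move: zs; rewrite ler_pdivlMr // => zs; rewrite -[(absC z)^-1]mul1r ler_pdivlMr // mulrAC ler_pdivrMr //; lra.
by rewrite mulrA; apply: ler_wpM2r; rewrite ?dens_ge0 // expr2 invfM mulrA divff ?mul1r // gt_eqF.
Qed.

(** In the outer half [r1 / |z|] is at most [|z| / r2], so decay gives the constant density bound
    [Kc / r2]. A segment may enter the inner half; then it is led around the middle circle, at the
    price of a factor [2]. The margins [r1 / 3] and [3 * r2] absorb [expR 1]. *)
Lemma half_neck_reach l Kc u c (r1 r2 : R) z z' : decay X l Kc -> 0 <= Kc -> Jhol_P1 u ->
  0 < r1 -> 2 * r1 <= r2 ->
  (forall z, r1 <= 3 * absC (z - c) -> absC (z - c) <= 3 * r2 -> absC (z - c) * dens u z <= l) ->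
  r1 * r2 <= absC (z - c) ^+ 2 -> r1 * r2 <= absC (z' - c) ^+ 2 ->
  absC (z - c) <= r2 -> absC (z' - c) <= r2 ->
  reach (u (Some z)) (u (Some z')) (2 * Kc * (absC (z' - z) / r2)).
Proof.
move=> dec Kc0 Ju r10 r12 ul zm zm' zr zr'.
have r20 : 0 < r2 by lra.
have Ju' := Jhol_P1_shift c Ju; have Jc := Jhol_P1_chart0 Ju'; have [sc _] := JholT Jc.
set v := chart0 _ in Jc sc.
have dv y : norm_du v y = dens u (Complex y.1 y.2 + c).
  by rewrite -dens_shift // /dens; case: (y).
pose rho := Num.sqrt (r1 * r2).
have rho0 : 0 < rho by rewrite sqrtr_gt0 mulr_gt0.
have rhoE : rho ^+ 2 = r1 * r2 by rewrite sqr_sqrtr // mulr_ge0 ?ltW.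
have mC (y : plane) : modulus y = absC (Complex y.1 y.2) by rewrite absC_modulus; case: (y).
have e3 := @expR1_lt3 R; have e0 := expR_gt0 (1 : R).
have B y : rho <= modulus y -> modulus y <= r2 -> norm_du v y <= Kc / r2.
  move=> y1 y2; have m0 : 0 < modulus y by apply: lt_le_trans y1.
  have rr : r1 <= rho by rewrite -(ler_pXn2r (n := 2)) ?nnegrE ?(ltW r10) ?(ltW rho0) // rhoE expr2 ler_pM2l //; lra.
  have Dy := dec v (r1 / 3) (3 * r2) y Jc.
  have h1 : 0 < r1 / 3 by rewrite divr_gt0.
  have h2 : forall z0 : plane, r1 / 3 <= modulus z0 <= 3 * r2 -> modulus z0 * norm_du v z0 <= l.
    move=> t /andP[t1 t2]; have := ul (Complex t.1 t.2 + c); rewrite addrK -mC -dv; apply => //.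
    by rewrite mulrC -ler_pdivrMr.
  have h3 : expR 1 * (r1 / 3) <= modulus y.
    apply: le_trans (le_trans rr y1); nra.
  have h4 : expR 1 * modulus y <= 3 * r2 by nra.
  have h := Dy h1 h2 h3 h4; rewrite -(ler_pM2l m0); apply: le_trans h _.
  rewrite [leRHS]mulrCA; apply: ler_wpM2l => //.
  have -> : modulus y / (3 * r2) = 3^-1 * (modulus y / r2).
    by rewrite invfM mulrCA.
  have k : r1 / 3 / modulus y <= 3^-1 * (modulus y / r2).
    rewrite ler_pdivrMr // [r1 / 3]mulrC -!mulrA ler_wpM2l ?invr_ge0 //.
    rewrite mulrCA -expr2 mulrC ler_pdivlMr //.
    by rewrite -rhoE lerXn2r // nnegrE ?(ltW rho0) ?modulus_ge0.
  have k2 : 0 <= modulus y / r2 by rewrite divr_ge0 ?modulus_ge0 // ltW.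
  by apply: le_trans (lerD (lexx _) k) _; lra.
have sub0 (y : plane) : y - 0 = y by rewrite subr0.
have rm w : r1 * r2 <= absC w ^+ 2 -> rho <= modulus (plane_of w).
  by move=> h; rewrite -absC_modulus -(ler_pXn2r (n := 2)) ?nnegrE ?absC_ge0 ?(ltW rho0) // rhoE.
have := @reach_avoiding _ _ X v [:: ((0, 0), rho)] (plane_of (z - c)) (plane_of (z' - c)) (Kc / r2) sc.
have vE t : v (plane_of t) = u (Some (t + c)) by rewrite /v chart0_plane_of.
rewrite !vE !subrK -plane_ofB -!absC_modulus opprB addrA subrK => H.
apply: reach_le (H _ _ _ _ _ _) => {H}.
- by rewrite -mulrA (mulrC (absC _)) !mulrA.
- by rewrite divr_ge0 // ltW.
- by move=> d; rewrite inE => /eqP ->.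
- by move=> d d' w; rewrite !inE => /eqP -> /eqP ->; rewrite eqxx.
- move=> d w; rewrite inE => /eqP -> /=; rewrite -[(0, 0)]/(0 : plane) sub0 => w1 w2; apply: B => //.
  rewrite -(ler_pXn2r (n := 2)) ?nnegrE ?modulus_ge0 ?(ltW r20) // sqr_modulus.
  by apply: le_trans w2 _; rewrite rhoE; nra.
- move=> s hs /(_ ((0, 0), rho)); rewrite inE eqxx => /(_ isT) /=; rewrite -[(0, 0)]/(0 : plane) sub0 => h.
  apply: B => //; apply: le_trans (modulus_seg _ _ hs) _.
  by rewrite ge_max -!absC_modulus zr.
- move=> d; rewrite inE => /eqP -> /=; rewrite -[(0, 0)]/(0 : plane) !sub0.
  by split; exact: rm.
Qed.

(* Inner half: invert; a point of the inner half and one of the outer half are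
   joined through the radial projection [y] of the former to the middle circle. *)
Lemma neck_reach l Kc u c (r1 r2 : R) z z' : decay X l Kc -> 0 <= Kc -> Jhol_P1 u ->
  0 < r1 -> 2 * r1 <= r2 ->
  (forall z, r1 <= 3 * absC (z - c) -> absC (z - c) <= 3 * r2 -> absC (z - c) * dens u z <= l) ->
  r1 <= absC (z - c) <= r2 -> r1 <= absC (z' - c) <= r2 ->
  reach (u (Some z)) (u (Some z')) (6 * Kc *
    Num.max (absC (z' - z) / r2) (r1 * absC ((z' - c)^-1 - (z - c)^-1))).
Proof.
move=> dec Kc0 Ju r10 r12 ul zr zr'.
have r20 : 0 < r2 by lra.
have ri1 : 0 < r1^-1 by rewrite invr_gt0.
have ri2 : 0 < r2^-1 by rewrite invr_gt0.
have rr : 2 * r2^-1 <= r1^-1.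
  by rewrite ler_pdivrMr // mulrC ler_pdivlMr.
have neq t : r1 <= absC (t - c) -> t != c.
  by move=> h; rewrite -subr_eq0 -absC_gt0 (lt_le_trans r10).
have outer t t' : r1 * r2 <= absC (t - c) ^+ 2 -> r1 * r2 <= absC (t' - c) ^+ 2 ->
    absC (t - c) <= r2 -> absC (t' - c) <= r2 ->
    reach (u (Some t)) (u (Some t')) (2 * Kc * (absC (t' - t) / r2)).
  exact: half_neck_reach dec Kc0 Ju r10 r12 ul.
have inner t t' : absC (t - c) ^+ 2 <= r1 * r2 -> absC (t' - c) ^+ 2 <= r1 * r2 ->
    r1 <= absC (t - c) -> r1 <= absC (t' - c) ->
    reach (u (Some t)) (u (Some t')) (2 * Kc * (r1 * absC ((t' - c)^-1 - (t - c)^-1))).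
  move=> m m' i i'.
  have Ji := Jhol_P1_inv c Ju.
  have a0 := lt_le_trans r10 i; have a0' := lt_le_trans r10 i'.
  have := @half_neck_reach l Kc _ 0 r2^-1 r1^-1 (t - c)^-1 (t' - c)^-1 dec Kc0 Ji ri2 rr.
  rewrite /= !P1_inv_ne ?neq // !subr0 invrK !absCV mulrC => H.
  rewrite mulrA mulrAC -mulrA; apply: reach_le (H _ _ _ _ _); first by rewrite lexx.
  - move=> w; rewrite subr0 => w1 w2.
    have w0 : 0 < absC w by move: ri2; nra.
    have wn : w != 0 by rewrite -absC_gt0.
    rewrite dens_inv //; have := ul (w^-1 + c); rewrite addrK absCV => h.
    have E : absC w * (absC w ^- 2 * dens u (w^-1 + c)) = (absC w)^-1 * dens u (w^-1 + c).
      by rewrite mulrA expr2 invfM mulrA divff ?mul1r // gt_eqF.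
    rewrite E; apply: h.
      by rewrite ler_pdivlMr // -ler_pdivlMl // mulrC.
    by move: w1; rewrite -[r2^-1]mul1r ler_pdivrMr // -[(absC w)^-1]mul1r ler_pdivrMr //; lra.
  - by rewrite exprVn -invfM lef_pV2 ?posrE ?mulr_gt0 ?exprn_gt0 // 1?mulrC.
  - by rewrite exprVn -invfM lef_pV2 ?posrE ?mulr_gt0 ?exprn_gt0 // 1?mulrC.
  - by rewrite lef_pV2 ?posrE.
  - by rewrite lef_pV2 ?posrE.
move: zr zr' => /andP[z1 z2] /andP[z1' z2'].
set Mx := Num.max _ _.
have M1 : absC (z' - z) / r2 <= Mx by rewrite le_max lexx.
have M2 : r1 * absC ((z' - c)^-1 - (z - c)^-1) <= Mx by rewrite le_max lexx orbT.
have M0 : 0 <= Mx by apply: le_trans M1; rewrite divr_ge0 ?absC_ge0 // ltW.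
have mixed t t' : r1 <= absC (t - c) -> absC (t - c) ^+ 2 <= r1 * r2 ->
    r1 * r2 <= absC (t' - c) ^+ 2 -> absC (t' - c) <= r2 ->
    absC (t' - t) / r2 <= Mx -> r1 * absC ((t' - c)^-1 - (t - c)^-1) <= Mx ->
    reach (u (Some t)) (u (Some t')) (6 * Kc * Mx).
  move=> t1 tm tm' t2' m1 m2.
  pose rho := Num.sqrt (r1 * r2); have rho0 : 0 < rho by rewrite sqrtr_gt0 mulr_gt0.
  have rhoE : rho ^+ 2 = r1 * r2 by rewrite sqr_sqrtr // mulr_ge0 ?ltW.
  pose a := absC (t - c); have a0 : 0 < a by apply: lt_le_trans t1.
  have ar : a <= rho by rewrite -(ler_pXn2r (n := 2)) ?nnegrE ?(ltW a0) ?(ltW rho0) // rhoE.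
  pose b := absC (t' - c).
  have rb : rho <= b by rewrite -(ler_pXn2r (n := 2)) ?nnegrE ?absC_ge0 ?(ltW rho0) // rhoE.
  have b0 : 0 < b by apply: lt_le_trans rb.
  have rr2 : rho <= r2 by apply: le_trans rb t2'.
  have r1r : r1 <= rho by apply: le_trans ar.
  (* Comparing moduli, the step from [t] to [y] is no longer than the one from [t] to [t'] in the
     coordinate [(z - c)^-1] ([yi], [tri2]), and the step from [y] to [t'] at most twice the one
     from [t] to [t'] in the coordinate [z] ([yt']). *)
  pose k := rho / a; pose y := cR k * (t - c) + c.
  have k1 : 1 <= k by rewrite ler_pdivlMr // mul1r.
  have yc : absC (y - c) = rho.
    by rewrite addrK absCM absC_cR ger0_norm ?divr_ge0 ?(ltW rho0) ?(ltW a0) // /k -/a divfK // gt_eqF.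
  have tn : t - c != 0 by rewrite subr_eq0 neq.
  have tn' : t' - c != 0 by rewrite -absC_gt0.
  have tri : b - a <= absC (t' - t).
    by have := absC_tri t' c t; rewrite -/a -/b; lra.
  have yt : absC (y - t) = rho - a.
    have -> : y - t = cR (k - 1) * (t - c).
      rewrite /y; case: (t) => t1_ t2_; case: (c) => c1 c2.
      by apply/eqP; rewrite eq_complex /=; apply/andP; split; apply/eqP; ring.
    rewrite absCM absC_cR ger0_norm ?subr_ge0 // mulrBl mul1r -/a /k divfK // gt_eqF //.
  have yt' : absC (t' - y) <= 2 * absC (t' - t).
    have := absC_tri t' y t; rewrite [absC (t - y)]absCB yt; lra.
  have yi : absC ((y - c)^-1 - (t - c)^-1) = a^-1 - rho^-1.
    have -> : (y - c)^-1 - (t - c)^-1 = cR (k^-1 - 1) * (t - c)^-1.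
      by rewrite addrK invfM -fmorphV /= rmorphB rmorph1 mulrBl mul1r.
    have ki : k^-1 <= 1 by rewrite invf_le1 // (lt_le_trans ltr01).
    rewrite absCM absC_cR absCV ler0_norm ?subr_le0 // -/a opprB mulrBl mul1r /k invf_div.
    by rewrite mulrAC divff ?mul1r // gt_eqF.
  have tri2 : a^-1 - b^-1 <= absC ((t' - c)^-1 - (t - c)^-1).
    have := absC_tri (t - c)^-1 0 (t' - c)^-1; rewrite !subr0 !absCV -/a -/b absCB; lra.
  have h1 := inner t y tm _ t1 _; have h2 := outer y t' _ tm' _ t2'.
  rewrite yc rhoE in h1 h2.
  apply: reach_le (reach_trans (h1 (lexx _) r1r) (h2 (lexx _) rr2)).
  have e1 : r1 * absC ((y - c)^-1 - (t - c)^-1) <= Mx.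
    apply: le_trans m2; rewrite ler_wpM2l ?(ltW r10) // yi; apply: le_trans tri2.
    by rewrite lerD2l lerN2 lef_pV2 ?posrE.
  have e2 : absC (t' - y) / r2 <= 2 * Mx.
    apply: (@le_trans _ _ (2 * absC (t' - t) / r2)); first by rewrite ler_wpM2r // ltW.
    by rewrite -mulrA ler_wpM2l.
  nra.
have [zm|/ltW zm] := leP (r1 * r2) (absC (z - c) ^+ 2);
  have [zm'|/ltW zm'] := leP (r1 * r2) (absC (z' - c) ^+ 2).
- by apply: reach_le (outer _ _ zm zm' z2 z2'); nra.
- apply: reach_sym; apply: mixed => //; by rewrite absCB.
- exact: mixed.
- by apply: reach_le (inner _ _ zm zm' z1 z1'); nra.
Qed.

End SphereReach.

(** * Greedy choice of points *)

Section Selection.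
Context {R : realType} {n : nat} (X : geometry R n).
Notation plane := (R * R)%type.
Notation cR := (real_complex R).
Notation MM := (measurableTypeR R * measurableTypeR R)%type.
Implicit Types (u : P1 R -> X) (z w c : R[i]).

Definition to_C (y : plane) : R[i] := Complex y.1 y.2.

Lemma plane_ofK : cancel plane_of to_C.
Proof. by case. Qed.

Lemma to_CK : cancel to_C plane_of.
Proof. by case. Qed.

Lemma dens_continuous u : Jhol_P1 u -> continuous (norm_du (chart0 u)).
Proof.
move=> Ju; have [sv _] := JholT (Jhol_P1_chart0 Ju).
by move=> z; exact: (norm_du_continuous (@openT _) sv).
Qed.

Lemma le_modulus (y : plane) : `|y.1| <= modulus y /\ `|y.2| <= modulus y.
Proof.
split; rewrite -(ler_pXn2r (n := 2)) ?nnegrE ?modulus_ge0 // real_normK ?num_real //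
  sqr_modulus /sqn; [rewrite lerDl|rewrite lerDr]; exact: sqr_ge0.
Qed.

(** The inverted map has bounded density near [0], and inversion multiplies densities by
    [|z| ^ -2]. *)
Lemma dens_infinity u d : Jhol_P1 u -> 0 < d ->
  exists r, forall z, r <= absC z -> dens u z < d.
Proof.
move=> Ju d0; pose u' := u \o P1_inv 0; have Ju' := Jhol_P1_inv 0 Ju.
pose D := dens u' 0.
have D0 : 0 <= D := dens_ge0 _ _.
have /nbhs_ballP[e /= e0 He] : \forall y \near ((0, 0) : plane), norm_du (chart0 u') y < D + 1.
  have c0 := dens_continuous Ju' (x := (0, 0)).
  have lt0 : D < D + 1 by rewrite ltrDl.
  exact: (c0 _ (lt_nbhsl lt0)).
pose r := Num.max (2 / e) ((D + 1) / d + 1).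
exists r => z rz.
have r1 : 2 / e <= r by rewrite le_max lexx.
have r2 : (D + 1) / d + 1 <= r by rewrite le_max lexx orbT.
have Dd : 0 <= (D + 1) / d by rewrite divr_ge0 ?addr_ge0 // ltW.
have r1' : 1 <= r by lra.
have a0 : 0 < absC z by lra.
have z0 : z != 0 by rewrite -absC_gt0.
have w0 : z^-1 != 0 by rewrite invr_eq0.
have := dens_inv 0 Ju w0; rewrite invrK addr0 -/u' => E.
have : dens u' z^-1 < D + 1.
  apply: He; have [h1 h2] := le_modulus (plane_of z^-1).
  have h3 : modulus (plane_of z^-1) < e.
    rewrite -absC_modulus absCV -[_^-1]mul1r ltr_pdivrMr //.
    move: r1; rewrite ler_pdivrMr // => r1; nra.
  by split; rewrite -ball_normE /= sub0r normrN; [apply: le_lt_trans h1 h3|apply: le_lt_trans h2 h3].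
rewrite E absCV exprVn invrK => h.
have : dens u z * d < d * d.
  have dz := dens_ge0 u z.
  have k : D + 1 <= (r - 1) * d by rewrite -ler_pdivrMr //; lra.
  have a1 : 1 <= absC z by lra.
  have a2 : absC z <= absC z ^+ 2 by rewrite expr2 ler_peMl // ltW.
  have h4 : absC z * dens u z <= absC z ^+ 2 * dens u z by rewrite ler_wpM2r.
  have h5 : r * dens u z < r * d.
    have h6 : r * dens u z <= absC z * dens u z by rewrite ler_wpM2r.
    by move: h h4 h6 k; lra.
  have r0 : 0 < r by lra.
  by move: h5; rewrite ltr_pM2l // => h5; rewrite ltr_pM2r.
by rewrite ltr_pM2r.
Qed.

Definition violates (kap : R) (P : seq R[i]) u z : Prop :=
  forall p, p \in P -> kap <= absC (z - p) * dens u z.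

(** The set of candidates is closed but unbounded. Since the density tends to zero at infinity,
    outside a large square it stays below its value at [z0], so the maximum over the compact part is
    global. *)
Lemma dens_argmax kap P u z0 : Jhol_P1 u -> 0 < dens u z0 -> violates kap P u z0 ->
  exists z, [/\ 0 < dens u z, violates kap P u z &
    forall z', violates kap P u z' -> dens u z' <= dens u z].
Proof.
move=> Ju d0 V0; have [r Hr] := dens_infinity Ju d0.
have cd := dens_continuous Ju.
pose V : set plane := [set y | violates kap P u (to_C y)].
pose r' := Num.max r (absC z0).
pose Q : set plane := [set` `[- r', r']%R] `*` [set` `[- r', r']%R].
have cV : closed V.
  have -> : V = \bigcap_(p in [set` P]) [set y | kap <= modulus (y - plane_of p) * norm_du (chart0 u) y].
    apply/seteqP; split=> y /= H p /= pP; have := H p pP.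
      by rewrite /dens absC_modulus plane_ofB to_CK.
    by rewrite /dens absC_modulus plane_ofB to_CK.
  apply: closed_bigI => p _.
  apply: (@preimage_closed _ _ (fun y : plane => modulus (y - plane_of p) * norm_du (chart0 u) y) [set t | kap <= t]).
    2: exact: closed_ge.
  move=> y _; apply: cvgM; last exact: cd.
  apply: (@continuous_comp _ _ _ (fun y : plane => y - plane_of p) modulus); last exact: modulus_continuous.
  by apply: cvgB; [exact: cvg_id|exact: cvg_cst].
have cQ : compact Q by apply: compact_setX; exact: segment_compact.
have cVQ : compact (V `&` Q).
  apply: (subclosed_compact _ cQ); last by move=> y [].
  apply: closedI => //; apply: compact_closed => //; exact: norm_hausdorff.
have inQ (y : plane) : modulus y <= r' -> Q y.
  move=> yr; have [h1 h2] := le_modulus y.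
  by split; rewrite /= in_itv /= -ler_norml; [apply: le_trans h1 yr|apply: le_trans h2 yr].
have [||z] := @compact_EVT_max _ _ (norm_du (chart0 u)) (V `&` Q) _ cVQ.
- exists (plane_of z0); split; first by rewrite /V /= plane_ofK.
  by apply: inQ; rewrite -absC_modulus le_max lexx orbT.
- by apply: continuous_subspaceT.
rewrite inE => -[Vz Qz] Hz.
have big : dens u z0 <= norm_du (chart0 u) z.
  apply: Hz; rewrite inE; split; first by rewrite /V /= plane_ofK.
  by apply: inQ; rewrite -absC_modulus le_max lexx orbT.
exists (to_C z); have E : dens u (to_C z) = norm_du (chart0 u) z by rewrite /dens to_CK.
split; first by rewrite E (lt_le_trans d0).
- exact: Vz.
move=> z' Vz'; rewrite E; have [zr|zr] := leP (absC z') r'.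
  apply: Hz; rewrite inE; split; first by rewrite /V /= plane_ofK.
  by apply: inQ; rewrite -absC_modulus.
apply: le_trans big; apply: ltW; apply: Hr.
by apply: le_trans (ltW zr); rewrite le_max lexx.
Qed.

(* [Y] consists of points added to [P0]; the discs of radius
   [kap / (3 * dens u y)] around them are disjoint and, by the mean value
   inequality, each carries energy at least [lam ^+ 2]. *)
Definition separated (kap : R) (P0 Y : seq R[i]) u : Prop :=
  uniq Y /\ forall y, y \in Y -> [/\ y \notin P0, 0 < dens u y &
    forall p, p \in P0 ++ Y -> p != y -> kap <= absC (y - p) * dens u y].

Lemma energy_disjoint (I : eqType) (s : seq I) (F : I -> set plane) (v : plane -> X) (L : R) :
  smooth_map setT v -> (forall i, measurable (F i : set MM)) -> uniq s -> trivIset [set` s] F ->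
  (forall i, i \in s -> (L%:E <= energy (F i) v)%E) ->
  (((size s)%:R * L)%:E <= energy setT v)%E.
Proof.
move=> sv mF us tF HL.
have mD : measurable (\big[setU/set0]_(i <- s) F i : set MM) by exact: bigsetU_measurable.
apply: le_trans (energy_le sv mD _ (@subsetT _ _)); last exact: measurableT.
rewrite /energy (ge0_integral_bigsetU _ mF us tF); last 2 first.
- by apply: measurable_funTS; exact: measurable_norm_du.
- by move=> z _; rewrite lee_fin sqr_ge0.
rewrite ge0_sume_distrr; last by move=> i _; apply: integral_ge0 => z _; rewrite lee_fin sqr_ge0.
rewrite -[X in (X <= _)%E](_ : (\sum_(i <- s) L%:E)%E = _).
  rewrite big_seq [X in (_ <= X)%E]big_seq; apply: lee_sum => i si; exact: HL.
by rewrite sumEFin big_const_seq count_predT iter_addr_0 mulr_natl.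
Qed.

Lemma separated_size C q kap lam P0 Y u : mean_value X C q -> 1 <= C -> 0 < lam ->
  lam ^+ 2 <= q -> 3 * Num.sqrt C * lam <= kap -> Jhol_P1 u -> separated kap P0 Y u ->
  (((size Y)%:R * lam ^+ 2)%:E <= energy setT (chart0 u))%E.
Proof.
move=> mv C1 lam0 lq kl Ju [uY sY].
have Jv := Jhol_P1_chart0 Ju; have [sv _] := JholT Jv.
have C0 : 0 < C by lra.
have sC : 0 < Num.sqrt C by rewrite sqrtr_gt0.
(* With this radius [(r y * dens u y) ^ 2 = C * lam ^ 2], as [ball_energy] requires, and separation
   by [kap >= 3 sqrt C lam] keeps the discs disjoint. *)
pose r y := Num.sqrt C * lam / dens u y.
apply: (@energy_disjoint _ Y (fun y => cdisc (plane_of y) (r y))) => //.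
- by move=> y; exact: measurable_cdisc.
- move=> y y' /= yY yY' [w [wy wy']]; apply/eqP; apply: contraT => yy'.
  have [_ d0 s1] := sY _ yY; have [_ d0' s2] := sY _ yY'.
  have h1 : kap <= absC (y - y') * dens u y by apply: s1; rewrite ?mem_cat ?yY' ?orbT // eq_sym.
  have h2 : kap <= absC (y - y') * dens u y' by rewrite absCB; apply: s2; rewrite ?mem_cat ?yY ?orbT.
  have yE : shift_plane (- plane_of y) w = w - plane_of y by [].
  have yE' : shift_plane (- plane_of y') w = w - plane_of y' by [].
  move: wy wy'; rewrite /cdisc /= yE yE' => wy wy'.
  have tri : absC (y - y') <= r y + r y'.
    rewrite absC_modulus plane_ofB -(subrKA w) -[plane_of y - w]opprB; apply: le_trans (modulusD _ _) _.
    by rewrite modulusN lerD.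
  have k0 : 0 < Num.sqrt C * lam by rewrite mulr_gt0.
  have b1 : 3 * r y <= absC (y - y') by rewrite /r mulrA ler_pdivrMr //; lra.
  have b2 : 3 * r y' <= absC (y - y') by rewrite /r mulrA ler_pdivrMr //; lra.
  have r1 : 0 < r y by rewrite divr_gt0.
  lra.
move=> y yY; have [_ d0 _] := sY _ yY.
apply: (ball_energy mv C0 Jv _ lq); first by rewrite divr_gt0 ?mulr_gt0.
rewrite -/(dens u y) /r divfK ?gt_eqF // exprMn sqr_sqrtr ?lexx //; exact: ltW.
Qed.

Lemma greedy C q kap lam (N : nat) P0 u : mean_value X C q -> 1 <= C -> 0 < lam ->
  lam ^+ 2 <= q -> 3 * Num.sqrt C * lam <= kap -> Jhol_P1 u ->
  (energy setT (chart0 u) <= (N%:R * lam ^+ 2)%:E)%E ->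
  exists Y, separated kap P0 Y u /\
    forall z, violates kap (P0 ++ Y) u z -> dens u z = 0.
Proof.
move=> mv C1 lam0 lq kl Ju EN.
have kap0 : 0 < kap by apply: lt_le_trans kl; rewrite !mulr_gt0 // sqrtr_gt0; lra.
(* [k] is a supply of steps that the energy bound exhausts. The last condition says that points were
   added in order of decreasing density: it keeps an earlier point [t] separated from a new [y],
   because [dens u y <= dens u t]. *)
suff H k Y : (N < size Y + k)%N -> separated kap P0 Y u ->
    (forall z y, violates kap (P0 ++ Y) u z -> y \in Y -> dens u z <= dens u y) ->
    exists Y', separated kap P0 Y' u /\ forall z, violates kap (P0 ++ Y') u z -> dens u z = 0.
  by apply: (H N.+1 [::]).
elim: k Y => [|k IH] Y Nk sY dY.
  have := separated_size mv C1 lam0 lq kl Ju sY => h.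
  have := le_trans h EN; rewrite lee_fin ler_pM2r ?exprn_gt0 // ler_nat leqNgt.
  by rewrite addn0 in Nk; rewrite Nk.
have [[z Vz dz]|none] := pselect (exists2 z, violates kap (P0 ++ Y) u z & dens u z != 0); last first.
  exists Y; split=> // z Vz; apply/eqP; apply: contraT => dz; case: none; by exists z.
have d0 : 0 < dens u z by rewrite lt0r dz dens_ge0.
have [y [y0 Vy my]] := dens_argmax Ju d0 Vz.
have yP : y \notin P0 ++ Y.
  by apply/negP => /Vy; rewrite subrr absC0 mul0r leNgt kap0.
apply: (IH (y :: Y)); first by rewrite /= addSnnS.
- split=> [|t]; first by case: sY => /= -> _; rewrite andbT; move: yP; rewrite mem_cat negb_or => /andP[].
  rewrite in_cons => /orP[/eqP->|tY].
    split=> //; first by move: yP; rewrite mem_cat negb_or => /andP[].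
    move=> p; rewrite mem_cat in_cons orbCA => /orP[/eqP->|pP py]; first by rewrite eqxx.
    by apply: Vy; rewrite mem_cat.
  have [_ /(_ _ tY)[tP t0 st]] := sY; split=> // p; rewrite mem_cat in_cons orbCA => /orP[/eqP-> yt|pP].
    apply: le_trans (Vy t _) _; first by rewrite mem_cat tY orbT.
    by rewrite absCB ler_wpM2l ?absC_ge0 // dY.
  by apply: st; rewrite mem_cat.
move=> z' t Vz'; have Vz'' : violates kap (P0 ++ Y) u z'.
  by move=> p pP; apply: Vz'; move: pP; rewrite !mem_cat in_cons => /orP[]->; rewrite ?orbT.
by rewrite in_cons => /orP[/eqP->|tY]; [exact: my|exact: dY].
Qed.

End Selection.

(** * Rooted trees and trees of components *)

Section TreeRealization.
Context {R : realType} (V L : finType) (v0 : V) (par : V -> V) (rk : V -> nat) (leaf_at : L -> V)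
  (par_rk : forall v, v != v0 -> (rk (par v) < rk v)%N).

Notation E := (V + L)%type.
Notation cell := (V + E)%type.

(** The edge [inl v] is [e_v], running from [v] to its parent, and is the root half edge for
    [v = v0]; the edges [inr p] are the other half edges. *)
Definition tree_bd (e : E) : {set V} :=
  match e with
  | inl v => if v == v0 then [set v0]%SET else [set v; par v]%SET
  | inr p => [set leaf_at p]%SET
  end.

Definition cell_root : cell := inl v0.

Definition cell_par (k : cell) : cell :=
  match k with
  | inl v => if v == v0 then cell_root else inr (inl v)
  | inr (inl v) => if v == v0 then cell_root else inl (par v)
  | inr (inr p) => inl (leaf_at p)
  end.

(** Doubling the rank leaves an odd value for the edge between a vertex and its parent, so that the
    height drops strictly on the way to the root. *)
Definition cell_height (k : cell) : nat :=
  match k with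
  | inl v => (rk v).*2
  | inr (inl v) => if v == v0 then (rk v0).*2.+1 else (rk v).*2.-1
  | inr (inr p) => (rk (leaf_at p)).*2.+1
  end.

Lemma cell_par_height k : k != cell_root -> (cell_height (cell_par k) < cell_height k)%N.
Proof.
case: k => [v|[v|p]] //=.
- case: (eqVneq v v0) => [->|v1 _]; first by rewrite eqxx.
  by rewrite /= (negbTE v1); have := par_rk v1; case: (rk v).
case: (eqVneq v v0) => [_|v1] _ //=.
by have := par_rk v1; case: (rk v) => // r; rewrite doubleS /= !ltnS leq_double.
Qed.

Lemma cell_par_root : cell_par cell_root = cell_root.
Proof. by rewrite /= eqxx. Qed.

Lemma iter_cell_par m k : (cell_height k <= m)%N -> iter m cell_par k = cell_root.
Proof.
elim: m k => [|m IH] k hk.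
  by apply/eqP; apply: contraLR hk => /cell_par_height; case: (cell_height k).
rewrite iterSr; have [->|k0] := eqVneq k cell_root.
  by rewrite cell_par_root; elim: m {IH hk} => // m; rewrite iterS => ->; exact: cell_par_root.
by apply: IH; rewrite -ltnS; apply: leq_trans hk; exact: cell_par_height.
Qed.

Lemma tree_bd_cell v e : v \in tree_bd e ->
  cell_par (inl v) = inr e \/ cell_par (inr e) = inl v.
Proof.
case: e => [w|p] /=; last by rewrite inE => /eqP ->; right.
case: eqVneq => [->|w0]; first by rewrite inE => /eqP ->; right.
by rewrite !inE => /orP[]/eqP ->; [left; rewrite (negbTE w0)|right].
Qed.

Notation space := 'rV[R]_#|{: cell}|.
Definition cell_pt (k : cell) : space := evec (enum_rank k).

Definition clamp (t : R) : R := Num.max 0 (Num.min 1 t).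

Definition height_bound : nat := \max_k cell_height k.

(* The point at height at most [s] on the path from [k] to the root. *)
Definition descent (k : cell) (s : R) : space :=
  cell_pt cell_root + \sum_(i < height_bound)
    clamp (s - (cell_height (iter i cell_par k))%:R + 1)
      *: (cell_pt (iter i cell_par k) - cell_pt (cell_par (iter i cell_par k))).

Lemma clamp1 t : 1 <= t -> clamp t = 1.
Proof. by move=> t1; rewrite /clamp min_l // max_r. Qed.

Lemma clamp0 t : t <= 0 -> clamp t = 0.
Proof. by move=> t0; rewrite /clamp min_r ?max_l // (le_trans t0). Qed.

Lemma clamp_ge0 t : 0 <= clamp t.
Proof. by rewrite le_max lexx. Qed.

Lemma clamp_le1 t : clamp t <= 1.
Proof. by rewrite ge_max ler01 ge_min lexx. Qed.

Lemma clamp_continuous : continuous clamp.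
Proof.
move=> t; apply: (@continuous_max R R (cst 0) (fun t => Num.min 1 t) t); first exact: cvg_cst.
apply: (@continuous_min R R (cst 1) id t); [exact: cvg_cst|exact: cvg_id].
Qed.

Lemma height_boundP k : (cell_height k <= height_bound)%N.
Proof. exact: leq_bigmax. Qed.

Lemma descent_par k s : descent k s = descent (cell_par k) s +
  clamp (s - (cell_height k)%:R + 1) *: (cell_pt k - cell_pt (cell_par k)).
Proof.
rewrite /descent -addrA; congr (_ + _).
set F := fun k : cell => clamp (s - (cell_height k)%:R + 1) *: (cell_pt k - cell_pt (cell_par k)).
have -> : \sum_(i < height_bound) F (iter i cell_par (cell_par k)) =
    \sum_(i < height_bound) F (iter i.+1 cell_par k).
  by apply: eq_bigr => i _; rewrite iterSr.
have := @big_ord_recl _ 0 +%R height_bound (fun i => F (iter i cell_par k)).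
have := @big_ord_recr _ 0 +%R height_bound (fun i => F (iter i cell_par k)).
move=> -> /=; rewrite iter_cell_par ?height_boundP // {2}/F cell_par_root subrr scaler0 addr0.
by move=> ->; rewrite addrC.
Qed.

Lemma descent_root s : descent cell_root s = cell_pt cell_root.
Proof.
rewrite /descent big1 ?addr0 // => i _.
have -> : iter i cell_par cell_root = cell_root.
  by elim: (nat_of_ord i) => // m; rewrite iterS => ->; exact: cell_par_root.
by rewrite cell_par_root subrr scaler0.
Qed.

Lemma descent_top k s : (cell_height k)%:R <= s -> descent k s = cell_pt k.
Proof.
have [m km] := ubnP (cell_height k); elim: m k km => // m IH k km ks.
have [->|k0] := eqVneq k cell_root; first exact: descent_root.
have hk := cell_par_height k0.
rewrite descent_par IH.
- by rewrite clamp1 ?scale1r; [rewrite addrC subrK|lra].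
- by apply: leq_trans hk _; rewrite -ltnS.
- by apply: le_trans ks; rewrite ler_nat ltnW.
Qed.

Lemma descent_bottom k : descent k 0 = cell_pt cell_root.
Proof.
have [m km] := ubnP (cell_height k); elim: m k km => // m IH k km.
have [->|k0] := eqVneq k cell_root; first exact: descent_root.
have hk := cell_par_height k0.
rewrite descent_par IH; last by apply: leq_trans hk _; rewrite -ltnS.
rewrite clamp0 ?scale0r ?addr0 // sub0r addrC subr_le0 ler1n.
by apply: leq_ltn_trans hk.
Qed.

Notation A := (realization (R := R) tree_bd).

Lemma realization_pt k : A (cell_pt k).
Proof. by left; exists k. Qed.

Lemma realization_edge k t : 0 <= t <= 1 -> A (cell_pt (cell_par k) + t *: (cell_pt k - cell_pt (cell_par k))).
Proof.
move=> /andP[t0 t1].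
have E (a b : space) (t' : R) : a + t' *: (b - a) = (1 - t') *: a + t' *: b.
  by rewrite scalerBr scalerBl scale1r addrA addrAC.
have E' (a b : space) (t' : R) : a + t' *: (b - a) = (1 - (1 - t')) *: b + (1 - t') *: a.
  by rewrite E (_ : 1 - (1 - t') = t') 1?addrC //; ring.
case: k => [v|[v|p]] /=.
- case: eqVneq => [->|vv]; first by rewrite subrr scaler0 addr0; exact: realization_pt.
  right; exists v, (inl v), (1 - t); rewrite -E'; split => //.
    by rewrite /tree_bd (negbTE vv) !inE eqxx.
  by rewrite subr_ge0 t1 gerBl.
- case: eqVneq => [->|vv].
    right; exists v0, (inl v0), t; rewrite -E; split => //; last by rewrite t0.
    by rewrite /tree_bd eqxx inE.
  right; exists (par v), (inl v), t; rewrite -E; split => //; last by rewrite t0.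
  by rewrite /tree_bd (negbTE vv) !inE eqxx orbT.
right; exists (leaf_at p), (inr p), t; rewrite -E; split => //; last by rewrite t0.
by rewrite /tree_bd inE.
Qed.

(** If the parent is not higher than [s], it has not moved and the segment lies in a single 1-cell.
    Otherwise [k] has already reached its parent, the two descents coincide, and the induction
    hypothesis applies one cell further. *)
Lemma descent_edge k s t : 0 <= t <= 1 ->
  A (descent (cell_par k) s + t *: (descent k s - descent (cell_par k) s)).
Proof.
have [m km] := ubnP (cell_height k); elim: m k km t => // m IH k km t tt.
have [->|k0] := eqVneq k cell_root.
  by rewrite cell_par_root subrr scaler0 addr0 descent_root; exact: realization_pt.
have hk := cell_par_height k0.
have -> : descent k s - descent (cell_par k) s =
    clamp (s - (cell_height k)%:R + 1) *: (cell_pt k - cell_pt (cell_par k)).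
  by rewrite [descent k s]descent_par addrAC subrr add0r.
have [h|h] := leP (cell_height (cell_par k))%:R s.
  rewrite (descent_top h) scalerA; apply: realization_edge.
  by case/andP: tt => t0 t1; rewrite mulr_ge0 ?clamp_ge0 //= mulr_ile1 ?clamp_ge0 ?clamp_le1.
rewrite clamp0 ?scale0r ?scaler0 ?addr0.
  have := IH (cell_par k) _ 1; rewrite scale1r addrC subrK; apply; last by rewrite ler01 lexx.
  by apply: leq_trans hk _; rewrite -ltnS.
have : ((cell_height (cell_par k)).+1)%:R <= (cell_height k)%:R :> R by rewrite ler_nat.
by rewrite -natr1; lra.
Qed.

Lemma pt_sum k (F : cell -> space) : \sum_k' cell_pt k 0 (enum_rank k') *: F k' = F k.
Proof.
rewrite (bigD1 k) //= big1 ?addr0 => [|k' kk].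
  by rewrite /cell_pt /evec mxE !eqxx scale1r.
by rewrite /cell_pt /evec mxE eqxx /= (inj_eq enum_rank_inj) (negbTE kk) scale0r.
Qed.

(* Every point of the realization lies on the segment from a cell to its parent. *)
Lemma realizationP x : A x -> exists k t, 0 <= t <= 1 /\
  forall F : cell -> space,
    \sum_k' x 0 (enum_rank k') *: F k' = F (cell_par k) + t *: (F k - F (cell_par k)).
Proof.
have comb (a b : cell) (t : R) (F : cell -> space) :
    \sum_k' ((1 - t) *: cell_pt a + t *: cell_pt b) 0 (enum_rank k') *: F k' = F a + t *: (F b - F a).
  under eq_bigr do rewrite mxE [X in X + _]mxE [X in _ + X]mxE scalerDl -!scalerA.
  by rewrite big_split /= -!scaler_sumr !pt_sum scalerBl scale1r scalerBr addrAC addrA.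
have flip (a b : space) (t : R) : a + t *: (b - a) = b + (1 - t) *: (a - b).
  by rewrite scalerBl scale1r [RHS]addrA [b + (a - b)]addrC subrK -scalerN opprB.
move=> [[k _ <-]|[v [e [t [ve tt ->]]]]].
  exists k, 1; rewrite ler01 lexx; split=> // F.
  by rewrite pt_sum scale1r addrC subrK.
have [h|h] := tree_bd_cell ve.
  exists (inl v), (1 - t); split.
    by case/andP: tt => t0 t1; rewrite subr_ge0 t1 gerBl.
  by move=> F; rewrite comb h flip.
exists (inr e), t; split=> // F.
by rewrite comb h.
Qed.

(** The homotopy extends the descent of the 0-cells linearly in the coordinates of the ambient
    space, so it is continuous everywhere; that it stays in the complex need only be checked on
    segments from a cell to its parent. *)
Lemma tree_contractible : contractible (R := R) A.
Proof.
exists (cell_pt cell_root); first exact: realization_pt.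
exists (fun tx : R * space => \sum_k tx.2 0 (enum_rank k) *: descent k (height_bound%:R * (1 - tx.1))).
have dc k : continuous (descent k).
  move=> s; apply: cvgD; first exact: cvg_cst.
  apply: (@cvg_big _ _ _ _ _ _ _ _ _ _ _ _ _) => [|i _]; first exact: add_continuous.
  apply: cvgZr_tmp; apply: (@continuous_comp _ _ _ (fun s : R => s - _ + 1) clamp); last exact: clamp_continuous.
  by apply: cvgD; [apply: cvgB; [exact: cvg_id|exact: cvg_cst]|exact: cvg_cst].
split.
- apply: continuous_subspaceT => -[t x].
  apply: cvg_big => [|k _]; first exact: add_continuous.
  apply: cvgZ.
    apply: (@continuous_comp _ _ _ (fun tx : R * space => tx.2) (fun x : space => x 0 (enum_rank k))).
      exact: cvg_snd.
    exact: coord_continuous.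
  apply: (@continuous_comp _ _ _ (fun tx : R * space => height_bound%:R * (1 - tx.1)) (descent k)); last exact: dc.
  apply: cvgMl_tmp; apply: cvgB; [exact: cvg_cst|exact: cvg_fst].
- move=> t x _ /realizationP[k [s [ss E]]]; rewrite /= E; exact: descent_edge.
- move=> x /realizationP[k [s [ss E]]] /=.
  have D k' : descent k' (height_bound%:R * (1 - 0)) = cell_pt k'.
    by apply: descent_top; rewrite subr0 mulr1 ler_nat height_boundP.
  under eq_bigr do rewrite D.
  apply/rowP => j; rewrite summxE (bigD1 (enum_val j)) //= big1 ?addr0 => [|k' kk].
    by rewrite !mxE enum_valK !eqxx /= mulr1.
  rewrite !mxE eqxx /= (_ : (j == enum_rank k') = false) ?mulr0 //.
  by apply/eqP => jk; move: kk; rewrite jk enum_rankK eqxx.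
- move=> x /realizationP[k [s [ss E]]] /=; rewrite subrr mulr0.
  by rewrite (E (fun k => descent k 0)) !descent_bottom subrr scaler0 addr0.
Qed.

Definition tree_epos (e : E) : option V := if e is inl v then Some v else None.

Definition tree_eneg (e : E) : option V :=
  match e with
  | inl v => if v == v0 then None else Some (par v)
  | inr p => Some (leaf_at p)
  end.

Lemma par_neq v : v != v0 -> par v != v.
Proof. by move=> /par_rk; apply: contraTneq => ->; rewrite ltnn. Qed.

Lemma tree_bd_card e : (1 <= #|tree_bd e| <= 2)%N.
Proof.
case: e => [v|p] /=; last by rewrite cards1.
case: eqVneq => [|vv]; first by rewrite cards1.
by rewrite cards2; case: (_ == _).
Qed.

Lemma tree_bd_orient e :
  tree_bd e = [set v | (tree_epos e == Some v) || (tree_eneg e == Some v)]%SET.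
Proof.
apply/setP => w; rewrite inE; case: e => [v|p] /=.
  case: (eqVneq v v0) => [->|vv]; first by rewrite inE orbF (inj_eq Some_inj) eq_sym.
  by rewrite !inE !(inj_eq Some_inj) ![w == _]eq_sym.
by rewrite inE (inj_eq Some_inj) eq_sym.
Qed.

Lemma tree_pos_neg e v : tree_epos e = Some v -> tree_eneg e <> Some v.
Proof.
case: e => [w|p] //= [->]; case: eqVneq => // vv [] /eqP.
by rewrite (negbTE (par_neq vv)).
Qed.

Lemma tree_up_pos v e : (tree_epos e == Some v) = (e == inl v :> E).
Proof. by case: e => [w|p] //=. Qed.

Lemma tree_root_half : tree_bd (inl v0) = [set v0]%SET.
Proof. by rewrite /= eqxx. Qed.

Definition tree_of : rooted_tree R :=
  @RootedTree R V E tree_bd tree_bd_card tree_contractible (inl v0) v0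
    tree_root_half tree_epos tree_eneg inl tree_bd_orient tree_pos_neg
    erefl tree_up_pos.

End TreeRealization.

(** * The tree of components of a curve of genus zero *)

Section CurveTree.
Context {R : realType} {m : nat} (S : marked_curve R m).
Notation comp := (curve_comp S).
Notation node := (curve_node S).

Definition joins (x y : comp * P1 R) : Prop :=
  exists nd b, branch nd b = x /\ branch nd (~~ b) = y.

(* [qa a] is the node on the component [a] in the direction of the root [a0],
   and [pa a] the corresponding point of the parent component [par a]. *)
Definition curve_tree (a0 : comp) (dp : comp -> nat) (par : comp -> comp) (qa pa : comp -> P1 R) : Prop :=
  [/\ par a0 = a0 /\ forall a, a != a0 -> (dp (par a) < dp a)%N,
      forall a, a != a0 -> joins (a, qa a) (par a, pa a),
      forall nd b, exists a, [/\ a != a0 &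
        (branch nd b = (a, qa a) /\ branch nd (~~ b) = (par a, pa a)) \/
        (branch nd b = (par a, pa a) /\ branch nd (~~ b) = (a, qa a))],
      forall a a', a != a0 -> a' != a0 -> (par a, pa a) = (par a', pa a') -> a = a'
    & forall a a', a != a0 -> a' != a0 -> (a, qa a) <> (par a', pa a')].

(** The depth is the length of a shortest path to the root, and the parent a neighbour of smaller
    depth. Distinct components use distinct nodes towards their parents, and by genus zero there are
    exactly as many nodes as components other than the root, so every node arises in this way. *)
Lemma curve_tree_exists a0 : exists dp par qa pa, curve_tree a0 dp par qa pa.
Proof.
pose e : rel comp := [rel s t | [exists nd, exists b,
               ((@branch _ _ S nd b).1 == s) && ((branch nd (~~ b)).1 == t)]].
have dP a : exists k, [exists p : k.-tuple comp, path e a0 p && (last a0 p == a)].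
  have /connectP[p pp la] := @curve_connected _ _ S a0 a.
  by exists (size p); apply/existsP; exists (in_tuple p) => /=; rewrite pp -la eqxx.
pose dp a := ex_minn (dP a).
have dpP k p a : path e a0 p -> last a0 p = a -> size p = k -> (dp a <= k)%N.
  move=> pp la sp; rewrite /dp; case: ex_minnP => k' _; apply.
  apply/existsP; subst k; exists (in_tuple p); rewrite /= pp la eqxx //.
have pred a : a != a0 -> exists nd b, (@branch _ _ S nd b).1 = a /\ (dp (branch nd (~~ b)).1 < dp a)%N.
  move=> aa; rewrite {2}/dp; case: ex_minnP => k /existsP[p /andP[pp /eqP la]] _.
  have := size_tuple p; move: (tval p) pp la => q; case/lastP: q => [_ /= a0a|q x].
    by rewrite a0a eqxx in aa.
  rewrite rcons_path last_rcons => /andP[pq eq_] xa; rewrite size_rcons => sq; subst x.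
  case/existsP: eq_ => nd /existsP[b /andP[/eqP b1 /eqP b2]].
  exists nd, (~~ b); rewrite negbK b1 b2 -sq ltnS; split=> //.
  exact: dpP pq erefl erefl.
have tot a : exists t : comp * P1 R * P1 R, if a == a0 then t.1.1 = a0 else
    joins (a, t.1.2) (t.1.1, t.2) /\ (dp t.1.1 < dp a)%N.
  have [aa|aa] := eqVneq a a0; first by exists (a0, None, None).
  have [nd [b [b1 b2]]] := pred _ aa.
  exists ((branch nd (~~ b)).1, (branch nd b).2, (branch nd (~~ b)).2); split=> //=.
  by exists nd, b; split; [rewrite -b1; case: branch|case: branch].
have [t Ht] := choice tot.
pose par a := (t a).1.1; pose qa a := (t a).1.2; pose pa a := (t a).2.
have jn a : a != a0 -> joins (a, qa a) (par a, pa a) by move=> /negbTE aa; have := Ht a; rewrite aa => -[].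
have dl a : a != a0 -> (dp (par a) < dp a)%N by move=> /negbTE aa; have := Ht a; rewrite aa => -[].
have p0 : par a0 = a0 by have := Ht a0; rewrite eqxx.
have ncross a a' : a != a0 -> a' != a0 -> (a, qa a) <> (par a', pa a').
  move=> aa aa' E; have [nd [b [b1 b2]]] := jn _ aa; have [nd' [b' [b1' b2']]] := jn _ aa'.
  have := b1; rewrite E -b2' => /branch_inj[ne be]; subst nd' b.
  rewrite negbK b1' in b2; case: b2 => pe _; case: E => ape _.
  have := dl _ aa; have := dl _ aa'; rewrite -ape -pe => h1 h2.
  by have := ltn_trans h1 h2; rewrite ltnn.
exists dp, par, qa, pa; split=> //; last first.
  move=> a a' aa aa' E; have [nd [b [b1 b2]]] := jn _ aa; have [nd' [b' [b1' b2']]] := jn _ aa'.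
  have := b2; rewrite E -b2' => /branch_inj[ne /negb_inj be]; subst nd' b'.
  by move: b1; rewrite b1' => -[].
have totg (x : {a | a != a0}) : exists nd, exists b,
    branch nd b = (val x, qa (val x)) /\ branch nd (~~ b) = (par (val x), pa (val x)).
  exact: (jn _ (valP x)).
have [g Hg] := choice totg.
have gi : injective g.
  move=> x y gxy; have [b [b1 b2]] := Hg x; have [b' [b1' b2']] := Hg y.
  rewrite -gxy in b1' b2'; apply/val_inj; have [be|be] := eqVneq b b'.
    by rewrite be b1' in b1; case: b1.
  have be' : b' = ~~ b by move: be; clear; case: b; case: b'.
  rewrite be' b2 in b1'; case: (ncross _ _ (valP y) (valP x)); exact: esym.
(* Vanishing of the arithmetic genus enters here: it makes the injection [g] from the components
   other than the root into the nodes surjective. *)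
have gs : (#|{: node}| <= #|{: {a | a != a0}}|)%N.
  rewrite card_sig -(leq_add2r 1) curve_genus (cardD1 a0) inE addnC leq_add2r.
  by apply: eq_leq; apply: eq_card => y; rewrite !inE andbT.
move=> nd b; have /codomP[x ->] := inj_card_onto gi gs nd.
exists (val x); split; first exact: (valP x).
have [b' [b1 b2]] := Hg x; have [->|bb] := eqVneq b b'; first by left.
have -> : b = ~~ b' by move: bb; clear; case: b; case: b'.
by rewrite negbK; right.
Qed.

(** A component of maximal depth is nobody's parent, so the only node it can carry is the one
    towards the root. *)
Lemma leaf_component : exists a0 q0, forall nd b, (@branch _ _ S nd b).1 = a0 -> branch nd b = (a0, q0).
Proof.
have /card_gt0P[a1 _] := @curve_nonempty _ _ S.
have [dp [par [qa [pa [[p0 dl] _ br _ _]]]]] := curve_tree_exists a1.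
pose a0 := [arg max_(a > a1) dp a].
have amax a : (dp a <= dp a0)%N by rewrite /a0; case: arg_maxnP => // a' _; exact.
exists a0, (qa a0) => nd b; have [a [aa [[-> _]|[-> _]]]] := br nd b => /= ba; first by rewrite ba.
by have := dl _ aa; rewrite ltnNge ba amax.
Qed.

End CurveTree.

(** * Fractional linear maps *)

Section Fractions.
Context {F : numFieldType}.
Implicit Types a b c d z : F.

Lemma derivable_affine a b z : derivable (fun w : F => a * w + b : F) z 1.
Proof.
by apply: derivableD; [apply: derivableM; [exact: derivable_cst|exact: derivable_id]|exact: derivable_cst].
Qed.

Lemma derivable_fraction a b c d z : c * z + d != 0 ->
  derivable (fun w : F => (a * w + b) / (c * w + d) : F) z 1.
Proof.
move=> z0; apply: derivableM; first exact: derivable_affine.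
by apply: derivableV => //; exact: derivable_affine.
Qed.

Lemma near_affine_neq0 c d z : c * z + d != 0 -> \forall w \near z, c * w + d != 0.
Proof.
move=> z0.
have cont : {for z, continuous (fun w : F => c * w + d : F)}.
  by apply: differentiable_continuous; apply/derivable1_diffP; exact: derivable_affine.
apply: (cont [set x : F | x != 0]); apply/nbhs_ballP.
exists `|c * z + d|; first by rewrite /= normr_gt0.
by move=> y; rewrite -ball_normE /= => h; apply: contraTneq h => ->; rewrite subr0 ltxx.
Qed.

Lemma near_always (P : Prop) z : P -> \forall w \near z, P.
Proof. by move=> p; apply: filterE. Qed.

End Fractions.

Section Moebius.
Context {R : realType}.
Notation C := R[i].
Implicit Types (p : P1 R) (x y k a b c d : C).

Lemma P1_ofZ k x y : k != 0 -> P1_of (k * x) (k * y) = P1_of x y.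
Proof.
move=> k0; rewrite /P1_of mulf_eq0 (negbTE k0) /=.
by case: eqVneq => // y0; congr Some; rewrite invfM mulrACA divff // mul1r.
Qed.

Lemma P1_of_rep x y : (x != 0) || (y != 0) ->
  exists k, [/\ k != 0, x = k * hx (P1_of x y) & y = k * hy (P1_of x y)].
Proof.
rewrite /P1_of; have [->|y0] := eqVneq y 0; rewrite ?orbF => h.
  by exists x; rewrite /= mulr1 mulr0.
by exists y; rewrite /= mulr1 mulrC divfK.
Qed.

Definition moeb (a b c d : C) (p : P1 R) : P1 R :=
  P1_of (a * hx p + b * hy p) (c * hx p + d * hy p).

Lemma moeb_rep a b c d p : a * d - b * c != 0 ->
  (a * hx p + b * hy p != 0) || (c * hx p + d * hy p != 0).
Proof.
move=> D; rewrite -negb_and; apply/negP => /andP[/eqP e1 /eqP e2].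
have h1 : (a * d - b * c) * hx p = 0.
  have -> : (a * d - b * c) * hx p = d * (a * hx p + b * hy p) - b * (c * hx p + d * hy p) by ring.
  by rewrite e1 e2 !mulr0 subr0.
have h2 : (a * d - b * c) * hy p = 0.
  have -> : (a * d - b * c) * hy p = a * (c * hx p + d * hy p) - c * (a * hx p + b * hy p) by ring.
  by rewrite e1 e2 !mulr0 subr0.
move: h1 h2; case: p {e1 e2} => [z|] /= /eqP h1 /eqP h2.
  by move: h2; rewrite mulr1 (negbTE D).
by move: h1; rewrite mulr1 (negbTE D).
Qed.

Lemma moeb_comp a b c d a' b' c' d' p : a' * d' - b' * c' != 0 ->
  moeb a b c d (moeb a' b' c' d' p) =
  moeb (a * a' + b * c') (a * b' + b * d') (c * a' + d * c') (c * b' + d * d') p.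
Proof.
move=> D; have [k [k0 kx ky]] := P1_of_rep (moeb_rep p D).
rewrite /moeb -[LHS](P1_ofZ _ _ k0) !mulrDr ![k * (_ * _)]mulrCA -kx -ky.
by congr P1_of; ring.
Qed.

Definition moebius (M : P1 R -> P1 R) : Prop :=
  exists a b c d, a * d - b * c != 0 /\ M =1 moeb a b c d.

Lemma moebius_comp M M' : moebius M -> moebius M' -> moebius (M \o M').
Proof.
move=> [a [b [c [d [D E]]]]] [a' [b' [c' [d' [D' E']]]]].
exists (a * a' + b * c'), (a * b' + b * d'), (c * a' + d * c'), (c * b' + d * d').
split; last by move=> p /=; rewrite E' E moeb_comp.
rewrite (_ : _ - _ = (a * d - b * c) * (a' * d' - b' * c')); last by ring.
by rewrite mulf_neq0.
Qed.

Lemma moebius_swap : moebius (@P1_swap R).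
Proof.
exists 0, 1, 1, 0; split; first by rewrite mul0r mul1r sub0r oppr_eq0 oner_neq0.
by move=> p; rewrite /moeb /P1_swap !mul0r !mul1r add0r addr0.
Qed.

Definition P1_affine (a b : C) (p : P1 R) : P1 R := omap (fun z => a * z + b) p.

Lemma moebius_affine a b : a != 0 -> moebius (P1_affine a b).
Proof.
move=> a0; exists a, b, 0, 1; split; first by rewrite mulr1 mulr0 subr0.
case=> [z|] /=; rewrite /moeb /= mul0r add0r; last by rewrite mulr1 !mulr0 addr0 /P1_of eqxx.
by rewrite !mulr1 /P1_of (negbTE (oner_neq0 _)) divr1.
Qed.

Lemma P1_shiftE q : P1_shift q =1 P1_affine 1 q.
Proof. by case=> [z|] //=; rewrite mul1r. Qed.

Lemma moebius_id : moebius id.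
Proof.
have [a [b [c [d [D E]]]]] := @moebius_affine 1 0 (oner_neq0 _).
exists a, b, c, d; split=> // p; rewrite -E.
by case: p => [z|] //=; rewrite mul1r addr0.
Qed.

Lemma moebius_ext M M' : M =1 M' -> moebius M -> moebius M'.
Proof. by move=> MM [a [b [c [d [D E]]]]]; exists a, b, c, d; split=> // p; rewrite -MM. Qed.

Lemma moeb_holo_at a b c d (z : C) : c * z + d != 0 ->
  affine_holo_at (fun w : Cfield => moeb a b c d (Some w)) z.
Proof.
move=> z0.
have nz := @near_affine_neq0 Cfield c d z z0.
have E : \forall w \near (z : Cfield), moeb a b c d (Some w) = Some ((a * w + b) / (c * w + d)).
  by apply: filterS nz => w w0; rewrite /moeb /= !mulr1 /P1_of (negbTE w0).
split; first by apply: filterS E => w ->.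
have dr := @derivable_fraction Cfield a b c d z z0.
apply: near_eq_derivable dr.
by apply: filterS E => w ->.
Qed.

Lemma moeb_swap a b c d p : a * d - b * c != 0 -> P1_swap (moeb a b c d p) = moeb c d a b p.
Proof.
move=> D; have [k [k0 kx ky]] := P1_of_rep (moeb_rep p D).
by rewrite /moeb /P1_swap -[LHS](P1_ofZ _ _ k0) -kx -ky.
Qed.

(** Where the denominator vanishes the numerator does not, and the swapped map has it as
    denominator. *)
Lemma moeb_holomorphic a b c d : a * d - b * c != 0 ->
  forall z, affine_holo_at (fun w : Cfield => moeb a b c d (Some w)) z \/
    affine_holo_at (fun w : Cfield => P1_swap (moeb a b c d (Some w))) z.
Proof.
move=> D z; have [z0|z0] := eqVneq (c * z + d) 0; last by left; exact: moeb_holo_at.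
right; have -> : (fun w : Cfield => P1_swap (moeb a b c d (Some w))) = (fun w : Cfield => moeb c d a b (Some w)).
  by apply/funext => w; exact: moeb_swap.
apply: moeb_holo_at; have := moeb_rep (Some z) D; rewrite /= !mulr1 z0 eqxx orbF //.
Qed.

Lemma moebius_holomorphic M : moebius M -> P1_holomorphic M.
Proof.
move=> mM z; have := moebius_comp mM moebius_swap.
case: mM => a [b [c [d [D /funext E]]]] [a' [b' [c' [d' [D' E']]]]]; split.
  by rewrite E; exact: moeb_holomorphic.
have E2 : (fun w : Cfield => M (P1_swap (Some w))) = (fun w : Cfield => moeb a' b' c' d' (Some w)).
  by apply/funext => w; rewrite -E'.
have -> : (fun w : Cfield => P1_swap (M (P1_swap (Some w)))) =
    (fun w : Cfield => P1_swap (moeb a' b' c' d' (Some w))).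
  by apply/funext => w; rewrite -E'.
by rewrite E2; exact: moeb_holomorphic.
Qed.

Lemma cst_holomorphic p : P1_holomorphic (fun=> p : P1 R).
Proof.
have H (x : C) (y : Cfield) : affine_holo_at (fun=> Some x) y.
  by split; [apply: (@near_always Cfield)|exact: derivable_cst].
case: p => [x|] z; first by split; left; exact: H.
by rewrite P1_swap_None; split; right; exact: H.
Qed.

End Moebius.

(** * Clusters and the model curve *)

Section ClusterArithmetic.
Context {R : realType} (eps : R) (eps0 : 0 < eps) (eps8 : 8 * eps <= 1).

Lemma eps_le : eps <= 8^-1.
Proof. by have := eps8; lra. Qed.

Lemma eps2_le : eps ^+ 2 <= 64^-1.
Proof. have := eps_le; have := eps0; nra. Qed.

Lemma eps3_le : eps ^+ 3 <= 512^-1.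
Proof. have := eps0; have := eps_le; have := eps2_le; rewrite [eps ^+ 3]exprS ; move=> h1 h2 h3; nra. Qed.

Lemma mu_arith : 6 * eps ^+ 3 <= 64^-1.
Proof. by have := eps3_le; lra. Qed.

Lemma separation_arith (m x y : R) : 0 < x -> m <= 64^-1 -> 0 <= y ->
  x <= m * y -> y <= m * x -> False.
Proof.
move=> x0 ml y0 h1 h2.
have m1 : m * x <= 64^-1 * x by rewrite ler_wpM2r // ltW.
have m2 : m * y <= 64^-1 * y by rewrite ler_wpM2r.
lra.
Qed.

(** In [growth], [D] bounds the diameter of the current set, [dl] is the distance from one of its
    points to the child being added, and [m * dl] bounds the size of that child. *)
Lemma growth_arith (m D dl : R) : 0 < m -> 0 <= dl -> m * dl <= D ->
  D + dl + m * dl <= D * (2 + m^-1).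
Proof.
move=> m0 dl0 h; have : dl <= D * m^-1 by rewrite ler_pdivlMr // mulrC.
lra.
Qed.

Lemma growth_ge (m : R) : 0 < m -> 2 <= 2 + m^-1.
Proof. by move=> m0; rewrite lerDl invr_ge0 ltW. Qed.

Lemma radius_regroup (b G x e : R) k :
  b ^+ k.+3 * (2 * x * G ^+ k / e) = (b * G) ^+ k * b ^+ 3 * (2 * x) / e.
Proof.
rewrite exprMn -[k.+3]addn3 exprD; move: (b ^+ k) (b ^+ 3) (G ^+ k) => u v g.
by rewrite !mulrA; congr (_ * _); ring.
Qed.

(** Write [b = 4 eps ^ 3] and [G = 2 + (6 eps ^ 3)^-1]. Then [b G = 8 eps ^ 3 + 2 / 3 <= 1], so [k]
    factors [b] absorb [G ^ k], and the remaining [b ^ 3 <= eps ^ 2] turns [2 x / eps] into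
    [2 eps x]. *)
Lemma radius_arith (k : nat) (x D : R) : 0 <= x ->
  D <= 2 * x * (2 + (6 * eps ^+ 3)^-1) ^+ k ->
  (4 * eps ^+ 3) ^+ k.+3 * (D / eps) <= 2 * eps * x.
Proof.
move=> x0 h; have e0 := eps0; have e2 := eps2_le; have e1 := eps_le; have e3 := eps3_le.
have p3 : 0 < eps ^+ 3 by rewrite exprn_gt0.
pose b := 4 * eps ^+ 3; pose G := 2 + (6 * eps ^+ 3)^-1.
have b0 : 0 < b by rewrite mulr_gt0.
have bG : b * G <= 1.
  have -> : b * G = 8 * eps ^+ 3 + 2 / 3.
    by rewrite /b /G; field; rewrite gt_eqF.
  lra.
have G0 : 0 < G by rewrite addr_gt0 // invr_gt0 mulr_gt0.
have bGk : (b * G) ^+ k <= 1 by rewrite exprn_ile1 // ltW // mulr_gt0.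
have b3 : b ^+ 3 <= eps ^+ 2.
  have -> : b ^+ 3 = (64 * eps ^+ 7) * eps ^+ 2 by rewrite /b; ring.
  have e7 : eps ^+ 7 <= 64^-1.
    have -> : eps ^+ 7 = eps ^+ 3 * eps ^+ 3 * eps by ring.
    have h1 : eps ^+ 3 * eps ^+ 3 <= eps ^+ 3 by rewrite ler_piMl ?(ltW p3) //; lra.
    have h2 : eps ^+ 3 * eps ^+ 3 * eps <= eps ^+ 3 * eps ^+ 3.
      by rewrite ler_piMr ?mulr_ge0 ?(ltW p3) //; lra.
    lra.
  nra.
rewrite -/b.
apply: (@le_trans _ _ (b ^+ k.+3 * (2 * x * G ^+ k / eps))).
  by rewrite ler_wpM2l ?exprn_ge0 ?(ltW b0) // ler_wpM2r // invr_ge0 ltW.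
have -> : b ^+ k.+3 * (2 * x * G ^+ k / eps) = (b * G) ^+ k * b ^+ 3 * (2 * x) / eps.
  exact: radius_regroup.
rewrite ler_pdivrMr //.
have -> : 2 * eps * x * eps = 1 * eps ^+ 2 * (2 * x) by ring.
apply: ler_wpM2r; first by rewrite mulr_ge0.
by apply: ler_pM => //; rewrite ?exprn_ge0 // ?mulr_ge0 ?ltW.
Qed.

Lemma half_arith (x a b d : R) : 0 <= x -> a <= 2^-1 * x -> b <= 2^-1 * x -> d <= a + b -> d <= 2 * x.
Proof. lra. Qed.

Lemma mixed_arith (x a b d g : R) : 0 <= x -> a <= 2^-1 * x -> b <= 2^-1 * x ->
  g <= x + b -> d <= a + g -> d <= 2 * x.
Proof. lra. Qed.

Lemma quarter_arith (m x a b : R) : 0 <= x -> m <= 64^-1 * x -> a <= m -> b <= m -> a + b <= x.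
Proof. lra. Qed.

Lemma gam_arith (D g : R) : D <= 8 * eps ^+ 3 * g -> D / eps <= 4 * eps * (2 * eps * g).
Proof.
move=> h; rewrite ler_pdivrMr //; apply: le_trans h _; rewrite le_eqVlt; apply/orP; left.
by apply/eqP; ring.
Qed.

Lemma mu_sum_arith (g : R) : 0 <= g -> 6 * eps ^+ 3 * (g + 6 * eps ^+ 3 * g) <= 8 * eps ^+ 3 * g.
Proof.
move=> g0; have h := mu_arith; have e3 : 0 < eps ^+ 3 by rewrite exprn_gt0.
have : eps ^+ 3 * g >= 0 by rewrite mulr_ge0 // ltW.
have : 6 * eps ^+ 3 * (eps ^+ 3 * g) <= 64^-1 * (eps ^+ 3 * g) by rewrite ler_wpM2r // mulr_ge0 // ltW.
move: h; move: (eps ^+ 3) => e; nra.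
Qed.

Lemma mu_radius_arith (g : R) : 0 <= g -> 6 * eps ^+ 3 * g <= 2 * eps * g / 2.
Proof.
move=> g0; have e0 := eps0; have e2 := eps2_le.
have -> : 6 * eps ^+ 3 * g = (eps * g) * (6 * eps ^+ 2) by ring.
have -> : 2 * eps * g / 2 = (eps * g) * 1 by field.
by rewrite ler_wpM2l ?mulr_ge0 ?(ltW e0) //; lra.
Qed.

Lemma gap_radius_arith (g : R) : 0 <= g -> 4 * (2 * eps * g) <= g.
Proof. by move=> g0; have e8 := eps8; rewrite (_ : 4 * _ = 8 * eps * g) ?ler_piMl //; ring. Qed.

Lemma outside_arith (D x : R) : 0 <= x -> D <= 2 * (6 * eps ^+ 3 * x) -> 5 * (D / eps) <= x.
Proof.
move=> x0 h; have e0 := eps0; have e2 := eps2_le.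
rewrite mulrA ler_pdivrMr //.
have k : 60 * eps ^+ 3 * x <= x * eps.
  have -> : 60 * eps ^+ 3 * x = (x * eps) * (60 * eps ^+ 2) by ring.
  by rewrite ler_piMr ?mulr_ge0 ?(ltW e0) //; lra.
lra.
Qed.

Lemma third_far (d r x z : R) : z <= 3 * r -> 4 * r <= x -> x <= d + z -> z / 3 <= d.
Proof. lra. Qed.

Lemma third_near (d s z : R) : 0 <= s -> s <= 3 * z -> z <= d + s / 8 -> z / 3 <= d.
Proof. lra. Qed.

Lemma half_disc (d r m x : R) : r <= x -> m <= r / 2 -> x <= d + m -> r / 2 <= d.
Proof. lra. Qed.

Lemma half_far (d r x w : R) : 0 <= r -> 4 * r <= x -> w <= 2 * r -> x <= w + d -> r / 2 <= d.
Proof. lra. Qed.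

Lemma outside_far (d s t w x : R) : 0 <= s -> t <= s -> w <= s -> 5 * s <= x -> x <= w + d -> t / 2 <= d.
Proof. lra. Qed.

Lemma sqrt2_arith (w r : R) : 0 <= r -> 0 <= w -> w ^+ 2 <= 2 * r ^+ 2 -> w <= 2 * r.
Proof. by move=> r0 w0 h; rewrite leNgt; apply/negP => h'; nra. Qed.

Lemma thirds_arith (k l x d : R) : 24 * k <= l -> 0 <= k -> x / 3 * d <= k -> x * d <= l.
Proof.
move=> h k0 h'; have E : x * d = 3 * (x / 3 * d) by field.
by rewrite E; lra.
Qed.

Lemma disjoint_arith (x r r' w w' : R) : 0 <= r -> 0 <= r' -> r + r' <= 4 * eps * x -> 0 <= x ->
  w <= 2 * r -> x <= w + w' -> r' <= w'.
Proof.
move=> r0 r0' h x0 wr xw; have e8 := eps8; have : 4 * eps * x <= 2^-1 * x by rewrite ler_wpM2r //; lra.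
lra.
Qed.

Lemma six_arith (K a b : R) : 0 <= K -> 0 <= a -> a <= b -> K * a <= 6 * K * b.
Proof.
move=> K0 a0 ab; rewrite [6 * K]mulrC -mulrA ler_wpM2l //; lra.
Qed.

Lemma six_arith2 (K a a' b : R) : 0 <= K -> 0 <= a -> 0 <= a' -> a <= b -> a' <= b -> K * a + K * a' <= 6 * K * b.
Proof.
move=> K0 a0 a0' ab ab'; rewrite -mulrDr [6 * K]mulrC -mulrA ler_wpM2l //; lra.
Qed.

Lemma double_arith (s r : R) : 0 <= r -> s <= 4 * eps * r -> 2 * s <= r.
Proof.
move=> r0 h; have : 4 * eps * r <= 2^-1 * r by rewrite ler_wpM2r //; have := eps8; lra.
lra.
Qed.

Lemma exterior_arith (B d x y c : R) : 0 <= B -> d <= 2 * B -> c <= B -> B + 2 * B / eps <= x -> x <= y + c ->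
  d / eps <= y.
Proof.
move=> B0 dB cB h h'; have : d / eps <= 2 * B / eps by rewrite ler_wpM2r // invr_ge0 ltW.
lra.
Qed.

Lemma quarter_cube (x : R) : x <= 512^-1 -> 4 * x <= 1.
Proof. lra. Qed.

Lemma halves_arith (k t d : R) : t / 2 * d <= k -> t * d <= 2 * k.
Proof.
move=> h; have E : t * d = 2 * (t / 2 * d) by field.
by rewrite E; lra.
Qed.

Lemma regroup_arith (k al s d : R) : 4 * k / al * (d / s) = 2 * (2 * k / (al * s)) * d.
Proof.
rewrite invfM; move: al^-1 s^-1 => a b.
have -> : 4 * k = 2 * 2 * k :> R by congr (_ * _); rewrite -natrM.
ring.
Qed.

Lemma seg_ball (z z' c : R * R) (s t : R) : 0 <= t <= 1 -> modulus (z - c) <= s -> modulus (z' - c) <= s ->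
  modulus (seg z z' t - c) <= s.
Proof.
move=> /andP[t0 t1] h h'.
have -> : seg z z' t - c = (1 - t) *: (z - c) + t *: (z' - c).
  have gen (V : lmodType R) (a b : V) : (1 - t) *: a + t *: b = a + t *: (b - a).
    by rewrite scalerBl scale1r scalerBr [RHS]addrA addrAC.
  by rewrite gen opprB addrA subrK /seg addrAC.
apply: le_trans (modulusD _ _) _; rewrite !modulusZ !ger0_norm ?subr_ge0 //.
have h1 : (1 - t) * modulus (z - c) <= (1 - t) * s by rewrite ler_wpM2l ?subr_ge0.
have h2 : t * modulus (z' - c) <= t * s by rewrite ler_wpM2l.
by apply: le_trans (lerD h1 h2) _; rewrite -mulrDl subrK mul1r.
Qed.

End ClusterArithmetic.

(** * Clusters of points and the tree that they form *)

Section Clusters.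
Context {R : realType} (C L : finType) (a0 : C) (par : C -> C) (dp : C -> nat) (compL : L -> C)
  (pos : (C + L)%type -> R[i]) (eps : R).
Notation Pt := (C + L)%type.
Implicit Types (S : {set Pt}) (p q w : Pt) (a b : C).

(* [inl a] is the node joining the component [a] to its parent; the point
   [inl a0] is not used. *)
Definition pcomp p : C := match p with inl a => par a | inr l => compL l end.

Definition full a : {set Pt} := [set p | (p != inl a0) && (pcomp p == a)]%SET.

Context (par_lt : forall a, a != a0 -> (dp (par a) < dp a)%N)
  (par0 : par a0 = a0) (full2 : forall a, (1 < #|full a|)%N)
  (pos_inj : forall p q, p != inl a0 -> q != inl a0 -> pcomp p = pcomp q -> pos p = pos q -> p = q)
  (eps0 : 0 < eps) (eps8 : 8 * eps <= 1).

(** Small enough that the gluing parameters stay below [4 eps] ([esupp_diam], [gam_arith]), large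
    enough that [4 eps ^ 3 (2 + mu^-1) <= 1] ([radius_arith]). *)
Definition mu : R := 6 * eps ^+ 3.

Definition pdist p q : R := absC (pos p - pos q).

(* The vertices of the model tree are the clusters. A cluster strictly inside
   [full a] hangs from the least cluster that strictly contains it, and [full a]
   from the least cluster of [par a] containing the node of [a]. *)
Definition cluster S : bool := (1 < #|S|)%N && [exists a, (S \subset full a) &&
  [forall w in S, forall w' in S, forall q in full a :\: S, pdist w w' <= mu * pdist w q]].

Definition vertex : finType := {S : {set Pt} | cluster S}.
Implicit Types (W : vertex).

Definition rep S : Pt := if [pick p in S] is Some p then p else inl a0.

Lemma rep_in S : S != finset.set0 -> rep S \in S.
Proof. by rewrite /rep; case: pickP => // S0; case/set0Pn => p; rewrite S0. Qed.

Definition vcomp W : C := pcomp (rep (val W)).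

Lemma card_gt1_neq0 S : (1 < #|S|)%N -> S != finset.set0.
Proof. by move=> S1; rewrite -card_gt0 (ltn_trans _ S1). Qed.

Lemma vertex_card W : (1 < #|val W|)%N.
Proof. by case: W => S /= /andP[]. Qed.

Lemma vertex_neq0 W : val W != finset.set0.
Proof. exact: card_gt1_neq0 (vertex_card W). Qed.

Lemma vertex_rep W : rep (val W) \in val W.
Proof. exact: rep_in (vertex_neq0 W). Qed.

Lemma vertexP W : (val W \subset full (vcomp W)) /\
  forall w w' q, w \in val W -> w' \in val W -> q \in full (vcomp W) -> q \notin val W ->
    pdist w w' <= mu * pdist w q.
Proof.
have rW := vertex_rep W; rewrite /vcomp.
case: W rW => S /= /andP[S1 /existsP[a /andP[Sa H]]] rS.
have -> : pcomp (rep S) = a by have := fintype.subsetP Sa _ rS; rewrite inE => /andP[_ /eqP].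
split=> // w w' q wS w'S qa qS; have := H.
move=> /forallP/(_ w)/implyP/(_ wS)/forallP/(_ w')/implyP/(_ w'S)/forallP/(_ q)/implyP; apply.
by rewrite inE qS.
Qed.

Lemma vertex_comp W p : p \in val W -> p != inl a0 /\ pcomp p = vcomp W.
Proof. by have [/fintype.subsetP sW _] := vertexP W; move=> /sW; rewrite inE => /andP[? /eqP]. Qed.

Lemma cluster_full a : cluster (full a).
Proof.
rewrite /cluster full2 /=; apply/existsP; exists a; rewrite subxx /=.
by apply/forallP => w; apply/implyP => _; apply/forallP => w'; apply/implyP => _;
  apply/forallP => q; rewrite finset.setDv inE.
Qed.

Definition vfull a : vertex := exist _ (full a) (cluster_full a).

Lemma vcomp_full a : vcomp (vfull a) = a.
Proof. by have := vertex_rep (vfull a); rewrite inE => /andP[_ /eqP]. Qed.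

Lemma full_inj : injective full.
Proof.
move=> a b E; have := vcomp_full a; have := vcomp_full b.
by rewrite /vcomp /= E => -> ->.
Qed.

Lemma pdistC p q : pdist p q = pdist q p.
Proof. exact: absCB. Qed.

Lemma pdist_ge0 p q : 0 <= pdist p q.
Proof. exact: absC_ge0. Qed.

Lemma pdist_tri p q w : pdist p q <= pdist p w + pdist w q.
Proof. exact: absC_tri. Qed.

Lemma pdistpp p : pdist p p = 0.
Proof. by rewrite /pdist subrr absC0. Qed.

Lemma mu0 : 0 < mu.
Proof. by rewrite mulr_gt0 // exprn_gt0. Qed.

Lemma mu_le : mu <= 64^-1.
Proof. by apply: mu_arith. Qed.

Lemma pdist_gt0 a p q : p \in full a -> q \in full a -> p != q -> 0 < pdist p q.
Proof.
rewrite !inE => /andP[p0 /eqP pa] /andP[q0 /eqP qa] pq.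
rewrite absC_gt0 subr_eq0; apply: contraNneq pq => e; apply/eqP; apply: pos_inj => //.
by rewrite pa qa.
Qed.

(* Two points of a cluster are much closer to each other than to any other
   point, so overlapping clusters are nested. *)
Lemma laminar W W' p : p \in val W -> p \in val W' ->
  (val W \subset val W') \/ (val W' \subset val W).
Proof.
move=> pW pW'; have [_ ca] := vertex_comp pW; have [_ ca'] := vertex_comp pW'.
have [sW dW] := vertexP W; have [sW' dW'] := vertexP W'; rewrite -ca in sW dW; rewrite -ca' in sW' dW'.
case: (boolP (val W \subset val W')) => [|/fintype.subsetPn[q qW qW']]; first by left.
case: (boolP (val W' \subset val W)) => [|/fintype.subsetPn[q' q'W' q'W]]; first by right.
exfalso.
have h1 := dW _ _ _ pW qW (fintype.subsetP sW' _ q'W') q'W.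
have h2 := dW' _ _ _ pW' q'W' (fintype.subsetP sW _ qW) qW'.
have pq : 0 < pdist p q.
  apply: (@pdist_gt0 (pcomp p)); [exact: (fintype.subsetP sW)|exact: (fintype.subsetP sW)|].
  by apply: contraNneq qW' => <-.
exact: separation_arith pq mu_le (pdist_ge0 _ _) h1 h2.
Qed.

(** From the parent component a full cluster is seen as a single point, the node of its
    component. *)
Definition supp W : {set Pt} := if W == vfull (vcomp W) then [set inl (vcomp W)]%SET else val W.

Definition psup S : vertex := [arg min_(W < vfull (pcomp (rep S)) | S \proper val W) #|val W|].

Definition inner S : Prop := [/\ S != finset.set0, S \subset full (pcomp (rep S)) & S != full (pcomp (rep S))].

Lemma psupP S : inner S -> S \proper val (psup S) /\
  forall W, S \proper val W -> val (psup S) \subset val W.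
Proof.
move=> [S0 Sa Sn]; rewrite /psup; case: arg_minnP => [|W SW Wmin].
  by rewrite finset.properEneq Sn.
split=> // W' SW'; have rS := rep_in S0.
have [//|h] := laminar (fintype.subsetP (proper_sub SW) _ rS) (fintype.subsetP (proper_sub SW') _ rS).
have /eqP : val W' == val W by rewrite eqEcard h Wmin.
by move=> ->.
Qed.

Lemma singleton_inner p : p != inl a0 -> inner [set p]%SET.
Proof.
move=> p0; have r : rep [set p]%SET = p by apply/finset.set1P; apply: rep_in; apply/set0Pn; exists p; rewrite inE.
rewrite /inner r; split.
- by apply/set0Pn; exists p; rewrite inE.
- by rewrite finset.sub1set inE p0 eqxx.
by apply: contraTneq (full2 (pcomp p)) => <-; rewrite cards1.
Qed.

Lemma supp_full a : supp (vfull a) = [set inl a]%SET.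
Proof. by rewrite /supp vcomp_full eqxx. Qed.

Lemma supp_inner W : W != vfull a0 -> inner (supp W).
Proof.
rewrite /supp; case: (eqVneq W (vfull (vcomp W))) => [e|Wn] W0.
  by apply: singleton_inner; apply: contraNneq W0 => -[c]; rewrite e c.
have [sW _] := vertexP W; split; [exact: vertex_neq0|exact: sW|].
by apply: contraNneq Wn => e; apply/eqP/val_inj.
Qed.

Definition vpar W : vertex := psup (supp W).
Definition lat (l : L) : vertex := psup [set inr l]%SET.

(** A lexicographic rank: first the depth of the component, then the cluster size, larger clusters
    being nearer to the root. The factor [#|Pt| + 1] lets the depth dominate. *)
Definition vrank W : nat := (dp (vcomp W) * #|{: Pt}|.+1 + (#|{: Pt}| - #|val W|))%N.

Lemma psup_comp S : inner S -> vcomp (psup S) = pcomp (rep S).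
Proof.
move=> iS; have [h _] := psupP iS; have [S0 _ _] := iS.
by have [_] := vertex_comp (fintype.subsetP (proper_sub h) _ (rep_in S0)).
Qed.

Lemma rep1 p : rep [set p]%SET = p.
Proof. by apply/finset.set1P; apply: rep_in; apply/set0Pn; exists p; rewrite inE. Qed.

Lemma vpar_rank W : W != vfull a0 -> (vrank (vpar W) < vrank W)%N.
Proof.
move=> W0; have iS := supp_inner W0; have [h _] := psupP iS.
have cW := psup_comp iS; rewrite /vrank /vpar cW.
have cle (S : {set Pt}) : (#|S| <= #|{: Pt}|)%N by exact: max_card.
move: h cW; rewrite /supp; case: eqVneq => [e|Wn] h cW.
  rewrite rep1 /=; have : (dp (par (vcomp W)) < dp (vcomp W))%N.
    by apply: par_lt; apply: contraNneq W0 => c0; rewrite e c0.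
  set x := dp _; set y := dp _ => xy.
  apply: (@leq_trans (x.+1 * #|{: Pt}|.+1)); last first.
    by apply: leq_trans (leq_addr _ _); rewrite leq_mul2r xy orbT.
  by rewrite mulSn addnC ltn_add2r ltnS leq_subr.
rewrite ltn_add2l; apply: ltn_sub2l; last exact: proper_card.
exact: leq_trans (proper_card h) (cle _).
Qed.

Notation edge_t := (vertex + L)%type.
Implicit Types (e : edge_t).

(** The chosen points inside the disc that the edge cuts out at its negative end. *)
Definition esupp e : {set Pt} := match e with inl W => supp W | inr l => [set inr l]%SET end.

(** Membership of [e] in the set [W^+]; the root edge has no negative end. *)
Definition child e W : bool := (e != inl (vfull a0)) && (psup (esupp e) == W).

Lemma esupp_inner e : e != inl (vfull a0) -> inner (esupp e).
Proof.
case: e => [W|l] e0 /=; first by apply: supp_inner; apply: contraNneq e0 => ->.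
exact: singleton_inner.
Qed.

Lemma child_proper e W : child e W -> esupp e \proper val W.
Proof. by case/andP=> /esupp_inner/psupP[h _] /eqP <-. Qed.

Lemma child_neq0 e W : child e W -> esupp e != finset.set0.
Proof. by case/andP=> /esupp_inner[]. Qed.

Lemma child_comp e W p : child e W -> p \in esupp e -> p != inl a0 /\ pcomp p = vcomp W.
Proof. by move=> /child_proper/proper_sub/fintype.subsetP h /h; exact: vertex_comp. Qed.

Lemma child_min e W W' : child e W -> esupp e \proper val W' -> val W \subset val W'.
Proof. by case/andP=> /esupp_inner/psupP[_ h] /eqP <-; exact: h. Qed.

Lemma esupp_cases e : (exists p, esupp e = [set p]%SET) \/ exists W, e = inl W /\ esupp e = val W /\ W != vfull (vcomp W).
Proof.
case: e => [W|l] /=; last by left; exists (inr l).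
rewrite /supp; case: eqVneq => [e|Wn]; first by left; exists (inl (vcomp W)).
by right; exists W.
Qed.

Lemma esupp_inj e e' : esupp e = esupp e' -> e = e'.
Proof.
case: e => [W|l]; case: e' => [W'|l'] /=; rewrite /supp.
- case: eqVneq => [e|Wn]; case: eqVneq => [e'|Wn'].
  + by move=> /finset.set1_inj [c]; rewrite e e' c.
  + by move=> h; have := vertex_card W'; rewrite -h cards1.
  + by move=> h; have := vertex_card W; rewrite h cards1.
  + by move=> /val_inj ->.
- case: eqVneq => [e|Wn] h; first by have /finset.set1_inj := h.
  by have := vertex_card W; rewrite h cards1.
- case: eqVneq => [e|Wn] h; first by have /finset.set1_inj := h.
  by have := vertex_card W'; rewrite -h cards1.
- by move=> /finset.set1_inj [->].
Qed.

Lemma esupp_nested e e' p : p \in esupp e -> p \in esupp e' ->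
  (esupp e \subset esupp e') \/ (esupp e' \subset esupp e).
Proof.
move=> pe pe'; have [[q E]|[W [_ [E _]]]] := esupp_cases e.
  by left; apply/fintype.subsetP => w; rewrite E inE => /eqP ->; move: pe; rewrite E inE => /eqP <-.
have [[q E']|[W' [_ [E' _]]]] := esupp_cases e'.
  by right; apply/fintype.subsetP => w; rewrite E' inE => /eqP ->; move: pe'; rewrite E' inE => /eqP <-.
by rewrite E E'; apply: (@laminar W W' p); rewrite -?E -?E'.
Qed.

(** Supports that meet are nested. If the inclusion were proper, the larger support would be a
    cluster strictly inside [W], whereas minimality of [W] above the smaller one makes [W] a subset
    of it. *)
Lemma child_disjoint e e' W p : child e W -> child e' W -> p \in esupp e -> p \in esupp e' -> e = e'.
Proof.
have H f f' : child f W -> child f' W -> esupp f \subset esupp f' -> f = f'.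
  move=> cf cf' sf; apply: esupp_inj; apply/eqP; rewrite finset.eqEsubset sf /=.
  apply: contraT => nf; have pf : esupp f \proper esupp f' by rewrite properE sf.
  have [[q E]|[W' [_ [E _]]]] := esupp_cases f'.
    have := proper_card pf; rewrite E cards1 ltnS leqn0 cards_eq0.
    by rewrite (negbTE (child_neq0 cf)).
  have := child_proper cf'; rewrite E => h; rewrite E in pf.
  by have := proper_sub_trans h (child_min cf pf); rewrite fintype.properxx.
move=> ce ce' pe pe'; have [h|h] := esupp_nested pe pe'; first exact: H.
by apply/esym; exact: H.
Qed.

(** The child through [p] is a largest cluster strictly inside [W] that contains [p], or, if there
    is none, the point [p] itself, as a leaf or as the full cluster behind a node. *)
Lemma child_cover W p : p \in val W -> exists e, child e W && (p \in esupp e).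
Proof.
move=> pW; pose Q W' := (p \in val W') && (val W' \proper val W).
have [/existsP[W1 QW1]|none] := boolP [exists W', Q W'].
  pose W2 := [arg max_(W' > W1 | Q W') #|val W'|].
  have [/andP[pW2 W2W] W2max] : Q W2 /\ forall W', Q W' -> (#|val W'| <= #|val W2|)%N.
    by rewrite /W2; case: arg_maxnP.
  have W2n : W2 != vfull (vcomp W2).
    apply: contraTneq W2W => E; rewrite properE negb_and E.
    have [sW _] := vertexP W; have [_ c1] := vertex_comp pW; have [_ c2] := vertex_comp pW2.
    by rewrite /= -c2 c1 sW orbT.
  have sE : supp W2 = val W2 by rewrite /supp (negbTE W2n).
  have e0 : inl W2 != inl (vfull a0) :> edge_t.
    by apply: contraNneq W2n => -[->]; rewrite vcomp_full.
  exists (inl W2); rewrite /= sE pW2 andbT /child e0 /= sE.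
  have iS := esupp_inner e0; rewrite /= sE in iS; have [h1 h2] := psupP iS.
  have h3 := h2 _ W2W; apply/eqP/val_inj/eqP; rewrite finset.eqEsubset h3 /=.
  apply: contraT => h4; have : Q (psup (val W2)).
    by rewrite /Q (fintype.subsetP (proper_sub h1) _ pW2) properE h3.
  by move=> /W2max; rewrite leqNgt proper_card.
have [p0 pc] := vertex_comp pW.
have [e [e0 eE]] : exists e, e != inl (vfull a0) /\ esupp e = [set p]%SET.
  case: p pW p0 pc {Q none} => [a|l] pW p0 pc; last by exists (inr l).
  exists (inl (vfull a)); rewrite /= supp_full; split=> //.
  by apply: contraNneq p0 => -[/full_inj ->].
exists e; rewrite eE inE eqxx andbT /child e0 eE /=.
have iS := singleton_inner p0; have [h1 h2] := psupP iS.
have pr : [set p]%SET \proper val W.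
  by rewrite properEcard finset.sub1set pW cards1 vertex_card.
have h3 := h2 _ pr; apply/eqP/val_inj/eqP; rewrite finset.eqEsubset h3 /=.
apply: contraT => h4; case/negP: none; apply/existsP; exists (psup [set p]%SET).
by rewrite /Q (fintype.subsetP (proper_sub h1)) ?inE // properE h3.
Qed.

Definition diam S : R := \big[Num.max/0]_(x : Pt * Pt | (x.1 \in S) && (x.2 \in S)) pdist x.1 x.2.

Lemma le_diam S p q : p \in S -> q \in S -> pdist p q <= diam S.
Proof.
move=> pS qS; apply: (@le_bigmax_cond _ _ _ 0 (p, q) _ (fun x => pdist x.1 x.2)).
by rewrite /= pS qS.
Qed.

Lemma diam_le S (x : R) : 0 <= x -> (forall p q, p \in S -> q \in S -> pdist p q <= x) -> diam S <= x.
Proof. by move=> x0 H; apply: bigmax_le => // -[p q] /andP[]; exact: H. Qed.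

Lemma diam_ge0 S : 0 <= diam S.
Proof. exact: bigmax_ge_id. Qed.

Lemma diam_gt0 W : 0 < diam (val W).
Proof.
have [sW _] := vertexP W; have /card_gt1P[p [q [pW qW pq]]] := vertex_card W.
apply: lt_le_trans (le_diam pW qW); apply: pdist_gt0 pq; exact: (fintype.subsetP sW).
Qed.

Lemma esupp_sep e W x y q : child e W -> x \in esupp e -> y \in esupp e ->
  q \in full (vcomp W) -> q \notin esupp e -> pdist x y <= mu * pdist x q.
Proof.
move=> ce xe ye qW qe; have [[p E]|[W' [_ [E _]]]] := esupp_cases e.
  move: xe ye; rewrite E !inE => /eqP -> /eqP ->.
  by rewrite pdistpp mulr_ge0 ?pdist_ge0 // ltW // mu0.
have [_ H] := vertexP W'; have [_ cx] := child_comp ce xe.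
rewrite E in xe ye qe; have [_ cx'] := vertex_comp xe.
by apply: H => //; rewrite -cx' cx.
Qed.

Definition kids W : {set edge_t} := [set e | child e W]%SET.

Lemma child_full e W p : child e W -> p \in esupp e -> p \in full (vcomp W).
Proof. by move=> ce /(child_comp ce)[p0 pc]; rewrite inE p0 pc eqxx. Qed.

(* Since [S] is not a cluster, some child outside [S] is close to it; adding
   that child multiplies the diameter by at most [2 + mu^-1]. *)
Lemma growth W t S e (D : R) :
  (#|kids W| - #|[set f in kids W | esupp f \subset S]%SET| <= t)%N ->
  S \subset val W -> (forall f p, child f W -> p \in S -> p \in esupp f -> esupp f \subset S) ->
  child e W -> esupp e \proper S -> 0 <= D -> (forall x y, x \in S -> y \in S -> pdist x y <= D) ->
  forall x y, x \in val W -> y \in val W -> pdist x y <= D * (2 + mu^-1) ^+ t.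
Proof.
have G2 := growth_ge mu0; set G := 2 + _ in G2 *.
have G1 : 1 <= G by apply: le_trans G2; rewrite ler1n.
elim: t S D => [|t IH] S D kt SW cl ce eS D0 HD x y xW yW.
  rewrite expr0 mulr1.
  have kS : kids W \subset [set f in kids W | esupp f \subset S]%SET.
    rewrite -(geq_leqif (subset_leqif_card _)); first by rewrite -subn_eq0 -leqn0.
    by apply/fintype.subsetP => f; rewrite inE => /andP[].
  have inS p : p \in val W -> p \in S.
    move=> /child_cover[f /andP[cf pf]].
    have := fintype.subsetP kS f; rewrite !inE cf => /(_ isT) /= h; exact: (fintype.subsetP h).
  by apply: HD; apply: inS.
have [WS|/fintype.subsetPn[p0 p0W p0S]] := boolP (val W \subset S).
  apply: le_trans (HD _ _ (fintype.subsetP WS _ xW) (fintype.subsetP WS _ yW)) _.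
  by rewrite ler_peMr // exprn_ege1.
have nclS : ~~ cluster S.
  apply/negP => cS; have := child_min ce (W' := exist _ S cS) eS.
  by move=> /fintype.subsetP/(_ _ p0W); rewrite /= (negbTE p0S).
have S1 : (1 < #|S|)%N.
  by apply: leq_ltn_trans (proper_card eS); rewrite card_gt0 (child_neq0 ce).
have [sW dW] := vertexP W.
move: nclS; rewrite /cluster S1 /= negb_exists => /forallP/(_ (vcomp W)).
rewrite (fintype.subset_trans SW sW) /= negb_forall_in => /exists_inP[w wS].
rewrite negb_forall_in => /exists_inP[w' w'S]; rewrite negb_forall_in => /exists_inP[q].
rewrite inE => /andP[qS qa]; rewrite -ltNge => lt.
have wW := fintype.subsetP SW _ wS; have w'W := fintype.subsetP SW _ w'S.
have qW : q \in val W.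
  by apply: contraLR lt => qW; rewrite -leNgt; exact: dW.
have [f /andP[cf qf]] := child_cover qW.
have muD : mu * pdist w q <= D by apply: le_trans (ltW lt) (HD _ _ wS w'S).
have wf : w \notin esupp f.
  by apply: contra qS => wf; exact: (fintype.subsetP (cl _ _ cf wS wf)).
have wa := fintype.subsetP sW _ wW.
have m0 := mu0; have m1 : mu <= 1 by apply: le_trans mu_le _; rewrite invf_le1 ?ler1n.
have DG : D <= D * G by rewrite ler_peMr.
have D2 : 2 * D <= D * G by rewrite mulrC ler_wpM2l.
have qx z : z \in esupp f -> pdist q z <= mu * pdist w q.
  by move=> zf; rewrite [pdist w q]pdistC; exact: esupp_sep cf qf zf wa wf.
have mixed z z' : z \in S -> z' \in esupp f -> pdist z z' <= D * G.
  move=> zS z'f; apply: le_trans (growth_arith m0 (pdist_ge0 w q) muD).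
  apply: le_trans (pdist_tri z z' q) _; rewrite lerD ?qx //.
  by apply: le_trans (pdist_tri z q w) _; rewrite lerD2r HD.
have both z z' : z \in esupp f -> z' \in esupp f -> pdist z z' <= D * G.
  move=> zf z'f; apply: le_trans (pdist_tri z z' q) _; apply: le_trans D2.
  by rewrite mulrDl !mul1r lerD // ?[pdist z q]pdistC; apply: le_trans (qx _ _) muD.
rewrite exprS mulrA; apply: (IH (S :|: esupp f)) => //.
- rewrite -ltnS; apply: leq_trans kt; apply: ltn_sub2l; last first.
    apply: proper_card; rewrite properE; apply/andP; split.
      apply/fintype.subsetP => g; rewrite !inE => /andP[-> /= h].
      exact: fintype.subset_trans h (finset.subsetUl _ _).
    apply/fintype.subsetPn; exists f; rewrite !inE cf /= ?finset.subsetUr //.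
    by apply/negP => /fintype.subsetP/(_ _ qf); rewrite (negbTE qS).
  apply: proper_card; rewrite properE; apply/andP; split.
    by apply/fintype.subsetP => g; rewrite inE => /andP[].
  apply/fintype.subsetPn; exists f; rewrite !inE cf //=.
  by apply/negP => /fintype.subsetP/(_ _ qf); rewrite (negbTE qS).
- by rewrite finset.subUset SW; exact: proper_sub (child_proper cf).
- move=> g p cg; rewrite inE => /orP[pS|pf] pg.
    exact: fintype.subset_trans (cl _ _ cg pS pg) (finset.subsetUl _ _).
  by rewrite (child_disjoint cg cf pg pf) finset.subsetUr.
- exact: proper_sub_trans eS (finset.subsetUl _ _).
- exact: le_trans DG.
- move=> z z'; rewrite !inE => /orP[zS|zf] /orP[z'S|z'f].
  + exact: le_trans (HD _ _ zS z'S) DG.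
  + exact: mixed.
  + by rewrite pdistC; exact: mixed.
  + exact: both.
Qed.

Lemma kids_gt1 W : (1 < #|kids W|)%N.
Proof.
have rW := vertex_rep W; have [e /andP[ce pe]] := child_cover rW.
have := child_proper ce; rewrite properE => /andP[_ /fintype.subsetPn[q qW qe]].
have [f /andP[cf qf]] := child_cover qW.
apply/card_gt1P; exists e, f; rewrite !inE; split=> //.
by apply: contraNneq qe => ->.
Qed.

(** Let [f] be the child containing [q]. The union of [e] and [f] has diameter at most twice the
    distance from the representative of [e] to [q]; [growth] starts from it with two children
    already used, which explains the exponent [#|kids W| - 2]. *)
Lemma child_distance e W q : child e W -> q \in val W -> q \notin esupp e ->
  diam (val W) <= 2 * pdist (rep (esupp e)) q * (2 + mu^-1) ^+ (#|kids W| - 2).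
Proof.
move=> ce qW qe; have [f /andP[cf qf]] := child_cover qW.
have c_e := rep_in (child_neq0 ce); set c := rep _ in c_e *.
have ef : e != f by apply: contraNneq qe => ->.
have cf' : c \notin esupp f by apply: contra ef => cf'; rewrite (child_disjoint ce cf c_e cf').
have x0 := pdist_ge0 c q; have m0 := mu0.
have m1 : mu * pdist c q <= 2^-1 * pdist c q.
  by rewrite ler_wpM2r //; apply: le_trans mu_le _; rewrite lef_pV2 ?posrE ?ler_nat.
have G2 := growth_ge m0.
apply: diam_le; first by rewrite mulr_ge0 ?mulr_ge0 ?exprn_ge0 ?(le_trans _ G2).
move=> p p' pW p'W; pose S := esupp e :|: esupp f.
have ex z : z \in esupp e -> pdist c z <= 2^-1 * pdist c q.
  by move=> ze; apply: le_trans m1; apply: esupp_sep ce c_e ze (child_full cf qf) qe.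
have fx z : z \in esupp f -> pdist q z <= 2^-1 * pdist c q.
  move=> zf; apply: le_trans m1; rewrite [pdist c q]pdistC.
  exact: esupp_sep cf qf zf (child_full ce c_e) cf'.
have half z z' w : pdist w z <= 2^-1 * pdist c q -> pdist w z' <= 2^-1 * pdist c q ->
    pdist z z' <= 2 * pdist c q.
  move=> h1 h2; have := pdist_tri z z' w; rewrite [pdist z w]pdistC.
  exact: half_arith.
have mixed z z' : z \in esupp e -> z' \in esupp f -> pdist z z' <= 2 * pdist c q.
  move=> /ex h1 /fx h2; have := pdist_tri z z' c; have := pdist_tri c z' q; rewrite [pdist z c]pdistC.
  exact: mixed_arith.
apply: (@growth W _ S e) => //.
- apply: leq_sub2l; apply/card_gt1P; exists e, f.
  by rewrite !inE ce cf finset.subsetUl finset.subsetUr ef.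
- by rewrite finset.subUset !proper_sub ?child_proper.
- move=> g z cg; rewrite inE => /orP[ze|zf] zg.
    by rewrite (child_disjoint cg ce zg ze) finset.subsetUl.
  by rewrite (child_disjoint cg cf zg zf) finset.subsetUr.
- rewrite properE finset.subsetUl /=; apply/fintype.subsetPn; exists q => //.
  by rewrite inE qf orbT.
- by rewrite mulr_ge0.
- move=> z z'; rewrite !inE => /orP[ze|zf] /orP[z'e|z'f].
  + exact: half (ex _ ze) (ex _ z'e).
  + exact: mixed.
  + by rewrite pdistC; exact: mixed.
  + exact: half (fx _ zf) (fx _ z'f).
Qed.

Definition centre e : R[i] := pos (rep (esupp e)).
Definition vcentre W : R[i] := pos (rep (val W)).
Definition vsize W : R := diam (val W) / eps.

(** For a child [e] of [W] the range is nonempty and its distances are at most the diameter, so the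
    initial value of the minimum does not decide it. *)
Definition gap e : R := let W := psup (esupp e) in
  \big[Num.min/diam (val W)]_(q in val W :\: esupp e) pdist (rep (esupp e)) q.

(** With this factor two radii add up to at most [4 eps] times the distance of the centres, which is
    the condition with [tau = 4 eps]. *)
Definition radius e : R := 2 * eps * gap e.

Lemma vsize_gt0 W : 0 < vsize W.
Proof. by rewrite divr_gt0 ?diam_gt0. Qed.

Lemma child_psup e W : child e W -> psup (esupp e) = W.
Proof. by case/andP => _ /eqP. Qed.

Lemma gap_le e W q : child e W -> q \in full (vcomp W) -> q \notin esupp e ->
  gap e <= pdist (rep (esupp e)) q.
Proof.
move=> ce qa qe; rewrite /gap (child_psup ce); have [qW|qW] := boolP (q \in val W).
  by apply: (@bigmin_le_cond _ _ _ _ q _ (fun q => pdist _ q)); rewrite inE qe.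
(* For [q] outside [W] the cluster property bounds the diameter of [W] by [2 mu] times the distance
   to [q], so comparison with the diameter is enough. *)
apply: le_trans (bigmin_le_id _ _ _ _) _.
have cW := fintype.subsetP (proper_sub (child_proper ce)) _ (rep_in (child_neq0 ce)).
have [_ H] := vertexP W.
apply: diam_le; first exact: pdist_ge0.
set c := rep _ in cW *; move=> p p' pW p'W.
have h1 := H c p q cW pW qa qW; have h2 := H c p' q cW p'W qa qW.
have m0 := mu0; have x0 := pdist_ge0 c q; have m1 := mu_le.
have m2 : mu * pdist c q <= 64^-1 * pdist c q by rewrite ler_wpM2r.
apply: le_trans (pdist_tri p p' c) _; rewrite pdistC.
exact: quarter_arith m2 h1 h2.
Qed.

Lemma le_gap e W (x : R) : child e W -> x <= diam (val W) ->
  (forall q, q \in val W -> q \notin esupp e -> x <= pdist (rep (esupp e)) q) -> x <= gap e.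
Proof.
move=> ce xd H; rewrite /gap (child_psup ce); apply: le_bigmin => // q.
by rewrite inE => /andP[qe qW]; exact: H.
Qed.

Lemma gap_gt0 e W : child e W -> 0 < gap e.
Proof.
move=> ce; have cf := child_full ce (rep_in (child_neq0 ce)).
have [q qW qe] : exists2 q, q \in val W & q \notin esupp e.
  by have := child_proper ce; rewrite properE => /andP[_ /fintype.subsetPn].
pose m := [arg min_(q' < q | q' \in val W :\: esupp e) pdist (rep (esupp e)) q']%O.
have [mW mmin] : m \in val W :\: esupp e /\
    forall q', q' \in val W :\: esupp e -> pdist (rep (esupp e)) m <= pdist (rep (esupp e)) q'.
  by rewrite /m; case: Order.TotalTheory.arg_minP => //; rewrite inE qe.
have [sW _] := vertexP W.
apply: (@lt_le_trans _ _ (Num.min (diam (val W)) (pdist (rep (esupp e)) m))).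
  rewrite lt_min diam_gt0 /=; move: mW; rewrite inE => /andP[me mW].
  apply: pdist_gt0 cf (fintype.subsetP sW _ mW) _.
  by apply: contraNneq me => <-; exact: rep_in (child_neq0 ce).
rewrite /gap (child_psup ce); apply: le_bigmin; first by rewrite ge_min lexx.
by move=> q' q'W; rewrite ge_min mmin ?orbT.
Qed.

Lemma gap_diam e W : child e W -> gap e <= diam (val W).
Proof. by move=> ce; rewrite /gap (child_psup ce); exact: bigmin_le_id. Qed.

Lemma esupp_radius e W p : child e W -> p \in esupp e -> pdist (rep (esupp e)) p <= mu * gap e.
Proof.
move=> ce pe; have c_e := rep_in (child_neq0 ce); have m0 := mu0.
rewrite mulrC -ler_pdivrMr //; apply: (le_gap ce).
  have := child_proper ce; rewrite properE => /andP[_ /fintype.subsetPn[q qW qe]].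
  have [sW _] := vertexP W.
  have h := esupp_sep ce c_e pe (fintype.subsetP sW _ qW) qe.
  rewrite ler_pdivrMr // mulrC; apply: le_trans h _; rewrite ler_wpM2l ?(ltW m0) //.
  by apply: le_diam => //; exact: (fintype.subsetP (proper_sub (child_proper ce))).
move=> q qW qe; rewrite ler_pdivrMr // mulrC; apply: esupp_sep ce c_e pe _ qe.
by have [sW _] := vertexP W; exact: (fintype.subsetP sW).
Qed.

(** Two points of the support are within [mu] times the distance from one of them to any outside
    point; the nearest such distance is at most [gap e] plus the offset [mu * gap e] from the
    representative. *)
Lemma esupp_diam e W : child e W -> diam (esupp e) <= 8 * eps ^+ 3 * gap e.
Proof.
move=> ce; have c_e := rep_in (child_neq0 ce); have m0 := mu0; have g0 := gap_gt0 ce.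
apply: diam_le => [|p q pe qe]; first by rewrite !mulr_ge0 // ltW // exprn_gt0.
apply: le_trans (mu_sum_arith eps0 eps8 (ltW g0)); rewrite -/mu.
have hp := esupp_radius ce pe.
have gp z : z \in val W -> z \notin esupp e -> pdist p z <= pdist (rep (esupp e)) z + mu * gap e.
  by move=> zW ze; rewrite addrC; apply: le_trans (pdist_tri p z (rep (esupp e))) _; rewrite lerD2r pdistC.
rewrite [mu * _]mulrC -ler_pdivrMr // -lerBlDr; apply: (le_gap ce).
  have := child_proper ce; rewrite properE => /andP[_ /fintype.subsetPn[z zW ze]].
  have [sW _] := vertexP W.
  have h := esupp_sep ce pe qe (fintype.subsetP sW _ zW) ze.
  apply: (@le_trans _ _ (pdist p q / mu)); first by rewrite gerBl mulr_ge0 // ltW.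
  rewrite ler_pdivrMr // mulrC; apply: le_trans h _; rewrite ler_wpM2l ?(ltW m0) //.
  by apply: le_diam => //; exact: (fintype.subsetP (proper_sub (child_proper ce))).
move=> z zW ze; have [sW _] := vertexP W.
have h := esupp_sep ce pe qe (fintype.subsetP sW _ zW) ze.
rewrite lerBlDr ler_pdivrMr // mulrC; apply: le_trans h _; rewrite ler_wpM2l ?(ltW m0) //.
exact: gp.
Qed.

Lemma radius_gt0 e W : child e W -> 0 < radius e.
Proof. by move=> ce; rewrite !mulr_gt0 // (gap_gt0 ce). Qed.

(** The distance estimate costs [2 + mu^-1] for each child beyond two, and three powers of
    [4 eps ^ 3] remain for the passage from [diam / eps] to a radius: together one power for each
    edge at [W]. *)
Lemma radius_alpha e W : child e W ->
  (4 * eps ^+ 3) ^+ (#|kids W|).+1 * vsize W <= radius e.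
Proof.
move=> ce; have k2 := kids_gt1 W; have e0 := eps0.
have -> : (#|kids W|).+1 = (#|kids W| - 2).+3 by rewrite -{1}(subnK k2) addn2.
have G2 := growth_ge mu0.
have G0 : 0 < 2 + mu^-1 by apply: lt_le_trans G2.
set k := (#|kids W| - 2)%N.
have -> : radius e = 2 * eps * gap e by [].
apply: radius_arith => //; first exact: ltW (gap_gt0 ce).
rewrite -/mu [2 * gap e]mulrC -mulrA -ler_pdivrMr ?mulr_gt0 ?exprn_gt0 //; apply: (le_gap ce).
  rewrite ler_pdivrMr ?mulr_gt0 ?exprn_gt0 // ler_peMr ?diam_ge0 //.
  apply: (@le_trans _ _ (2 * 1)); first by rewrite mulr1 ler1n.
  by rewrite ler_wpM2l // exprn_ege1 // (le_trans _ G2) // ler1n.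
move=> q qW qe.
by rewrite ler_pdivrMr ?mulr_gt0 ?exprn_gt0 // mulrC mulrAC; exact: child_distance.
Qed.

(** * The model tree, its parameters and its curve *)

Definition model_tree : rooted_tree R :=
  @tree_of R vertex L (vfull a0) vpar vrank lat vpar_rank.

Notation cR := (real_complex R).

Lemma eneg_child (e : edge model_tree) (W : vert model_tree) : (eneg e = Some W) <-> child e W.
Proof.
rewrite /child; case: e => [V|l] /=; last by split=> [[<-]|/eqP <-]; rewrite ?eqxx.
rewrite (inj_eq inl_inj); case: (eqVneq V (vfull a0)) => [_|VV] /=; first by split.
by split=> [[<-]|/eqP <-]; rewrite ?eqxx.
Qed.

Lemma epos_inl (e : edge model_tree) (W : vert model_tree) : epos e = Some W -> e = inl W.
Proof. by case: e => [V|l] //= [->]. Qed.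

Lemma model_degree (W : vert model_tree) : degree W = (#|kids W|).+1.
Proof.
rewrite /degree; have -> : [set e : edge model_tree | W \in bd e]%SET = (inl W : edge model_tree) |: kids W.
  apply/setP => e; rewrite !inE bd_orient inE; congr (_ || _).
    by case: e => [V|l] //=; rewrite (inj_eq inl_inj) (inj_eq Some_inj).
  by apply/eqP/idP => /eneg_child.
rewrite cardsU1 inE; case: (boolP (child _ _)) => // /eneg_child h.
by case: (@pos_neg _ model_tree (inl W) W).
Qed.

Lemma model_stable : stable_tree model_tree.
Proof. by move=> W; rewrite model_degree ltnS kids_gt1. Qed.

Lemma model_Eext (e : edge model_tree) :
  (e \in Eext model_tree) = (if e is inl V then V == vfull a0 else true).
Proof.
rewrite inE; case: e => [V|l] /=; last by rewrite cards1.
case: (eqVneq V (vfull a0)) => [_|VV]; first by rewrite cards1.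
by rewrite cards2 [V == _]eq_sym (par_neq vpar_rank VV).
Qed.

Lemma model_Eint (e : edge model_tree) : e \in Eint model_tree -> exists2 V, e = inl V & V != vfull a0.
Proof.
rewrite inE; case: e => [V|l] /=; last by rewrite cards1.
by case: (eqVneq V (vfull a0)) => [_|VV _]; [rewrite cards1|exists V].
Qed.

(** A full cluster hangs on a genuine node, with gluing parameter zero. For an inner cluster the
    product [edge_gam * edge_rho] is the ratio of the two cluster sizes, so that the equation of the
    curve is a change of affine coordinate. *)
Definition edge_gam (e : edge_t) : R[i] :=
  if e is inl W then if W == vfull (vcomp W) then 0 else cR (vsize W / radius e) else 0.
Definition edge_zed (e : edge_t) : R[i] :=
  let W := psup (esupp e) in (centre e - vcentre W) / cR (vsize W).
Definition edge_rho (e : edge_t) : R[i] := cR (radius e / vsize (psup (esupp e))).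

Definition model_params : params model_tree :=
  @Params R model_tree edge_gam edge_zed edge_rho.

Lemma absC_cRdiv z (x : R) : 0 < x -> absC (z / cR x) = absC z / x.
Proof. by move=> x0; rewrite absCM absCV absC_cR gtr0_norm. Qed.

Lemma cR_neq0 (x : R) : 0 < x -> cR x != 0.
Proof. by move=> x0; rewrite -absC_gt0 absC_cR gtr0_norm. Qed.

Lemma rho_abs e W : child e W -> absC (edge_rho e) = radius e / vsize W.
Proof.
move=> ce; rewrite /edge_rho (child_psup ce) absC_cR gtr0_norm //.
by rewrite divr_gt0 ?vsize_gt0 ?(radius_gt0 ce).
Qed.

Lemma zed_eq e W : child e W -> edge_zed e = (centre e - vcentre W) / cR (vsize W).
Proof. by move=> ce; rewrite /edge_zed (child_psup ce). Qed.

Lemma vsize_eps W : vsize W * eps = diam (val W).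
Proof. by rewrite /vsize divfK // gt_eqF. Qed.

Lemma gap_centres e e' W : child e W -> child e' W -> e <> e' -> gap e <= absC (centre e - centre e').
Proof.
move=> ce ce' ee'; have r' := rep_in (child_neq0 ce').
apply: (gap_le ce); first exact: child_full ce' r'.
by apply/negP => h; apply: ee'; exact: child_disjoint ce ce' h r'.
Qed.

Lemma radius_sep e e' W : child e W -> child e' W -> e <> e' ->
  radius e + radius e' <= 4 * eps * absC (centre e - centre e').
Proof.
move=> ce ce' ee'; have e0 := eps0.
have g1 := gap_centres ce ce' ee'; have g2 := gap_centres ce' ce (fun h => ee' (esym h)).
rewrite absCB in g2; rewrite /radius -mulrDr.
have -> : 4 * eps = 2 * eps * 2 :> R by rewrite mulrAC; congr (_ * _); rewrite -natrM.
by rewrite -[leRHS]mulrA ler_wpM2l ?mulr_ge0 ?(ltW e0) // mulr2n mulrDl mul1r lerD.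
Qed.

Lemma model_param_space : param_space eps (4 * eps) (fun v : vert model_tree => (4 * eps ^+ 3) ^+ degree v)
  model_params.
Proof.
have e0 := eps0; split=> /=.
- move=> W e /eneg_child ce; have s0 := vsize_gt0 W.
  rewrite (zed_eq ce) absC_cRdiv // ler_pdivrMr // mulrC vsize_eps; split.
    apply: le_diam; last exact: vertex_rep.
    exact: (fintype.subsetP (proper_sub (child_proper ce)) _ (rep_in (child_neq0 ce))).
  rewrite (rho_abs ce) ler_pdivlMr // ler_pdivrMr // model_degree (radius_alpha ce) /=.
  rewrite /radius ler_wpM2l ?mulr_ge0 ?(ltW e0) //; apply: le_trans (gap_diam ce) _.
  rewrite -vsize_eps ler_piMr ?(ltW s0) //; apply: le_trans (eps_le eps8) _.
  by rewrite invf_le1 ?ler1n.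
- move=> W e e' /eneg_child ce /eneg_child ce' ee'; have s0 := vsize_gt0 W.
  rewrite (rho_abs ce) (rho_abs ce') (zed_eq ce) (zed_eq ce') -mulrBl opprB addrA subrK.
  rewrite absC_cRdiv // -mulrDl mulrA ler_wpM2r ?invr_ge0 ?(ltW s0) //.
  exact: (radius_sep ce ce' ee').
move=> e /model_Eint[V -> V0] /=; case: eqVneq => [_|Vn].
  by rewrite absC0 mulr_ge0 // ltW.
have ce : child (inl V) (vpar V) by rewrite /child (inj_eq inl_inj) V0 eqxx.
have r0 := radius_gt0 ce; have s0 := vsize_gt0 V.
rewrite absC_cR gtr0_norm; last by rewrite divr_gt0.
rewrite ler_pdivrMr // /radius /vsize.
apply: gam_arith => //; have := esupp_diam ce.
by rewrite /= /supp (negbTE Vn).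
Qed.

(* The node of [b] through which a component [a <> b] is seen from [b]; it is
   [None] when it leads towards the root. *)
Definition toward b a : P1 R :=
  if [pick c | [&& c != a0, par c == b & fconnect par a c]] is Some c then Some (pos (inl c)) else None.

Definition seen b (x : C * P1 R) : P1 R := if x.1 == b then x.2 else toward b x.1.

Lemma dp_iter k a : (dp (iter k par a) <= dp a)%N.
Proof.
elim: k => // k IH; rewrite iterS; apply: leq_trans IH.
by have [->|h] := eqVneq (iter k par a) a0; [rewrite par0|exact: ltnW (par_lt h)].
Qed.

Lemma fconnect_dp a b : fconnect par a b -> (dp b <= dp a)%N.
Proof. by move=> h; rewrite -(iter_findex h) dp_iter. Qed.

Lemma fconnect_step a b : fconnect par a b -> b != a -> fconnect par (par a) b.
Proof.
move=> ab ba; have := iter_findex ab; case: (findex par a b) => [|k]; first by move=> /= e; rewrite e eqxx in ba.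
by rewrite iterSr => <-; exact: fconnect_iter.
Qed.

Lemma fconnect_from_root b : fconnect par a0 b -> b = a0.
Proof.
move=> h; rewrite -(iter_findex h); elim: (findex _ _ _) => // k IH.
by rewrite iterS IH par0.
Qed.

Lemma not_below_par b : b != a0 -> ~~ fconnect par (par b) b.
Proof. by move=> h; apply/negP => /fconnect_dp; rewrite leqNgt par_lt. Qed.

Lemma fconnect_root a : fconnect par a a0.
Proof.
have [m am] := ubnP (dp a); elim: m a am => // m IH a am.
have [->|h] := eqVneq a a0; first exact: connect0.
apply: connect_trans (fconnect1 _ _) (IH _ _).
by apply: leq_trans (par_lt h) _; rewrite -ltnS.
Qed.

Lemma child_unique a b c : b != a0 -> c != a0 -> par b = par c ->
  fconnect par a b -> fconnect par a c -> b = c.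
Proof.
move=> b0 c0 bc; have H b' c' i j : b' != a0 -> c' != a0 -> par b' = par c' ->
    iter i par a = b' -> iter j par a = c' -> (i < j)%N -> False.
  move=> b0' c0' bc' ib jc ij; have /negP := not_below_par c0'; apply; rewrite -bc' -jc -ib.
  by rewrite -(subnK ij) iterD iterS; exact: fconnect_iter.
move=> /iter_findex bE /iter_findex cE; case: (ltngtP (findex par a b) (findex par a c)) => h.
- by case: (H _ _ _ _ b0 c0 bc bE cE h).
- by case: (H _ _ _ _ c0 b0 (esym bc) cE bE h).
- by rewrite -bE h cE.
Qed.

Lemma toward_below b a : b != a0 -> fconnect par a b ->
  a != par b /\ toward (par b) a = Some (pos (inl b)).
Proof.
move=> b0 ab; split; first by apply: contraTneq ab => ->; exact: not_below_par.
rewrite /toward; case: pickP => [c /and3P[c0 /eqP cb ac]|/(_ b)]; last by rewrite b0 eqxx ab.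
by rewrite (child_unique c0 b0 cb ac ab).
Qed.

Lemma toward_above b a : ~~ fconnect par a b -> a != b /\ toward b a = None.
Proof.
move=> ab; split; first by apply: contraNneq ab => ->; exact: connect0.
rewrite /toward; case: pickP => // c /and3P[c0 /eqP cb ac]; case/negP: ab.
by apply: connect_trans ac _; rewrite -cb; exact: fconnect1.
Qed.

Lemma below_child b a : fconnect par a b -> a != b ->
  exists c, [/\ c != a0, par c = b & fconnect par a c].
Proof.
move=> ab nab; have ex : exists k, iter k par a == b by exists (findex par a b); rewrite iter_findex.
case: (ex_minnP ex) => -[|k] /eqP kb kmin; first by rewrite -kb eqxx in nab.
exists (iter k par a); split=> //; last exact: fconnect_iter.
apply/eqP => k0; have := kmin k; rewrite ltnn => H; suff: false by [].
by apply: H; rewrite -kb iterS k0 par0.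
Qed.

Lemma seen_below b x : b != a0 -> fconnect par x.1 b -> seen (par b) x = Some (pos (inl b)).
Proof. by move=> b0 /(toward_below b0)[h e]; rewrite /seen (negbTE h). Qed.

Lemma seen_above b x : ~~ fconnect par x.1 b -> seen b x = None.
Proof. by move=> /toward_above[h e]; rewrite /seen (negbTE h). Qed.

Definition vmap W : P1 R -> P1 R := P1_affine (cR (vsize W))^-1 (- (vcentre W / cR (vsize W))).

(** The map is defined on the disjoint union of the components; [model_point_inj] shows that it
    identifies nothing but the branches of nodes. *)
Definition model_point (x : C * P1 R) : vert model_tree -> P1 R := fun W => vmap W (seen (vcomp W) x).

Lemma vmap_Some W z : vmap W (Some z) = Some ((z - vcentre W) / cR (vsize W)).
Proof. by rewrite /vmap /=; congr Some; rewrite mulrC mulrBl. Qed.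

Lemma vmap_inj W : injective (vmap W).
Proof.
have s0 := cR_neq0 (vsize_gt0 W); move=> [z|] [w|] //; rewrite !vmap_Some => -[h].
have : (z - vcentre W) / cR (vsize W) * cR (vsize W) = (w - vcentre W) / cR (vsize W) * cR (vsize W) by rewrite h.
by rewrite !divfK // => /addIr ->.
Qed.

Lemma vmap_surj W (x : P1 R) : exists y, x = vmap W y.
Proof.
have s0 := cR_neq0 (vsize_gt0 W); case: x => [z|]; last by exists None.
by exists (Some (z * cR (vsize W) + vcentre W)); rewrite vmap_Some addrK mulfK.
Qed.

Lemma moebius_vmap W : moebius (vmap W).
Proof. by apply: moebius_affine; rewrite invr_eq0 cR_neq0 // vsize_gt0. Qed.

Lemma vpar_child W : W != vfull a0 -> child (inl W) (vpar W).
Proof. by move=> W0; rewrite /child (inj_eq inl_inj) W0 eqxx. Qed.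

Lemma vpar_comp W : W != vfull (vcomp W) -> vcomp (vpar W) = vcomp W.
Proof.
move=> Wn; have W0 : W != vfull a0 by apply: contraNneq Wn => ->; rewrite vcomp_full.
rewrite /vpar (psup_comp (supp_inner W0)) /supp (negbTE Wn); exact: (vertex_comp (vertex_rep W)).2.
Qed.

Lemma vpar_full_comp b : b != a0 -> vcomp (vpar (vfull b)) = par b.
Proof.
move=> b0; have W0 : vfull b != vfull a0.
  by apply: contraNneq b0 => /(congr1 vcomp); rewrite !vcomp_full => ->.
by rewrite /vpar (psup_comp (supp_inner W0)) supp_full rep1.
Qed.

Lemma vfull_eq b c : (vfull b == vfull c) = (b == c).
Proof. by apply/eqP/eqP => [/(congr1 vcomp)|->] //; rewrite !vcomp_full. Qed.

Definition edge_eq (x : vert model_tree -> P1 R) W : Prop :=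
  (hx (x (vpar W)) - edge_zed (inl W) * hy (x (vpar W))) * hy (x W)
    = edge_gam (inl W) * edge_rho (inl W) * hx (x W) * hy (x (vpar W)).

Lemma Cp_edge x : Cp model_params x <-> forall W, W != vfull a0 -> edge_eq x W.
Proof.
split=> [H W W0|H e u v].
  by apply: (H (inl W)) => //; apply/eneg_child; exact: vpar_child.
move=> /eneg_child ce /epos_inl ev; subst e.
have v0 : v != vfull a0 by case/andP: ce => h _; apply: contraNneq h => ->.
by have := H v v0; rewrite /edge_eq /vpar -(child_psup ce).
Qed.

(** After substitution the equation equates two affine coordinates, centred at the same point, of
    one point of the component. *)
Lemma edge_eq_inner x W (p : P1 R) : W != vfull (vcomp W) -> x (vpar W) = vmap (vpar W) p ->
  edge_eq x W <-> x W = vmap W p.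
Proof.
move=> Wn xp; have W0 : W != vfull a0 by apply: contraNneq Wn => ->; rewrite vcomp_full.
have ce := vpar_child W0; have r0 := radius_gt0 ce; have s0 := vsize_gt0 W; have s1 := vsize_gt0 (vpar W).
have S0 := cR_neq0 s0; have S1 := cR_neq0 s1.
have cE : centre (inl W) = vcentre W by rewrite /centre /= /supp (negbTE Wn).
rewrite /edge_eq xp /= (negbTE Wn) (zed_eq ce) cE /edge_rho (child_psup ce).
have -> : cR (vsize W / radius (inl W)) * cR (radius (inl W) / vsize (vpar W)) = cR (vsize W) / cR (vsize (vpar W)).
  by rewrite -!rmorphM -fmorphV -rmorphM /= mulrA divfK // gt_eqF.
case: p xp => [t|] _.
  rewrite !vmap_Some /= !mulr1 -mulrBl opprB addrA subrK.
  case: (x W) => [w|] /=; rewrite ?mulr1 ?mulr0.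
    rewrite [_ / _ * w]mulrAC; split=> [/(mulIf (invr_neq0 S1)) h|[->]].
      by congr Some; rewrite h mulrC mulKf.
    by rewrite mulrCA divff // mulr1.
  split=> [/esym/eqP|//]; rewrite mulf_eq0 (negbTE S0) invr_eq0 (negbTE S1) //.
rewrite /= mulr0 subr0 mul1r mulr0.
by case: (x W) => [w|] /=; split=> // /eqP; rewrite oner_eq0.
Qed.

(** With gluing parameter zero the equation is a product: either the parent coordinate is at the
    node, or the coordinate of the full cluster is infinite. *)
Lemma edge_eq_node b x : b != a0 ->
  edge_eq x (vfull b) <-> x (vpar (vfull b)) = vmap (vpar (vfull b)) (Some (pos (inl b))) \/ x (vfull b) = None.
Proof.
move=> b0; have W0 : vfull b != vfull a0 by rewrite vfull_eq.
have ce := vpar_child W0; have s1 := vsize_gt0 (vpar (vfull b)).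
have cE : centre (inl (vfull b)) = pos (inl b) by rewrite /centre /= supp_full rep1.
rewrite vmap_Some /edge_eq /edge_gam vcomp_full eqxx (zed_eq ce) cE !mul0r.
have hy0 (p : P1 R) : hy p = 0 <-> p = None by case: p => [w|] /=; split=> // /eqP; rewrite oner_eq0.
split=> [/eqP|].
  rewrite mulf_eq0 => /orP[|/eqP/hy0]; last by right.
  case: (x (vpar _)) => [w|] /=; first by rewrite mulr1 subr_eq0 => /eqP ->; left.
  by rewrite mulr0 subr0 oner_eq0.
by case=> ->; rewrite /= ?mulr1 ?subrr ?mul0r ?mulr0.
Qed.

Lemma full_or_inner W : W = vfull (vcomp W) \/ W != vfull (vcomp W).
Proof. by case: eqVneq; [left|right]. Qed.

Lemma model_point_Cp x : Cp model_params (model_point x).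
Proof.
apply/Cp_edge => W W0; have [e|Wn] := full_or_inner W; last first.
  by apply/(edge_eq_inner (p := seen (vcomp W) x) Wn); rewrite /model_point ?(vpar_comp Wn).
set b := vcomp W in e; rewrite e in W0 *; have b0 : b != a0 by rewrite -vfull_eq.
apply/edge_eq_node => //; rewrite /model_point vpar_full_comp // vcomp_full.
have [ab|ab] := boolP (fconnect par x.1 b); first by left; rewrite seen_below.
by right; rewrite seen_above.
Qed.

(** Inside a component each coordinate is determined by that of the parent cluster, so a single
    point [y b] per component remains; the edges between components leave the alternative at their
    node. *)
Lemma Cp_coordinates x : Cp model_params x ->
  exists y : C -> P1 R, (forall W, x W = vmap W (y (vcomp W))) /\
    forall b, b != a0 -> y (par b) = Some (pos (inl b)) \/ y b = None.
Proof.
move=> /Cp_edge H.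
have ex b : exists y, x (vfull b) = vmap (vfull b) y by exact: vmap_surj.
have [y Hy] := choice ex; exists y.
have xW W : x W = vmap W (y (vcomp W)).
  have [m Wm] := ubnP (vrank W); elim: m W Wm => // m IH W Wm.
  have [->|Wn] := full_or_inner W; first by rewrite Hy vcomp_full.
  have W0 : W != vfull a0 by apply: contraNneq Wn => ->; rewrite vcomp_full.
  have := H W W0; move=> /(edge_eq_inner Wn) h; apply: h.
  rewrite IH ?(vpar_comp Wn) //.
  by apply: leq_trans (vpar_rank W0) _; rewrite -ltnS.
split=> // b b0; have W0 : vfull b != vfull a0 by rewrite vfull_eq.
have /(edge_eq_node _ b0) [] := H _ W0; rewrite xW ?vpar_full_comp // ?vcomp_full.
  by move=> /vmap_inj; left.
by rewrite -[None]/(vmap (vfull b) None) => /vmap_inj; right.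
Qed.

(** [G a] says that on the proper ancestors of [a] the tuple looks like a point lying on [a]. A
    deepest such [a] carries the point: all components that are neither [a] nor an ancestor of it
    must be at infinity. *)
Lemma Cp_model_point x : Cp model_params x -> exists y, x = model_point y.
Proof.
move=> /Cp_coordinates[y [xE yE]].
pose G a := [forall b, (fconnect par a b && (b != a)) ==> `[< y b = toward b a >]].
have GP a b : G a -> fconnect par a b -> b != a -> y b = toward b a.
  by move=> /forallP/(_ b)/implyP h ab ba; apply/asboolP; apply: h; rewrite ab.
have Ga0 : G a0.
  by apply/forallP => b; apply/implyP => /andP[/fconnect_from_root ->]; rewrite eqxx.
pose a := [arg max_(a > a0 | G a) dp a].
have [Ga amax] : G a /\ forall b, G b -> (dp b <= dp a)%N by rewrite /a; case: arg_maxnP.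
(* By induction on the depth of [b]. If [y b] is not infinite, then [y (par b)] is the node of [b]:
   impossible at infinity, impossible on a proper ancestor of [a] because the nodes are distinct,
   and if [par b = a] then [b] would satisfy [G], against maximality. *)
have N b : ~~ fconnect par a b -> y b = None.
  have [m bm] := ubnP (dp b); elim: m b bm => // m IH b bm nab.
  have b0 : b != a0 by apply: contraNneq nab => ->; exact: fconnect_root.
  have [h|//] := yE _ b0.
  have [ac|nac] := boolP (fconnect par a (par b)); last first.
    by move: h; rewrite IH //; apply: leq_trans (par_lt b0) _; rewrite -ltnS.
  have [ca|ca] := eqVneq (par b) a; last first.
    have [c [c0 cb acc]] := below_child ac (contra_neq (@esym _ _ _) ca).
    move: h; rewrite (GP _ _ Ga ac ca) -cb (toward_below c0 acc).2 => -[e].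
    have := pos_inj _ _ _ e; rewrite !(inj_eq inl_inj) => /(_ c0 b0 cb) [cbe].
    by rewrite -cbe acc in nab.
  have Gb : G b.
    apply/forallP => c; apply/implyP => /andP[bc cb]; apply/asboolP.
    have ac' : fconnect par a c by rewrite -ca; exact: fconnect_step bc _.
    have [->|cna] := eqVneq c a.
      by rewrite -ca h (toward_below b0 (connect0 _ _)).2.
    rewrite (GP _ _ Ga ac' cna).
    have [d [d0 dc ad]] := below_child ac' (contra_neq (@esym _ _ _) cna).
    have bd : fconnect par b d by apply: connect_trans ad; rewrite -ca; exact: fconnect1.
    by rewrite -dc (toward_below d0 ad).2 (toward_below d0 bd).2.
  by have := amax _ Gb; rewrite -ca leqNgt par_lt.
exists (a, y a); apply/funext => W; rewrite xE /model_point; congr vmap.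
rewrite /seen /=; case: eqVneq => [->//|aW].
have [h|h] := boolP (fconnect par a (vcomp W)); last by rewrite (toward_above h).2 N.
by apply: GP => //; rewrite eq_sym.
Qed.

Definition node_pair (x x' : C * P1 R) : Prop :=
  exists b, [/\ b != a0, x = (b, None) & x' = (par b, Some (pos (inl b)))].

Lemma model_point_eq x x' : model_point x = model_point x' <-> forall b, seen b x = seen b x'.
Proof.
split=> [E b|E]; last by apply/funext => W; rewrite /model_point E.
by have := congr1 (@^~ (vfull b)) E; rewrite /model_point /= vcomp_full => /vmap_inj.
Qed.

Lemma node_pair_point x x' : node_pair x x' -> model_point x = model_point x'.
Proof.
move=> [b [b0 -> ->]]; apply/model_point_eq => c; rewrite /seen /=.
case: (eqVneq b c) => [<-|bc].
  have [h1 h2] := toward_above (not_below_par b0).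
  by rewrite (negbTE h1) h2.
case: (eqVneq (par b) c) => [<-|pc]; first by rewrite (toward_below b0 (connect0 _ _)).2.
have [h|h] := boolP (fconnect par b c); last first.
  have h' : ~~ fconnect par (par b) c by apply: contra h => h; apply: connect_trans (fconnect1 _ _) h.
  by rewrite (toward_above h).2 (toward_above h').2.
have h' := fconnect_step h (contra_neq (@esym _ _ _) bc).
have [d [d0 dc ad]] := below_child h' pc.
have bd : fconnect par b d by apply: connect_trans (fconnect1 _ _) ad.
by rewrite -dc (toward_below d0 ad).2 (toward_below d0 bd).2.
Qed.

(** A point is seen at its own coordinate from its component and at a node, or at infinity, from all
    others. If two points on different components look the same from everywhere, the components are
    adjacent and both points are the node between them. *)
Lemma model_point_inj x x' : model_point x = model_point x' ->
  [\/ x = x', node_pair x x' | node_pair x' x].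
Proof.
move=> /model_point_eq; case: x => a y; case: x' => a' y' E.
have [aa|naa] := eqVneq a a'.
  subst a'; have := E a; rewrite /seen /= eqxx => ->; exact: Or31.
have half b c u v : b != c -> (forall d, seen d (b, u) = seen d (c, v)) -> fconnect par c b ->
    node_pair (c, v) (b, u).
  move=> bc Ed cb; have [d [d0 db cd]] := below_child cb (contra_neq (@esym _ _ _) bc).
  have lt1 := par_lt d0; rewrite db in lt1.
  have dE : d = c.
    apply/eqP; apply: contraT => dc.
    have [g [g0 gd cg]] := below_child cd (contra_neq (@esym _ _ _) dc).
    have := Ed d; rewrite seen_above; last by apply/negP => /fconnect_dp; rewrite leqNgt lt1.
    by rewrite -gd (seen_below (x := (c, v)) g0 cg).
  subst d; exists c; split=> //.
    congr (_, _); have := Ed c; rewrite [in RHS]/seen /= eqxx => <-.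
    by apply: seen_above; apply/negP => /fconnect_dp; rewrite leqNgt lt1.
  congr (_, _); first by [].
  by have := Ed b; rewrite {1}/seen /= eqxx => ->; rewrite -db seen_below.
have [h|h] := boolP (fconnect par a' a); first by apply: Or33; exact: half.
have [h'|h'] := boolP (fconnect par a a').
  by apply: Or32; apply: half => //; rewrite eq_sym.
exfalso; have a0' : a != a0 by apply: contraNneq h => ->; exact: fconnect_root.
have := E (par a); rewrite (seen_below (x := (a, y)) a0' (connect0 _ _)) => E1.
have y'N : y' = None.
  by have := E a'; rewrite [in RHS]/seen /= eqxx => <-; exact: seen_above.
have [pa|npa] := eqVneq a' (par a).
  by move: E1; rewrite /seen /= pa eqxx y'N.
have [k|k] := boolP (fconnect par a' (par a)); last by move: E1; rewrite seen_above.
have [d [d0 da ad]] := below_child k npa.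
move: E1; rewrite -da seen_below // => -[e].
have := pos_inj _ _ _ e; rewrite !(inj_eq inl_inj) => /(_ a0' d0 (esym da)) [ade].
by rewrite ade ad in h.
Qed.

(** * Regions of the model curve in terms of the components *)

Lemma in_full c : c != a0 -> inl c \in full (par c).
Proof. by move=> c0; rewrite inE (inj_eq inl_inj) c0 eqxx. Qed.

Lemma seen_cases b x : x.1 = b \/ seen b x = None \/
  exists c, [/\ c != a0, par c = b, fconnect par x.1 c & seen b x = Some (pos (inl c))].
Proof.
have [|nb] := eqVneq x.1 b; first by left.
right; have [h|h] := boolP (fconnect par x.1 b); last by left; exact: seen_above.
have [c [c0 cb xc]] := below_child h nb; right; exists c; split=> //.
by rewrite -cb seen_below.
Qed.

Lemma mu_radius e W : child e W -> mu * gap e <= radius e / 2.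
Proof. by move=> ce; apply: mu_radius_arith => //; exact: ltW (gap_gt0 ce). Qed.

Lemma gap_radius e W : child e W -> 4 * radius e <= gap e.
Proof. by move=> ce; apply: gap_radius_arith => //; exact: ltW (gap_gt0 ce). Qed.

Lemma esupp_near e W p : child e W -> p \in esupp e -> absC (pos p - centre e) <= radius e / 2.
Proof. by move=> ce pe; rewrite absCB; apply: le_trans (esupp_radius ce pe) (mu_radius ce). Qed.

Lemma esupp_far e W p : child e W -> p \in full (vcomp W) -> p \notin esupp e ->
  4 * radius e <= absC (pos p - centre e).
Proof. by move=> ce pf pe; rewrite absCB; apply: le_trans (gap_radius ce) (gap_le ce pf pe). Qed.

Lemma diam_vsize W : diam (val W) <= vsize W / 8.
Proof.
rewrite -vsize_eps ler_wpM2l ?(ltW (vsize_gt0 W)) //; exact: eps_le.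
Qed.

Lemma vertex_near W p : p \in val W -> absC (pos p - vcentre W) <= vsize W / 8.
Proof. by move=> pW; apply: le_trans (diam_vsize W); apply: le_diam => //; exact: vertex_rep. Qed.

Lemma vertex_far W p : p \in full (vcomp W) -> p \notin val W ->
  5 * vsize W <= absC (pos p - vcentre W).
Proof.
move=> pf pW; have [_ H] := vertexP W; have rW := vertex_rep W.
rewrite absCB; apply: outside_arith => //; first exact: absC_ge0.
apply: diam_le => [|w w' wW w'W]; first by rewrite !mulr_ge0 ?absC_ge0 // ltW // exprn_gt0.
apply: le_trans (pdist_tri w w' (rep (val W))) _; rewrite mulr_natl mulr2n.
by apply: lerD; [rewrite pdistC; exact: H|exact: H].
Qed.

Lemma in_disc_vmap W (y : P1 R) : in_disc 0 1 (vmap W y) ->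
  exists2 z, y = Some z & absC (z - vcentre W) <= vsize W.
Proof.
case: y => [z|] //; rewrite vmap_Some /= subr0 absC_cRdiv ?vsize_gt0 //.
by rewrite ler_pdivrMr ?vsize_gt0 // mul1r => h; exists z.
Qed.

Lemma in_disc_edge e W (y : P1 R) : child e W ->
  in_disc (edge_zed e) (absC (edge_rho e)) (vmap W y) ->
  exists2 z, y = Some z & absC (z - centre e) <= radius e.
Proof.
move=> ce; case: y => [z|] //; have s0 := vsize_gt0 W.
rewrite vmap_Some /= (zed_eq ce) (rho_abs ce) -mulrBl opprB addrA subrK absC_cRdiv //.
by rewrite ler_pM2r ?invr_gt0 // => h; exists z.
Qed.

Lemma out_disc_edge e W z : child e W ->
  ~ in_open_disc (edge_zed e) (absC (edge_rho e)) (vmap W (Some z)) -> radius e <= absC (z - centre e).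
Proof.
move=> ce; have s0 := vsize_gt0 W.
rewrite vmap_Some /= (zed_eq ce) (rho_abs ce) -mulrBl opprB addrA subrK absC_cRdiv //.
by rewrite ltr_pM2r ?invr_gt0 // => /negP; rewrite -leNgt.
Qed.

Lemma out_unit_vmap W z : ~ in_open_disc 0 1 (vmap W (Some z)) -> vsize W <= absC (z - vcentre W).
Proof.
rewrite vmap_Some /= subr0 absC_cRdiv ?vsize_gt0 //.
by rewrite ltr_pdivrMr ?vsize_gt0 // mul1r => /negP; rewrite -leNgt.
Qed.

Lemma proj_neg_edge e W (x : vert model_tree -> P1 R) z : child e W -> x W = vmap W (Some z) ->
  proj_neg model_params x W e = Some ((z - centre e) / cR (radius e)).
Proof.
move=> ce xW; have s0 := vsize_gt0 W; have r0 := radius_gt0 ce.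
have S0 := cR_neq0 s0; have R0 := cR_neq0 r0.
rewrite /proj_neg xW vmap_Some /= !mulr1 (zed_eq ce) -mulrBl opprB addrA subrK.
have rE : cR (radius e / vsize W) = cR (radius e) / cR (vsize W) by rewrite rmorphM fmorphV.
rewrite /edge_rho (child_psup ce) rE /P1_of.
rewrite mulf_eq0 invr_eq0 (negbTE R0) (negbTE S0) /=; congr Some.
by rewrite invfM invrK mulrACA mulVf // mulr1.
Qed.

(** A point on another component is seen from [vcomp W] at infinity or at a chosen point. Chosen
    points of [W] lie well inside the removed discs and the others far outside the unit disc, so
    only points of the component itself remain. *)
Lemma thick_region W x : region model_params (inl W) (model_point x) ->
  exists z, [/\ x = (vcomp W, Some z), absC (z - vcentre W) <= vsize W
    & forall e, child e W -> radius e <= absC (z - centre e)].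
Proof.
move=> [_ /in_disc_vmap[z sz zW] out].
have outz e : child e W -> radius e <= absC (z - centre e).
  move=> ce; apply: (out_disc_edge ce); rewrite -sz; apply: out; exact/eneg_child.
exists z; split=> //; case: (seen_cases (vcomp W) x) => [xW|[sN|[c [c0 cb xc sc]]]].
- by move: sz; rewrite /seen xW eqxx; case: x xW {out} => a y /= -> ->.
- by rewrite sN in sz.
move: sz; rewrite sc => -[cz]; have cf := in_full c0; rewrite cb in cf.
exfalso; have [pW|pW] := boolP (inl c \in val W).
  have [e /andP[ce pe]] := child_cover pW.
  have := le_trans (outz e ce) _; rewrite -cz => /(_ _ (esupp_near ce pe)).
  by rewrite leNgt ltr_pdivrMr // ltr_pMr ?ltr1n // (radius_gt0 ce).
have := le_trans (vertex_far cf pW) _; rewrite cz => /(_ _ zW).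
by rewrite leNgt ltr_pMl ?ltr1n ?vsize_gt0.
Qed.

Lemma leaf_region l x : region model_params (inr (inr l)) (model_point x) ->
  exists z, x = (compL l, Some z) /\ absC (z - pos (inr l)) <= radius (inr l).
Proof.
have ce : child (inr l) (lat l) by rewrite /child eqxx.
have vl : vcomp (lat l) = compL l by have [_] := child_comp ce (finset.set11 (inr l)) .
have cE : centre (inr l) = pos (inr l) by rewrite /centre /= rep1.
move=> [_ H _]; have /(in_disc_edge ce)[z sz zr] := H (lat l) erefl.
rewrite vl cE in sz zr; exists z; split=> //.
case: (seen_cases (compL l) x) => [xW|[sN|[c [c0 cb xc sc]]]].
- by move: sz; rewrite /seen xW eqxx; case: x xW {H} => a y /= -> ->.
- by rewrite sN in sz.
move: sz; rewrite sc => -[cz]; have cf := in_full c0; rewrite cb -vl in cf.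
have := esupp_far ce cf; rewrite inE /= => /(_ isT); rewrite cz cE => h.
have := le_trans h zr; rewrite leNgt ltr_pMl ?ltr1n //; exact: radius_gt0 ce.
Qed.

Lemma root_region x : region model_params (inr (inl (vfull a0))) (model_point x) ->
  x.1 = a0 /\ ~ in_open_disc 0 1 (vmap (vfull a0) x.2).
Proof.
move=> [_ _ /(_ _ erefl)]; rewrite /model_point vcomp_full => H.
case: (seen_cases a0 x) => [xW|[sN|[c [c0 cb xc sc]]]].
- by split=> //; move: H; rewrite /seen xW eqxx.
- case: (eqVneq x.1 a0) => [xa|x0].
    by split=> //; move: H; rewrite /seen xa eqxx.
  have [c [c0 cb xc]] := below_child (fconnect_root x.1) x0.
  by move: sN; rewrite -cb seen_below.
move: H; rewrite sc => /out_unit_vmap h; have cf := in_full c0; rewrite cb in cf.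
have := le_trans h (vertex_near (W := vfull a0) cf).
by rewrite leNgt ltr_pdivrMr // ltr_pMr ?ltr1n // vsize_gt0.
Qed.

Lemma neck_region V x : V != vfull (vcomp V) ->
  region model_params (inr (inl V)) (model_point x) ->
  exists z, x = (vcomp V, Some z) /\ vsize V <= absC (z - vcentre V) <= radius (inl V).
Proof.
move=> Vn; have V0 : V != vfull a0 by apply: contraNneq Vn => ->; rewrite vcomp_full.
have ce := vpar_child V0; have vc := vpar_comp Vn.
have cE : centre (inl V) = vcentre V by rewrite /centre /= /supp (negbTE Vn).
move=> [_ H1 H2]; have /(in_disc_edge ce)[z sz zr] := H1 (vpar V) (proj2 (eneg_child _ _) ce).
have /= := H2 V erefl; rewrite vc cE in sz zr; rewrite /model_point sz => /out_unit_vmap zV.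
exists z; rewrite zV zr; split=> //.
case: (seen_cases (vcomp V) x) => [xW|[sN|[c [c0 cb xc sc]]]].
- by move: sz; rewrite /seen xW eqxx; case: x xW {H1 H2} => a y /= -> ->.
- by rewrite sN in sz.
move: sz; rewrite sc => -[cz]; have cf := in_full c0; rewrite cb in cf; exfalso.
have [pV|pV] := boolP (inl c \in val V).
  have := le_trans zV _; rewrite -cz => /(_ _ (vertex_near pV)).
  by rewrite leNgt ltr_pdivrMr // ltr_pMr ?ltr1n // vsize_gt0.
rewrite -vc in cf; have := esupp_far ce cf; rewrite /= /supp (negbTE Vn) => /(_ pV).
rewrite cE cz => h; have := le_trans h zr; rewrite leNgt ltr_pMl ?ltr1n //; exact: radius_gt0 ce.
Qed.

Lemma node_region b x : b != a0 -> region model_params (inr (inl (vfull b))) (model_point x) ->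
  (exists z, x = (par b, Some z) /\ absC (z - pos (inl b)) <= radius (inl (vfull b))) \/
  (x.1 = b /\ ~ in_open_disc 0 1 (vmap (vfull b) x.2)).
Proof.
move=> b0; have V0 : vfull b != vfull a0 by rewrite vfull_eq.
have ce := vpar_child V0; have vc := vpar_full_comp b0.
have cE : centre (inl (vfull b)) = pos (inl b) by rewrite /centre /= supp_full rep1.
move=> [_ H1 H2]; have /(in_disc_edge ce)[z sz zr] := H1 _ (proj2 (eneg_child _ _) ce).
have /= := H2 _ erefl; rewrite vc cE in sz zr; rewrite /model_point vcomp_full => out.
case: (seen_cases (par b) x) => [xW|[sN|[c [c0 cb xc sc]]]].
- by left; exists z; split=> //; move: sz; rewrite /seen xW eqxx; case: x xW {H1 H2 out} => a y /= -> ->.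
- by rewrite sN in sz.
have cz : pos (inl c) = z by move: sz; rewrite sc => -[].
right; have cbE : c = b.
  apply/eqP; apply: contraT => ncb; have cf := in_full c0; rewrite cb -vc in cf.
  have := esupp_far ce cf; rewrite /= supp_full inE (inj_eq inl_inj) => /(_ ncb).
  rewrite cE cz => h; have := le_trans h zr; rewrite leNgt ltr_pMl ?ltr1n //; exact: radius_gt0 ce.
subst c; have [xb|nxb] := eqVneq x.1 b.
  by split=> //; move: out; rewrite /seen xb eqxx.
have [d [d0 db xd]] := below_child xc nxb.
move: out; rewrite -{2}db (seen_below d0 xd) => /out_unit_vmap h.
have df := in_full d0; rewrite db in df.
have := le_trans h (vertex_near (W := vfull b) df).
by rewrite leNgt ltr_pdivrMr // ltr_pMr ?ltr1n // vsize_gt0.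
Qed.

Lemma absC_tri2 (z w y : R[i]) : absC (z - w) <= absC (y - w) + absC (y - z).
Proof. by rewrite [leRHS]addrC [absC (y - z)]absCB; exact: absC_tri. Qed.

Lemma absC_tri3 (z w y : R[i]) : absC (z - w) <= absC (y - z) + absC (y - w).
Proof. by rewrite [leRHS]addrC; exact: absC_tri2. Qed.

Lemma absC_div_unit (z : R[i]) (s : R) : 0 < s -> absC z <= s -> absC (z / cR s) <= 1.
Proof. by move=> s0 zs; rewrite absC_cRdiv // ler_pdivrMr // mul1r. Qed.

Lemma esupp_avoided e W p z : child e W -> p \in esupp e -> radius e <= absC (z - centre e) ->
  radius e / 2 <= absC (z - pos p).
Proof.
by move=> ce pe h; exact: half_disc h (esupp_near ce pe) (absC_tri z (centre e) (pos p)).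
Qed.

Lemma vpar_bound W : 0 < (4 * eps ^+ 3) ^+ (#|kids W|).+1 <= 1.
Proof.
have e3 : 0 < 4 * eps ^+ 3 by rewrite mulr_gt0 // exprn_gt0.
rewrite exprn_gt0 //= exprn_ile1 ?(ltW e3) //.
by have := eps3_le eps0 eps8; exact: quarter_cube.
Qed.

(** * Lipschitz bounds on the regions *)

Context {n : nat} (X : geometry R n) (u : C -> P1 R -> X) (l Kc kap : R)
  (Ju : forall a, Jhol_P1 (u a)) (dec : decay X l Kc) (Kc0 : 0 <= Kc) (l0 : 0 <= l) (kap0 : 0 <= kap)
  (kapl : 24 * kap <= l)
  (away : forall a (z : R[i]) (t : R), 0 <= t -> (forall p, p \in full a -> t <= absC (z - pos p)) -> t * dens (u a) z <= kap)
  (node_fit : forall b, b != a0 -> u b None = u (par b) (Some (pos (inl b)))).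

Lemma dens_le a (z : R[i]) (t t' : R) : 0 < t' -> t' <= t -> (forall p, p \in full a -> t / 2 <= absC (z - pos p)) ->
  dens (u a) z <= 2 * kap / t'.
Proof.
move=> t0 tt H; have tp := lt_le_trans t0 tt; have k0 := kap0.
have h : t / 2 * dens (u a) z <= kap by apply: away => //; rewrite divr_ge0 // ltW.
apply: (@le_trans _ _ (2 * kap / t)); last first.
  by rewrite ler_wpM2l ?mulr_ge0 // lef_pV2.
by rewrite ler_pdivlMr // mulrC; apply: halves_arith.
Qed.

(** All removed discs have radius at least [alpha * vsize W], so on the paths of [reach_avoiding]
    the chosen points are at least half as far away and the density is at most
    [2 kap / (alpha * vsize W)]; the detours double the length. *)
Lemma thick_reach W z z' :
  absC (z - vcentre W) <= vsize W -> absC (z' - vcentre W) <= vsize W ->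
  (forall e, child e W -> radius e <= absC (z - centre e)) ->
  (forall e, child e W -> radius e <= absC (z' - centre e)) ->
  reach (u (vcomp W) (Some z)) (u (vcomp W) (Some z'))
    (4 * kap / (4 * eps ^+ 3) ^+ (#|kids W|).+1 * (absC (z' - z) / vsize W)).
Proof.
move=> zW z'W oz oz'; have s0 := vsize_gt0 W; have /andP[a0' a1] := vpar_bound W.
set al := (4 * eps ^+ 3) ^+ _ in a0' a1 *.
have as0 : 0 < al * vsize W by rewrite mulr_gt0.
have ra e : child e W -> al * vsize W <= radius e by exact: radius_alpha.
have as1 : al * vsize W <= vsize W by rewrite ler_piMl // ltW.
have [su _] := JholT (Jhol_P1_chart0 (Ju (vcomp W))).
pose D := [seq (plane_of (centre e), radius e) | e <- enum (kids W)].
have DP d : d \in D -> exists2 e, child e W & d = (plane_of (centre e), radius e).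
  by move=> /mapP[e]; rewrite mem_enum inE => ce ->; exists e.
have mE y e : modulus (y - plane_of (centre e)) = absC (to_C y - centre e).
  by rewrite absC_modulus plane_ofB to_CK.
have -> : 4 * kap / al * (absC (z' - z) / vsize W) =
    2 * (2 * kap / (al * vsize W)) * modulus (plane_of z' - plane_of z).
  by rewrite -plane_ofB -absC_modulus; exact: regroup_arith.
rewrite -!chart0_plane_of; apply: (@reach_avoiding _ _ _ _ D) => //.
- by rewrite divr_ge0 ?(ltW as0) // mulr_ge0 ?kap0.
- by move=> d /DP[e ce ->] /=; exact: radius_gt0 ce.
- move=> d d' y /DP[e ce ->] /DP[e' ce' ->] ee' /=; rewrite !mE => ye.
  have nee' : e <> e' by move=> h; rewrite h eqxx in ee'.
  apply: (disjoint_arith eps8 _ _ (radius_sep ce ce' nee') (absC_ge0 _) (w := absC (to_C y - centre e))).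
  + exact: ltW (radius_gt0 ce).
  + exact: ltW (radius_gt0 ce').
  + by rewrite ye ler_peMl ?ler1n // ltW // (radius_gt0 ce).
  + exact: absC_tri3.
- move=> d y /DP[e ce ->] /=; rewrite mE -sqr_modulus mE => ye y2.
  rewrite -[y]to_CK -/(dens (u (vcomp W)) (to_C y)).
  apply: (dens_le as0 (ra _ ce)) => p pf; have [pe|pe] := boolP (p \in esupp e).
    exact: esupp_avoided ce pe ye.
  apply: half_far (esupp_far ce pf pe) _ _; first exact: ltW (radius_gt0 ce).
    by apply: sqrt2_arith y2; [exact: ltW (radius_gt0 ce)|exact: absC_ge0].
  exact: absC_tri2.
- move=> s /andP[s00 s1] H; set y := seg _ _ s in H *.
  have yW : absC (to_C y - vcentre W) <= vsize W.
    rewrite absC_modulus plane_ofB to_CK; apply: seg_ball; rewrite ?s00 ?s1 //.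
      by rewrite -plane_ofB -absC_modulus.
    by rewrite -plane_ofB -absC_modulus.
  rewrite -[y]to_CK -/(dens (u (vcomp W)) (to_C y)).
  apply: (dens_le as0 (lexx _)) => p pf; have [pW|pW] := boolP (p \in val W).
    have [e /andP[ce pe]] := child_cover pW.
    apply: (@le_trans _ _ (radius e / 2)); first by rewrite ler_pM2r ?ra.
    apply: (esupp_avoided ce pe); rewrite -mE.
    by apply: (H (plane_of (centre e), radius e)); apply: map_f; rewrite mem_enum inE.
  apply: outside_far (ltW s0) as1 yW (vertex_far pf pW) _.
  exact: absC_tri2.
- by move=> d /DP[e ce ->] /=; rewrite -!plane_ofB -!absC_modulus; split; [exact: oz|exact: oz'].
Qed.

Definition point_map (x : C * P1 R) : X := u x.1 x.2.

Lemma thick_lipschitz W x x' : region model_params (inl W) (model_point x) ->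
  region model_params (inl W) (model_point x') ->
  reach (point_map x) (point_map x') (4 * kap / (4 * eps ^+ 3) ^+ degree (W : vert model_tree) *
    region_dist model_params (inl W) (model_point x) (model_point x')).
Proof.
move=> /thick_region[z [-> zW oz]] /thick_region[z' [-> z'W oz']].
apply: reach_le (thick_reach zW z'W oz oz'); rewrite model_degree.
have s0 := vsize_gt0 W; have /andP[a0' _] := vpar_bound W.
rewrite ler_wpM2l ?divr_ge0 ?mulr_ge0 ?kap0 ?(ltW a0') //.
rewrite /= /proj_pos /model_point /seen /= eqxx !vmap_Some.
apply: le_trans (P1_dist_unit_disc (absC_div_unit s0 zW) (absC_div_unit s0 z'W)).
by rewrite -mulrBl opprB addrA subrK absC_cRdiv // absCB.
Qed.

Lemma dens_third a z x : 0 <= x -> (forall p, p \in full a -> x / 3 <= absC (z - pos p)) ->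
  x * dens (u a) z <= l.
Proof. by move=> x0 H; apply: thirds_arith kapl kap0 _; apply: away => //; rewrite divr_ge0. Qed.

(** Chosen points outside the support are at least four radii from the centre. Within three radii
    they are therefore at least a third as far from [z] as the centre is, and the factor lost is
    covered by [24 kap <= l]. *)
Lemma dens_edge e W z : child e W -> absC (z - centre e) <= 3 * radius e ->
  (forall p, p \in esupp e -> absC (z - centre e) / 3 <= absC (z - pos p)) ->
  absC (z - centre e) * dens (u (vcomp W)) z <= l.
Proof.
move=> ce zr H; apply: dens_third => [|p pf]; first exact: absC_ge0.
have [pe|pe] := boolP (p \in esupp e); first exact: H.
exact: third_far zr (esupp_far ce pf pe) (absC_tri3 _ _ _).
Qed.

Lemma dens_edge1 e W p z : child e W -> esupp e = [set p]%SET -> absC (z - pos p) <= 3 * radius e ->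
  absC (z - pos p) * dens (u (vcomp W)) z <= l.
Proof.
move=> ce eE; have cE : centre e = pos p by rewrite /centre eE rep1.
rewrite -cE => zr; apply: dens_edge ce zr _ => q; rewrite eE inE => /eqP ->.
by rewrite cE ler_pdivrMr // ler_peMr ?absC_ge0 // ler1n.
Qed.

Lemma disc_end e W p z z' : child e W -> esupp e = [set p]%SET ->
  absC (z - pos p) <= radius e -> absC (z' - pos p) <= radius e ->
  reach (u (vcomp W) (Some z)) (u (vcomp W) (Some z')) (Kc * (absC (z' - z) / radius e)).
Proof.
move=> ce eE zr zr'; apply: disc_reachC dec Kc0 (Ju _) (radius_gt0 ce) _ zr zr' => y.
exact: dens_edge1 ce eE.
Qed.

Lemma exterior_param V (y : P1 R) : ~ in_open_disc 0 1 (vmap V y) ->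
  exists w : R[i], [/\ y = P1_inv (vcentre V) (Some w), absC w * vsize V <= 1
    & vmap V y = P1_swap (Some (cR (vsize V) * w))].
Proof.
have s0 := vsize_gt0 V; have S0 := cR_neq0 s0.
case: y => [z|] h; last first.
  exists 0; rewrite absC0 mul0r mulr0 P1_swap0; split => //.
  by rewrite /P1_inv P1_swap0.
have zV := out_unit_vmap h; have z0 : z - vcentre V != 0 by rewrite -absC_gt0 (lt_le_trans s0).
exists (z - vcentre V)^-1; rewrite absCV mulrC ler_pdivrMr ?mul1r ?absC_gt0 //; split=> //.
  by rewrite P1_inv_ne // -subr_eq0.
by rewrite vmap_Some P1_swap_Some ?mulf_neq0 ?invr_eq0 // invfM invrK mulrC.
Qed.

Lemma dens_exterior b z : vsize (vfull b) / 3 <= absC (z - vcentre (vfull b)) ->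
  absC (z - vcentre (vfull b)) * dens (u b) z <= l.
Proof.
have s0 := vsize_gt0 (vfull b); rewrite ler_pdivrMr // mulrC => h.
apply: dens_third => [|p pf]; first exact: absC_ge0.
by apply: (third_near (ltW s0) h); apply: le_trans (absC_tri _ _ (pos p)) _; rewrite lerD2l; exact: vertex_near.
Qed.

Lemma exterior_end b (w w' : R[i]) : absC w * vsize (vfull b) <= 1 -> absC w' * vsize (vfull b) <= 1 ->
  reach (u b (P1_inv (vcentre (vfull b)) (Some w))) (u b (P1_inv (vcentre (vfull b)) (Some w')))
    (Kc * (absC (w' - w) * vsize (vfull b))).
Proof. exact: exterior_reach dec Kc0 l0 (Ju b) (vsize_gt0 _) (@dens_exterior b). Qed.

Lemma swap_dist V (w w' : R[i]) : absC w * vsize V <= 1 -> absC w' * vsize V <= 1 ->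
  absC (w' - w) * vsize V <= P1_dist (P1_swap (Some (cR (vsize V) * w))) (P1_swap (Some (cR (vsize V) * w'))).
Proof.
have s0 := vsize_gt0 V; have E z : absC (cR (vsize V) * z) = absC z * vsize V.
  by rewrite absCM absC_cR gtr0_norm // mulrC.
by move=> h h'; apply: le_trans (P1_dist_swap_disc _ _); rewrite ?E // -mulrBr E absCB.
Qed.

Lemma disc_dist e z z' : 0 < radius e -> absC (z - centre e) <= radius e -> absC (z' - centre e) <= radius e ->
  absC (z' - z) / radius e <=
  P1_dist (Some ((z - centre e) / cR (radius e))) (Some ((z' - centre e) / cR (radius e))).
Proof.
move=> r0 h h'; apply: le_trans (P1_dist_unit_disc (absC_div_unit r0 h) (absC_div_unit r0 h')).
by rewrite -mulrBl opprB addrA subrK absC_cRdiv // absCB.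
Qed.

Lemma P1_distC (p q : P1 R) : P1_dist p q = P1_dist q p.
Proof.
rewrite /P1_dist [P1_norm p * _]mulrC; congr (2 * acos (_ / _)).
case: p => [[a b]|]; case: q => [[c d]|]; rewrite !absC_modulus /modulus /sqn /=; congr Num.sqrt; ring.
Qed.

Lemma region_distC (T : rooted_tree R) (p : params T) (t : vert T + edge T) y y' : region_dist p t y y' = region_dist p t y' y.
Proof.
case: t => [V|e] /=; first exact: P1_distC.
congr Num.max; first by case: (epos e) => // v; exact: P1_distC.
by case: (eneg e) => // v; exact: P1_distC.
Qed.

Lemma seen_self a (y : P1 R) : seen a (a, y) = y.
Proof. by rewrite /seen eqxx. Qed.

Lemma leaf_lipschitz i x x' : region model_params (inr (inr i)) (model_point x) ->
  region model_params (inr (inr i)) (model_point x') ->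
  reach (point_map x) (point_map x')
    (6 * Kc * region_dist model_params (inr (inr i)) (model_point x) (model_point x')).
Proof.
have ce : child (inr i) (lat i) by rewrite /child eqxx.
have vl : vcomp (lat i) = compL i by have [_] := child_comp ce (finset.set11 (inr i)).
have cE : centre (inr i) = pos (inr i) by rewrite /centre /= rep1.
move=> /leaf_region[z [-> zr]] /leaf_region[z' [-> z'r]].
rewrite /point_map /= -vl; apply: reach_le (disc_end ce erefl zr z'r).
have r0 := radius_gt0 ce.
have pE y : proj_neg model_params (model_point (vcomp (lat i), Some y)) (lat i) (inr i) =
    Some ((y - centre (inr i)) / cR (radius (inr i))).
  by apply: (proj_neg_edge ce); rewrite /model_point seen_self.
have := @disc_dist (inr i) z z' r0; rewrite cE => /(_ zr z'r) h.
apply: six_arith => //; first by rewrite divr_ge0 ?absC_ge0 ?(ltW r0).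
by rewrite /= !pE cE le_max h orbT.
Qed.

Lemma exterior_bound b (w w' : R[i]) (d : R) : absC w * vsize (vfull b) <= 1 -> absC w' * vsize (vfull b) <= 1 ->
  P1_dist (P1_swap (Some (cR (vsize (vfull b)) * w))) (P1_swap (Some (cR (vsize (vfull b)) * w'))) <= d ->
  reach (u b (P1_inv (vcentre (vfull b)) (Some w))) (u b (P1_inv (vcentre (vfull b)) (Some w'))) (6 * Kc * d).
Proof.
move=> h h' hd; apply: reach_le (exterior_end h h').
apply: six_arith => //; first by rewrite mulr_ge0 ?absC_ge0 // ltW // vsize_gt0.
exact: le_trans (swap_dist h h') hd.
Qed.

Lemma root_lipschitz x x' : region model_params (inr (inl (vfull a0))) (model_point x) ->
  region model_params (inr (inl (vfull a0))) (model_point x') ->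
  reach (point_map x) (point_map x')
    (6 * Kc * region_dist model_params (inr (inl (vfull a0))) (model_point x) (model_point x')).
Proof.
case: x => a y; case: x' => a' y' /root_region[/= ->] /exterior_param[w [-> h E]].
move=> /root_region[/= ->] /exterior_param[w' [-> h' E']].
apply: exterior_bound h h' _.
by rewrite le_max /proj_pos /model_point vcomp_full !seen_self E E' lexx.
Qed.

Lemma neck_lipschitz V x x' : V != vfull (vcomp V) -> region model_params (inr (inl V)) (model_point x) ->
  region model_params (inr (inl V)) (model_point x') ->
  reach (point_map x) (point_map x')
    (6 * Kc * region_dist model_params (inr (inl V)) (model_point x) (model_point x')).
Proof.
move=> Vn; have V0 : V != vfull a0 by apply: contraNneq Vn => ->; rewrite vcomp_full.
have ce := vpar_child V0; have vc := vpar_comp Vn; have r0 := radius_gt0 ce; have s0 := vsize_gt0 V.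
have eE : esupp (inl V) = val V by rewrite /= /supp (negbTE Vn).
have cE : centre (inl V) = vcentre V by rewrite /centre eE.
(* The gluing parameter is at most [4 eps <= 1 / 2], which is the ratio of radii that [neck_reach]
   asks for. *)
have sr : 2 * vsize V <= radius (inl V).
  have := gam_arith eps0 (esupp_diam ce); rewrite eE -/(vsize V) -/(radius (inl V)).
  exact: double_arith (ltW r0).
move=> /(neck_region Vn)[z [-> zV]] /(neck_region Vn)[z' [-> z'V]].
have cond y : vsize V <= 3 * absC (y - vcentre V) -> absC (y - vcentre V) <= 3 * radius (inl V) ->
    absC (y - vcentre V) * dens (u (vcomp V)) y <= l.
  rewrite -vc -cE => h1 h2; apply: dens_edge ce h2 _ => p; rewrite eE => pV.
  apply: (third_near (ltW s0) h1); apply: le_trans (absC_tri _ _ (pos p)) _.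
  by rewrite lerD2l cE; exact: vertex_near.
apply: reach_le (neck_reach dec Kc0 (Ju (vcomp V)) s0 sr cond zV z'V).
rewrite ler_wpM2l ?mulr_ge0 ?Kc0 //.
have /andP[zs zr] := zV; have /andP[z's z'r] := z'V.
rewrite ge_max; apply/andP; split.
  rewrite le_max; apply/orP; right; rewrite /region_dist.
  have -> : @eneg _ model_tree (inl V) = Some (vpar V) by apply/eneg_child.
  have pE y : proj_neg model_params (model_point (vcomp V, Some y)) (vpar V) (inl V) =
      Some ((y - centre (inl V)) / cR (radius (inl V))).
    by apply: (proj_neg_edge ce); rewrite /model_point vc seen_self.
  by rewrite !pE; have := @disc_dist (inl V) z z' r0; rewrite cE => /(_ zr z'r).
have ext y : vsize V <= absC (y - vcentre V) -> absC (y - vcentre V)^-1 * vsize V <= 1 /\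
    vmap V (Some y) = P1_swap (Some (cR (vsize V) * (y - vcentre V)^-1)).
  move=> h; have y0 : y - vcentre V != 0 by rewrite -absC_gt0 (lt_le_trans s0).
  rewrite absCV mulrC ler_pdivrMr ?mul1r ?absC_gt0 //; split=> //.
  by rewrite vmap_Some P1_swap_Some ?mulf_neq0 ?invr_eq0 ?cR_neq0 // invfM invrK mulrC.
have [h1 E1] := ext _ zs; have [h2 E2] := ext _ z's.
rewrite le_max; apply/orP; left; rewrite /region_dist /proj_pos /model_point !seen_self E1 E2.
by rewrite mulrC; exact: swap_dist.
Qed.

(** The region is a pair of discs joined at the node. Two points on different branches are connected
    through the node; seen from the other branch each of them is at the node, so each half of the
    path is bounded by one of the two distances whose maximum is taken. *)
Lemma node_lipschitz b x x' : b != a0 -> region model_params (inr (inl (vfull b))) (model_point x) ->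
  region model_params (inr (inl (vfull b))) (model_point x') ->
  reach (point_map x) (point_map x')
    (6 * Kc * region_dist model_params (inr (inl (vfull b))) (model_point x) (model_point x')).
Proof.
move=> b0; have V0 : vfull b != vfull a0 by rewrite vfull_eq.
have ce := vpar_child V0; have vc := vpar_full_comp b0; have r0 := radius_gt0 ce; have s0 := vsize_gt0 (vfull b).
have eE : esupp (inl (vfull b)) = [set inl b]%SET by rewrite /= supp_full.
have cE : centre (inl (vfull b)) = pos (inl b) by rewrite /centre eE rep1.
have rdE y y' : region_dist model_params (inr (inl (vfull b))) y y' =
    Num.max (P1_dist (y (vfull b)) (y' (vfull b)))
      (P1_dist (proj_neg model_params y (vpar (vfull b)) (inl (vfull b)))
               (proj_neg model_params y' (vpar (vfull b)) (inl (vfull b)))).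
  rewrite /region_dist.
  by have -> : @eneg _ model_tree (inl (vfull b)) = Some (vpar (vfull b)) by apply/eneg_child.
have inE z : absC (z - pos (inl b)) <= radius (inl (vfull b)) ->
    model_point (par b, Some z) (vfull b) = P1_swap (Some (cR (vsize (vfull b)) * 0)) /\
    proj_neg model_params (model_point (par b, Some z)) (vpar (vfull b)) (inl (vfull b)) =
      Some ((z - centre (inl (vfull b))) / cR (radius (inl (vfull b)))).
  move=> zr; split; last by apply: (proj_neg_edge ce); rewrite /model_point vc seen_self.
  by rewrite /model_point vcomp_full seen_above ?not_below_par // mulr0 P1_swap0.
have outE (w : R[i]) : proj_neg model_params (model_point (b, P1_inv (vcentre (vfull b)) (Some w))) (vpar (vfull b)) (inl (vfull b)) =
      Some ((pos (inl b) - centre (inl (vfull b))) / cR (radius (inl (vfull b)))).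
  by apply: (proj_neg_edge ce); rewrite /model_point vc (seen_below (x := (b, _)) b0) //= connect0.
have w0 : absC 0 * vsize (vfull b) <= 1 by rewrite absC0 mul0r.
have c0 : absC (pos (inl b) - pos (inl b)) <= radius (inl (vfull b)) by rewrite subrr absC0 ltW.
have mixed z (w : R[i]) : absC (z - pos (inl b)) <= radius (inl (vfull b)) -> absC w * vsize (vfull b) <= 1 ->
    vmap (vfull b) (P1_inv (vcentre (vfull b)) (Some w)) = P1_swap (Some (cR (vsize (vfull b)) * w)) ->
    reach (u (par b) (Some z)) (u b (P1_inv (vcentre (vfull b)) (Some w)))
      (6 * Kc * region_dist model_params (inr (inl (vfull b))) (model_point (par b, Some z))
         (model_point (b, P1_inv (vcentre (vfull b)) (Some w)))).
  move=> zr wr E; have h1 := disc_end ce eE zr c0; rewrite vc -(node_fit b0) in h1.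
  have h2 := exterior_end w0 wr; rewrite {1}/P1_inv P1_swap0 /= in h2.
  apply: reach_le (reach_trans h1 h2).
  apply: six_arith2 => //.
  - by rewrite divr_ge0 ?absC_ge0 // ltW.
  - by rewrite mulr_ge0 ?absC_ge0 // ltW.
  - rewrite rdE le_max (inE _ zr).2 outE; apply/orP; right.
    by apply: disc_dist; rewrite ?cE.
  rewrite rdE le_max (inE _ zr).1 {1}/model_point vcomp_full seen_self E; apply/orP; left.
  exact: swap_dist.
move=> /(node_region b0) [[z [-> zr]]|]; last first.
  case: x => a y [xa out]; rewrite [a](xa : a = b).
  have [w [-> wr E]] := exterior_param (out : ~ in_open_disc 0 1 (vmap (vfull b) y)).
  move=> /(node_region b0) [[z' [-> zr']]|].
    by rewrite region_distC; apply: reach_sym; exact: mixed.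
  case: x' => a' y' [xa' out']; rewrite [a'](xa' : a' = b).
  have [w' [-> w'r E']] := exterior_param (out' : ~ in_open_disc 0 1 (vmap (vfull b) y')).
  apply: exterior_bound => //.
  by rewrite rdE le_max /model_point !vcomp_full !seen_self E E' lexx.
move=> /(node_region b0) [[z' [-> zr']]|].
  have h1 := disc_end ce eE zr zr'; rewrite vc in h1; apply: reach_le h1.
  apply: six_arith => //; first by rewrite divr_ge0 ?absC_ge0 // ltW.
  rewrite rdE le_max (inE _ zr).2 (inE _ zr').2; apply/orP; right.
  by apply: disc_dist; rewrite ?cE.
case: x' => a' y' [xa' out']; rewrite [a'](xa' : a' = b).
have [w' [-> w'r E']] := exterior_param (out' : ~ in_open_disc 0 1 (vmap (vfull b) y')).
exact: mixed.
Qed.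

Lemma edge_lipschitz (e : edge model_tree) x x' : region model_params (inr e) (model_point x) ->
  region model_params (inr e) (model_point x') ->
  reach (point_map x) (point_map x')
    (6 * Kc * region_dist model_params (inr e) (model_point x) (model_point x')).
Proof.
case: e => [V|i]; last exact: leaf_lipschitz.
have [->|Vn] := full_or_inner V; last exact: neck_lipschitz.
by have [->|b0] := eqVneq (vcomp V) a0; [exact: root_lipschitz|exact: node_lipschitz].
Qed.

Lemma model_point_slot a (W : vert model_tree) :
  (exists2 M, moebius M & forall z, model_point (a, z) W = M z) \/
  exists y, forall z, model_point (a, z) W = y.
Proof.
rewrite /model_point /seen; have [e|ne] /= := eqVneq a (vcomp W).
  by left; exists (vmap W) => //; exact: moebius_vmap.
by right; exists (vmap W (toward (vcomp W) a)).
Qed.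

Lemma lat_child i : child (inr i) (lat i).
Proof. by rewrite /child eqxx. Qed.

Lemma vcomp_lat i : vcomp (lat i) = compL i.
Proof. by have [_] := child_comp (lat_child i) (finset.set11 (inr i)). Qed.

Lemma centre_leaf i : centre (inr i) = pos (inr i).
Proof. by rewrite /centre /= rep1. Qed.

Lemma leaf_region_mem i z : absC (z - pos (inr i)) <= radius (inr i) ->
  region model_params (inr (inr i)) (model_point (compL i, Some z)).
Proof.
move=> zr; have ce := lat_child i; have s0 := vsize_gt0 (lat i).
split=> [|W /eneg_child cW|v /epos_inl //]; first exact: model_point_Cp.
have <- : lat i = W by rewrite -(child_psup cW).
rewrite /model_point vcomp_lat seen_self vmap_Some /= (zed_eq ce) (rho_abs ce) -mulrBl opprB addrA subrK.
by rewrite absC_cRdiv // ler_pM2r ?invr_gt0 // centre_leaf.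
Qed.

Lemma leaf_radius i d : (forall q, q \in full (compL i) -> q != inr i -> d <= absC (pos (inr i) - pos q)) ->
  2 * eps * d <= radius (inr i).
Proof.
move=> H; have ce := lat_child i; have e0 := eps0.
rewrite /radius ler_wpM2l ?mulr_ge0 ?(ltW e0) //.
have [sW _] := vertexP (lat i); rewrite vcomp_lat in sW.
have H' q : q \in val (lat i) -> q \notin esupp (inr i) -> d <= pdist (rep (esupp (inr i))) q.
  by rewrite inE /= => qW qi; rewrite rep1; apply: H => //; exact: (fintype.subsetP sW).
apply: (le_gap ce) => //.
have := child_proper ce; rewrite properE => /andP[/fintype.subsetP sub /fintype.subsetPn[q qW qe]].
apply: le_trans (H' _ qW qe) (le_diam _ qW); exact/sub/rep_in/(child_neq0 ce).
Qed.

Lemma root_region_mem y : ~ in_open_disc 0 1 (vmap (vfull a0) y) ->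
  region model_params (inr (inl (vfull a0))) (model_point (a0, y)).
Proof.
move=> H; split=> [|W /eneg_child|v /epos_inl [<-]]; first exact: model_point_Cp.
  by rewrite /child eqxx.
by rewrite /model_point vcomp_full seen_self.
Qed.

(** If all chosen points are within [B] of the origin, the size of the full cluster is at most
    [2 B / eps] and its centre is within [B]. *)
Lemma root_far B z : (forall q, q \in full a0 -> absC (pos q) <= B) -> B + 2 * B / eps <= absC z ->
  region model_params (inr (inl (vfull a0))) (model_point (a0, Some z)).
Proof.
move=> HB zB; apply: root_region_mem; rewrite vmap_Some /= subr0 absC_cRdiv ?vsize_gt0 //.
have rB := HB _ (vertex_rep (vfull a0)); have B0 := le_trans (absC_ge0 _) rB.
apply/negP; rewrite -leNgt ler_pdivlMr ?vsize_gt0 // mul1r.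
apply: (exterior_arith eps0 B0 _ rB zB).
  apply: diam_le => [|p q pf qf]; first by rewrite mulr_ge0.
  rewrite mulr_natl mulr2n; apply: le_trans (absCD _ _) _; rewrite absCN.
  by apply: lerD; exact: HB.
have -> : z = (z - vcentre (vfull a0)) + vcentre (vfull a0) by rewrite subrK.
by rewrite addrK; exact: absCD.
Qed.

Lemma root_sigma : is_sigma model_params (root_edge model_tree) (model_point (a0, None)).
Proof.
split; first exact: model_point_Cp.
rewrite eqxx; apply/funext => W; rewrite /model_point /seen /=.
case: eqVneq => [//|h]; rewrite (toward_above _).2 //.
by apply: contra h => /fconnect_from_root ->.
Qed.

Lemma leaf_sigma i : is_sigma model_params (inr i : edge model_tree) (model_point (compL i, Some (pos (inr i)))).
Proof.
split; first exact: model_point_Cp.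
have -> : (inr i == root_edge model_tree) = false by [].
move=> W /eneg_child cW; have <- : lat i = W by rewrite -(child_psup cW).
by rewrite /model_point vcomp_lat seen_self vmap_Some /= (zed_eq (lat_child i)) centre_leaf.
Qed.

Lemma model_Eext_leaves : Eext model_tree = (root_edge model_tree |: [set (inr i : edge model_tree) | i : L])%SET.
Proof.
apply/setP => e; rewrite model_Eext !inE; case: e => [V|i] /=.
  rewrite (inj_eq inl_inj); case: eqP => //= _; apply/esym/negbTE/negP => /imsetP[i _] //.
by apply/esym/imsetP; exists i.
Qed.

(** The conclusions are phrased without clusters. The last two exhibit discs and exteriors contained
    in the ends, for the lower bounds on energy. *)
Lemma cluster_model : exists (T : rooted_tree R) (p : params T) (h : C * P1 R -> vert T -> P1 R)
    (leaf : L -> edge T),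
  [/\ stable_tree T,
      param_space eps (4 * eps) (fun v => (4 * eps ^+ 3) ^+ degree v) p,
      [/\ injective leaf, forall i, leaf i != root_edge T &
        Eext T = (root_edge T |: [set leaf i | i : L])%SET],
      [/\ range h = Cp p,
        forall x x', h x = h x' <-> [\/ x = x', node_pair x x' | node_pair x' x] &
        forall a v, (exists2 M, moebius M & forall z, h (a, z) v = M z) \/
          exists y, forall z, h (a, z) v = y] &
      [/\ forall (w : vert T + edge T) x x', region p w (h x) -> region p w (h x') ->
          reach (u x.1 x.2) (u x'.1 x'.2)
            ((if w is inl v then 4 * kap / (4 * eps ^+ 3) ^+ degree v else 6 * Kc) *
             region_dist p w (h x) (h x')),
        is_sigma p (root_edge T) (h (a0, None)) /\
        forall i, is_sigma p (leaf i) (h (compL i, Some (pos (inr i)))),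
        forall i d z, (forall q, q \in full (compL i) -> q != inr i -> d <= absC (pos (inr i) - pos q)) ->
          absC (z - pos (inr i)) <= 2 * eps * d ->
          region p (inr (leaf i)) (h (compL i, Some z)) &
        forall B z, (forall q, q \in full a0 -> absC (pos q) <= B) -> B + 2 * B / eps <= absC z ->
          region p (inr (root_edge T)) (h (a0, Some z))]].
Proof.
exists model_tree, model_params, model_point, inr; split.
- exact: model_stable.
- exact: model_param_space.
- by split=> [i j []||] //; exact: model_Eext_leaves.
- split; last exact: model_point_slot.
  + apply/seteqP; split=> [x [y _ <-]|x /Cp_model_point[y ->]]; first exact: model_point_Cp.
    by exists y.
  move=> x x'; split; first exact: model_point_inj.
  by case=> [->|/node_pair_point|/node_pair_point] //.
split.
- by case=> [v|e] x x'; [exact: thick_lipschitz|exact: edge_lipschitz].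
- by split; [exact: root_sigma|exact: leaf_sigma].
- move=> i d z H zd; apply: leaf_region_mem; exact: le_trans zd (leaf_radius H).
exact: root_far.
Qed.

End Clusters.

(** * Coordinates on the components *)

Section Coordinates.
Context {R : realType} {n : nat} (X : geometry R n).
Notation plane := (R * R)%type.
Notation MM := (measurableTypeR R * measurableTypeR R)%type.
Implicit Types (u : P1 R -> X) (z w c q : R[i]) (phi psi : P1 R -> P1 R).

(** No measurability is asked, since regions arrive as preimages under parametrizations: the
    integral of a nonnegative function is a supremum over simple functions below it. *)
Lemma energy_subset (D D' : set plane) (u : plane -> X) : D `<=` D' -> (energy D u <= energy D' u)%E.
Proof.
move=> DD; apply: lee_wpmul2l; first by rewrite lee_fin invr_ge0.
have f0 (z : plane) : (0 <= (norm_du u z ^+ 2)%:E)%E by rewrite lee_fin sqr_ge0.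
rewrite !ge0_integralE //; apply: ge_ereal_sup => _ [h hD <-].
apply: ereal_sup_ubound; exists h => // z; apply: le_trans (hD z) _.
rewrite !patchE; case: ifPn => [zD|_]; last by case: ifP.
by rewrite (mem_set (DD _ (set_mem zD))).
Qed.

Lemma energy_off0 (D : set MM) (u : plane -> X) : smooth_map setT u -> measurable D ->
  energy D u = energy (D `\ (0, 0)) u.
Proof.
move=> su mD; congr (_ * _)%E; apply: ge0_negligible_integral => //.
- exact: measurable_set00.
- by apply: measurable_funTS; exact: measurable_norm_du.
- by move=> z _; rewrite lee_fin sqr_ge0.
exact: mu2_set0.
Qed.

Lemma smooth_chart0 u : Jhol_P1 u -> smooth_map setT (chart0 u).
Proof. by move=> Ju; have [] := JholT (Jhol_P1_chart0 Ju). Qed.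

Lemma chart0_inv u q (z : plane) : z != (0, 0) -> chart0 (u \o P1_inv q) z = chart0 (u \o P1_shift q) (cinv z).
Proof. by move=> z0; rewrite /chart0 /= /P1_inv P1_swap_affine. Qed.

Lemma energy_P1_inv u q : Jhol_P1 u ->
  energy setT (chart0 (u \o P1_inv q)) = energy setT (chart0 u).
Proof.
move=> Ju; have Js := Jhol_P1_shift q Ju.
have E1 : energy setT (chart0 u) = energy setT (chart0 (u \o P1_shift q)).
  by rewrite chart0_shift; exact: energy_shift (smooth_chart0 Ju) (@measurableT _ MM).
rewrite E1; apply/esym.
exact: energy_inversion (smooth_chart0 Js) (smooth_chart0 (Jhol_P1_inv q Ju)) (@chart0_inv u q) (@measurableT _ MM).
Qed.

Lemma dens0_constant u : Jhol_P1 u -> (forall z, dens u z = 0) -> forall p p', u p = u p'.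
Proof.
move=> Ju d0; have c0 (z z' : plane) : chart0 u z = chart0 u z'.
  apply: norm_du0_constant; first exact: smooth_chart0.
  by move=> y; rewrite -(to_CK y); exact: d0.
pose u' := u \o P1_inv 0; have Ju' : Jhol_P1 u' by exact: Jhol_P1_inv.
have d1 z : z != 0 -> dens u' z = 0 by move=> z0; rewrite dens_inv // d0 mulr0.
have d2 : dens u' 0 = 0.
  apply/eqP; apply: contraT => h; have h0 : 0 < dens u' 0 by rewrite lt0r h dens_ge0.
  have cn := dens_continuous Ju' (x := (0, 0)).
  have [e /= e0 He] : exists2 e, 0 < e & ball ((0, 0) : plane) e `<=` [set y | 0 < norm_du (chart0 u') y].
    by apply/nbhs_ballP; exact: (cn _ (lt_nbhsr h0)).
  have : ball ((0, 0) : plane) e (e / 2, 0).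
    by split; rewrite -ball_normE /= sub0r normrN ?normr0 // gtr0_norm ?divr_gt0 //; lra.
  move=> /He /=; rewrite -(to_CK (e / 2, 0)) -/(dens u' _) d1 ?ltxx //.
  by rewrite -(plane_of_eq0) to_CK xpair_eqE gt_eqF ?divr_gt0.
have c1 (z z' : plane) : chart0 u' z = chart0 u' z'.
  apply: norm_du0_constant; first exact: smooth_chart0.
  by move=> y; rewrite -(to_CK y) -/(dens u' _); have [->|/d1] := eqVneq (to_C y) 0.
have uN p : u p = u (Some 0).
  case: p => [z|]; first by rewrite -!chart0_plane_of; exact: c0.
  have E1 : chart0 u' (0, 0) = u None by rewrite /chart0 /u' /= /P1_inv P1_swap_affine0.
  rewrite -E1 (c1 _ (1, 0)) /chart0 /u' /= /P1_inv P1_swap_affine ?xpair_eqE ?oner_eq0 //.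
  have -> (y : plane) : P1_shift 0 (affine y) = affine y by rewrite /= addr0.
  by rewrite -chart0_plane_of; exact: c0.
by move=> p p'; rewrite uN [RHS]uN.
Qed.

(** What a change of coordinate on a component must respect: bijectivity, the complex structure,
    J-holomorphic maps and their energy. The inverse [psi] is the map that parametrizes the model
    curve, hence it is the one required to be fractional linear. *)
Definition coordinate phi psi : Prop :=
  [/\ cancel phi psi, cancel psi phi, moebius psi &
    forall u, Jhol_P1 u -> Jhol_P1 (u \o phi) /\
      energy setT (chart0 (u \o phi)) = energy setT (chart0 u)].

Lemma coordinate_id : coordinate id id.
Proof. by split=> //; exact: moebius_id. Qed.

Lemma P1_shiftK q : cancel (P1_shift q) (P1_shift (- q)).
Proof. by case=> [z|] //=; rewrite addrK. Qed.

Lemma P1_shiftNK q : cancel (P1_shift (- q)) (P1_shift q).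
Proof. by case=> [z|] //=; rewrite subrK. Qed.

Lemma coordinate_inv q : coordinate (P1_inv q) (@P1_swap R \o P1_shift (- q)).
Proof.
split=> [p|p||u Ju].
- by rewrite /P1_inv /= P1_shiftK P1_swapK.
- by rewrite /P1_inv /= P1_swapK P1_shiftNK.
- apply: moebius_comp moebius_swap _; apply: moebius_ext (fsym (@P1_shiftE _ _)) _.
  exact: moebius_affine (oner_neq0 _).
by split; [exact: Jhol_P1_inv|exact: energy_P1_inv].
Qed.

Lemma coordinate_comp phi psi phi' psi' : coordinate phi psi -> coordinate phi' psi' ->
  coordinate (phi \o phi') (psi' \o psi).
Proof.
move=> [k1 k2 m H] [k1' k2' m' H']; split.
- by move=> p; rewrite /= k1 k1'.
- by move=> p; rewrite /= k2' k2.
- exact: moebius_comp.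
move=> u Ju; have [J1 E1] := H _ Ju; have [J2 E2] := H' _ J1.
have C : u \o (phi \o phi') = (u \o phi) \o phi' by [].
rewrite C; split.
  exact: J2.
exact: (etrans E2 E1).
Qed.

Lemma coordinate_at (p : P1 R) : exists phi psi, coordinate phi psi /\ phi None = p.
Proof.
case: p => [q|]; last by exists id, id; split=> //; exact: coordinate_id.
exists (P1_inv q), (@P1_swap R \o P1_shift (- q)); split; first exact: coordinate_inv.
by rewrite /P1_inv P1_swap_None /= add0r.
Qed.

(** [P1_inv c] identifies the exterior of radius [r] with the punctured disc of radius [r^-1] about
    [c], where [ball_energy] applies; the missing centre has measure zero. *)
Lemma exterior_energy (C q' : R) u c (a r L : R) : mean_value X C q' -> 0 < C -> Jhol_P1 u -> dens u c = a ->
  0 < r -> L <= q' -> C * L <= (a / r) ^+ 2 ->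
  (L%:E <= energy [set y | (r <= modulus y)%R] (chart0 (u \o P1_inv c)))%E.
Proof.
move=> mv C0 Ju da r0 Lq CL; have Js := Jhol_P1_shift c Ju.
pose D := cdisc (0 : plane) r^-1.
have DE y : D y <-> modulus y <= r^-1.
  by rewrite /D /cdisc /= /shift_plane oppr0 /= !addr0; case: y.
have mD : measurable (D : set MM) by exact: measurable_cdisc.
have m0 : measurable ([set (0, 0)] : set MM) by exact: measurable_set00.
have h1 : (L%:E <= energy D (chart0 (u \o P1_shift c)))%E.
  apply: (ball_energy mv C0 (Jhol_P1_chart0 Js)) => //; first by rewrite invr_gt0.
  have -> : norm_du (chart0 (u \o P1_shift c)) 0 = a by rewrite -da -[c in RHS]add0r -dens_shift.
  by rewrite [r^-1 * a]mulrC.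
apply: le_trans h1 _; rewrite (energy_off0 (smooth_chart0 Js) mD).
rewrite (energy_inversion (smooth_chart0 Js) (smooth_chart0 (Jhol_P1_inv c Ju)) (@chart0_inv u c)) //.
  apply: energy_subset => y [/DE]; rewrite /= => yD y0.
  have y1 : sqn y != 0 by rewrite sqn_eq0; apply: contra_notN y0 => /eqP ->; rewrite /cinv /= !mul0r oppr0.
  have my : 0 < modulus y by rewrite modulus_gt0 -sqn_eq0.
  have : modulus (cinv y) = (modulus y)^-1.
    by rewrite -[y]to_CK -plane_ofV -!absC_modulus absCV.
  by move=> E; move: yD; rewrite E lef_pV2.
exact: measurableD.
Qed.

End Coordinates.

(** * Choice of the root component and of its point at infinity *)

Section RootChoice.
Context {R : realType}.

Lemma kap_le (k l : R) : 24 * k <= l -> 0 <= k -> k <= l.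
Proof. lra. Qed.

Context {n m : nat} (X : geometry R n) (S : marked_curve R m)
  (f : curve_comp S * P1 R -> X) (C q : R).
Notation comp := (curve_comp S).
Context (C0 : 0 < C) (mv : mean_value X C q) (st : stable_map f).

Definition comp_map (phi : P1 R -> P1 R) (a : comp) : P1 R -> X := (fun z => f (a, z)) \o phi.

Lemma Jhol_comp a : Jhol_P1 (fun z => f (a, z)).
Proof. by case: st => -[_ H] _. Qed.

Definition constant_on a := forall z z', f (a, z) = f (a, z').

Lemma stable_constant a : constant_on a ->
  (3 <= #|[set i | (mark S i).1 == a]%SET|
        + #|[set nb : curve_node S * bool | (branch nb.1 nb.2).1 == a]%SET|)%N.
Proof. by case: st => _; apply. Qed.

Lemma dens0_constant_on a phi psi : coordinate X phi psi ->
  (forall z, dens (comp_map phi a) z = 0) -> constant_on a.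
Proof.
move=> [_ k2 _ H] d0 z z'; have [J _] := H _ (Jhol_comp a).
by have := dens0_constant J d0 (psi z) (psi z'); rewrite /comp_map /= !k2.
Qed.

(* Without marked points, the point at infinity of the root coordinate is a
   point of a leaf component where the density is maximal, and the end of the
   root edge carries energy. *)
Definition energetic_end (a0 : comp) (phi0 : P1 R -> P1 R) : Prop :=
  ('I_m -> False) /\ exists a : R,
    [/\ 0 < a, forall z, absC z ^+ 2 * dens (comp_map phi0 a0) z <= a,
        forall r L, 0 < r -> L <= q -> C * L <= (a / r) ^+ 2 ->
          (L%:E <= energy [set y | (r <= modulus y)%R] (chart0 (comp_map phi0 a0)))%E &
        forall nd b, (@branch _ _ S nd b).1 = a0 -> branch nd b = (a0, phi0 (Some 0))].

Lemma root_exists : exists a0 phi0 psi0, [/\ coordinate X phi0 psi0,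
  forall nd b, @branch _ _ S nd b <> (a0, phi0 None) &
  (exists i, mark S i = (a0, phi0 None)) \/ energetic_end a0 phi0].
Proof.
case: (pickP (fun _ : 'I_m => true)) => [i _|none].
  have [phi [psi [co cN]]] := coordinate_at X (mark S i).2.
  have mE : mark S i = ((mark S i).1, phi None) by rewrite cN; case: mark.
  exists (mark S i).1, phi, psi; split=> //; last by left; exists i.
  by move=> nd b; rewrite -mE => h; exact: (mark_smooth (esym h)).
have none' : 'I_m -> False by move=> i; have := none i.
have [a0 [q0 Hq]] := leaf_component S.
have [phi [psi [co cN]]] := coordinate_at X q0.
have [k1 k2 _ H] := co; have [J _] := H _ (Jhol_comp a0).
have [z0 d0] : exists z0, 0 < dens (comp_map phi a0) z0.
  apply: contrapT => nz; have : constant_on a0.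
    apply: dens0_constant_on co _ => z; apply/eqP; apply: contraT => dz.
    by case: nz; exists z; rewrite lt0r dz dens_ge0.
  move=> /stable_constant; rewrite [X in (X + _)%N]eq_card0 => [|i]; last by case: (none' i).
  suff h : (#|[set nb : curve_node S * bool | (branch nb.1 nb.2).1 == a0]%SET| <= 1)%N.
    by move=> /leq_trans/(_ h).
  apply/card_le1_eqP => -[nd b] [nd' b']; rewrite !inE => /eqP /Hq /= h1 /eqP /Hq /= h2.
  by have [-> ->] := branch_inj (etrans h1 (esym h2)).
(* With an empty list of points no condition is left, so this is a global maximum. *)
have [c [dc _ dmax]] := @dens_argmax _ _ _ 0 [::] _ z0 J d0 (fun p => ltac:(by [])).
exists a0, (phi \o P1_inv c), ((@P1_swap R \o P1_shift (- c)) \o psi); split.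
- exact: coordinate_comp co (coordinate_inv X c).
- move=> nd b E; have := Hq nd b; rewrite E => /(_ erefl) [].
  by rewrite -cN /= /P1_inv P1_swap_None /= add0r => /(can_inj k1).
right; split=> //; exists (dens (comp_map phi a0) c); split=> //.
- move=> z; have [->|z0'] := eqVneq z 0; first by rewrite absC0 expr0n mul0r dens_ge0.
  have a0z : 0 < absC z ^+ 2 by rewrite exprn_gt0 // absC_gt0.
  have -> : comp_map (phi \o P1_inv c) a0 = comp_map phi a0 \o P1_inv c by [].
  by rewrite (dens_inv c J z0') mulVKf ?gt_eqF //; apply: dmax.
- move=> r L r0 Lq CL.
  exact: (exterior_energy mv C0 J erefl r0 Lq CL).
by move=> nd b /Hq ->; rewrite /= /P1_inv P1_swap0 /= cN.
Qed.

End RootChoice.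

(** * Special and added points in the coordinates *)

Section Points.
Context {R : realType} {n m : nat} (X : geometry R n) (S : marked_curve R m)
  (f : curve_comp S * P1 R -> X).
Notation comp := (curve_comp S).
Context (a0 : comp) (dp : comp -> nat) (par : comp -> comp) (qa pa : comp -> P1 R)
  (phi psi : comp -> P1 R -> P1 R) (kap : R) (Y : comp -> seq R[i]).
Context (ct : curve_tree a0 dp par qa pa) (co : forall a, coordinate X (phi a) (psi a))
  (phiN : forall a, a != a0 -> phi a None = qa a)
  (root_free : forall nd b, @branch _ _ S nd b <> (a0, phi a0 None)).

(** A marked point at infinity of the root component becomes the root edge instead of a leaf. *)
Definition finite_mark : finType := {i : 'I_m | mark S i != (a0, phi a0 None)}.
Definition coo (x : comp * P1 R) : R[i] := hx (psi x.1 x.2).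
Definition spec (p : (comp + finite_mark)%type) : comp * P1 R :=
  match p with inl c => (par c, pa c) | inr i => mark S (val i) end.
Definition special (a : comp) : seq R[i] :=
  [seq coo (spec p) | p <- enum {: comp + finite_mark} & (p != inl a0) && ((spec p).1 == a)].

Definition leaf_t : finType := (finite_mark + {a : comp & 'I_(size (Y a))})%type.
Definition leaf_comp (x : leaf_t) : comp :=
  match x with inl i => (mark S (val i)).1 | inr t => tag t end.
Definition point (p : (comp + leaf_t)%type) : R[i] :=
  match p with
  | inl c => coo (spec (inl c))
  | inr (inl i) => coo (spec (inr i))
  | inr (inr t) => nth 0 (Y (tag t)) (tagged t)
  end.

Notation fullP := (full a0 par leaf_comp).

Lemma infinity_branch a : a != a0 -> exists nd b, @branch _ _ S nd b = (a, phi a None).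
Proof.
move=> aa; have [_ /(_ _ aa)[nd [b [h _]]] _ _ _] := ct.
by exists nd, b; rewrite h phiN.
Qed.

(** Infinity is the node towards the root or, on the root component, a point that is no node and no
    other marked point; by [curve_tree] a node leading away from the root differs from it. *)
Lemma spec_finite p : p != inl a0 -> psi (spec p).1 (spec p).2 = Some (coo (spec p)).
Proof.
move=> p0; suff : spec p <> ((spec p).1, phi (spec p).1 None).
  rewrite /coo; case: (spec p) => a x /= h; case E : (psi a x) => [//|]; case: h.
  by have [_ k2 _ _] := co a; rewrite -E k2.
case: p p0 => [c|i] p0 /=.
  have c0 : c != a0 by apply: contraNneq p0 => ->.
  have [_ /(_ _ c0)[nd [b [_ h]]] _ _ nc] := ct.
  have [pc|pc] := eqVneq (par c) a0; first by move=> E; case: (@root_free nd (~~ b)); rewrite h E pc.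
  by rewrite phiN // => E; apply: (nc _ _ pc c0).
have [pc|pc] := eqVneq (mark S (val i)).1 a0.
  by move=> E; case/eqP: (valP i); apply: (etrans E); congr (_, phi _ None); exact: pc.
have [nd [b h]] := infinity_branch pc.
by rewrite -h; exact: mark_smooth.
Qed.

Lemma spec_inj p p' : p != inl a0 -> p' != inl a0 -> spec p = spec p' -> p = p'.
Proof.
have nm c i : c != a0 -> (par c, pa c) <> mark S i.
  move=> c0; have [_ /(_ _ c0)[nd [b [_ h]]] _ _ _] := ct.
  by rewrite -h => E; exact: (mark_smooth (esym E)).
have nc c : inl c != inl a0 :> (comp + finite_mark) -> c != a0 by apply: contraNneq => ->.
have [_ _ _ pinj _] := ct.
case: p => [c|i] /=; case: p' => [c'|i'] /= h h' E.
- by rewrite (pinj _ _ (nc _ h) (nc _ h') E).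
- by case: (nm _ _ (nc _ h) E).
- by case: (nm _ _ (nc _ h') (esym E)).
- by congr inr; apply/val_inj/(@mark_inj _ _ S).
Qed.

Lemma coo_inj p p' : p != inl a0 -> p' != inl a0 -> (spec p).1 = (spec p').1 ->
  coo (spec p) = coo (spec p') -> p = p'.
Proof.
move=> h h' E1 E2; apply: spec_inj => //.
have := spec_finite h; rewrite E2 -(spec_finite h') -E1.
have [_ k2 _ _] := co (spec p).1; move=> /(can_inj k2).
by move: E1; case: (spec p) => a x; case: (spec p') => a' x' /= -> ->.
Qed.

Lemma mem_special a z : (z \in special a) <-> exists p, [/\ p != inl a0, (spec p).1 = a & z = coo (spec p)].
Proof.
split=> [/mapP[p]|[p [p0 <- ->]]].
  by rewrite mem_filter => /andP[/andP[p0 /eqP pE] _] ->; exists p.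
by apply: map_f; rewrite mem_filter p0 eqxx mem_enum.
Qed.

Lemma mem_points a z : (z \in special a ++ Y a) <-> exists2 p, p \in fullP a & z = point p.
Proof.
rewrite mem_cat; split=> [/orP[/mem_special[p [p0 pE ->]]|zY]|[p]].
- case: p p0 pE => [c|i] p0 pE.
    by exists (inl c) => //; rewrite inE /= -pE eqxx andbT; exact: p0.
  by exists (inr (inl i)) => //; rewrite inE /= -pE eqxx.
- have zs : (index z (Y a) < size (Y a))%N by rewrite index_mem.
  exists (inr (inr (existT (fun a => 'I_(size (Y a))) a (Ordinal zs)))); first by rewrite inE /= eqxx.
  by rewrite /= nth_index.
rewrite inE => /andP[p0 /eqP pE] ->; case: p p0 pE => [c|[i|t]] p0 pE.
- apply/orP; left; apply/mem_special; exists (inl c); split=> //.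
- by apply/orP; left; apply/mem_special; exists (inr i).
- by apply/orP; right; move: pE => /= <-; rewrite mem_nth // ltn_ord.
Qed.

Lemma point_inj p p' : (forall a, uniq (Y a)) -> (forall a y, y \in Y a -> y \notin special a) ->
  p != inl a0 -> p' != inl a0 -> pcomp par leaf_comp p = pcomp par leaf_comp p' ->
  point p = point p' -> p = p'.
Proof.
move=> uY Ys.
have sp q : q != inl a0 -> coo (spec q) \in special (spec q).1.
  by move=> q0; apply/mem_special; exists q.
have mixed q t : q != inl a0 -> (spec q).1 = tag t -> coo (spec q) <> point (inr (inr t)).
  move=> q0 qt E; have := sp _ q0; rewrite qt E; apply/negP/Ys.
  by rewrite /= mem_nth.
case: p => [c|[i|t]]; case: p' => [c'|[i'|t']] p0 p0' Ec E.
- by have := @coo_inj (inl c) (inl c') p0 p0' Ec E => -[->].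
- by have := @coo_inj (inl c) (inr i') p0 p0' Ec E.
- by case: (mixed (inl c) t' p0 Ec E).
- by have := @coo_inj (inr i) (inl c') p0 p0' Ec E.
- by have := @coo_inj (inr i) (inr i') p0 p0' Ec E => -[->].
- by case: (mixed (inr i) t' p0 Ec E).
- by case: (mixed (inl c') t p0' (esym Ec) (esym E)).
- by case: (mixed (inr i') t p0' (esym Ec) (esym E)).
move: t t' Ec E {p0 p0'} => [a j] [a' j'] /= aa; subst a' => /eqP.
by rewrite nth_uniq // => /eqP /val_inj ->.
Qed.

Context (l Kc : R) (dec : decay X l Kc) (Kc0 : 0 <= Kc)
  (kap0 : 0 < kap) (kapl : 24 * kap <= l) (st : stable_map f).
Context (fullY : forall a z, violates kap (special a ++ Y a) (comp_map f (phi a) a) z ->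
     dens (comp_map f (phi a) a) z = 0).

Definition umap a := comp_map f (phi a) a.

Lemma Jhol_umap a : Jhol_P1 (umap a).
Proof. by have [_ _ _ H] := co a; exact: (H _ (Jhol_comp st a)).1. Qed.

(** If the bound failed, [z] would still violate all conditions, and after the greedy choice the
    density vanishes at such points. *)
Lemma umap_away a z t : 0 <= t -> (forall p, p \in fullP a -> t <= absC (z - point p)) ->
  t * dens (umap a) z <= kap.
Proof.
move=> t0 H; rewrite leNgt; apply/negP => lt.
have d0 : dens (umap a) z = 0.
  apply: fullY => w /mem_points[p /H tp ->]; apply: le_trans (ltW lt) _.
  by rewrite ler_wpM2r ?dens_ge0.
by move: lt; rewrite d0 mulr0 ltNge ltW.
Qed.

Lemma umap_node b : b != a0 -> umap b None = umap (par b) (Some (point (inl b))).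
Proof.
move=> b0; have p0 : inl b != inl a0 :> (comp + finite_mark) by apply: contraNneq b0 => -[->].
rewrite /umap /comp_map /= phiN // -(spec_finite p0) /=.
have [k1 k2 _ _] := co (par b); rewrite k2.
have [_ /(_ _ b0)[nd [b' [h h']]] _ _ _] := ct; have [[Hf _] _] := st.
by apply: Hf; right; exists nd, b'.
Qed.

(* With at most one point the density is at most [l / |z - p|] on a whole
   infinite cylinder, where it decays to zero. *)
Lemma nonconstant_points a : ~ constant_on f a -> (1 < #|fullP a|)%N.
Proof.
move=> nc; rewrite ltnNge; apply/negP => le1; apply: nc.
apply: (dens0_constant_on st (co a)).
have [E|[p pf]] : #|fullP a| = 0%N \/ exists p, p \in fullP a.
- by case: (posnP #|fullP a|) => [|/card_gt0P]; [left|right].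
- move=> z; apply: fullY => w /mem_points[p pf _].
  by move/eqP: E; rewrite cards_eq0 => /eqP E; rewrite E inE in pf.
have one w : w \in fullP a -> w = p by move=> wf; exact: (card_le1_eqP le1).
have Js := Jhol_P1_shift (point p) (Jhol_umap a).
have H (y : R * R) : modulus y * norm_du (chart0 (umap a \o P1_shift (point p))) y <= l.
  have yE := dens_shift (point p) (to_C y) (Jhol_umap a).
  rewrite /dens to_CK in yE; rewrite yE -/(dens (umap a) (to_C y + point p)).
  have -> : modulus y = absC (to_C y + point p - point p) by rewrite addrK absC_modulus to_CK.
  apply: le_trans (kap_le kapl (ltW kap0)).
  by apply: umap_away => [|w /one ->]; rewrite ?absC_ge0.
have d0 := global_decay dec Kc0 (Jhol_P1_chart0 Js) H.
move=> z; have := dens_shift (point p) (z - point p) (Jhol_umap a); rewrite subrK => <-.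
exact: d0.
Qed.

(** Stability provides three special points, of which at most one is at infinity; the proof injects
    them into infinity and the chosen points. *)
Lemma constant_points a : constant_on f a -> (1 < #|fullP a|)%N.
Proof.
move=> /(stable_constant st); set Ms := [set i | _]%SET; set Bs := [set nb | _]%SET => le3.
pose s := [seq mark S i | i <- enum Ms] ++ [seq branch nb.1 nb.2 | nb <- enum Bs].
have us : uniq s.
  rewrite cat_uniq !map_inj_uniq ?enum_uniq /= ?andbT; last exact: mark_inj.
    apply/hasPn => _ /mapP[nb _ ->]; apply/negP => /mapP[i _ E].
    exact: (mark_smooth (esym E)).
  by move=> [nd b] [nd' b'] /= /branch_inj[-> ->].
pose s' := (a, phi a None) :: [seq (a, phi a (Some (point p))) | p <- enum (fullP a)].
have sub : {subset s <= s'}.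
  have key x : x.1 = a -> (exists2 p, p != inl a0 & spec p = x) \/ x = (a, phi a None) -> x \in s'.
    move=> xa [[p p0 px]|->]; last by rewrite inE eqxx.
    rewrite inE; apply/orP; right; apply/mapP.
    have : coo (spec p) \in special a ++ Y a.
      by rewrite mem_cat; apply/orP; left; apply/mem_special; exists p; rewrite px.
    move=> /mem_points[w wf E]; exists w; first by rewrite mem_enum.
    rewrite -E -(spec_finite p0) px xa; have [_ k2 _ _] := co a.
    by rewrite k2 -xa; case: (x).
  have keyM i : (exists2 p, p != inl a0 & spec p = mark S i) \/ mark S i = (a0, phi a0 None).
    have [->|h] := eqVneq (mark S i) (a0, phi a0 None); first by right.
    by left; exists (inr (exist _ i h)).
  move=> x; rewrite mem_cat => /orP[] /mapP.
    case=> i; rewrite mem_enum inE => /eqP ia ->; apply: key => //.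
    have [|h] := keyM i; [by left|right].
    by rewrite h in ia *; rewrite -ia.
  case=> -[nd b]; rewrite mem_enum inE => /= /eqP ia ->; apply: key => //.
  have [_ _ /(_ nd b)[c [c0 [[h h']|[h h']]]] _ _] := ct; rewrite h in ia *.
    by right; rewrite -ia /= phiN.
  by left; exists (inl c).
have := uniq_leq_size us sub; rewrite size_cat !size_map /= -!cardE => h.
by rewrite size_map -cardE in h; rewrite -ltnS; exact: leq_trans h.
Qed.

Lemma points_gt1 a : (1 < #|fullP a|)%N.
Proof.
have [h|h] := pselect (constant_on f a); [exact: constant_points|exact: nonconstant_points].
Qed.

End Points.

(** * Assembly *)

Section ModelCurve.
Context {R : realType} {n m : nat} (X : geometry R n) (S : marked_curve R m)
  (f : curve_comp S * P1 R -> X).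
Notation comp := (curve_comp S).
Context (a0 : comp) (dp : comp -> nat) (par : comp -> comp) (qa pa : comp -> P1 R)
  (phi psi : comp -> P1 R -> P1 R) (Y : comp -> seq R[i]).
Context (ct : curve_tree a0 dp par qa pa) (co : forall a, coordinate X (phi a) (psi a))
  (phiN : forall a, a != a0 -> phi a None = qa a)
  (root_free : forall nd b, @branch _ _ S nd b <> (a0, phi a0 None)).
Notation pos := (@point R m S a0 par pa phi psi Y).

Definition to_coord (x : comp * P1 R) : comp * P1 R := (x.1, psi x.1 x.2).

Lemma to_coord_inj : injective to_coord.
Proof.
move=> [a z] [a' z'] [/= <- h]; have [_ k2 _ _] := co a.
by have -> : z = z' by exact: (can_inj k2).
Qed.

Lemma to_coord_surj x : exists y, to_coord y = x.
Proof.
by case: x => a z; exists (a, phi a z); rewrite /to_coord /=; have [-> _ _ _] := co a.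
Qed.

Lemma to_coord_infinity a : a != a0 -> to_coord (a, qa a) = (a, None).
Proof. by move=> aa; rewrite /to_coord /= -phiN //; have [-> _ _ _] := co a. Qed.

Lemma to_coord_node a : a != a0 -> to_coord (par a, pa a) = (par a, Some (pos (inl a))).
Proof.
move=> aa; have p0 : inl a != inl a0 :> (comp + finite_mark a0 phi) by apply: contraNneq aa => -[->].
by rewrite /to_coord /= (spec_finite ct co phiN root_free p0).
Qed.

Lemma same_point_node_pair x x' : same_point x x' <->
  [\/ to_coord x = to_coord x', node_pair a0 par pos (to_coord x) (to_coord x')
    | node_pair a0 par pos (to_coord x') (to_coord x)].
Proof.
have back y y' : node_pair a0 par pos (to_coord y) (to_coord y') ->
    exists2 b, b != a0 & y = (b, qa b) /\ y' = (par b, pa b).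
  move=> [b [b0]]; rewrite -(to_coord_infinity b0) -(to_coord_node b0).
  by move=> /to_coord_inj -> /to_coord_inj ->; exists b.
have [_ jn br _ _] := ct; split.
  case=> [->|[nd [b [-> ->]]]]; first exact: Or31.
  have [a [aa [[-> ->]|[-> ->]]]] := br nd b; [apply: Or32|apply: Or33];
    by exists a; rewrite to_coord_infinity // to_coord_node.
case=> [/to_coord_inj ->|/back[b b0 [-> ->]]|/back[b b0 [-> ->]]]; first by left.
  by have [nd [c [h h']]] := jn _ b0; right; exists nd, c.
by have [nd [c [h h']]] := jn _ b0; right; exists nd, (~~ c); rewrite negbK.
Qed.

Definition coord_branch nd b := to_coord (@branch _ _ S nd b).
Definition no_mark (i : 'I_0) : comp * P1 R := (a0, None).

Lemma coord_branch_inj nd b nd' b' : coord_branch nd b = coord_branch nd' b' -> nd = nd' /\ b = b'.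
Proof. by move=> /to_coord_inj/branch_inj. Qed.

Lemma no_mark_inj : injective no_mark.
Proof. by case. Qed.

Lemma no_mark_smooth i nd b : no_mark i <> coord_branch nd b.
Proof. by case: i. Qed.

(** The same curve with its nodes expressed in the new coordinates and its marked points forgotten,
    as [map_space] measures energy on an unmarked curve. *)
Definition coord_curve : marked_curve R 0 :=
  @MarkedCurve R 0 comp (curve_node S) coord_branch no_mark coord_branch_inj no_mark_inj no_mark_smooth
    (@curve_nonempty _ _ S) (@curve_connected _ _ S) (@curve_genus _ _ S).

Context (T : rooted_tree R) (p : params T) (h : comp * P1 R -> vert T -> P1 R)
  (hrange : range h = Cp p)
  (hP : forall x x', h x = h x' <-> [\/ x = x', node_pair a0 par pos x x' | node_pair a0 par pos x' x])
  (hslot : forall a v, (exists2 M, moebius M & forall z, h (a, z) v = M z) \/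
     exists y, forall z, h (a, z) v = y).

Lemma coord_iso : curve_iso (S := S) p (h \o to_coord).
Proof.
split.
- move=> a v; have [_ _ mp _] := co a.
  have [[M mM hM]|[y hy]] := hslot a v.
    apply: moebius_holomorphic; apply: moebius_ext (moebius_comp mM mp) => z.
    by rewrite /= -hM.
  rewrite (_ : (fun z => _) = (fun=> y)); first exact: cst_holomorphic.
  by apply/funext => z; rewrite /= hy.
- by move=> y y'; rewrite /= same_point_node_pair; exact: hP.
rewrite -hrange; apply/seteqP; split=> [_ [x _ <-]|_ [x _ <-]]; first by exists (to_coord x).
by have [y <-] := to_coord_surj x; exists y.
Qed.

Lemma coord_curve_iso : curve_iso (S := coord_curve) p h.
Proof.
split=> //.
- move=> a v; have [[M mM hM]|[y hy]] := hslot a v.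
    by apply: moebius_holomorphic; apply: moebius_ext mM => z; rewrite hM.
  rewrite (_ : (fun z => _) = (fun=> y)); first exact: cst_holomorphic.
  by apply/funext => z; rewrite hy.
move=> x x'; have [y yx] := to_coord_surj x; have [y' yx'] := to_coord_surj x'.
rewrite -yx -yx' hP -same_point_node_pair; split.
  by case=> [->|[nd [b [-> ->]]]]; [left|right; exists nd, b].
case=> [/to_coord_inj ->|[nd [b [/to_coord_inj -> /to_coord_inj ->]]]]; first by left.
by right; exists nd, b.
Qed.

End ModelCurve.

Section Energies.
Context {R : realType} {n m : nat} (X : geometry R n) (S : marked_curve R m)
  (f : curve_comp S * P1 R -> X).
Notation comp := (curve_comp S).

Lemma curve_energy_ge (D : set (R * R)) (U : set (comp * P1 R)) a :
  (forall z, D z -> U (a, affine z)) -> (energy D (chart0 (fun z => f (a, z))) <= curve_energy f U)%E.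
Proof.
move=> DU; rewrite /curve_energy (bigD1 a) //=; apply: le_trans (energy_subset _ (DU : D `<=` [set z | U (a, affine z)])) _.
by apply: leeDl; apply: sume_ge0 => a' _; exact: energy_ge0.
Qed.

Context (C q kap lam A : R) (phi psi : comp -> P1 R -> P1 R) (P0 : comp -> seq R[i]).
Context (C1 : 1 <= C) (mv : mean_value X C q) (lam0 : 0 < lam) (lq : lam ^+ 2 <= q)
  (kl : 3 * Num.sqrt C * lam <= kap) (st : stable_map f)
  (EA : (curve_energy f setT <= A%:E)%E) (co : forall a, coordinate X (phi a) (psi a)).

Lemma coord_energy a : energy setT (chart0 (comp_map f (phi a) a)) = energy setT (chart0 (fun z => f (a, z))).
Proof. by have [_ _ _ H] := co a; exact: (H _ (Jhol_comp st a)).2. Qed.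

Lemma greedy_points : exists Y : comp -> seq R[i], forall a,
  separated kap (P0 a) (Y a) (comp_map f (phi a) a) /\
  forall z, violates kap (P0 a ++ Y a) (comp_map f (phi a) a) z -> dens (comp_map f (phi a) a) z = 0.
Proof.
suff H a : exists Y, separated kap (P0 a) Y (comp_map f (phi a) a) /\
    forall z, violates kap (P0 a ++ Y) (comp_map f (phi a) a) z -> dens (comp_map f (phi a) a) z = 0.
  by have [Y HY] := choice H; exists Y.
have Ju : Jhol_P1 (comp_map f (phi a) a) by have [_ _ _ H] := co a; exact: (H _ (Jhol_comp st a)).1.
(* The number of steps comes from the total energy [A], which bounds the energy of each
   component. *)
apply: (@greedy _ _ _ C q kap lam (Num.truncn (A / lam ^+ 2)).+1) => //.
rewrite coord_energy; apply: le_trans (curve_energy_ge (U := setT) (fun _ _ => I)) _.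
apply: le_trans EA _; rewrite lee_fin -ler_pdivrMr ?exprn_gt0 //.
exact: ltW (truncnS_gt _).
Qed.

Lemma separated_total (Y : comp -> seq R[i]) : 0 <= A ->
  (forall a, separated kap (P0 a) (Y a) (comp_map f (phi a) a)) ->
  (\sum_a size (Y a) <= Num.truncn (A / lam ^+ 2))%N.
Proof.
move=> A0 sY; rewrite truncn_ge_nat ?divr_ge0 ?exprn_ge0 ?(ltW lam0) //.
rewrite ler_pdivlMr ?exprn_gt0 // -lee_fin; apply: le_trans EA.
rewrite natr_sum mulr_suml -sumEFin; apply: lee_sum => a _.
have Ju : Jhol_P1 (comp_map f (phi a) a) by have [_ _ _ H] := co a; exact: (H _ (Jhol_comp st a)).1.
apply: le_trans (separated_size mv C1 lam0 lq kl Ju (sY a)) _.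
by rewrite coord_energy.
Qed.

End Energies.

Section EnergyArithmetic.
Context {R : realType}.
Implicit Types C lam eps kap d a : R.

(** On the disc of radius [2 eps kap / d] the relevant product is [2 eps kap = 6 sqrt C lam], far
    more than needed. *)
Lemma leaf_energy_arith C lam eps d : 1 <= C -> 0 < lam -> 0 < eps -> 0 < d ->
  C * (lam ^+ 2 / (9 * C)) <= (2 * eps * ((3 * Num.sqrt C * lam / eps) / d) * d) ^+ 2.
Proof.
move=> C1 lam0 eps0 d0; have C0 : 0 < C by lra.
have -> : 2 * eps * ((3 * Num.sqrt C * lam / eps) / d) * d = 6 * lam * Num.sqrt C.
  by field; rewrite !gt_eqF.
rewrite exprMn sqr_sqrtr ?(ltW C0) //.
have -> : C * (lam ^+ 2 / (9 * C)) = lam ^+ 2 / 9 by field; rewrite gt_eqF.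
have l2 : 0 < lam ^+ 2 by rewrite exprn_gt0.
by have := l2; have := C1; rewrite exprMn; nra.
Qed.

(** [B] is the radius containing all chosen points. The quotient is [3 sqrt C lam / (2 (eps + 2))],
    at least [lam / 3] because [eps] is at most [1 / 8] and [sqrt C] at least [1]. *)
Lemma root_energy_arith C lam eps a : 1 <= C -> 0 < lam -> 0 < eps -> 8 * eps <= 1 -> 0 < a ->
  let B := 2 * a / (3 * Num.sqrt C * lam / eps) in
  0 < B + 2 * B / eps /\ C * (lam ^+ 2 / (9 * C)) <= (a / (B + 2 * B / eps)) ^+ 2.
Proof.
move=> C1 lam0 eps0 eps8 a0; have C0 : 0 < C by lra.
have s0 : 0 < Num.sqrt C by rewrite sqrtr_gt0.
have s1 : 1 <= Num.sqrt C by rewrite -[leLHS]sqrtr1; exact: ler_wsqrtr.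
move=> B; have B0 : 0 < B by rewrite !(divr_gt0, mulr_gt0).
have S0 : 0 < B + 2 * B / eps by rewrite addr_gt0 // !(divr_gt0, mulr_gt0).
split=> //.
have e2 : 0 < eps + 2 by lra.
have -> : a / (B + 2 * B / eps) = 3 * Num.sqrt C * lam / (2 * (eps + 2)).
  have k0 : 0 < 3 * Num.sqrt C * lam by rewrite !mulr_gt0.
  rewrite /B; move: (3 * Num.sqrt C * lam) k0 => k k0.
  have -> : 2 * a / (k / eps) + 2 * (2 * a / (k / eps)) / eps = 2 * a * (eps + 2) / k.
    by field; rewrite !gt_eqF.
  by field; rewrite !gt_eqF.
have -> : C * (lam ^+ 2 / (9 * C)) = (lam / 3) ^+ 2 by field; rewrite gt_eqF.
rewrite ler_pXn2r ?nnegrE ?divr_ge0 ?mulr_ge0 ?(ltW lam0) ?(ltW e2) ?sqrtr_ge0 //.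
rewrite ler_pdivlMr ?mulr_gt0 //.
have h : lam <= Num.sqrt C * lam by rewrite ler_peMl // ltW.
nra.
Qed.

Lemma root_bound_arith (k x y y' d a : R) : 0 < k -> 0 <= y' -> 0 < d -> x <= y' + y -> k <= x * d ->
  y <= y' -> y' ^+ 2 * d <= a -> y' <= 2 * a / k.
Proof.
move=> k0 y0 d0 xy kx yy h; rewrite ler_pdivlMr //.
have h1 : x * d <= 2 * y' * d by rewrite ler_wpM2r ?(ltW d0) //; lra.
apply: (@le_trans _ _ (y' * (2 * y' * d))); first by rewrite ler_wpM2l // (le_trans kx).
have -> : y' * (2 * y' * d) = 2 * (y' ^+ 2 * d) by ring.
by rewrite ler_wpM2l.
Qed.

End EnergyArithmetic.

Section Assembly.
Context {R : realType} {n m : nat} (X : geometry R n) (S : marked_curve R m)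
  (f : curve_comp S * P1 R -> X) (K : set X) (C q l Kc eps lam A : R).
Notation comp := (curve_comp S).
Notation kap := (3 * Num.sqrt C * lam / eps).
Context (C1 : 1 <= C) (mv : mean_value X C q) (dec : decay X l Kc) (Kc0 : 0 <= Kc) (l0 : 0 <= l)
  (eps0 : 0 < eps) (eps8 : 8 * eps <= 1) (lam0 : 0 < lam) (lq : lam ^+ 2 <= q) (kapl : 24 * kap <= l)
  (A0 : 0 <= A) (st : stable_map f) (fK : range f `<=` K) (EA : (curve_energy f setT <= A%:E)%E).

Lemma kap_gt0 : 0 < kap.
Proof. by rewrite divr_gt0 // !mulr_gt0 // sqrtr_gt0 (lt_le_trans _ C1). Qed.

Lemma kap_ge : 3 * Num.sqrt C * lam <= kap.
Proof.
rewrite ler_pdivlMr // ler_piMr ?mulr_ge0 ?sqrtr_ge0 ?(ltW lam0) //.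
by move: eps8; lra.
Qed.

Lemma C_gt0 : 0 < C.
Proof. exact: lt_le_trans C1. Qed.

Lemma energy_small : lam ^+ 2 / (9 * C) <= q.
Proof.
apply: le_trans lq; rewrite ler_pdivrMr ?mulr_gt0 ?C_gt0 // ler_peMr ?exprn_ge0 ?(ltW lam0) //.
by move: C1; lra.
Qed.

Lemma card_leaves (a0 : comp) (phi : comp -> P1 R -> P1 R) (Y : comp -> seq R[i]) :
  (#|{: leaf_t a0 phi Y}| <= m + \sum_a size (Y a))%N.
Proof.
rewrite card_sum leq_add //; first by rewrite card_sig; apply: leq_trans (max_card _) _; rewrite card_ord.
rewrite card_tagged sumnE big_map big_enum; apply: leq_sum => a _.
by rewrite card_ord.
Qed.

Section Root.
Context (a0 : comp) (dp : comp -> nat) (par : comp -> comp) (qa pa : comp -> P1 R)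
  (phi psi : comp -> P1 R -> P1 R) (Y : comp -> seq R[i]).
Context (ct : curve_tree a0 dp par qa pa) (co : forall a, coordinate X (phi a) (psi a))
  (phiN : forall a, a != a0 -> phi a None = qa a)
  (root_free : forall nd b, @branch _ _ S nd b <> (a0, phi a0 None))
  (sepY : forall a, separated kap (special a0 par pa phi psi a) (Y a) (comp_map f (phi a) a))
  (fullY : forall a z, violates kap (special a0 par pa phi psi a ++ Y a) (comp_map f (phi a) a) z ->
     dens (comp_map f (phi a) a) z = 0).
Notation fullP := (full a0 par (@leaf_comp R m S a0 phi Y)).
Notation pos := (@point R m S a0 par pa phi psi Y).
Notation leafT := (leaf_t a0 phi Y).

Lemma positions_inj (p p' : (comp + leafT)%type) : p != inl a0 -> p' != inl a0 ->
  pcomp par (@leaf_comp R m S a0 phi Y) p = pcomp par (@leaf_comp R m S a0 phi Y) p' ->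
  pos p = pos p' -> p = p'.
Proof.
apply: (point_inj ct co phiN root_free) => [a|a y ya]; first by have [] := sepY a.
by have [_ /(_ _ ya)[]] := sepY a.
Qed.

Lemma added_distance (t : {a : comp & 'I_(size (Y a))}) (p : (comp + leafT)%type) :
  p \in fullP (tag t) -> p != inr (inr t) ->
  0 < dens (umap f phi (tag t)) (pos (inr (inr t))) /\
  kap <= absC (pos (inr (inr t)) - pos p) * dens (umap f phi (tag t)) (pos (inr (inr t))).
Proof.
move=> pf pt; have yY : pos (inr (inr t)) \in Y (tag t) by rewrite mem_nth.
have [_ /(_ _ yY)[_ d0 sep]] := sepY (tag t); split=> //; apply: sep.
  by apply/mem_points; exists p.
apply: contra_neq pt => E; move: pf; rewrite inE => /andP[p0 /eqP pc].
exact: positions_inj.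
Qed.

(** Let [y] be the farthest chosen point. If it is the node, it is [0]. Otherwise it was added,
    hence separated from some other chosen point at distance at most [2 |y|]: so
    [kap <= 2 |y| |df|], and [|y| ^ 2 |df| <= a] gives the bound. *)
Lemma root_points_bound (a : R) : 0 < a -> ('I_m -> False) ->
  (forall z, absC z ^+ 2 * dens (umap f phi a0) z <= a) ->
  (forall nd b, (@branch _ _ S nd b).1 = a0 -> branch nd b = (a0, phi a0 (Some 0))) ->
  forall p, p \in fullP a0 -> absC (pos p) <= 2 * a / kap.
Proof.
move=> a_gt0 none Ha Hb p0 pf0; have k0 := kap_gt0.
pose p := [arg max_(p > p0 | p \in fullP a0) absC (pos p)]%O.
have [pf pmax] : p \in fullP a0 /\ forall p', p' \in fullP a0 -> absC (pos p') <= absC (pos p).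
  by rewrite /p; case: Order.TotalTheory.arg_maxP.
apply: le_trans (pmax _ pf0) _; case: {p0 pf0} p pf pmax => [c|[i|t]] pf pmax.
- move: pf; rewrite inE => /andP[c0' /eqP /= pc].
  have c0 : c != a0 by apply: contraNneq c0' => ->.
  have [_ /(_ _ c0)[nd [b [_ h]]] _ _ _] := ct.
  have := Hb nd (~~ b); rewrite h pc => /(_ erefl) [E].
  rewrite /coo /= E; have [-> _ _ _] := co a0.
  by rewrite /= absC0; apply: divr_ge0; [rewrite mulr_ge0 // ltW|exact: ltW].
- by case: (none (val i)).
have ta : tag t = a0 by move: pf; rewrite inE => /andP[_ /eqP].
have [p' p'f pt] : exists2 p', p' \in fullP a0 & p' != inr (inr t).
  have /card_gt1P[x [y [xf yf xy]]] :=
    points_gt1 ct co phiN root_free dec Kc0 k0 kapl st fullY a0.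
  have [xt|xt] := eqVneq x (inr (inr t)); last by exists x.
  by exists y => //; rewrite -xt eq_sym.
have p'f' : p' \in fullP (tag t) by rewrite ta.
have [d0 hk] := added_distance p'f' pt; have := Ha (pos (inr (inr t))).
rewrite ta in d0 hk; move: hk (pmax _ p'f) d0 (dens_ge0 (umap f phi a0) (pos (inr (inr t)))).
have := absCD (pos (inr (inr t))) (- pos p'); rewrite absCN.
move=> xy hk y'y d0 _ hd; exact: root_bound_arith k0 (absC_ge0 _) d0 xy hk y'y hd.
Qed.

Section Model.
Context (T : rooted_tree R) (p : params T) (h : comp * P1 R -> vert T -> P1 R) (leaf : leafT -> edge T)
  (f' : (vert T -> P1 R) -> X).
Context (linj : injective leaf) (lroot : forall i, leaf i != root_edge T)
  (EextE : Eext T = (root_edge T |: [set leaf i | i : leafT])%SET)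
  (f'h : forall x, f' (h x) = umap f phi x.1 x.2).

(** [insub] fails exactly for a marked point at infinity of the root component, which is matched
    with the root edge. *)
Definition mark_edge (i : 'I_m) : edge T :=
  if insub i is Some j then leaf (inl (j : finite_mark a0 phi)) else root_edge T.

Lemma mark_edgeP i : (exists j : finite_mark a0 phi, val j = i /\ mark_edge i = leaf (inl j)) \/
  (mark S i = (a0, phi a0 None) /\ mark_edge i = root_edge T).
Proof.
rewrite /mark_edge; case: insubP => [j _ ji|/negPn/eqP h1]; first by left; exists j.
by right.
Qed.

Lemma mark_edge_leaf (j : finite_mark a0 phi) : mark_edge (val j) = leaf (inl j).
Proof. by rewrite /mark_edge valK. Qed.

Lemma mark_edge_root i : mark S i = (a0, phi a0 None) -> mark_edge i = root_edge T.
Proof.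
move=> mi; case: (mark_edgeP i) => [[j [ji _]]|[]] //.
by have := valP j; rewrite ji mi eqxx.
Qed.

Lemma mark_edge_inj : injective mark_edge.
Proof.
move=> i i'; case: (mark_edgeP i) => [[j [<- ->]]|[mi ->]];
  case: (mark_edgeP i') => [[j' [<- ->]]|[mi' ->]].
- by move=> /linj [->].
- by move=> E; have := lroot (inl j); rewrite E eqxx.
- by move=> E; have := lroot (inl j'); rewrite -E eqxx.
by move=> _; apply: (@mark_inj _ _ S); rewrite mi mi'.
Qed.

Lemma mark_edge_ext : [set mark_edge i | i : 'I_m]%SET \subset Eext T.
Proof.
apply/fintype.subsetP => _ /imsetP[i _ ->]; rewrite EextE.
case: (mark_edgeP i) => [[j [_ ->]]|[_ ->]]; last by rewrite !inE eqxx.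
by rewrite !inE; apply/orP; right; apply/imsetP; exists (inl j).
Qed.

Lemma card_Eext : (#|Eext T| <= Num.truncn (A / lam ^+ 2) + m + 1)%N.
Proof.
rewrite EextE; apply: leq_trans (leq_card_setU _ _) _; rewrite cards1 addnC leq_add2r.
apply: leq_trans (leq_imset_card _ _) _; apply: leq_trans (card_leaves _ _ _) _.
rewrite [X in (X <= _)%N]addnC leq_add2r; exact: (separated_total C1 mv lam0 lq kap_ge st EA co A0 sepY).
Qed.

Lemma mark_sigma i : is_sigma p (root_edge T) (h (a0, None)) ->
  (forall j, is_sigma p (leaf j) (h (leaf_comp j, Some (pos (inr j))))) ->
  is_sigma p (mark_edge i) ((h \o to_coord psi) (mark S i)).
Proof.
move=> sr sl; case: (mark_edgeP i) => [[j [<- ->]]|[mi ->]]; last first.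
  by rewrite /= mi /to_coord /=; have [-> _ _ _] := co a0.
have := sl (inl j); congr (is_sigma _ _ (h _)); rewrite /to_coord /=; congr (_, _).
exact/esym/(@spec_finite _ _ _ _ _ _ _ _ _ _ _ _ ct co phiN root_free (inr j)).
Qed.

Notation N := (coord_curve a0 co).

Lemma chart_model a : chart0 (fun z => (f' \o h) (a, z)) = chart0 (umap f phi a).
Proof. by apply/funext => z; rewrite /chart0 /= f'h. Qed.

(** Separation says that every other chosen point is at distance at least [kap / d0] from [y], so
    the disc of radius [2 eps kap / d0] lies in the end; there the mean value inequality yields the
    energy. *)
Lemma leaf_energy (t : {a : comp & 'I_(size (Y a))}) :
  (forall d z, (forall p, p \in fullP (tag t) -> p != inr (inr t) -> d <= absC (pos (inr (inr t)) - pos p)) ->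
     absC (z - pos (inr (inr t))) <= 2 * eps * d ->
     region p (inr (leaf (inr t))) (h (tag t, Some z))) ->
  ((lam ^+ 2 / (9 * C))%:E <=
     curve_energy (S := N) (f' \o h) (h @^-1` region p (inr (leaf (inr t)))))%E.
Proof.
move=> reg; set y := pos (inr (inr t)) in reg *; pose d0 := dens (umap f phi (tag t)) y.
have d_gt0 : 0 < d0.
  have /card_gt1P[x [w [xf wf xw]]] :=
    points_gt1 ct co phiN root_free dec Kc0 kap_gt0 kapl st fullY (tag t).
  have [xt|xt] := eqVneq x (inr (inr t)); last by case: (added_distance xf xt).
  by rewrite xt eq_sym in xw; case: (added_distance wf xw).
pose r := 2 * eps * (kap / d0).
have r0 : 0 < r by rewrite !mulr_gt0 ?invr_gt0 // ?sqrtr_gt0 ?C_gt0.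
apply: le_trans (_ : (energy (cdisc (plane_of y) r) (chart0 (umap f phi (tag t))) <= _)%E); last first.
  rewrite -chart_model; apply: (@curve_energy_ge _ _ _ X N) => z zr /=.
  apply: (reg (kap / d0)) => [w wf wt|].
    have [_ hk] := added_distance wf wt; rewrite ler_pdivrMr //.
  by rewrite absC_modulus plane_ofB; move: zr; rewrite /cdisc /=; congr (modulus _ <= _); case: (z).
apply: (ball_energy mv C_gt0 (Jhol_P1_chart0 (Jhol_umap co st (tag t))) r0 energy_small).
exact: leaf_energy_arith.
Qed.

Lemma root_energy : energetic_end f C q a0 (phi a0) ->
  (forall B z, (forall p, p \in fullP a0 -> absC (pos p) <= B) -> B + 2 * B / eps <= absC z ->
     region p (inr (root_edge T)) (h (a0, Some z))) ->
  ((lam ^+ 2 / (9 * C))%:E <=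
     curve_energy (S := N) (f' \o h) (h @^-1` region p (inr (root_edge T))))%E.
Proof.
move=> [none [a [a_gt0 Ha He Hb]]] reg.
have HB := root_points_bound a_gt0 none Ha Hb.
have [S0 CL] := root_energy_arith C1 lam0 eps0 eps8 a_gt0.
apply: le_trans (He _ _ S0 energy_small CL) _.
rewrite -[comp_map f (phi a0) a0]/(umap f phi a0) -chart_model.
apply: (@curve_energy_ge _ _ _ X N) => z zS /=; apply: reg HB _.
by rewrite absC_modulus; move: zS; rewrite /=; congr (_ <= modulus _); case: (z).
Qed.

End Model.

End Root.

Lemma model_map : exists (T : rooted_tree R) (F : {set edge T}) (b : 'I_m -> edge T) (p : params T)
    (f' : (vert T -> P1 R) -> X),
  let alpha := fun v : vert T => (4 * eps ^+ 3) ^+ degree v in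
  [/\ stable_tree T,
      (#|Eext T| <= Num.truncn (A / lam ^+ 2) + m + 1)%N,
      F \subset Eext T,
      [/\ param_space eps (4 * eps) alpha p, f' @` Cp p `<=` K,
        forall (w : vert T + edge T) x y, region p w x -> region p w y ->
          reach (f' x) (f' y) ((if w is inl v then 4 * kap / alpha v else 6 * Kc) * region_dist p w x y) &
        exists (N : marked_curve R 0) (h : curve_comp N * P1 R -> vert T -> P1 R),
          [/\ curve_iso p h, Jhol_curve (f' \o h) &
            forall e, e \in (Eext T :\: F)%SET ->
              ((lam ^+ 2 / (9 * C))%:E <= curve_energy (f' \o h) (h @^-1` region p (inr e)))%E]] &
      stable_map_iso f F b p f'].
Proof.
have [a0 [phi0 [psi0 [co0 rf end0]]]] := root_exists C_gt0 mv st.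
have [dp [par [qa [pa ct]]]] := curve_tree_exists a0.
have exc a : exists t : (P1 R -> P1 R) * (P1 R -> P1 R),
    if a == a0 then t = (phi0, psi0) else coordinate X t.1 t.2 /\ t.1 None = qa a.
  case: eqP => [_|_]; first by exists (phi0, psi0).
  by have [phi [psi [h1 h2]]] := coordinate_at X (qa a); exists (phi, psi).
have [t Ht] := choice exc; pose phi a := (t a).1; pose psi a := (t a).2.
have t0 : t a0 = (phi0, psi0) by have := Ht a0; rewrite eqxx.
have p0 : phi a0 = phi0 by rewrite /phi t0.
have co a : coordinate X (phi a) (psi a).
  have := Ht a; rewrite /phi /psi; case: eqP => [-> ->|_ []] //.
have phiN a : a != a0 -> phi a None = qa a.
  by move=> /negbTE aa; have := Ht a; rewrite aa => -[].
have rfree nd b : @branch _ _ S nd b <> (a0, phi a0 None) by rewrite p0.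
rewrite -p0 in end0.
have [Y HY] := greedy_points (special a0 par pa phi psi) C1 mv lam0 lq kap_ge st EA co.
have sY a := (HY a).1; have fY a := (HY a).2.
have [[par0 par_lt] _ _ _ _] := ct.
have full2 := points_gt1 ct co phiN rfree dec Kc0 kap_gt0 kapl st fY.
have posI := positions_inj ct co phiN rfree sY.
have away := umap_away kap_gt0 fY.
have nfit := umap_node Y ct co phiN rfree st.
have [T [p [h [leaf [stT pT [linj lroot EextE] [hr hP hslot] [lip [sroot sleaf] lreg rreg]]]]]] :=
  cluster_model par_lt par0 full2 posI eps0 eps8 (Jhol_umap co st) dec Kc0 l0 (ltW kap_gt0) kapl away nfit.
have wd x x' : h x = h x' -> umap f phi x.1 x.2 = umap f phi x'.1 x'.2.
  by move=> /hP[->|[c [c0 -> ->]]|[c [c0 -> ->]]] //=; rewrite nfit.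
(* Off the curve any value will do, as only the restriction of [f'] to [Cp p] matters; on the curve
   [wd] makes the value independent of the preimage. *)
have exf y : exists v : X, forall x, h x = y -> umap f phi x.1 x.2 = v.
  have [[x <-]|nx] := pselect (exists x, h x = y); last by exists (f (a0, None)) => x hx; case: nx; exists x.
  by exists (umap f phi x.1 x.2) => x' /wd.
have isoN : curve_iso (S := coord_curve a0 co) p h by exact: (coord_curve_iso ct co phiN rfree hr hP hslot).
have [f' Hf'] := choice exf.
have f'h x : f' (h x) = umap f phi x.1 x.2 by rewrite (Hf' _ x erefl).
exists T, [set mark_edge leaf i | i : 'I_m]%SET, (mark_edge leaf), p, f'; split=> //.
- exact: (card_Eext co sY EextE).
- exact: (mark_edge_ext EextE).
- split=> //.
  + move=> _ [y yp <-]; move: yp; rewrite -hr => -[x _ <-]; rewrite f'h.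
    by apply: fK; exists (x.1, phi x.1 x.2).
  + move=> w x y xw yw; have Cw z : region p w z -> Cp p z by case: (w) => ? [].
    have := Cw _ xw; rewrite -{1}hr => -[x' _ xE]; have := Cw _ yw; rewrite -{1}hr => -[y' _ yE].
    by rewrite -xE -yE !f'h; apply: lip; rewrite ?xE ?yE.
  exists (coord_curve a0 co), h; split.
  + exact: isoN.
  + split=> [x x' xx|a].
      have [_ /(_ x x')[_ /(_ xx) hx] _] := isoN.
      by rewrite /= hx.
    have := Jhol_umap co st a; congr Jhol_P1.
    by apply/funext => z; rewrite /= f'h.
  move=> e; rewrite EextE finset.in_setD finset.in_setU1 => /andP[eF] /orP[/eqP e0|/imsetP[j _ ej]].
    rewrite e0; apply: (root_energy ct co phiN rfree sY fY f'h) => //; case: end0 => // -[i mi].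
    by case/negP: eF; rewrite e0; apply/imsetP; exists i => //; rewrite (mark_edge_root _ mi).
  rewrite ej; case: j ej => [j|s] ej.
    by case/negP: eF; rewrite ej; apply/imsetP; exists (val j) => //; rewrite mark_edge_leaf.
  by apply: (leaf_energy ct co phiN rfree sY fY f'h) => d z Hd; exact: lreg.
split; first exact: (mark_edge_inj linj lroot).
split=> //; exists (h \o to_coord psi); split.
- exact: (coord_iso ct co phiN rfree hr hP hslot).
- by move=> i; exact: (mark_sigma ct co phiN rfree).
apply/funext => -[a z]; rewrite /= f'h /umap /comp_map /=; have [_ k2 _ _] := co a.
by rewrite k2.
Qed.

End Assembly.

(** * The constants of the statement *)

Section Constants.
Context {R : realType}.
Implicit Types (C l q lam eps Kc : R).

Lemma sqrt_ge1 C : 1 <= C -> 1 <= Num.sqrt C.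
Proof. by move=> C1; rewrite -[leLHS]sqrtr1; exact: ler_wsqrtr. Qed.

(** [24 kap] is eight times [9 lam sqrt C / eps], hence at most [8 l eps (1 - eps)], and
    [8 eps <= 1]. *)
Lemma step_le_cylinder C l lam eps : 1 <= C -> 0 < l -> 0 < lam -> 0 < eps -> 8 * eps <= 1 ->
  9 * lam * Num.sqrt C <= l * eps ^+ 2 * (1 - eps) -> 24 * (3 * Num.sqrt C * lam / eps) <= l.
Proof.
move=> C1 l0 lam0 eps0 eps8 h; rewrite mulrA ler_pdivrMr //.
have le0 : 0 < l * eps by rewrite mulr_gt0.
have h1 : l * eps ^+ 2 * (1 - eps) <= l * eps * eps.
  by rewrite expr2 mulrA ler_piMr ?mulr_ge0 ?(ltW eps0) ?(ltW l0) //; lra.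
have h2 : l * eps * eps <= l * eps * 8^-1 by rewrite ler_wpM2l ?(ltW le0) //; lra.
have -> : 24 * (3 * Num.sqrt C * lam) = 8 * (9 * lam * Num.sqrt C) by ring.
lra.
Qed.

Lemma step_le_scale C l (L0 : R) lam eps : 1 <= C -> 0 < l <= L0 -> 0 < lam -> 0 < eps -> 8 * eps <= 1 ->
  9 * lam * Num.sqrt C <= l * eps ^+ 2 * (1 - eps) -> lam <= L0.
Proof.
move=> C1 /andP[l0 lL] lam0 eps0 eps8 h; have s1 := sqrt_ge1 C1.
have h0 : lam * 1 <= lam * Num.sqrt C by rewrite ler_wpM2l // ltW.
have e2 : eps ^+ 2 * (1 - eps) <= 1.
  by rewrite mulr_ile1 ?exprn_ge0 ?exprn_ile1 ?(ltW eps0) //; lra.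
have : l * eps ^+ 2 * (1 - eps) <= l by rewrite -mulrA ler_piMr // ltW.
lra.
Qed.

Lemma step_le_quantum q lam eps : 0 < lam -> 0 < eps -> 8 * eps <= 1 -> 0 < q ->
  pi * lam ^+ 2 <= q * eps ^+ 2 -> lam ^+ 2 <= q.
Proof.
move=> lam0 eps0 eps8 q0 h.
have l2 : 0 < lam ^+ 2 by rewrite exprn_gt0.
have h1 : lam ^+ 2 <= pi * lam ^+ 2 by rewrite ler_peMl ?(ltW l2) // (le_trans _ (pi_ge2 R)) // ler1n.
have h2 : q * eps ^+ 2 <= q by rewrite ler_piMr ?(ltW q0) // exprn_ile1 ?(ltW eps0) //; lra.
exact: le_trans h1 (le_trans h h2).
Qed.

(** After cancellation the claim is [12 eps lam <= 9 pi lambda0], which follows from [eps <= 1],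
    [lam <= lambda0] and [pi >= 2]. *)
Lemma thick_constant C (L0 : R) lam eps (alpha : R) : 1 <= C -> 0 < lam -> lam <= L0 -> 0 < eps -> 8 * eps <= 1 -> 0 < alpha ->
  4 * (3 * Num.sqrt C * lam / eps) / alpha <= 9 * pi * Num.sqrt C / eps ^+ 2 * alpha^-1 * L0.
Proof.
move=> C1 lam0 lL eps0 eps8 al0; have s1 := sqrt_ge1 C1; have p2 := pi_ge2 R.
rewrite [leRHS]mulrAC ler_pM2r ?invr_gt0 //.
have -> : 4 * (3 * Num.sqrt C * lam / eps) = 12 * Num.sqrt C * lam * eps / eps ^+ 2.
  by field; rewrite gt_eqF.
have -> : 9 * pi * Num.sqrt C / eps ^+ 2 * L0 = 9 * pi * Num.sqrt C * L0 / eps ^+ 2 by ring.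
rewrite ler_pM2r ?invr_gt0 ?exprn_gt0 //.
have h1 : 12 * Num.sqrt C * lam * eps <= 12 * Num.sqrt C * lam.
  by rewrite ler_piMr ?mulr_ge0 ?sqrtr_ge0 ?(ltW lam0) //; lra.
have h2 : 12 * Num.sqrt C * lam <= 12 * Num.sqrt C * L0 by rewrite ler_wpM2l // mulr_ge0 ?sqrtr_ge0.
have h3 : 0 <= Num.sqrt C * L0 by rewrite mulr_ge0 ?sqrtr_ge0 // (le_trans (ltW lam0)).
have h4 : 2 * (Num.sqrt C * L0) <= pi * (Num.sqrt C * L0) by rewrite ler_wpM2r.
lra.
Qed.

Lemma neck_constant (L0 : R) Kc (M : R) eps : 0 < L0 -> 0 <= Kc -> 6 * Kc / L0 <= M -> 0 < eps -> 8 * eps <= 1 ->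
  6 * Kc <= M / eps ^+ 2 * L0.
Proof.
move=> L00 Kc0; rewrite ler_pdivrMr // => h eps0 eps8.
have M0 : 0 <= M * L0 by apply: le_trans h; rewrite mulr_ge0.
apply: (le_trans h).
rewrite mulrAC ler_pdivlMr ?exprn_gt0 // ler_piMr // exprn_ile1 ?(ltW eps0) //; lra.
Qed.

Lemma region_dist_ge0 (T : rooted_tree R) (p : params T) (w : vert T + edge T) x y : 0 <= region_dist p w x y.
Proof.
case: w => [v|e] /=; first exact: P1_dist_ge0.
by rewrite le_max; case: (epos e) => [v|]; rewrite ?P1_dist_ge0 ?lexx.
Qed.

End Constants.

Theorem theorem4p2 (R : realType) (lambda0 : @geo_constant R) (C : R)
    (q l : @geo_constant R) (hconst : a_priori_constants lambda0 C q l) :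
  exists M : @geo_constant R,
    depends_on 2 M /\ (forall n B, 1 <= M n B) /\
    forall (n j : nat) (B : nat -> R) (X : geometry R n),
      (3 <= j)%N -> bounded_geometry X j B ->
    forall eps lam : R, 0 < eps -> 0 < lam ->
      8 * eps <= 1 ->
      9 * lam * Num.sqrt C <= l n B * eps ^+ 2 * (1 - eps) ->
      pi * lam ^+ 2 <= q n B * eps ^+ 2 ->
    forall (m : nat) (A : R) (K : set X) (S : marked_curve R m)
      (f : curve_comp S * P1 R -> X),
      0 <= A -> compact K -> stable_map f -> range f `<=` K ->
      (curve_energy f setT <= A%:E)%E ->
    exists (T : rooted_tree R) (F : {set edge T}) (b : 'I_m -> edge T)
      (p : params T) (f' : (vert T -> P1 R) -> X),
      let alpha := fun v : vert T => (4 * eps ^+ 3) ^+ degree v in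
      let eta := (3 * Num.sqrt C)^-1 * (lam / lambda0 n B) in
      let Lambda := fun w : vert T + edge T =>
        match w with
        | inl v => 9 * pi * Num.sqrt C / eps ^+ 2 * (alpha v)^-1
        | inr e => M n B / eps ^+ 2
        end in
      [/\ stable_tree T,
          (#|Eext T| <= Num.truncn (A / lam ^+ 2) + m + 1)%N,
          F \subset Eext T,
          map_space F (lambda0 n B) eps (4 * eps) alpha K eta Lambda (p, f')
        & stable_map_iso f F b p f'].
Proof.
case: hconst => -[dl0 [c0 [_ Hl0]]] [C1 dq Hq] [dl [c [K1 [dc dK Hl]]]].
pose Kc n B := decay_constant (B 0%N) (l n B) (c n B) (K1 1%N n B).
(* The factor [6] is that of the bounds on necks and ends; dividing by [lambda0] matches the unit in
   which Lipschitz constants are measured. [Kc] involves [B 0], [l], [c] and [K 1], and [K i]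
   depends on bounds up to order [i + 1], so order [2] suffices. *)
exists (fun n B => Num.max 1 (6 * Kc n B / lambda0 n B)); split; [|split].
- move=> n B B' BB; rewrite /Kc.
  have e0 := dl0 n B B' (fun k k1 => BB k (leq_trans k1 (leqnSn 1))).
  have [dK1 _] := dK 1%N (leqnn 1).
  by rewrite e0 (dl n B B' BB) (dc n B B' BB) (dK1 n B B' BB) (BB 0%N).
- by move=> n B; rewrite le_max lexx.
move=> n j B X j3 bg eps lam eps0 lam0 eps8 hl hq m A K S f A0 _ st fK EA.
have [L00 _ _] := Hl0 n j B X j3 bg.
have [q0 mv] := Hq n j B X j3 bg.
have [lL cc cyl] := Hl n j B X j3 bg; have /andP[l0 _] := lL.
have [_ K1ge] := dK 1%N (leqnn 1); have K10 : 0 <= K1 1%N n B := le_trans ler01 (K1ge n B).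
have Kc0 : 0 <= Kc n B by rewrite mulr_ge0 // sqrtr_ge0.
have lc : long_cylinder X (l n B) (c n B) (K1 1%N n B).
  move=> Rm Rp u RR Ju per ul; have [[a [_ h1 h1']] h2] := cyl Rm Rp u RR Ju per ul; split; first by exists a.
  move=> RR2 s t hs.
  by apply: h2 => //; exact: leq_trans j3.
have dec : decay X (l n B) (Kc n B).
  move=> u r1 r2 z Ju r10 ul z1 z2.
  exact: (annulus_decay (bounded_geometry_tame bg) lc l0 cc K10 Ju r10 ul z1 z2).
have lq := step_le_quantum lam0 eps0 eps8 q0 hq.
have kl := step_le_cylinder C1 l0 lam0 eps0 eps8 hl.
have lamL := step_le_scale C1 lL lam0 eps0 eps8 hl.
have [T [F [b [p [f' [stT cT FT [ps fk lip [N [h [iso Jh en]]]] sm]]]]]] :=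
  model_map C1 mv dec Kc0 (ltW l0) eps0 eps8 lam0 lq kl A0 st fK EA.
exists T, F, b, p, f'; split=> //; split=> //=.
  move=> w x y wx wy; apply: le_trans (reach_rdist (lip w x y wx wy)) _.
  rewrite lee_fin ler_wpM2r ?region_dist_ge0 //; case: (w) => [v|e].
    by apply: thick_constant => //; rewrite exprn_gt0 // mulr_gt0 // exprn_gt0.
  by apply: neck_constant => //; rewrite le_max lexx orbT.
exists N, h; split=> // e eF; apply: le_trans (en e eF).
(* Both sides agree, since [eta * lambda0 = lam / (3 sqrt C)]. *)
rewrite lee_fin le_eqVlt; apply/orP; left; apply/eqP.
rewrite -mulrA divfK ?gt_eqF // exprMn exprVn exprMn sqr_sqrtr; last exact: ltW (lt_le_trans ltr01 C1).
by rewrite mulrC; congr (_ / (_ * _)); ring.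
Qed.
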